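(* Let $c\in\mathbb{R}$, let $I\subseteq\mathbb{R}$ be an open interval, and let $a,d:I\to\mathbb{R}$ be real analytic functions with $a(s)>0$ for all $s$. The only solution (on a neighbourhood of $I\equiv I\times\{0\}$ in $\mathbb{C}$, $z=s+it$) to the Cauchy problem $$\Delta(\log\phi)=-2c\,\phi,\qquad \phi(s,0)=a(s),\qquad \phi_t(s,0)=d(s)$$ is $$\phi(s,t)=\frac{4|g'(z)|^2}{(1+c|g(z)|^2)^2},$$ where $g(z)$ is the meromorphic extension of $g(s)=\pi(\alpha(s))$, $\pi:\mathcal{Q}(c)\to\mathbb{C}\cup\{\infty\}$ is the stereographic projection, and $\alpha(s)$ is the only curve (up to orientation-preserving congruence) in $\mathcal{Q}(c)$ whose arclength parameter $u$ and geodesic curvature $\kappa$ are given respectively by $$u(s)=\int^s\sqrt{a(r)}\,dr,\qquad \kappa(s)=\frac{-d(s)}{2\,a(s)^{3/2}}.$$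
   Context: $\mathcal{Q}(c)$ is the standard 2-dimensional Riemannian space form of constant curvature $c$: $\mathcal{Q}(0)=\mathbb{R}^2$; for $c>0$, $\mathcal{Q}(c)=\{x_0^2+x_1^2+x_2^2=1/c\}\subset\mathbb{R}^3$ with the Euclidean induced metric; for $c<0$, $\mathcal{Q}(c)=\{-x_0^2+x_1^2+x_2^2=1/c,\ x_0>0\}$ with the metric induced from $-dx_0^2+dx_1^2+dx_2^2$. The stereographic projection is $\pi(x_0,x_1,x_2)=\frac{x_1+ix_2}{1-\sqrt{c}\,x_0}$ if $c>0$, $\pi(x_0,x_1,x_2)=\frac{x_1+ix_2}{1+\sqrt{-c}\,x_0}$ if $c<0$, and $\pi(x_1,x_2)=\frac12(x_1+ix_2)$ if $c=0$; in all cases the metric of $\mathcal{Q}(c)$ is $\frac{4|d\zeta|^2}{(1+c|\zeta|^2)^2}$ in the coordinate $\zeta=\pi$. $\mathcal{Q}(c)$ is oriented so that $\pi$ preserves orientation, $J$ denotes the corresponding rotation by $+90^\circ$ in tangent planes, and the geodesic curvature of a regular curve $\alpha$ is $\kappa=\langle\nabla_{\alpha'}\alpha',J\alpha'\rangle/|\alpha'|^3$. *)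

(* Defs.v *)
From Stdlib Require Import Reals Lra Nsatz.
From Coquelicot Require Export Coquelicot.
Open Scope R_scope.

Definition R3 : Type := (R * R * R)%type.
Definition x0 (p : R3) : R := fst (fst p).
Definition x1 (p : R3) : R := snd (fst p).
Definition x2 (p : R3) : R := snd p.

(* Ambient form: Lorentzian if c < 0, Euclidean otherwise. *)
Definition sig (c : R) : R := if Rlt_dec c 0 then -1 else 1.
Definition form (c : R) (u v : R3) : R :=
  sig c * x0 u * x0 v + x1 u * x1 v + x2 u * x2 v.

(* The plane Q(0) = R^2 is realised in R^3 as {x0 = 0}, so that the three
   cases share one ambient space. *)
Definition Q (c : R) (p : R3) : Prop :=
  (c = 0 -> x0 p = 0) /\
  (c <> 0 -> form c p p = 1 / c) /\
  (c < 0 -> 0 < x0 p).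

(* The complex plane with a point at infinity, None. *)
Definition sphere : Type := option C.
Definition finite_part (w : sphere) : C :=
  match w with Some w => w | None => RtoC 0 end.
Definition sphere_inv (w : sphere) : sphere :=
  match w with
  | None => Some (RtoC 0)
  | Some w => if Ceq_dec w (RtoC 0) then None else Some (Cinv w)
  end.

Definition stereo (c : R) (p : R3) : sphere :=
  if Rlt_dec 0 c then
    if Req_EM_T (1 - sqrt c * x0 p) 0 then None
    else Some (Cdiv (x1 p, x2 p) (RtoC (1 - sqrt c * x0 p)))
  else if Rlt_dec c 0 then
    Some (Cdiv (x1 p, x2 p) (RtoC (1 + sqrt (- c) * x0 p)))
  else Some (Cmult (RtoC (1 / 2)) (x1 p, x2 p)).

(* Unit normal of Q(c) in R^3.  Its sign is the one for which the orientation
   that it induces on Q(c) is preserved by the stereographic projection: at the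
   point x1 = x2 = 0 where the projection vanishes (x0 = -1/sqrt c, 1/sqrt(-c)
   or 0) it is e_0, and there the differential of the projection is
   v |-> (v1 + i v2)/2.  See [stereo_conformal]. *)
Definition normal (c : R) (p : R3) : R3 :=
  if Rlt_dec 0 c then scal (- sqrt c) p
  else if Rlt_dec c 0 then scal (sqrt (- c)) p
  else (1, 0, 0).

Definition tangent (c : R) (p v : R3) : Prop := form c (normal c p) v = 0.

Definition cross (u v : R3) : R3 :=
  (x1 u * x2 v - x2 u * x1 v,
   x2 u * x0 v - x0 u * x2 v,
   x0 u * x1 v - x1 u * x0 v).

(* Rotation by +90 degrees in the tangent plane at p: the vector J v with
   form c (J v) w = det (normal c p, v, w) for all w. *)
Definition J (c : R) (p v : R3) : R3 :=
  let w := cross (normal c p) v in (sig c * x0 w, x1 w, x2 w).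

Definition stereo_denom (c : R) (p : R3) : R :=
  if Rlt_dec 0 c then 1 - sqrt c * x0 p
  else if Rlt_dec c 0 then 1 + sqrt (- c) * x0 p
  else 2.
Definition stereo_denom_lin (c : R) (v : R3) : R :=
  if Rlt_dec 0 c then - sqrt c * x0 v
  else if Rlt_dec c 0 then sqrt (- c) * x0 v
  else 0.

Lemma finite_part_stereo (c : R) (p : R3) :
  finite_part (stereo c p) =
    (x1 p / stereo_denom c p, x2 p / stereo_denom c p).
Proof.
unfold stereo, stereo_denom.
destruct (Rlt_dec 0 c) as [hc|hc].
- destruct (Req_EM_T (1 - sqrt c * x0 p) 0) as [h|h]; simpl.
  + rewrite h; unfold Rdiv; rewrite Rinv_0, !Rmult_0_r; reflexivity.
  + unfold Cdiv, Cinv, Cmult, RtoC; simpl; f_equal; field; exact h.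
- destruct (Rlt_dec c 0) as [hc'|hc']; simpl.
  + destruct (Req_EM_T (1 + sqrt (- c) * x0 p) 0) as [h|h].
    * unfold Cdiv, Cinv, Cmult, RtoC; simpl; rewrite h; unfold Rdiv.
      rewrite Rinv_0; f_equal; ring.
    * unfold Cdiv, Cinv, Cmult, RtoC; simpl; f_equal; field; exact h.
  + unfold Cmult, RtoC; simpl; f_equal; field.
Qed.

Lemma stereo_conformal_alg (e k D p0 p1 p2 v0 v1 v2 : R) :
  e * e = 1 -> D = 1 - e * k * p0 -> D <> 0 ->
  k * k * (e * p0 * p0 + p1 * p1 + p2 * p2) = e ->
  e * p0 * v0 + p1 * v1 + p2 * v2 = 0 ->
  let l1 := (v1 * D + e * k * v0 * p1) / D ^ 2 in
  let l2 := (v2 * D + e * k * v0 * p2) / D ^ 2 in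
  let w0 := - k * (p1 * v2 - p2 * v1) in
  let w1 := - e * k * (p2 * v0 - p0 * v2) in
  let w2 := - e * k * (p0 * v1 - p1 * v0) in
  (w1 * D + e * k * w0 * p1) / D ^ 2 = - l2 /\
  (w2 * D + e * k * w0 * p2) / D ^ 2 = l1 /\
  e * v0 * v0 + v1 * v1 + v2 * v2 =
    4 * (l1 ^ 2 + l2 ^ 2) /
      (1 + e * k * k * ((p1 / D) ^ 2 + (p2 / D) ^ 2)) ^ 2.
Proof.
intros he hD hD0 hq ht l1 l2 w0 w1 w2.
assert (hq' : e * k * k * (p1 * p1 + p2 * p2) = 1 - k * k * p0 * p0) by nsatz.
split; [|split].
- unfold l2, w0, w1, Rdiv; rewrite Ropp_mult_distr_l; f_equal; subst D; clear -he hq ht; nsatz.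
- unfold l1, w0, w2, Rdiv; f_equal; subst D; clear -he hq ht; nsatz.
- replace (1 + e * k * k * ((p1 / D) ^ 2 + (p2 / D) ^ 2)) with (2 / D).
  2:{ apply (Rmult_eq_reg_r (D ^ 2)); [|now apply pow_nonzero].
      replace (2 / D * D ^ 2) with (2 * D) by (field; exact hD0).
      replace ((1 + e * k * k * ((p1 / D) ^ 2 + (p2 / D) ^ 2)) * D ^ 2)
        with (D * D + e * k * k * (p1 * p1 + p2 * p2)) by (field; exact hD0).
      rewrite hq', hD; nsatz. }
  replace (4 * (l1 ^ 2 + l2 ^ 2) / (2 / D) ^ 2)
    with (((v1 * D + e * k * v0 * p1) ^ 2 + (v2 * D + e * k * v0 * p2) ^ 2)
          / D ^ 2) by (unfold l1, l2; field; exact hD0).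
  apply (Rmult_eq_reg_r (D ^ 2)); [|now apply pow_nonzero].
  match goal with |- _ = ?X / _ * _ =>
    replace (X / D ^ 2 * D ^ 2) with X by (field; exact hD0) end.
  subst D.
  assert (E1 : p1 * v1 + p2 * v2 = - e * p0 * v0) by lra.
  assert (E2 : k * k * (p1 * p1 + p2 * p2) = e - e * k * k * p0 * p0) by lra.
  transitivity ((v1 * v1 + v2 * v2) * (1 - e * k * p0) ^ 2
    + 2 * e * k * (1 - e * k * p0) * v0 * (- e * p0 * v0)
    + e * e * v0 * v0 * (e - e * k * k * p0 * p0)).
  + assert (he' : (e - 1) * (e + 1) = 0) by lra.
    destruct (Rmult_integral _ _ he') as [h|h];
      [replace e with 1 by lra|replace e with (-1) by lra]; ring.
  + rewrite <- E2.
    replace (- e * p0 * v0) with (p1 * v1 + p2 * v2) by lra; ring.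
Qed.

Lemma is_derive_ratio (x v D D' : R) :
  D <> 0 ->
  is_derive (fun h => (x + h * v) / (D + h * D')) 0 ((v * D - D' * x) / D ^ 2).
Proof.
intros hD; auto_derive.
- rewrite Rmult_0_l, Rplus_0_r; repeat split; exact hD.
- field; rewrite ?Rmult_0_l, ?Rplus_0_r; exact hD.
Qed.

(* Writing l for the differential of the projection at p applied to v, the one
   applied to J v is i l, and the metric is 4 |l|^2 / (1 + c |zeta|^2)^2: the
   definitions above fit the orientation and metric carried by the
   projection. *)
Lemma stereo_conformal (c : R) (p v : R3) :
  Q c p -> tangent c p v -> stereo c p <> None ->
  let zeta w h := finite_part (stereo c (plus p (scal h w))) in
  exists l1 l2 : R,
    is_derive (fun h : R => Re (zeta v h)) 0 l1 /\
    is_derive (fun h : R => Im (zeta v h)) 0 l2 /\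
    is_derive (fun h : R => Re (zeta (J c p v) h)) 0 (- l2) /\
    is_derive (fun h : R => Im (zeta (J c p v) h)) 0 l1 /\
    form c v v =
      4 * (l1 ^ 2 + l2 ^ 2)
        / (1 + c * Cmod (finite_part (stereo c p)) ^ 2) ^ 2.
Proof.
intros hQ ht hp zeta.
assert (hz : forall w h, zeta w h =
  ((x1 p + h * x1 w) / (stereo_denom c p + h * stereo_denom_lin c w),
   (x2 p + h * x2 w) / (stereo_denom c p + h * stereo_denom_lin c w))).
{ intros w h; unfold zeta; rewrite finite_part_stereo.
  assert (E : stereo_denom c (plus p (scal h w)) =
              stereo_denom c p + h * stereo_denom_lin c w).
  { unfold stereo_denom, stereo_denom_lin, x0; simpl.
    unfold plus, scal, mult; simpl; unfold mult; simpl.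
    destruct (Rlt_dec 0 c); [|destruct (Rlt_dec c 0)]; ring. }
  rewrite E; reflexivity. }
assert (hm : forall x y, Cmod (x, y) ^ 2 = x ^ 2 + y ^ 2).
{ intros x y; unfold Cmod; apply pow2_sqrt; simpl; nra. }
set (D := stereo_denom c p) in *.
assert (main : D <> 0 /\
  let l1 := (x1 v * D - stereo_denom_lin c v * x1 p) / D ^ 2 in
  let l2 := (x2 v * D - stereo_denom_lin c v * x2 p) / D ^ 2 in
  let w := J c p v in
  (x1 w * D - stereo_denom_lin c w * x1 p) / D ^ 2 = - l2 /\
  (x2 w * D - stereo_denom_lin c w * x2 p) / D ^ 2 = l1 /\
  form c v v = 4 * (l1 ^ 2 + l2 ^ 2) /
    (1 + c * ((x1 p / D) ^ 2 + (x2 p / D) ^ 2)) ^ 2).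
{ destruct p as [[p0 p1] p2], v as [[v0 v1] v2].
  destruct hQ as [hQ0 [hQ1 hQ2]].
  unfold D, tangent, J, cross, normal, form, sig, stereo, stereo_denom,
    stereo_denom_lin, x0, x1, x2 in *; clear D hz zeta.
  destruct (Rlt_dec 0 c) as [hc|hc].
  - destruct (Rlt_dec c 0) as [hc'|hc']; [exfalso; lra|].
    unfold scal in *; simpl in *; unfold scal in *; simpl in *;
      unfold mult in *; simpl in *.
    set (k := sqrt c) in *.
    assert (hk : k * k = c) by (apply sqrt_sqrt; lra).
    assert (hk0 : 0 < k) by (apply sqrt_lt_R0; lra).
    assert (hD : 1 - k * p0 <> 0).
    { destruct (Req_EM_T (1 - k * p0) 0); [now exfalso; apply hp|easy]. }
    specialize (hQ1 ltac:(lra)).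
    assert (hq : k * k * (1 * p0 * p0 + p1 * p1 + p2 * p2) = 1).
    { rewrite hk; rewrite hQ1; field; lra. }
    assert (ht' : 1 * p0 * v0 + p1 * v1 + p2 * v2 = 0).
    { apply (Rmult_eq_reg_l (- k)); [|lra]; rewrite Rmult_0_r, <- ht; ring. }
    split; [exact hD|].
    destruct (stereo_conformal_alg 1 k (1 - k * p0) p0 p1 p2 v0 v1 v2)
      as [h1 [h2 h3]]; try assumption; try ring.
    rewrite <- hk; split; [|split].
    + etransitivity; [|etransitivity; [exact h1|]]; field; exact hD.
    + etransitivity; [|etransitivity; [exact h2|]]; field; exact hD.
    + rewrite h3; replace (1 * k * k) with (k * k) by ring.
      unfold Rminus; rewrite <- !Ropp_mult_distr_l, !Ropp_involutive,
        !Rmult_1_l; reflexivity.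
  - destruct (Rlt_dec c 0) as [hc'|hc'].
    + unfold scal in *; simpl in *; unfold scal in *; simpl in *;
        unfold mult in *; simpl in *.
      set (k := sqrt (- c)) in *.
      assert (hk : k * k = - c) by (apply sqrt_sqrt; lra).
      assert (hk0 : 0 < k) by (apply sqrt_lt_R0; lra).
      specialize (hQ1 ltac:(lra)); specialize (hQ2 hc').
      assert (hD : 1 + k * p0 <> 0) by nra.
      assert (hq : k * k * (-1 * p0 * p0 + p1 * p1 + p2 * p2) = -1).
      { rewrite hk; rewrite hQ1; field; lra. }
      assert (ht' : -1 * p0 * v0 + p1 * v1 + p2 * v2 = 0).
      { apply (Rmult_eq_reg_l k); [|lra]; rewrite Rmult_0_r, <- ht; ring. }
      split; [exact hD|].
      destruct (stereo_conformal_alg (-1) k (1 + k * p0) p0 p1 p2 v0 v1 v2)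
        as [h1 [h2 h3]]; try assumption; try ring.
      assert (hc2 : c = -1 * k * k) by lra.
      rewrite hc2; split; [|split].
      * etransitivity; [|etransitivity; [exact h1|]]; field; exact hD.
      * etransitivity; [|etransitivity; [exact h2|]]; field; exact hD.
      * rewrite h3; replace (-1 * k * v0) with (- (k * v0)) by ring.
        unfold Rminus; rewrite <- !Ropp_mult_distr_l; reflexivity.
    + assert (c = 0) by lra; subst c; simpl in *.
      assert (v0 = 0) by lra.
      subst v0; split; [lra|]; split; [|split]; field. }
destruct main as [hD [h1 [h2 h3]]].
exists ((x1 v * D - stereo_denom_lin c v * x1 p) / D ^ 2),
       ((x2 v * D - stereo_denom_lin c v * x2 p) / D ^ 2).
split; [|split; [|split; [|split]]].
- apply (is_derive_ext (fun h => (x1 p + h * x1 v) / (D + h * stereo_denom_lin c v))).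
  + intros h; now rewrite hz.
  + now apply is_derive_ratio.
- apply (is_derive_ext (fun h => (x2 p + h * x2 v) / (D + h * stereo_denom_lin c v))).
  + intros h; now rewrite hz.
  + now apply is_derive_ratio.
- rewrite <- h1.
  apply (is_derive_ext (fun h => (x1 p + h * x1 (J c p v)) /
                                 (D + h * stereo_denom_lin c (J c p v)))).
  + intros h; now rewrite hz.
  + now apply is_derive_ratio.
- rewrite <- h2 at 1.
  apply (is_derive_ext (fun h => (x2 p + h * x2 (J c p v)) /
                                 (D + h * stereo_denom_lin c (J c p v)))).
  + intros h; now rewrite hz.
  + now apply is_derive_ratio.
- rewrite finite_part_stereo, hm; exact h3.
Qed.

Definition curve_deriv (n : nat) (alpha : R -> R3) (s : R) : R3 :=
  (Derive_n (fun r => x0 (alpha r)) n s,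
   Derive_n (fun r => x1 (alpha r)) n s,
   Derive_n (fun r => x2 (alpha r)) n s).

Definition speed (c : R) (alpha : R -> R3) (s : R) : R :=
  sqrt (form c (curve_deriv 1 alpha s) (curve_deriv 1 alpha s)).

(* The covariant derivative is the tangential part of the ambient second
   derivative; form c p p = 1 / c on Q(c) when c <> 0. *)
Definition cov_accel (c : R) (alpha : R -> R3) (s : R) : R3 :=
  minus (curve_deriv 2 alpha s)
        (scal (c * form c (curve_deriv 2 alpha s) (alpha s)) (alpha s)).

Definition geod_curvature (c : R) (alpha : R -> R3) (s : R) : R :=
  form c (cov_accel c alpha s) (J c (alpha s) (curve_deriv 1 alpha s))
    / speed c alpha s ^ 3.

(* [ex_derive f s] is not redundant: [ex_derive_n f 2] only speaks of the total
   function [Derive f]. *)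
Definition C2_fun_at (f : R -> R) (s : R) : Prop :=
  ex_derive f s /\ ex_derive_n f 2 s /\ continuous (Derive_n f 2) s.

Definition regular_curve (c : R) (I : R -> Prop) (alpha : R -> R3) : Prop :=
  forall s, I s ->
    Q c (alpha s) /\
    C2_fun_at (fun r => x0 (alpha r)) s /\
    C2_fun_at (fun r => x1 (alpha r)) s /\
    C2_fun_at (fun r => x2 (alpha r)) s /\
    0 < speed c alpha s.

(* The arclength parameter is only defined up to an additive constant, hence
   the comparison of the two integrals between arbitrary points of I. *)
Definition curve_with_data (c : R) (I : R -> Prop) (a d : R -> R)
    (alpha : R -> R3) : Prop :=
  regular_curve c I alpha /\
  (forall r s, I r -> I s ->
     RInt (speed c alpha) r s = RInt (fun x => sqrt (a x)) r s) /\
  (forall s, I s ->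
     geod_curvature c alpha s = - d s / (2 * Rpower (a s) (3 / 2))).

(* Orientation-preserving congruence of Q(c): a rigid motion of the ambient
   space (an affine map whose linear part L preserves the form) that maps Q(c)
   onto itself and whose differential commutes with J on tangent planes. *)
Definition congruence (c : R) (T : R3 -> R3) : Prop :=
  (forall p, Q c p -> Q c (T p)) /\
  (forall q, Q c q -> exists p, Q c p /\ T p = q) /\
  exists L : R3 -> R3,
    is_linear L /\
    (forall u v, form c (L u) (L v) = form c u v) /\
    (forall p q, minus (T p) (T q) = L (minus p q)) /\
    (forall p v, Q c p -> tangent c p v -> L (J c p v) = J c (T p) (L v)).

Definition Rbar_interval (lo hi : Rbar) (s : R) : Prop :=
  Rbar_lt lo s /\ Rbar_lt s hi.

Definition real_analytic_at (f : R -> R) (s : R) : Prop :=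
  exists b : nat -> R, locally s (fun r => is_pseries b (r - s) (f r)).

Definition holomorphic_at (f : C -> sphere) (z : C) : Prop :=
  locally z (fun w => f w <> None /\
                      ex_derive (fun v : C => finite_part (f v)) w).

(* The value None marks the poles: z is a pole of G when 1 / G, extended by 0
   at z, is holomorphic in a full neighbourhood of z. *)
Definition meromorphic_on (U : C -> Prop) (G : C -> sphere) : Prop :=
  forall z, U z ->
    match G z with
    | Some _ => holomorphic_at G z
    | None => holomorphic_at (fun w => sphere_inv (G w)) z /\
              locally z (fun w => w <> z -> G w <> None)
    end.

Definition nbhd_of (I : R -> Prop) (U : C -> Prop) : Prop :=
  open U /\ forall s, I s -> U (s, 0).

Definition meromorphic_extension (I : R -> Prop) (g : R -> sphere)
    (U : C -> Prop) (G : C -> sphere) : Prop :=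
  nbhd_of I U /\ meromorphic_on U G /\ forall s, I s -> G (s, 0) = g s.

Definition Laplacian (f : R -> R -> R) (s t : R) : R :=
  partial_derive 2 0 f s t + partial_derive 0 2 f s t.

Definition liouville_solution (c : R) (I : R -> Prop) (a d : R -> R)
    (U : C -> Prop) (phi : R -> R -> R) : Prop :=
  (forall s t, U (s, t) ->
     0 < phi s t /\
     ex_diff_n phi 2 s t /\
     Laplacian (fun x y => ln (phi x y)) s t = - 2 * c * phi s t) /\
  (forall s, I s ->
     phi s 0 = a s /\ Derive (fun t => phi s t) 0 = d s).

(* Only meaningful where G is finite; at a pole the intended value is the limit,
   which continuity of a solution determines. *)
Definition pullback_metric (c : R) (G : C -> sphere) (z : C) : R :=
  4 * Cmod (C_derive (fun w => finite_part (G w)) z) ^ 2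
    / (1 + c * Cmod (finite_part (G z)) ^ 2) ^ 2.

(* Main.v *)
(* With p = a'/(2a) and q = d/(2a), the curve together with its velocity v and the
   unnormalised normal n = J v solves the linear system
     alpha' = v,  v' = p v - q n - c a alpha,  n' = p n + q v.
   Linearity gives existence on all of I; the frame relations are first
   integrals, so two curves with the same data differ by the rigid motion that
   matches their frames at one point; and power series solutions show that alpha
   is analytic, hence extends holomorphically.  The projection then becomes a
   quotient N/D, and its pullback metric is
     phi = 4 |N'D - ND'|^2 / (|D|^2 + c |N|^2)^2,
   which is unchanged when N and D are multiplied by a common factor, hence
   regular at the poles, and whose logarithm has Laplacian -2c phi by Lagrange's
   identity.

   For uniqueness, put A = -phi_s/(2 phi), B = -phi_t/(2 phi).  The Schwarzian
   derivative of g, written in terms of A, B and their first derivatives, is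
   holomorphic, and the Cauchy data determine it on the axis, hence everywhere by
   the identity theorem.  Its real and imaginary parts turn the equation into a
   first order system for (ln phi, A, B) along vertical lines, to which
   uniqueness for ordinary differential equations applies.  The identity theorem
   is obtained without contour integrals: Goursat's bisection provides
   primitives, and a weighted maximum principle applies to them. *)
Require Import Defs.
From Stdlib Require Import Reals.
From Coquelicot Require Import Coquelicot.
From Stdlib Require Import Lra Lia Psatz ClassicalEpsilon.
Open Scope R_scope.

(** * Functions of two real variables *)

(** For c > 0 the curve may pass through the point that is projected to infinity, so g may have
    poles on I itself. There N and D vanish together, and so do numerator and denominator of the
    metric. The equation of the sphere, (1 - mu x0)(1 + mu x0) = c (x1^2 + x2^2), supplies a second
    pair N', D' with D N' = N D', where D' has a simple zero at the pole and N' does not vanish. The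
    Cauchy data are computed from N and D off the poles and reach the poles by continuity along I,
    the poles being isolated. Complex derivatives are handled as pairs of real total differentials.
    Their continuity is not part of [holomorphic_at], so Green's formula is not at hand and path
    independence comes from bisection. No width of a neighbourhood is uniform along I. Every
    neighbourhood is therefore built as a union of boxes or as the interior of the set where the
    required property holds, and only has to contain a box around each point of I. *)

Notation dpl := differentiable_pt_lim.

Lemma dpl_eq (f : R -> R -> R) s t a b a' b' :
  dpl f s t a b -> a = a' -> b = b' -> dpl f s t a' b'.
Proof. now intros h -> ->. Qed.

Lemma dpl_fst (s t : R) : dpl (fun u _ => u) s t 1 0.
Proof. apply (differentiable_pt_lim_proj1_0 (fun u => u)), derivable_pt_lim_id. Qed.

Lemma dpl_snd (s t : R) : dpl (fun _ v => v) s t 0 1.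
Proof.
intros eps; apply locally_2d_forall; intros u v.
replace (v - t - (0 * (u - s) + 1 * (v - t))) with 0 by ring.
rewrite Rabs_R0; apply Rmult_le_pos; [apply Rlt_le, eps|].
apply Rle_trans with (1 := Rabs_pos (u - s)), Rmax_l.
Qed.

Lemma dpl_const (k s t : R) : dpl (fun _ _ => k) s t 0 0.
Proof. apply (differentiable_pt_lim_proj1_0 (fun _ => k)), derivable_pt_lim_const. Qed.

Lemma dpl_comp1 (g : R -> R) (f : R -> R -> R) (s t l a b : R) :
  is_derive g (f s t) l -> dpl f s t a b ->
  dpl (fun u v => g (f u v)) s t (l * a) (l * b).
Proof.
intros hg hf.
assert (h := differentiable_pt_lim_comp (fun u _ => g u) f (fun _ _ => 0) s t l 0 a b 0 0).
eapply dpl_eq; [apply h| |]; try ring; auto.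
- apply differentiable_pt_lim_proj1_0, is_derive_Reals, hg.
- apply dpl_const.
Qed.

Lemma dpl_plus (f g : R -> R -> R) s t a b a' b' :
  dpl f s t a b -> dpl g s t a' b' ->
  dpl (fun u v => f u v + g u v) s t (a + a') (b + b').
Proof.
intros hf hg.
assert (h := differentiable_pt_lim_comp Rplus f g s t 1 1 a b a' b').
eapply dpl_eq; [apply h; auto| |]; try ring.
intros eps; apply locally_2d_forall; intros u v.
match goal with |- Rabs ?x <= _ => replace x with 0 by ring end.
rewrite Rabs_R0; apply Rmult_le_pos; [apply Rlt_le, eps|].
apply Rle_trans with (1 := Rabs_pos (u - f s t)), Rmax_l.
Qed.

Lemma dpl_mult (f g : R -> R -> R) s t a b a' b' :
  dpl f s t a b -> dpl g s t a' b' ->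
  dpl (fun u v => f u v * g u v) s t (a * g s t + f s t * a') (b * g s t + f s t * b').
Proof.
intros hf hg.
assert (h := differentiable_pt_lim_comp Rmult f g s t (g s t) (f s t) a b a' b').
eapply dpl_eq; [apply h; auto| |]; try ring.
intros eps; exists eps; intros u v hu hv.
replace (u * v - f s t * g s t - (g s t * (u - f s t) + f s t * (v - g s t)))
  with ((u - f s t) * (v - g s t)) by ring.
rewrite Rabs_mult; apply Rmult_le_compat; auto using Rabs_pos; [lra|apply Rmax_r].
Qed.

Lemma dpl_opp (f : R -> R -> R) s t a b :
  dpl f s t a b -> dpl (fun u v => - f u v) s t (- a) (- b).
Proof.
intros h.
eapply dpl_eq; [apply (dpl_comp1 Ropp f s t (-1)); [|exact h]| |]; try ring.
auto_derive; [exact I|ring].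
Qed.

Lemma dpl_minus (f g : R -> R -> R) s t a b a' b' :
  dpl f s t a b -> dpl g s t a' b' ->
  dpl (fun u v => f u v - g u v) s t (a - a') (b - b').
Proof. intros hf hg; apply dpl_plus; [exact hf|now apply dpl_opp]. Qed.

Lemma dpl_inv (f : R -> R -> R) s t a b :
  f s t <> 0 -> dpl f s t a b ->
  dpl (fun u v => / f u v) s t (- a * / f s t * / f s t) (- b * / f s t * / f s t).
Proof.
intros h0 h.
eapply dpl_eq; [apply (dpl_comp1 Rinv f s t (- / f s t * / f s t)); [|exact h]| |]; try ring.
auto_derive; [exact h0|field; exact h0].
Qed.

Lemma dpl_continuity (f : R -> R -> R) s t a b :
  dpl f s t a b -> continuity_2d_pt f s t.
Proof. intros h; apply differentiable_continuity_pt; now exists a, b. Qed.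

Lemma dpl_derive_s (f : R -> R -> R) s t a b :
  dpl f s t a b -> is_derive (fun u => f u t) s a.
Proof.
intros h; apply is_derive_Reals.
replace a with (a * 1 + b * 0) by ring.
apply (derivable_pt_lim_comp_2d f (fun u => u) (fun _ => t)); auto.
- apply derivable_pt_lim_id.
- apply derivable_pt_lim_const.
Qed.

Lemma dpl_derive_t (f : R -> R -> R) s t a b :
  dpl f s t a b -> is_derive (fun v => f s v) t b.
Proof.
intros h; apply is_derive_Reals.
replace b with (a * 0 + b * 1) by ring.
apply (derivable_pt_lim_comp_2d f (fun _ => s) (fun v => v)); auto.
- apply derivable_pt_lim_const.
- apply derivable_pt_lim_id.
Qed.

Lemma locally_2d_C (P : C -> Prop) (s t : R) :
  locally (T := C_UniformSpace) (s, t) P <-> locally_2d (fun u v => P (u, v)) s t.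
Proof.
rewrite locally_2d_locally; split; apply filter_imp; now intros [u v].
Qed.

Lemma locally_2d_imp (P Q : R -> R -> Prop) s t :
  (forall u v, P u v -> Q u v) -> locally_2d P s t -> locally_2d Q s t.
Proof. intros h; apply locally_2d_impl, locally_2d_forall; exact h. Qed.

Lemma continuity_2d_pt_locally (f : R -> R -> R) (P : R -> Prop) s t :
  continuity_2d_pt f s t -> locally (f s t) P -> locally_2d (fun u v => P (f u v)) s t.
Proof.
intros hf [e he]; destruct (hf e) as [r hr].
exists r; intros u v hu hv; apply he, hr; assumption.
Qed.

(** Partial derivatives are existential witnesses instead of [Derive], so that closure under sums,
    products and inverses is an induction that exhibits them. Differentiability is asked near the
    point, continuity of the last derivatives at the point alone. *)
Fixpoint Cn (n : nat) (f : R -> R -> R) (s t : R) : Prop :=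
  match n with
  | O => continuity_2d_pt f s t
  | S n => exists fs ft : R -> R -> R,
      locally_2d (fun u v => dpl f u v (fs u v) (ft u v)) s t /\
      Cn n fs s t /\ Cn n ft s t
  end.

Lemma Cn_continuity n f s t : Cn n f s t -> continuity_2d_pt f s t.
Proof.
destruct n as [|n]; [easy|].
intros (fs & ft & h & _); apply locally_2d_singleton in h.
now apply dpl_continuity in h.
Qed.

Lemma Cn_pred n f s t : Cn (S n) f s t -> Cn n f s t.
Proof.
revert f; induction n as [|n IH]; intros f h.
- now apply Cn_continuity in h.
- destruct h as (fs & ft & h & h1 & h2); exists fs, ft; auto.
Qed.

Lemma locally_2d_locally2 (P : R -> R -> Prop) s t :
  locally_2d P s t -> locally_2d (locally_2d P) s t.
Proof.
intros h; eapply locally_2d_impl_strong; [|exact h].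
apply locally_2d_forall; auto.
Qed.

Lemma dpl_ext_loc (f g : R -> R -> R) s t :
  locally_2d (fun u v => f u v = g u v) s t ->
  locally_2d (fun u v => forall a b, dpl f u v a b -> dpl g u v a b) s t.
Proof.
intros h; apply locally_2d_locally2 in h; revert h; apply locally_2d_imp.
intros u v h a b; now apply differentiable_pt_lim_ext.
Qed.

Lemma Cn_ext_loc n f g s t :
  locally_2d (fun u v => f u v = g u v) s t -> Cn n f s t -> Cn n g s t.
Proof.
intros h; destruct n as [|n].
- now apply continuity_2d_pt_ext_loc.
- intros (fs & ft & h0 & h1 & h2); exists fs, ft; split; auto.
  generalize (locally_2d_and _ _ _ _ (dpl_ext_loc _ _ _ _ h) h0).
  apply locally_2d_imp; intros u v [k k']; now apply k.
Qed.

Lemma Cn_const n k s t : Cn n (fun _ _ => k) s t.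
Proof.
revert k; induction n as [|n IH]; intros k; simpl.
- apply continuity_2d_pt_const.
- exists (fun _ _ => 0), (fun _ _ => 0); repeat split; auto.
  apply locally_2d_forall; intros; apply dpl_const.
Qed.

Lemma Cn_plus n f g s t : Cn n f s t -> Cn n g s t -> Cn n (fun u v => f u v + g u v) s t.
Proof.
revert f g; induction n as [|n IH]; intros f g; simpl.
- apply continuity_2d_pt_plus.
- intros (fs & ft & h & h1 & h2) (gs & gt & k & k1 & k2).
  exists (fun u v => fs u v + gs u v), (fun u v => ft u v + gt u v); repeat split; auto.
  generalize (locally_2d_and _ _ _ _ h k); apply locally_2d_imp.
  intros u v [a b]; now apply dpl_plus.
Qed.

Lemma Cn_mult n f g s t : Cn n f s t -> Cn n g s t -> Cn n (fun u v => f u v * g u v) s t.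
Proof.
revert f g; induction n as [|n IH]; intros f g hf hg.
- now apply continuity_2d_pt_mult.
- assert (hf' := Cn_pred _ _ _ _ hf); assert (hg' := Cn_pred _ _ _ _ hg).
  destruct hf as (fs & ft & h & h1 & h2), hg as (gs & gt & k & k1 & k2).
  exists (fun u v => fs u v * g u v + f u v * gs u v),
         (fun u v => ft u v * g u v + f u v * gt u v); repeat split; auto using Cn_plus.
  generalize (locally_2d_and _ _ _ _ h k); apply locally_2d_imp.
  intros u v [a b]; now apply dpl_mult.
Qed.

Lemma Cn_opp n f s t : Cn n f s t -> Cn n (fun u v => - f u v) s t.
Proof.
intros h; apply Cn_ext_loc with (fun u v => (-1) * f u v).
- apply locally_2d_forall; intros; ring.
- apply Cn_mult; [apply Cn_const|exact h].
Qed.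

Lemma Cn_inv n f s t : f s t <> 0 -> Cn n f s t -> Cn n (fun u v => / f u v) s t.
Proof.
intros h0; revert f h0; induction n as [|n IH]; intros f h0 hf.
- now apply continuity_2d_pt_inv.
- assert (hf' := Cn_pred _ _ _ _ hf); assert (hc := Cn_continuity _ _ _ _ hf).
  destruct hf as (fs & ft & h & h1 & h2).
  exists (fun u v => - fs u v * / f u v * / f u v),
         (fun u v => - ft u v * / f u v * / f u v); repeat split;
    [|apply Cn_mult; [apply Cn_mult|]; auto using Cn_opp..].
  generalize (locally_2d_and _ _ _ _ h (continuity_2d_pt_neq_0 _ _ _ hc h0)).
  apply locally_2d_imp; intros u v [a b]; now apply dpl_inv.
Qed.

Lemma Cn_ex_diff_n n f s t : Cn n f s t -> ex_diff_n f n s t.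
Proof.
revert f; induction n as [|n IH]; intros f hf.
- split; [exact hf|exact I].
- assert (hc := Cn_continuity _ _ _ _ hf).
  destruct hf as (fs & ft & h & h1 & h2).
  assert (h' := locally_2d_singleton _ _ _ h).
  split; [exact hc|repeat split].
  + eexists; eapply dpl_derive_s; exact h'.
  + eexists; eapply dpl_derive_t; exact h'.
  + apply ex_diff_n_ext_loc with fs; auto.
    revert h; apply locally_2d_imp; intros u v h.
    symmetry; apply is_derive_unique; eapply dpl_derive_s; exact h.
  + apply ex_diff_n_ext_loc with ft; auto.
    revert h; apply locally_2d_imp; intros u v h.
    symmetry; apply is_derive_unique; eapply dpl_derive_t; exact h.
Qed.

(** The increment splits into a horizontal step, controlled by the mean value theorem and the
    continuity of [fs], and a vertical step at the abscissa [s], for which the derivative at [t]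
    suffices. *)
Lemma dpl_of_partials (f fs : R -> R -> R) (s t b : R) :
  locally_2d (fun u v => is_derive (fun z => f z v) u (fs u v)) s t ->
  is_derive (fun z => f s z) t b ->
  continuity_2d_pt fs s t ->
  dpl f s t (fs s t) b.
Proof.
intros h1 h2 h3.
apply filterdiff_differentiable_pt_lim.
apply (is_derive_filterdiff f s t fs b); auto.
- now apply locally_2d_locally in h1.
- now apply continuity_2d_pt_filterlim.
Qed.

(** * Complex differentiability as a pair of real differentials *)

Notation Cderiv := (@is_derive C_AbsRing C_NormedModule).

(** Total differentiability of both parts with the Cauchy-Riemann equations: the s-derivative of F
    is l and its t-derivative is i l. In this form the real rules of calculus apply, and
    [hol_is_derive] links it to the complex derivative of the statement. *)
Definition hol (F : C -> C) (s t : R) (l : C) : Prop :=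
  dpl (fun u v => Re (F (u, v))) s t (Re l) (- Im l) /\
  dpl (fun u v => Im (F (u, v))) s t (Im l) (Re l).

Lemma Cmod_le_2Rmax (z : C) : Cmod z <= 2 * Rmax (Rabs (Re z)) (Rabs (Im z)).
Proof.
apply Rle_trans with (1 := Cmod_2Rmax z).
apply Rmult_le_compat_r.
- apply Rle_trans with (1 := Rabs_pos (Re z)), Rmax_l.
- apply Rlt_le, sqrt_less; lra.
Qed.

Lemma hol_is_derive (F : C -> C) (s t : R) (l : C) :
  hol F s t l <-> Cderiv F (s, t) l.
Proof.
assert (key : forall u v, let dz := (Cminus (u, v) (s, t)) in
  Cminus (Cminus (F (u, v)) (F (s, t))) (Cmult dz l) =
  (Re (F (u, v)) - Re (F (s, t)) - (Re l * (u - s) + - Im l * (v - t)),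
   Im (F (u, v)) - Im (F (s, t)) - (Im l * (u - s) + Re l * (v - t)))).
{ intros u v dz; unfold dz, Cminus, Cplus, Copp, Cmult, Re, Im; simpl.
  f_equal; ring. }
split.
- intros [h1 h2]; split; [apply is_linear_scal_l|].
  intros x hx eps.
  apply (is_filter_lim_locally_unique (V := AbsRing_NormedModule C_AbsRing)) in hx; subst x.
  apply locally_C, (locally_2d_C (fun x => norm (minus (minus (F x) (F (s, t)))
     (scal (minus x (s, t)) l)) <= eps * norm (minus x (s, t)))).
  (* The modulus is at most twice the larger component, hence [eps / 2] for each component. *)
  assert (he : 0 < eps / 2) by (destruct eps; simpl; lra).
  generalize (locally_2d_and _ _ _ _ (h1 (mkposreal _ he)) (h2 (mkposreal _ he))).
  apply locally_2d_imp; simpl; intros u v [k1 k2].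
  change (Cmod (Cminus (Cminus (F (u, v)) (F (s, t))) (Cmult (Cminus (u, v) (s, t)) l))
    <= eps * Cmod (Cminus (u, v) (s, t))).
  rewrite key.
  apply Rle_trans with (1 := Cmod_le_2Rmax _).
  assert (k3 := Rmax_Cmod (Cminus (u, v) (s, t))); simpl in k3.
  assert (hpos := cond_pos eps).
  assert (k4 := Rmax_lub _ _ _ k1 k2); simpl.
  apply Rle_trans with (1 := Rmult_le_compat_l 2 _ _ ltac:(lra) k4).
  assert (eps * Rmax (Rabs (u - s)) (Rabs (v - t)) <= eps * Cmod (Cminus (u, v) (s, t))).
  { apply Rmult_le_compat_l; [lra|exact k3]. }
  unfold Re, Im in *; simpl in *; unfold Rminus in *; lra.
- intros [_ h]; specialize (h (s, t) (fun P H => H)).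
  assert (h' : forall eps : posreal, locally_2d (fun u v =>
    Cmod (Cminus (Cminus (F (u, v)) (F (s, t))) (Cmult (Cminus (u, v) (s, t)) l))
    <= eps * Cmod (Cminus (u, v) (s, t))) s t).
  { intros eps; specialize (h eps).
    apply (proj2 (locally_C (s, t) _)) in h.
    now apply (locally_2d_C (fun x => norm (minus (minus (F x) (F (s, t)))
     (scal (minus x (s, t)) l)) <= eps * norm (minus x (s, t)))) in h. }
  split; intros eps;
  assert (he : 0 < eps / 2) by (destruct eps; simpl; lra);
  generalize (h' (mkposreal _ he)); apply locally_2d_imp; intros u v k;
  rewrite key in k; simpl in k;
  assert (k5 := Cmod_le_2Rmax (Cminus (u, v) (s, t)));
  match type of k with Cmod ?z <= _ => assert (k4 := Rmax_Cmod z) end;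
  unfold Re, Im in k5; simpl in k4, k5.
  + apply Rle_trans with (1 := Rmax_l _ _) in k4.
    assert (hpos := cond_pos eps); unfold Re, Im in *; simpl in *; unfold Rminus in *; nra.
  + apply Rle_trans with (1 := Rmax_r _ _) in k4.
    assert (hpos := cond_pos eps); unfold Re, Im in *; simpl in *; unfold Rminus in *; nra.
Qed.

Lemma hol_eq F s t l l' : hol F s t l -> l = l' -> hol F s t l'.
Proof. now intros h <-. Qed.

Lemma hol_unique F s t l l' : hol F s t l -> hol F s t l' -> l = l'.
Proof.
intros h h'; apply hol_is_derive in h; apply hol_is_derive in h'.
apply is_C_derive_unique in h; apply is_C_derive_unique in h'; congruence.
Qed.

Lemma hol_ext_loc F G s t l :
  locally_2d (fun u v => F (u, v) = G (u, v)) s t -> hol F s t l -> hol G s t l.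
Proof.
intros h [h1 h2]; split; (eapply differentiable_pt_lim_ext; [|eassumption]);
  revert h; apply locally_2d_imp; now intros u v ->.
Qed.

Lemma hol_const k s t : hol (fun _ => k) s t (RtoC 0).
Proof. split; eapply dpl_eq; try apply dpl_const; simpl; ring. Qed.

Lemma hol_id s t : hol (fun z => z) s t (RtoC 1).
Proof. split; eapply dpl_eq; try apply dpl_fst; try apply dpl_snd; simpl; ring. Qed.

Lemma hol_plus F G s t l m :
  hol F s t l -> hol G s t m -> hol (fun z => Cplus (F z) (G z)) s t (Cplus l m).
Proof.
intros [h1 h2] [k1 k2]; split.
- eapply dpl_eq; [exact (dpl_plus _ _ _ _ _ _ _ _ h1 k1)| |]; simpl; unfold Re, Im; ring.
- eapply dpl_eq; [exact (dpl_plus _ _ _ _ _ _ _ _ h2 k2)| |]; simpl; unfold Re, Im; ring.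
Qed.

Lemma hol_mult F G s t l m :
  hol F s t l -> hol G s t m ->
  hol (fun z => Cmult (F z) (G z)) s t (Cplus (Cmult l (G (s, t))) (Cmult (F (s, t)) m)).
Proof.
intros [h1 h2] [k1 k2]; split.
- eapply dpl_eq; [exact (dpl_minus _ _ _ _ _ _ _ _ (dpl_mult _ _ _ _ _ _ _ _ h1 k1)
    (dpl_mult _ _ _ _ _ _ _ _ h2 k2))| |]; simpl; unfold Re, Im; ring.
- eapply dpl_eq; [exact (dpl_plus _ _ _ _ _ _ _ _ (dpl_mult _ _ _ _ _ _ _ _ h1 k2)
    (dpl_mult _ _ _ _ _ _ _ _ h2 k1))| |]; simpl; unfold Re, Im; ring.
Qed.

Lemma hol_scal k F s t l : hol F s t l -> hol (fun z => Cmult k (F z)) s t (Cmult k l).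
Proof.
intros h; eapply hol_eq; [exact (hol_mult _ _ _ _ _ _ (hol_const k s t) h)|].
cbv beta; ring.
Qed.

Lemma hol_minus F G s t l m :
  hol F s t l -> hol G s t m -> hol (fun z => Cminus (F z) (G z)) s t (Cminus l m).
Proof.
intros [h1 h2] [k1 k2]; split.
- eapply dpl_eq; [exact (dpl_minus _ _ _ _ _ _ _ _ h1 k1)| |]; simpl; unfold Re, Im; ring.
- eapply dpl_eq; [exact (dpl_minus _ _ _ _ _ _ _ _ h2 k2)| |]; simpl; unfold Re, Im; ring.
Qed.

Lemma hol_shift F x0 s t l :
  hol F (s - x0) t l -> hol (fun z => F (Re z - x0, Im z)) s t l.
Proof.
intros [h1 h2]; split.
- assert (h := differentiable_pt_lim_comp (fun u v => Re (F (u, v)))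
    (fun u _ => u - x0) (fun _ v => v) s t _ _ 1 0 0 1 h1).
  eapply dpl_eq; [apply h| |]; try ring; try apply dpl_snd.
  eapply dpl_eq; [apply dpl_minus; [apply dpl_fst|apply dpl_const]| |]; ring.
- assert (h := differentiable_pt_lim_comp (fun u v => Im (F (u, v)))
    (fun u _ => u - x0) (fun _ v => v) s t _ _ 1 0 0 1 h2).
  eapply dpl_eq; [apply h| |]; try ring; try apply dpl_snd.
  eapply dpl_eq; [apply dpl_minus; [apply dpl_fst|apply dpl_const]| |]; ring.
Qed.

Lemma Cnorm2_pos (z : C) : z <> RtoC 0 -> 0 < Re z ^ 2 + Im z ^ 2.
Proof.
intros hz; destruct (Req_dec (Re z) 0) as [h|h].
- destruct (Req_dec (Im z) 0) as [h'|h']; [|nra].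
  exfalso; apply hz; destruct z as [a b]; simpl in *; unfold Re, Im, RtoC in *; simpl in *; congruence.
- nra.
Qed.

Lemma hol_div F G s t l m :
  G (s, t) <> RtoC 0 -> hol F s t l -> hol G s t m ->
  hol (fun z => Cdiv (F z) (G z)) s t
    (Cdiv (Cminus (Cmult l (G (s, t))) (Cmult (F (s, t)) m)) (Cmult (G (s, t)) (G (s, t)))).
Proof.
intros h0 hF hG.
assert (hp := Cnorm2_pos _ h0).
(* The reciprocal is the conjugate over the squared modulus, so each of its parts is a real
   quotient. *)
assert (hI : hol (fun z => Cinv (G z)) s t (Copp (Cdiv m (Cmult (G (s, t)) (G (s, t)))))).
{ destruct hG as [h1 h2].
  assert (hn := dpl_plus _ _ _ _ _ _ _ _ (dpl_mult _ _ _ _ _ _ _ _ h1 h1)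
    (dpl_mult _ _ _ _ _ _ _ _ h2 h2)).
  apply dpl_inv in hn; [|simpl in *; lra].
  assert (Re (G (s, t)) * Re (G (s, t)) + Im (G (s, t)) * Im (G (s, t)) <> 0) by nra.
  split.
  - eapply differentiable_pt_lim_ext.
    2:{ eapply dpl_eq; [exact (dpl_mult _ _ _ _ _ _ _ _ h1 hn)| |].
        - simpl; unfold Re, Im in *; simpl in *.
          field; simpl in *; nra.
        - simpl; unfold Re, Im in *; simpl in *; field; simpl in *; nra. }
    apply locally_2d_forall; intros u v; unfold Cinv, Re, Im; simpl.
    unfold Rdiv; f_equal; f_equal; ring.
  - eapply differentiable_pt_lim_ext.
    2:{ eapply dpl_eq; [exact (dpl_opp _ _ _ _ _ (dpl_mult _ _ _ _ _ _ _ _ h2 hn))| |];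
        simpl; unfold Re, Im in *; simpl in *; field; simpl in *; nra. }
    apply locally_2d_forall; intros u v; unfold Cinv, Re, Im; simpl.
    unfold Rdiv; rewrite <- Ropp_mult_distr_l; do 3 f_equal; ring. }
eapply hol_eq; [exact (hol_mult _ _ _ _ _ _ hF hI)|].
cbv beta; field; exact h0.
Qed.

(** * Closed forms and Goursat's theorem *)

(** The recursion runs in the sigma type of points satisfying [Inv k], so that the step hypothesis
    applies to every point it reaches. *)
Lemma dependent_choice {X : Type} (Inv : nat -> X -> Prop) (Rel : nat -> X -> X -> Prop) x0 :
  Inv O x0 ->
  (forall k x, Inv k x -> exists y, Inv (S k) y /\ Rel k x y) ->
  exists f : nat -> X, f O = x0 /\ forall k, Inv k (f k) /\ Rel k (f k) (f (S k)).
Proof.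
intros h0 hs.
set (F := fun k => {x : X | Inv k x}).
set (next := fun k (x : F k) =>
  let y := constructive_indefinite_description _ (hs k (proj1_sig x) (proj2_sig x)) in
  exist (Inv (S k)) (proj1_sig y) (proj1 (proj2_sig y)) : F (S k)).
set (g := nat_rect F (exist _ x0 h0) next).
exists (fun k => proj1_sig (g k)); split; [reflexivity|].
intros k; split; [exact (proj2_sig (g k))|].
simpl; unfold next; simpl.
exact (proj2 (proj2_sig (constructive_indefinite_description _
  (hs k (proj1_sig (g k)) (proj2_sig (g k)))))).
Qed.

Lemma pow_half_pos k : 0 < (/ 2) ^ k.
Proof. apply pow_lt; lra. Qed.

(** The intervals [a k, a k + W/2^k] are nested, and the supremum of their left ends lies in all of
    them. *)
Lemma nested_limit (a : nat -> R) (W : R) :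
  0 <= W ->
  (forall k, a k <= a (S k) <= a k + W * (/ 2) ^ S k) ->
  exists p, forall k, a k <= p <= a k + W * (/ 2) ^ k.
Proof.
intros hW h.
assert (hinc : forall k j, a k <= a (k + j)%nat).
{ intros k j; induction j as [|j IH]; [rewrite Nat.add_0_r; lra|].
  rewrite Nat.add_succ_r; specialize (h (k + j)%nat); lra. }
assert (hdec : forall k j, a (k + j)%nat + W * (/ 2) ^ (k + j) <= a k + W * (/ 2) ^ k).
{ intros k j; induction j as [|j IH]; [rewrite Nat.add_0_r; lra|].
  rewrite Nat.add_succ_r; specialize (h (k + j)%nat); simpl in *; lra. }
assert (hub : forall k j, a j <= a k + W * (/ 2) ^ k).
{ intros k j; assert (hp := Rmult_le_pos _ _ hW (Rlt_le _ _ (pow_half_pos j))).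
  destruct (Nat.le_ge_cases k j) as [hkj|hkj].
  - specialize (hdec k (j - k)%nat); replace (k + (j - k))%nat with j in hdec by lia; lra.
  - specialize (hinc j (k - j)%nat); replace (j + (k - j))%nat with k in hinc by lia.
    assert (hp' := Rmult_le_pos _ _ hW (Rlt_le _ _ (pow_half_pos k))); lra. }
destruct (completeness (fun x => exists k, x = a k)) as [p [hp1 hp2]].
- exists (a O + W * (/ 2) ^ O); intros x [k ->]; apply hub.
- exists (a O), O; reflexivity.
- exists p; intros k; split; [apply hp1; now exists k|].
  apply hp2; intros x [j ->]; apply hub.
Qed.

(** [Bad a c k] speaks of the rectangle of level k with lower left corner (a, c) and sides W/2^k,
    H/2^k. If badness always passes to one of the four quarters, the chosen rectangles shrink to a
    point. The step may use that its rectangle lies in the initial one. Extreme values and Goursat's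
    theorem both come from this. *)
Lemma bisection_2d (Bad : R -> R -> nat -> Prop) (a0 c0 W H : R) :
  0 <= W -> 0 <= H ->
  Bad a0 c0 O ->
  (forall a c k, a0 <= a -> a + W * (/ 2) ^ k <= a0 + W ->
     c0 <= c -> c + H * (/ 2) ^ k <= c0 + H -> Bad a c k ->
     exists i j, (i = 0 \/ i = 1) /\ (j = 0 \/ j = 1) /\
       Bad (a + i * (W * (/ 2) ^ S k)) (c + j * (H * (/ 2) ^ S k)) (S k)) ->
  exists p q, (a0 <= p <= a0 + W) /\ (c0 <= q <= c0 + H) /\
    forall k, exists a c, Bad a c k /\
      a0 <= a /\ a + W * (/ 2) ^ k <= a0 + W /\
      c0 <= c /\ c + H * (/ 2) ^ k <= c0 + H /\
      (a <= p <= a + W * (/ 2) ^ k) /\ (c <= q <= c + H * (/ 2) ^ k).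
Proof.
intros hW hH h0 hs.
destruct (dependent_choice (fun k (x : R * R) => Bad (fst x) (snd x) k /\
   a0 <= fst x /\ fst x + W * (/ 2) ^ k <= a0 + W /\
   c0 <= snd x /\ snd x + H * (/ 2) ^ k <= c0 + H)
  (fun k x y => (fst x <= fst y <= fst x + W * (/ 2) ^ S k) /\
                (snd x <= snd y <= snd x + H * (/ 2) ^ S k)) (a0, c0))
  as (f & hf0 & hf).
- simpl; repeat split; auto; lra.
- intros k [a c] (hb & h1 & h2 & h3 & h4); simpl in *.
  destruct (hs a c k h1 h2 h3 h4 hb) as (i & j & hi & hj & hb').
  assert (hWk := Rmult_le_pos _ _ hW (Rlt_le _ _ (pow_half_pos k))).
  assert (hHk := Rmult_le_pos _ _ hH (Rlt_le _ _ (pow_half_pos k))).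
  eexists (_, _); simpl; split; [split; [exact hb'|]|]; simpl;
    destruct hi as [-> | ->], hj as [-> | ->]; repeat split; lra.
- destruct (nested_limit (fun k => fst (f k)) W hW) as [p hp];
    [intros k; apply hf|].
  destruct (nested_limit (fun k => snd (f k)) H hH) as [q hq];
    [intros k; apply hf|].
  exists p, q; repeat split.
  + specialize (hp O); rewrite hf0 in hp; simpl in hp; lra.
  + specialize (hp O); rewrite hf0 in hp; simpl in hp; lra.
  + specialize (hq O); rewrite hf0 in hq; simpl in hq; lra.
  + specialize (hq O); rewrite hf0 in hq; simpl in hq; lra.
  + intros k; exists (fst (f k)), (snd (f k)).
    destruct (hf k) as [(h1 & h2) _]; repeat split; try apply h1; try apply h2;
      try apply hp; try apply hq.
Qed.

Lemma small_half_pow (L eps : R) : 0 < eps -> exists k, L * (/ 2) ^ k < eps.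
Proof.
intros he.
destruct (pow_lt_1_zero (/ 2) ltac:(rewrite Rabs_pos_eq; lra) (eps / (Rabs L + 1))) as [k hk].
- apply Rdiv_lt_0_compat; [lra|]; assert (h := Rabs_pos L); lra.
- exists k; specialize (hk k (le_n k)).
  assert (hp := pow_half_pos k); rewrite Rabs_pos_eq in hk by lra.
  assert (h := Rabs_pos L).
  apply Rle_lt_trans with ((Rabs L + 1) * (/ 2) ^ k).
  + apply Rmult_le_compat_r; [lra|]; assert (h' := Rle_abs L); lra.
  + apply (Rmult_lt_compat_l (Rabs L + 1)) in hk; [|lra].
    replace eps with ((Rabs L + 1) * (eps / (Rabs L + 1))); [lra|field; lra].
Qed.

Lemma continuity_2d_max (f : R -> R -> R) (a b c d : R) :
  a <= b -> c <= d ->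
  (forall s t, a <= s <= b -> c <= t <= d -> continuity_2d_pt f s t) ->
  exists p q, (a <= p <= b) /\ (c <= q <= d) /\
    forall s t, a <= s <= b -> c <= t <= d -> f s t <= f p q.
Proof.
intros hab hcd hf.
(* A rectangle is bad when every value taken on the whole domain is matched or exceeded on it. *)
set (Bad := fun x y k => forall s t, a <= s <= b -> c <= t <= d ->
  exists s' t', (x <= s' <= x + (b - a) * (/ 2) ^ k) /\
    (y <= t' <= y + (d - c) * (/ 2) ^ k) /\ f s t <= f s' t').
destruct (bisection_2d Bad a c (b - a) (d - c)) as (p & q & hp & hq & h).
- lra.
- lra.
- intros s t hs ht; exists s, t; simpl; repeat split; lra.
- intros x y k hx hx' hy hy' hB.
  apply NNPP; intros hn.
  set (w := (b - a) * (/ 2) ^ S k); set (v := (d - c) * (/ 2) ^ S k).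
  assert (ew : (b - a) * (/ 2) ^ k = 2 * w) by (unfold w; simpl; lra).
  assert (ev : (d - c) * (/ 2) ^ k = 2 * v) by (unfold v; simpl; lra).
  assert (hN : forall i j, i = 0 \/ i = 1 -> j = 0 \/ j = 1 ->
    exists s t, a <= s <= b /\ c <= t <= d /\ forall s' t',
     x + i * w <= s' <= x + i * w + w -> y + j * v <= t' <= y + j * v + v -> f s' t' < f s t).
  { intros i j hi hj; apply NNPP; intros hn'; apply hn; exists i, j.
    do 2 (split; [assumption|]).
    intros s t hs ht; apply NNPP; intros hn''; apply hn'; exists s, t.
    do 2 (split; [assumption|]).
    intros s' t' hs' ht'; apply Rnot_le_lt; intros hle; apply hn''.
    exists s', t'; repeat split; try apply hs'; try apply ht'; assumption. }
  destruct (hN 0 0) as (s1 & t1 & hs1 & ht1 & k1); auto.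
  destruct (hN 0 1) as (s2 & t2 & hs2 & ht2 & k2); auto.
  destruct (hN 1 0) as (s3 & t3 & hs3 & ht3 & k3); auto.
  destruct (hN 1 1) as (s4 & t4 & hs4 & ht4 & k4); auto.
  (* If each quarter is strictly beaten by some value, the largest of these four values beats the
     whole rectangle, contrary to [hB]. *)
  assert (hM : exists s t, a <= s <= b /\ c <= t <= d /\ f s1 t1 <= f s t /\
     f s2 t2 <= f s t /\ f s3 t3 <= f s t /\ f s4 t4 <= f s t).
  { destruct (Rle_dec (f s1 t1) (f s2 t2)), (Rle_dec (f s3 t3) (f s4 t4));
    [destruct (Rle_dec (f s2 t2) (f s4 t4));[exists s4, t4|exists s2, t2]
    |destruct (Rle_dec (f s2 t2) (f s3 t3));[exists s3, t3|exists s2, t2]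
    |destruct (Rle_dec (f s1 t1) (f s4 t4));[exists s4, t4|exists s1, t1]
    |destruct (Rle_dec (f s1 t1) (f s3 t3));[exists s3, t3|exists s1, t1]];
    repeat split; lra. }
  destruct hM as (s & t & hs & ht & m1 & m2 & m3 & m4).
  destruct (hB s t hs ht) as (s' & t' & hs' & ht' & hle).
  rewrite ew in hs'; rewrite ev in ht'.
  destruct (Rle_dec s' (x + w)), (Rle_dec t' (y + v));
    [specialize (k1 s' t')|specialize (k2 s' t')|specialize (k3 s' t')|specialize (k4 s' t')]; lra.
- exists p, q; split; [lra|split; [lra|]].
  intros s t hs ht; apply Rnot_lt_le; intros hlt.
  assert (he : 0 < f s t - f p q) by lra.
  destruct (hf p q ltac:(lra) ltac:(lra) (mkposreal _ he)) as [r hr]; simpl in hr.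
  destruct (small_half_pow (Rmax (b - a) (d - c)) r (cond_pos r)) as [k hk].
  destruct (h k) as (x & y & hB & _ & _ & _ & _ & hx & hy).
  destruct (hB s t hs ht) as (s' & t' & hs' & ht' & hle).
  assert (hpk := pow_half_pos k).
  assert ((b - a) * (/ 2) ^ k <= Rmax (b - a) (d - c) * (/ 2) ^ k)
    by (apply Rmult_le_compat_r; [lra|apply Rmax_l]).
  assert ((d - c) * (/ 2) ^ k <= Rmax (b - a) (d - c) * (/ 2) ^ k)
    by (apply Rmult_le_compat_r; [lra|apply Rmax_r]).
  assert (h1 := hr s' t' ltac:(apply Rabs_def1; lra) ltac:(apply Rabs_def1; lra)).
  apply Rabs_def2 in h1; lra.
Qed.

(** The integral of P ds + T dt counterclockwise along the boundary of [a, b] x [c, d]. *)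
Definition rect_integral (P T : R -> R -> R) (a b c d : R) : R :=
  RInt (fun s => P s c) a b - RInt (fun s => P s d) a b
  + (RInt (fun t => T b t) c d - RInt (fun t => T a t) c d).

Lemma continuity_2d_continuous_s (f : R -> R -> R) s t :
  continuity_2d_pt f s t -> continuous (fun u => f u t) s.
Proof.
intros h; apply continuity_pt_filterlim; intros e he.
destruct (h (mkposreal _ he)) as [r hr]; exists r; split; [apply cond_pos|].
intros u [_ hu]; apply hr; [exact hu|]; rewrite Rminus_eq_0, Rabs_R0; apply cond_pos.
Qed.

Lemma continuity_2d_continuous_t (f : R -> R -> R) s t :
  continuity_2d_pt f s t -> continuous (fun v => f s v) t.
Proof.
intros h; apply continuity_pt_filterlim; intros e he.
destruct (h (mkposreal _ he)) as [r hr]; exists r; split; [apply cond_pos|].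
intros u [_ hu]; apply hr; [|exact hu]; rewrite Rminus_eq_0, Rabs_R0; apply cond_pos.
Qed.

(** Affine functions P and T with the same cross coefficient [m] make a closed form, whose integral
    around a rectangle is zero. What remains are the errors: 2 eps rho times the length for each
    pair of opposite sides. *)
Lemma rect_integral_small (P T : R -> R -> R) (a b c d p q Ps m Rt eps rho : R) :
  a <= b -> c <= d ->
  (forall s t, a <= s <= b -> c <= t <= d ->
     continuity_2d_pt P s t /\ continuity_2d_pt T s t) ->
  (forall s t, a <= s <= b -> c <= t <= d ->
     Rabs (P s t - P p q - (Ps * (s - p) + m * (t - q))) <= eps * rho /\
     Rabs (T s t - T p q - (m * (s - p) + Rt * (t - q))) <= eps * rho) ->
  Rabs (rect_integral P T a b c d) <= 2 * eps * rho * ((b - a) + (d - c)).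
Proof.
intros hab hcd hc h.
assert (iP : forall t, c <= t <= d -> ex_RInt (fun s => P s t) a b).
{ intros t ht; apply (ex_RInt_continuous (V := R_CompleteNormedModule)).
  rewrite Rmin_left, Rmax_right by exact hab; intros s hs.
  apply continuity_2d_continuous_s, hc; auto. }
assert (iR : forall s, a <= s <= b -> ex_RInt (fun t => T s t) c d).
{ intros s hs; apply (ex_RInt_continuous (V := R_CompleteNormedModule)).
  rewrite Rmin_left, Rmax_right by exact hcd; intros t ht.
  apply (continuity_2d_continuous_t T), hc; auto. }
assert (E1 : Rabs (RInt (fun s => (P s c - P s d) - m * (c - d)) a b) <= (b - a) * (2 * (eps * rho))).
{ apply abs_RInt_le_const; [exact hab| |].
  - apply (ex_RInt_minus (V := R_NormedModule)); [|apply ex_RInt_const].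
    apply (ex_RInt_minus (V := R_NormedModule)); apply iP; lra.
  - intros s hs; destruct (h s c hs ltac:(lra)) as [h1 _], (h s d hs ltac:(lra)) as [h2 _].
    apply Rabs_le_between in h1; apply Rabs_le_between in h2; apply Rabs_le_between; lra. }
assert (E2 : Rabs (RInt (fun t => (T b t - T a t) - m * (b - a)) c d) <= (d - c) * (2 * (eps * rho))).
{ apply abs_RInt_le_const; [exact hcd| |].
  - apply (ex_RInt_minus (V := R_NormedModule)); [|apply ex_RInt_const].
    apply (ex_RInt_minus (V := R_NormedModule)); apply iR; lra.
  - intros t ht; destruct (h b t ltac:(lra) ht) as [_ h1], (h a t ltac:(lra) ht) as [_ h2].
    apply Rabs_le_between in h1; apply Rabs_le_between in h2; apply Rabs_le_between; lra. }
rewrite (RInt_minus (fun s => P s c - P s d) (fun _ => m * (c - d))) in E1;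
  [|apply (ex_RInt_minus (V := R_NormedModule)); apply iP; lra|apply ex_RInt_const].
rewrite (RInt_minus (fun s => P s c) (fun s => P s d)) in E1; try (apply iP; lra).
rewrite (RInt_minus (fun t => T b t - T a t) (fun _ => m * (b - a))) in E2;
  [|apply (ex_RInt_minus (V := R_NormedModule)); apply iR; lra|apply ex_RInt_const].
rewrite (RInt_minus (fun t => T b t) (fun t => T a t)) in E2; try (apply iR; lra).
rewrite RInt_const in E1, E2.
unfold minus, plus, opp, scal in E1, E2; simpl in E1, E2; unfold mult in E1, E2; simpl in E1, E2.
unfold rect_integral.
apply Rabs_le_between in E1; apply Rabs_le_between in E2; apply Rabs_le_between.
nra.
Qed.

Lemma rect_integral_split (P T : R -> R -> R) (a w c h : R) :
  0 <= w -> 0 <= h ->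
  (forall s t, a <= s <= a + 2 * w -> c <= t <= c + 2 * h ->
     continuity_2d_pt P s t /\ continuity_2d_pt T s t) ->
  rect_integral P T a (a + 2 * w) c (c + 2 * h) =
    rect_integral P T a (a + w) c (c + h) + rect_integral P T (a + w) (a + w + w) c (c + h)
    + (rect_integral P T a (a + w) (c + h) (c + h + h)
       + rect_integral P T (a + w) (a + w + w) (c + h) (c + h + h)).
Proof.
intros hw hh hc.
assert (iP : forall x y t, a <= x -> x <= y -> y <= a + 2 * w -> c <= t <= c + 2 * h ->
  ex_RInt (fun s => P s t) x y).
{ intros x y t hx hxy hy ht; apply (ex_RInt_continuous (V := R_CompleteNormedModule)).
  rewrite Rmin_left, Rmax_right by lra; intros s hs.
  apply continuity_2d_continuous_s, hc; lra. }
assert (iR : forall x y s, c <= x -> x <= y -> y <= c + 2 * h -> a <= s <= a + 2 * w ->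
  ex_RInt (fun t => T s t) x y).
{ intros x y s hx hxy hy hs; apply (ex_RInt_continuous (V := R_CompleteNormedModule)).
  rewrite Rmin_left, Rmax_right by lra; intros t ht.
  apply (continuity_2d_continuous_t T), hc; lra. }
unfold rect_integral.
replace (a + w + w) with (a + 2 * w) by ring.
replace (c + h + h) with (c + 2 * h) by ring.
rewrite <- (RInt_Chasles (fun s => P s c) a (a + w) (a + 2 * w)) by (apply iP; lra).
rewrite <- (RInt_Chasles (fun s => P s (c + 2 * h)) a (a + w) (a + 2 * w)) by (apply iP; lra).
rewrite <- (RInt_Chasles (fun t => T a t) c (c + h) (c + 2 * h)) by (apply iR; lra).
rewrite <- (RInt_Chasles (fun t => T (a + 2 * w) t) c (c + h) (c + 2 * h)) by (apply iR; lra).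
unfold plus; simpl; ring.
Qed.

(** The common coefficient [m] expresses that P ds + T dt is closed; nothing is known of its
    continuity. If the integral is J in absolute value, some quarter carries at least J/4, and so on
    down to a point. At that point differentiability makes the integral around a small rectangle of
    size rho negligible against rho^2. *)
Lemma goursat_rect (P T Ps m Rt : R -> R -> R) (a b c d : R) :
  a <= b -> c <= d ->
  (forall s t, a <= s <= b -> c <= t <= d ->
     dpl P s t (Ps s t) (m s t) /\ dpl T s t (m s t) (Rt s t)) ->
  rect_integral P T a b c d = 0.
Proof.
intros hab hcd hd.
assert (hc : forall s t, a <= s <= b -> c <= t <= d ->
     continuity_2d_pt P s t /\ continuity_2d_pt T s t).
{ intros s t hs ht; destruct (hd s t hs ht); split; eapply dpl_continuity; eassumption. }
apply NNPP; intros hne.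
set (J := Rabs (rect_integral P T a b c d)).
assert (hJ : 0 < J) by now apply Rabs_pos_lt.
set (W := b - a); set (H := d - c).
set (Bad := fun x y k => J * (/ 4) ^ k <=
  Rabs (rect_integral P T x (x + W * (/ 2) ^ k) y (y + H * (/ 2) ^ k))).
destruct (bisection_2d Bad a c W H) as (p & q & hp & hq & hB); try (unfold W, H; lra).
- unfold Bad; simpl; rewrite !Rmult_1_r; unfold W, H.
  replace (a + (b - a)) with b by ring; replace (c + (d - c)) with d by ring.
  apply Rle_refl.
- intros x y k hx hx' hy hy' hB; unfold Bad in *.
  set (w := W * (/ 2) ^ S k); set (h := H * (/ 2) ^ S k).
  assert (hw : 0 <= w) by (apply Rmult_le_pos; [unfold W; lra|apply Rlt_le, pow_half_pos]).
  assert (hh : 0 <= h) by (apply Rmult_le_pos; [unfold H; lra|apply Rlt_le, pow_half_pos]).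
  assert (ew : W * (/ 2) ^ k = 2 * w) by (unfold w; simpl; lra).
  assert (eh : H * (/ 2) ^ k = 2 * h) by (unfold h; simpl; lra).
  rewrite ew, eh in hB; rewrite ew in hx'; rewrite eh in hy'.
  assert (W = b - a) by easy; assert (H = d - c) by easy.
  rewrite rect_integral_split in hB; auto; [|intros; apply hc; lra].
  apply NNPP; intros hn.
  assert (hN : forall i j, i = 0 \/ i = 1 -> j = 0 \/ j = 1 ->
    Rabs (rect_integral P T (x + i * w) (x + i * w + w) (y + j * h) (y + j * h + h))
      < J * (/ 4) ^ S k).
  { intros i j hi hj; apply Rnot_le_lt; intros hle; apply hn; exists i, j; auto. }
  assert (n1 := hN 0 0 ltac:(auto) ltac:(auto)); assert (n2 := hN 1 0 ltac:(auto) ltac:(auto)).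
  assert (n3 := hN 0 1 ltac:(auto) ltac:(auto)); assert (n4 := hN 1 1 ltac:(auto) ltac:(auto)).
  rewrite ?Rmult_0_l, ?Rmult_1_l, ?Rplus_0_r in *.
  assert (e4 : J * (/ 4) ^ k = 4 * (J * (/ 4) ^ S k)) by (simpl; lra).
  rewrite e4 in hB.
  apply Rabs_def2 in n1; apply Rabs_def2 in n2; apply Rabs_def2 in n3; apply Rabs_def2 in n4.
  revert hB; apply Rlt_not_le, Rabs_def1; lra.
- assert (hW : 0 <= W) by (unfold W; lra); assert (hH : 0 <= H) by (unfold H; lra).
  (* The summand 1 keeps L positive for degenerate rectangles. With eps = J/(4 L^2) the upper bound
     2 eps (L/2^k)^2 is one half of the lower bound J/4^k. *)
  set (L := W + H + 1).
  assert (he : 0 < J / (4 * L * L)) by (apply Rdiv_lt_0_compat; unfold L; nra).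
  destruct (hd p q) as [dP dR]; try (unfold W, H in *; lra).
  destruct (dP (mkposreal _ he)) as [r1 hr1]; destruct (dR (mkposreal _ he)) as [r2 hr2].
  simpl in hr1, hr2.
  destruct (small_half_pow L (Rmin r1 r2)) as [k hk];
    [apply Rmin_glb_lt; apply cond_pos|].
  destruct (hB k) as (x & y & hb & hx1 & hx2 & hy1 & hy2 & hpx & hqy).
  assert (hpk := pow_half_pos k).
  assert (m1 := Rmin_l r1 r2); assert (m2 := Rmin_r r1 r2).
  assert (hWk : 0 <= W * (/ 2) ^ k) by (apply Rmult_le_pos; lra).
  assert (hHk : 0 <= H * (/ 2) ^ k) by (apply Rmult_le_pos; lra).
  assert (eL : L * (/ 2) ^ k = W * (/ 2) ^ k + H * (/ 2) ^ k + (/ 2) ^ k) by (unfold L; ring).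
  assert (hsm := rect_integral_small P T x (x + W * (/ 2) ^ k) y (y + H * (/ 2) ^ k) p q
    (Ps p q) (m p q) (Rt p q) (J / (4 * L * L)) (L * (/ 2) ^ k)).
  unfold Bad in hb.
  assert (hs : Rabs (rect_integral P T x (x + W * (/ 2) ^ k) y (y + H * (/ 2) ^ k)) <=
     2 * (J / (4 * L * L)) * (L * (/ 2) ^ k) * (L * (/ 2) ^ k)).
  { eapply Rle_trans; [apply hsm|]; try lra.
    - intros s t hs ht; apply hc; unfold W, H in *; lra.
    - intros s t hs ht.
      assert (hmx : Rmax (Rabs (s - p)) (Rabs (t - q)) <= L * (/ 2) ^ k).
      { apply Rmax_lub; apply Rabs_le_between; lra. }
      split.
      + eapply Rle_trans; [apply hr1|apply Rmult_le_compat_l; [lra|exact hmx]];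
          apply Rabs_def1; lra.
      + eapply Rle_trans; [apply hr2|apply Rmult_le_compat_l; [lra|exact hmx]];
          apply Rabs_def1; lra.
    - apply Rmult_le_compat_l; [|lra].
      apply Rmult_le_pos; [lra|]; rewrite eL; lra. }
  replace (2 * (J / (4 * L * L)) * (L * (/ 2) ^ k) * (L * (/ 2) ^ k))
    with (J / 2 * (/ 4) ^ k) in hs.
  + assert (0 < (/ 4) ^ k) by (apply pow_lt; lra).
    assert (0 < J * (/ 4) ^ k) by now apply Rmult_lt_0_compat.
    lra.
  + replace ((/ 4) ^ k) with ((/ 2) ^ k * (/ 2) ^ k)
      by (rewrite <- Rpow_mult_distr; f_equal; lra).
    field; unfold L; lra.
Qed.

Lemma rect_integral_swap_s (P T : R -> R -> R) (a b c d : R) :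
  ex_RInt (fun s => P s c) a b -> ex_RInt (fun s => P s d) a b ->
  rect_integral P T b a c d = - rect_integral P T a b c d.
Proof.
intros h1 h2; unfold rect_integral.
rewrite <- (opp_RInt_swap _ _ _ h1), <- (opp_RInt_swap _ _ _ h2).
unfold opp; simpl; ring.
Qed.

Lemma rect_integral_swap_t (P T : R -> R -> R) (a b c d : R) :
  ex_RInt (fun t => T a t) c d -> ex_RInt (fun t => T b t) c d ->
  rect_integral P T a b d c = - rect_integral P T a b c d.
Proof.
intros h1 h2; unfold rect_integral.
rewrite <- (opp_RInt_swap _ _ _ h1), <- (opp_RInt_swap _ _ _ h2).
unfold opp; simpl; ring.
Qed.

Definition box (x0 delta H s t : R) : Prop := Rabs (s - x0) < delta /\ Rabs t < H.

Lemma box_elim x0 delta H s t :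
  box x0 delta H s t -> x0 - delta < s < x0 + delta /\ - H < t < H.
Proof. intros [h1 h2]; apply Rabs_def2 in h1; apply Rabs_def2 in h2; lra. Qed.

Lemma box_intro x0 delta H s t :
  x0 - delta < s < x0 + delta -> - H < t < H -> box x0 delta H s t.
Proof. split; apply Rabs_def1; lra. Qed.

Lemma box_locally x0 delta H s t :
  box x0 delta H s t -> locally_2d (box x0 delta H) s t.
Proof.
intros h; apply box_elim in h.
assert (hr : 0 < Rmin (Rmin (s - (x0 - delta)) (x0 + delta - s)) (Rmin (t + H) (H - t))).
{ repeat apply Rmin_glb_lt; lra. }
exists (mkposreal _ hr); simpl; intros u v hu hv.
assert (a1 := Rmin_l (Rmin (s - (x0 - delta)) (x0 + delta - s)) (Rmin (t + H) (H - t))).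
assert (a2 := Rmin_r (Rmin (s - (x0 - delta)) (x0 + delta - s)) (Rmin (t + H) (H - t))).
assert (a3 := Rmin_l (s - (x0 - delta)) (x0 + delta - s)).
assert (a4 := Rmin_r (s - (x0 - delta)) (x0 + delta - s)).
assert (a5 := Rmin_l (t + H) (H - t)); assert (a6 := Rmin_r (t + H) (H - t)).
apply Rabs_def2 in hu; apply Rabs_def2 in hv.
apply box_intro; lra.
Qed.

Lemma RInt_derive_open (f : R -> R) (lo hi a s : R) :
  lo < a < hi -> lo < s < hi ->
  (forall x, lo < x < hi -> continuous f x) ->
  is_derive (fun x => RInt f a x) s (f s).
Proof.
intros ha hs hf.
apply (is_derive_RInt f (fun x => RInt f a x) a s); [|now apply hf].
assert (hr : 0 < Rmin (s - lo) (hi - s)) by (apply Rmin_glb_lt; lra).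
exists (mkposreal _ hr); intros x hx.
apply (RInt_correct (V := R_CompleteNormedModule)), (ex_RInt_continuous (V := R_CompleteNormedModule)).
intros z hz; apply hf.
change (Rabs (x - s) < Rmin (s - lo) (hi - s)) in hx.
assert (m1 := Rmin_l (s - lo) (hi - s)); assert (m2 := Rmin_r (s - lo) (hi - s)).
apply Rabs_def2 in hx.
revert hz; unfold Rmin, Rmax; destruct (Rle_dec a x); lra.
Qed.

(** The integral along the axis and then along the vertical has t-derivative T. By Goursat's theorem
    the path that takes the vertical at [x0] first gives the same value, and this one has
    s-derivative P. *)
Lemma closed_form_potential (P T Ps m Tt : R -> R -> R) (x0 delta H : R) :
  0 < delta -> 0 < H ->
  (forall s t, box x0 delta H s t ->
     dpl P s t (Ps s t) (m s t) /\ dpl T s t (m s t) (Tt s t)) ->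
  exists Phi : R -> R -> R, Phi x0 0 = 0 /\
    forall s t, box x0 delta H s t -> dpl Phi s t (P s t) (T s t).
Proof.
intros hdelta hH hd.
assert (hcP : forall s t, box x0 delta H s t -> continuity_2d_pt P s t).
{ intros s t h; destruct (hd s t h) as [h' _]; eapply dpl_continuity, h'. }
assert (hcT : forall s t, box x0 delta H s t -> continuity_2d_pt T s t).
{ intros s t h; destruct (hd s t h) as [_ h']; eapply dpl_continuity, h'. }
exists (fun s t => RInt (fun u => P u 0) x0 s + RInt (fun v => T s v) 0 t).
split; [rewrite !RInt_point; apply Rplus_0_r|].
assert (iP : forall x y t, x0 - delta < x -> x <= y -> y < x0 + delta -> - H < t < H ->
  ex_RInt (fun s => P s t) x y).
{ intros x y t hx hxy hy ht; apply (ex_RInt_continuous (V := R_CompleteNormedModule)).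
  rewrite Rmin_left, Rmax_right by lra; intros s hs.
  apply continuity_2d_continuous_s, hcP, box_intro; lra. }
assert (iT : forall x y s, - H < x -> x <= y -> y < H -> x0 - delta < s < x0 + delta ->
  ex_RInt (fun t => T s t) x y).
{ intros x y s hx hxy hy hs; apply (ex_RInt_continuous (V := R_CompleteNormedModule)).
  rewrite Rmin_left, Rmax_right by lra; intros t ht.
  apply (continuity_2d_continuous_t T), hcT, box_intro; lra. }
(* Goursat's theorem wants ordered bounds; in the other three quadrants the integral changes sign
   once or twice. *)
assert (hz : forall s t, box x0 delta H s t -> rect_integral P T x0 s 0 t = 0).
{ intros s t h; apply box_elim in h.
  assert (hG : forall a b c d, x0 - delta < a -> a <= b -> b < x0 + delta ->
    - H < c -> c <= d -> d < H -> rect_integral P T a b c d = 0).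
  { intros a b c d h1 h2 h3 h4 h5 h6.
    apply goursat_rect with Ps m Tt; try lra; intros; apply hd, box_intro; lra. }
  destruct (Rle_dec x0 s), (Rle_dec 0 t).
  - apply hG; lra.
  - rewrite rect_integral_swap_t by (apply iT; lra); rewrite hG by lra; ring.
  - rewrite rect_integral_swap_s by (apply iP; lra); rewrite hG by lra; ring.
  - rewrite rect_integral_swap_s by (apply iP; lra).
    rewrite rect_integral_swap_t by (apply iT; lra); rewrite hG by lra; ring. }
intros s t hst.
apply (dpl_of_partials _ P).
- generalize (box_locally _ _ _ _ _ hst); apply locally_2d_imp; intros u v huv.
  assert (hb := box_elim _ _ _ _ _ huv).
  (* On this second path the vertical part does not depend on the abscissa. *)
  apply is_derive_ext_loc with (fun z => RInt (fun y => T x0 y) 0 v + RInt (fun x => P x v) x0 z).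
  + generalize (locally_2d_1d_const_y _ _ _ (box_locally _ _ _ _ _ huv)); apply filter_imp.
    intros z hz'; specialize (hz z v hz'); unfold rect_integral in hz; lra.
  + rewrite <- (Rplus_0_l (P u v)).
    apply (is_derive_plus (fun _ => RInt (fun y => T x0 y) 0 v) (fun z => RInt (fun x => P x v) x0 z)).
    * apply (is_derive_const (RInt (fun y => T x0 y) 0 v : R_NormedModule) u).
    * apply (RInt_derive_open (fun x => P x v) (x0 - delta) (x0 + delta)); try lra.
      intros x hx; apply continuity_2d_continuous_s, hcP, box_intro; lra.
- rewrite <- (Rplus_0_l (T s t)).
  assert (hb := box_elim _ _ _ _ _ hst).
  apply (is_derive_plus (fun _ => RInt (fun u => P u 0) x0 s) (fun z => RInt (fun v => T s v) 0 z)).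
  + apply (is_derive_const (RInt (fun u => P u 0) x0 s : R_NormedModule) t).
  + apply (RInt_derive_open (fun v => T s v) (- H) H); try lra.
    intros x hx; apply (continuity_2d_continuous_t T), hcT, box_intro; lra.
- now apply hcP.
Qed.

(** * The identity theorem *)

Lemma derive_pos_right (f f1 : R -> R) (x y : R) :
  x < y -> (forall u, x <= u <= y -> is_derive f u (f1 u)) ->
  (forall u, x < u < y -> 0 < f1 u) -> f x < f y.
Proof.
intros hxy hd hp.
destruct (MVT_cor2 f f1 x y hxy) as (c & hc & hc').
- intros u hu; apply is_derive_Reals, hd; exact hu.
- specialize (hp c hc'); nra.
Qed.

(** If l > 0, then [f1] lies above f1 x just after x and below it just before. According to the sign
    of f1 x, f increases to the right of x or decreases towards x from the left, and takes a larger
    value next to x. *)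
Lemma second_derivative_at_max (f f1 : R -> R) (x l : R) :
  locally x (fun u => is_derive f u (f1 u)) -> is_derive f1 x l ->
  locally x (fun u => f u <= f x) -> l <= 0.
Proof.
intros h1 h2 h3; apply Rnot_lt_le; intros hl.
apply is_derive_Reals in h2.
destruct (h2 (l / 2) ltac:(lra)) as [d2 hd2].
destruct (filter_and _ _ h1 h3) as [d1 hd1].
set (r := Rmin d1 d2 / 2).
assert (hr : 0 < r /\ r < d1 /\ r < d2).
{ unfold r; assert (a1 := Rmin_l d1 d2); assert (a2 := Rmin_r d1 d2).
  assert (0 < Rmin d1 d2) by (apply Rmin_glb_lt; apply cond_pos); lra. }
assert (hmono : forall u, x - r <= u <= x + r -> u <> x ->
   (f1 u - f1 x) / (u - x) > 0).
{ intros u hu hne; specialize (hd2 (u - x) ltac:(lra) ltac:(apply Rabs_def1; lra)).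
  replace (x + (u - x)) with u in hd2 by ring; apply Rabs_def2 in hd2; lra. }
assert (hder : forall u, x - r <= u <= x + r -> is_derive f u (f1 u) /\ f u <= f x).
{ intros u hu; apply hd1; change (Rabs (u - x) < d1); apply Rabs_def1; lra. }
destruct (Rle_dec 0 (f1 x)) as [h|h].
- assert (f x < f (x + r)).
  { apply (derive_pos_right f f1); [lra| |].
    - intros u hu; apply hder; lra.
    - intros u hu; specialize (hmono u ltac:(lra) ltac:(lra)).
      assert (0 < (f1 u - f1 x) / (u - x) * (u - x)) by (apply Rmult_lt_0_compat; lra).
      replace ((f1 u - f1 x) / (u - x) * (u - x)) with (f1 u - f1 x) in H by (field; lra); lra. }
  destruct (hder (x + r)); lra.
- assert (- f (x - r) < - f x).
  { apply (derive_pos_right (fun u => - f u) (fun u => - f1 u)); [lra| |].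
    - intros u hu; apply (is_derive_opp f), hder; lra.
    - intros u hu; specialize (hmono u ltac:(lra) ltac:(lra)).
      assert (0 < (f1 u - f1 x) / (u - x) * (x - u)) by (apply Rmult_lt_0_compat; lra).
      replace ((f1 u - f1 x) / (u - x) * (x - u)) with (f1 x - f1 u) in H by (field; lra); lra. }
  destruct (hder (x - r)); lra.
Qed.

(** [auto_derive] states its result with [Derive] of the abstract functions; this puts the
    derivative given by [h] in place of such a term. *)
Ltac rewrite_derive h :=
  match type of h with
  | is_derive ?f ?x ?l => let e := fresh in
      assert (e : Derive (fun z : R => f z) x = l) by (apply is_derive_unique; exact h);
      rewrite e; clear e
  end.

(** The second derivative test along one coordinate line. It is applied to both directions and the
    results are added: with k harmonic and P + iQ holomorphic the terms in [k2], [P2] and [Q2] then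
    cancel. *)
Lemma weighted_second_derivative_at_max (k k1 P P1 Q Q1 : R -> R) (x k2 P2 Q2 lam eps x0 : R) :
  locally x (fun u => is_derive k u (k1 u) /\ is_derive P u (P1 u) /\ is_derive Q u (Q1 u)) ->
  is_derive k1 x k2 -> is_derive P1 x P2 -> is_derive Q1 x Q2 ->
  (let v u := exp (2 * lam * k u) * (P u * P u + Q u * Q u) + eps * (u - x0) ^ 2 in
   locally x (fun u => v u <= v x)) ->
  exp (2 * lam * k x) *
    ((2 * lam * k2 + 4 * lam ^ 2 * k1 x ^ 2) * (P x ^ 2 + Q x ^ 2)
     + 8 * lam * k1 x * (P x * P1 x + Q x * Q1 x)
     + 2 * (P1 x ^ 2 + Q1 x ^ 2 + P x * P2 + Q x * Q2)) + 2 * eps <= 0.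
Proof.
intros hd hk hP hQ hmax.
assert (hd0 := locally_singleton _ _ hd); destruct hd0 as (hk0 & hP0 & hQ0).
eapply second_derivative_at_max with (x := x)
  (f := fun u => exp (2 * lam * k u) * (P u * P u + Q u * Q u) + eps * (u - x0) ^ 2)
  (f1 := fun u => exp (2 * lam * k u) * (2 * lam * k1 u * (P u * P u + Q u * Q u)
     + 2 * (P u * P1 u + Q u * Q1 u)) + 2 * eps * (u - x0)).
- revert hd; apply filter_imp; intros u (a & b & d).
  auto_derive.
  + repeat split; eexists; eassumption.
  + rewrite_derive a; rewrite_derive b; rewrite_derive d; ring.
- auto_derive.
  + repeat split; eexists; eassumption.
  + rewrite_derive hk0; rewrite_derive hP0; rewrite_derive hQ0;
    rewrite_derive hk; rewrite_derive hP; rewrite_derive hQ; ring.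
- exact hmax.
Qed.

(** By the Cauchy-Riemann equations the real and imaginary parts of F dz are closed forms; their
    potentials are the two parts of the primitive. *)
Lemma hol_primitive (F : C -> C) (F1 : C -> C) (x0 delta H : R) :
  0 < delta -> 0 < H ->
  (forall s t, box x0 delta H s t -> hol F s t (F1 (s, t))) ->
  exists G, G (x0, 0) = RtoC 0 /\ forall s t, box x0 delta H s t -> hol G s t (F (s, t)).
Proof.
intros hdelta hH hF.
destruct (closed_form_potential (fun s t => Re (F (s, t))) (fun s t => - Im (F (s, t)))
  (fun s t => Re (F1 (s, t))) (fun s t => - Im (F1 (s, t))) (fun s t => - Re (F1 (s, t)))
  x0 delta H hdelta hH) as (A & hA0 & hA).
{ intros s t h; destruct (hF s t h) as [h1 h2]; split; [exact h1|now apply dpl_opp]. }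
destruct (closed_form_potential (fun s t => Im (F (s, t))) (fun s t => Re (F (s, t)))
  (fun s t => Im (F1 (s, t))) (fun s t => Re (F1 (s, t))) (fun s t => - Im (F1 (s, t)))
  x0 delta H hdelta hH) as (B & hB0 & hB).
{ intros s t h; now destruct (hF s t h) as [h1 h2]. }
exists (fun z => (A (Re z) (Im z), B (Re z) (Im z))); split.
- simpl; now rewrite hA0, hB0.
- intros s t h; split; [now apply hA|now apply hB].
Qed.

Lemma derive_zero_const (f : R -> R) (lo hi a b : R) :
  lo < a < hi -> lo < b < hi ->
  (forall x, lo < x < hi -> is_derive f x 0) -> f a = f b.
Proof.
assert (key : forall a b, a < b -> lo < a < hi -> lo < b < hi ->
  (forall x, lo < x < hi -> is_derive f x 0) -> f a = f b).
{ intros u v huv hu hv hd.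
  apply (eq_is_derive f u v); [|exact huv].
  intros t ht; apply hd; lra. }
intros ha hb hd; destruct (Rtotal_order a b) as [h|[->|h]]; auto.
symmetry; auto.
Qed.

(** The function k = sinh(mu (H - t)) cos(mu (s - x0)) is harmonic, positive inside, and zero on the
    top and on both lateral sides, while F is zero on the bottom. Hence the subharmonic function
    exp(2 lam k) |F|^2 is at most M = max |F|^2 on the boundary, whatever lam is, and so it is
    inside. Letting lam grow forces F = 0. The second derivative [F2] serves the test at an interior
    maximum. *)
Lemma hol_zero_upper (F F1 F2 : C -> C) (x0 delta H s0 t0 : R) :
  0 < delta -> 0 < H ->
  (forall s t, x0 - delta <= s <= x0 + delta -> 0 <= t <= H ->
     hol F s t (F1 (s, t)) /\ hol F1 s t (F2 (s, t))) ->
  (forall s, x0 - delta <= s <= x0 + delta -> F (s, 0) = RtoC 0) ->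
  x0 - delta < s0 < x0 + delta -> 0 < t0 < H -> F (s0, t0) = RtoC 0.
Proof.
intros hdelta hH hF hz hs0 ht0.
(* This frequency puts the zeros of the cosine on the lateral sides. *)
set (mu := PI / (2 * delta)).
assert (hmu : 0 < mu) by (apply Rdiv_lt_0_compat; [apply PI_RGT_0|lra]).
assert (hmud : mu * delta = PI / 2) by (unfold mu; field; lra).
set (k := fun s t => (exp (mu * (H - t)) - exp (- (mu * (H - t)))) / 2 * cos (mu * (s - x0))).
set (ks := fun s t => - mu * ((exp (mu * (H - t)) - exp (- (mu * (H - t)))) / 2) * sin (mu * (s - x0))).
set (kt := fun s t => - mu * ((exp (mu * (H - t)) + exp (- (mu * (H - t)))) / 2) * cos (mu * (s - x0))).
assert (dks : forall s t, is_derive (fun u => k u t) s (ks s t)).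
{ intros s t; unfold k, ks; auto_derive; [exact I|unfold Rminus; field]. }
assert (dkt : forall s t, is_derive (fun v => k s v) t (kt s t)).
{ intros s t; unfold k, kt; auto_derive; [exact I|unfold Rminus; field]. }
assert (dkss : forall s t, is_derive (fun u => ks u t) s (- mu ^ 2 * k s t)).
{ intros s t; unfold k, ks; auto_derive; [exact I|unfold Rminus; field]. }
assert (dktt : forall s t, is_derive (fun v => kt s v) t (mu ^ 2 * k s t)).
{ intros s t; unfold k, kt; auto_derive; [exact I|unfold Rminus; field]. }
assert (ck : forall s t, continuity_2d_pt k s t).
{ intros s t; unfold k; apply continuity_2d_pt_mult.
  - apply (continuity_1d_2d_pt_comp (fun x => (exp (mu * (H - x)) - exp (- (mu * (H - x)))) / 2) (fun u v => v)).
    + apply derivable_continuous_pt, ex_derive_Reals_0; auto_derive; exact I.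
    + apply continuity_2d_pt_id2.
  - apply (continuity_1d_2d_pt_comp (fun x => cos (mu * (x - x0))) (fun u v => u)).
    + apply derivable_continuous_pt, ex_derive_Reals_0; auto_derive; exact I.
    + apply continuity_2d_pt_id1. }
assert (kpos : 0 < k s0 t0).
{ unfold k; apply Rmult_lt_0_compat.
  - assert (exp (- (mu * (H - t0))) < exp (mu * (H - t0))); [|lra].
    apply exp_increasing; assert (0 < mu * (H - t0)) by (apply Rmult_lt_0_compat; lra); lra.
  - apply cos_gt_0; nra. }
set (P := fun s t => Re (F (s, t))); set (Q := fun s t => Im (F (s, t))).
set (N := fun s t => P s t * P s t + Q s t * Q s t).
assert (cN : forall s t, x0 - delta <= s <= x0 + delta -> 0 <= t <= H -> continuity_2d_pt N s t).
{ intros s t hs ht; destruct (hF s t hs ht) as [[h1 h2] _].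
  apply continuity_2d_pt_plus; apply continuity_2d_pt_mult;
    (eapply dpl_continuity; eassumption). }
destruct (continuity_2d_max N (x0 - delta) (x0 + delta) 0 H) as (p1 & q1 & hp1 & hq1 & hM);
  try lra; auto.
set (M := N p1 q1) in *.
assert (hM0 : 0 <= M) by (unfold M, N; nra).
(* The added eps (s - x0)^2 makes the function strictly subharmonic, so that an interior maximum is
   contradictory. *)
assert (key : forall lam eps, 0 < eps ->
  exp (2 * lam * k s0 t0) * N s0 t0 <= M + eps * delta ^ 2).
{ intros lam eps heps.
  set (v := fun s t => exp (2 * lam * k s t) * N s t + eps * (s - x0) ^ 2).
  destruct (continuity_2d_max v (x0 - delta) (x0 + delta) 0 H) as (p & q & hp & hq & hv);
    try lra.
  { intros s t hs ht; apply continuity_2d_pt_plus; [apply continuity_2d_pt_mult|].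
    - apply (continuity_1d_2d_pt_comp (fun x => exp (2 * lam * x)) k); [|apply ck].
      apply derivable_continuous_pt, ex_derive_Reals_0; auto_derive; exact I.
    - now apply cN.
    - apply (continuity_1d_2d_pt_comp (fun x => eps * (x - x0) ^ 2) (fun u _ => u)).
      + apply derivable_continuous_pt, ex_derive_Reals_0; auto_derive; exact I.
      + apply continuity_2d_pt_id1. }
  assert (hv0 := hv s0 t0 ltac:(lra) ltac:(lra)).
  assert (hbd : v p q <= M + eps * delta ^ 2).
  { assert (hsq : eps * (p - x0) ^ 2 <= eps * delta ^ 2) by (apply Rmult_le_compat_l; nra).
    assert (hk0 : k p q = 0 -> v p q <= M + eps * delta ^ 2).
    { intros h0; unfold v; rewrite h0, Rmult_0_r, exp_0, Rmult_1_l.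
      specialize (hM p q hp hq); lra. }
    destruct (Req_dec q 0) as [hq0|hq0].
    { unfold v, N, P, Q; rewrite hq0, (hz p hp); simpl; nra. }
    destruct (Req_dec q H) as [hqH|hqH].
    { apply hk0; unfold k; rewrite hqH, Rminus_eq_0, Rmult_0_r, Ropp_0; lra. }
    destruct (Req_dec p (x0 + delta)) as [hpr|hpr].
    { apply hk0; unfold k; rewrite hpr.
      replace (mu * (x0 + delta - x0)) with (PI / 2) by (rewrite <- hmud; ring).
      rewrite cos_PI2; lra. }
    destruct (Req_dec p (x0 - delta)) as [hpl|hpl].
    { apply hk0; unfold k; rewrite hpl.
      replace (mu * (x0 - delta - x0)) with (- (PI / 2)) by (rewrite <- hmud; ring).
      rewrite cos_neg, cos_PI2; lra. }
    exfalso.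
    assert (hrr : 0 < Rmin (Rmin (p - (x0 - delta)) (x0 + delta - p)) (Rmin q (H - q)))
      by (repeat apply Rmin_glb_lt; lra).
    set (r := mkposreal _ hrr).
    assert (hr : forall u, Rabs u < r -> x0 - delta <= p + u <= x0 + delta /\ 0 <= q + u <= H).
    { intros u hu; simpl in hu.
      assert (a1 := Rmin_l (Rmin (p - (x0 - delta)) (x0 + delta - p)) (Rmin q (H - q))).
      assert (a2 := Rmin_r (Rmin (p - (x0 - delta)) (x0 + delta - p)) (Rmin q (H - q))).
      assert (a3 := Rmin_l (p - (x0 - delta)) (x0 + delta - p)).
      assert (a4 := Rmin_r (p - (x0 - delta)) (x0 + delta - p)).
      assert (a5 := Rmin_l q (H - q)); assert (a6 := Rmin_r q (H - q)).
      apply Rabs_def2 in hu; lra. }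
    destruct (hF p q hp hq) as [_ [h3 h4]].
    assert (hs := weighted_second_derivative_at_max (fun u => k u q) (fun u => ks u q)
      (fun u => P u q) (fun u => Re (F1 (u, q))) (fun u => Q u q) (fun u => Im (F1 (u, q))) p
      (- mu ^ 2 * k p q) (Re (F2 (p, q))) (Im (F2 (p, q))) lam eps x0).
    assert (ht := weighted_second_derivative_at_max (fun u => k p u) (fun u => kt p u)
      (fun u => P p u) (fun u => - Im (F1 (p, u))) (fun u => Q p u) (fun u => Re (F1 (p, u))) q
      (mu ^ 2 * k p q) (- Re (F2 (p, q))) (- Im (F2 (p, q))) lam 0 x0).
    lapply hs; clear hs.
    2:{ exists r; intros u hu; change (Rabs (u - p) < r) in hu; destruct (hr _ hu) as [hu' _].
        rewrite (Rplus_minus p u) in hu'.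
        destruct (hF u q hu' hq) as [[h1 h2] _].
        split; [apply dks|split]; [apply (dpl_derive_s P _ _ _ _ h1)|apply (dpl_derive_s Q _ _ _ _ h2)]. }
    intros hs; specialize (hs (dkss p q)).
    specialize (hs (dpl_derive_s (fun s t => Re (F1 (s, t))) _ _ _ _ h3) (dpl_derive_s (fun s t => Im (F1 (s, t))) _ _ _ _ h4)).
    lapply ht; clear ht.
    2:{ exists r; intros u hu; change (Rabs (u - q) < r) in hu; destruct (hr _ hu) as [_ hu'].
        rewrite (Rplus_minus q u) in hu'.
        destruct (hF p u hp hu') as [[h1 h2] _].
        split; [apply dkt|split]; [apply (dpl_derive_t P _ _ _ _ h1)|apply (dpl_derive_t Q _ _ _ _ h2)]. }
    intros ht; specialize (ht (dktt p q)).
    specialize (ht (dpl_derive_t (fun s t => - Im (F1 (s, t))) _ _ _ _ (dpl_opp _ _ _ _ _ h4)) (dpl_derive_t (fun s t => Re (F1 (s, t))) _ _ _ _ h3)).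
    lapply hs; clear hs.
    2:{ simpl; exists r; intros u hu; change (Rabs (u - p) < r) in hu; destruct (hr _ hu) as [hu' _].
        rewrite (Rplus_minus p u) in hu'.
        specialize (hv u q hu' hq); unfold v, N in hv; simpl in hv; lra. }
    lapply ht; clear ht.
    2:{ simpl; exists r; intros u hu; change (Rabs (u - q) < r) in hu; destruct (hr _ hu) as [_ hu'].
        rewrite (Rplus_minus q u) in hu'.
        specialize (hv p u hp hu'); unfold v, N in hv; simpl in hv; lra. }
    intros ht hs.
    assert (hE := exp_pos (2 * lam * k p q)).
    set (E := exp (2 * lam * k p q)) in *.
    set (a := ks p q) in *; set (b := kt p q) in *.
    set (x := Re (F1 (p, q))) in *; set (y := Im (F1 (p, q))) in *.
    (* The two inequalities add up to 4 E |F' + lam (k_s - i k_t) F|^2 + 2 eps <= 0. *)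
    assert (0 <= 4 * E * ((x + lam * (a * P p q + b * Q p q)) ^ 2 + (y + lam * (a * Q p q - b * P p q)) ^ 2)).
    { apply Rmult_le_pos; [lra|apply Rplus_le_le_0_compat; apply pow2_ge_0]. }
    lra. }
  assert (0 <= eps * (s0 - x0) ^ 2) by (apply Rmult_le_pos; [lra|apply pow2_ge_0]).
  unfold v in hv0, hbd; lra. }
assert (key' : forall lam, exp (2 * lam * k s0 t0) * N s0 t0 <= M).
{ intros lam; apply Rnot_lt_le; intros hlt.
  assert (he : 0 < (exp (2 * lam * k s0 t0) * N s0 t0 - M) / (2 * delta ^ 2)).
  { apply Rdiv_lt_0_compat; nra. }
  specialize (key lam _ he).
  replace ((exp (2 * lam * k s0 t0) * N s0 t0 - M) / (2 * delta ^ 2) * delta ^ 2)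
    with ((exp (2 * lam * k s0 t0) * N s0 t0 - M) / 2) in key by (field; lra).
  lra. }
assert (hN : N s0 t0 <= 0).
{ apply Rnot_lt_le; intros hN.
  (* For this value of lam the estimate exp x > 1 + x already gives (1 + 2 lam k) N > M. *)
  assert (hl : 0 < M / (N s0 t0 * k s0 t0) + 1).
  { assert (0 <= M / (N s0 t0 * k s0 t0)); [|lra].
    apply Rmult_le_pos; [lra|apply Rlt_le, Rinv_0_lt_compat, Rmult_lt_0_compat; assumption]. }
  specialize (key' (M / (N s0 t0 * k s0 t0) + 1)).
  assert (he := exp_ineq1 (2 * (M / (N s0 t0 * k s0 t0) + 1) * k s0 t0)).
  assert (hx : 0 < 2 * (M / (N s0 t0 * k s0 t0) + 1) * k s0 t0)
    by (apply Rmult_lt_0_compat; lra).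
  specialize (he ltac:(lra)).
  assert ((1 + 2 * (M / (N s0 t0 * k s0 t0) + 1) * k s0 t0) * N s0 t0 < M).
  { eapply Rlt_le_trans; [apply Rmult_lt_compat_r; [exact hN|exact he]|exact key']. }
  replace ((1 + 2 * (M / (N s0 t0 * k s0 t0) + 1) * k s0 t0) * N s0 t0)
    with (N s0 t0 + 2 * M + 2 * k s0 t0 * N s0 t0) in H0 by (field; lra).
  assert (0 < k s0 t0 * N s0 t0) by now apply Rmult_lt_0_compat.
  lra. }
assert (hP : P s0 t0 = 0) by (unfold N in hN; nra).
assert (hQ : Q s0 t0 = 0) by (unfold N in hN; nra).
unfold P, Q in *; destruct (F (s0, t0)) as [u w]; simpl in *; unfold Re, Im, RtoC in *; simpl in *; congruence.
Qed.

(** The half-turn z -> 2 x0 - z preserves the axis and the box, exchanges its two halves, and unlike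
    conjugation is holomorphic. It reduces the lower half of a box to the upper one. *)
Lemma hol_reflect (F : C -> C) x0 s t l :
  hol F (2 * x0 - s) (- t) l -> hol (fun z => F (2 * x0 - Re z, - Im z)) s t (Copp l).
Proof.
assert (d1 : dpl (fun u _ => 2 * x0 - u) s t (-1) 0).
{ eapply dpl_eq; [apply dpl_minus; [apply dpl_const|apply dpl_fst]| |]; ring. }
assert (d2 : dpl (fun _ v => - v) s t 0 (-1)).
{ eapply dpl_eq; [apply dpl_opp, dpl_snd| |]; ring. }
intros [h1 h2]; split.
- eapply dpl_eq; [exact (differentiable_pt_lim_comp (fun u v => Re (F (u, v))) _ _ s t _ _ _ _ _ _ h1 d1 d2)| |];
    simpl; unfold Re, Im; ring.
- eapply dpl_eq; [exact (differentiable_pt_lim_comp (fun u v => Im (F (u, v))) _ _ s t _ _ _ _ _ _ h2 d1 d2)| |];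
    simpl; unfold Re, Im; ring.
Qed.

(* Goursat supplies two successive primitives, both vanishing on the axis, so
   that the maximum principle applies to a C^2 function. *)
Theorem identity_theorem (F F1 : C -> C) (x0 delta H : R) :
  (forall s t, box x0 delta H s t -> hol F s t (F1 (s, t))) ->
  (forall s, Rabs (s - x0) < delta -> F (s, 0) = RtoC 0) ->
  forall s t, box x0 delta H s t -> F (s, t) = RtoC 0.
Proof.
intros hF hz s0 t0 h0.
assert (hdelta : 0 < delta) by (apply Rle_lt_trans with (1 := Rabs_pos (s0 - x0)), h0).
assert (hH : 0 < H) by (apply Rle_lt_trans with (1 := Rabs_pos t0), h0).
assert (prim : forall G G1 : C -> C, (forall s t, box x0 delta H s t -> hol G s t (G1 (s, t))) ->
  (forall s, Rabs (s - x0) < delta -> G (s, 0) = RtoC 0) ->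
  exists E, (forall s t, box x0 delta H s t -> hol E s t (G (s, t))) /\
    forall s, Rabs (s - x0) < delta -> E (s, 0) = RtoC 0).
{ intros G G1 hG hG0.
  destruct (hol_primitive G G1 x0 delta H hdelta hH hG) as (E & hE0 & hE).
  exists E; split; [exact hE|].
  intros s hs; apply Rabs_def2 in hs.
  assert (hd : forall x, x0 - delta < x < x0 + delta ->
    is_derive (fun u => Re (E (u, 0))) x 0 /\ is_derive (fun u => Im (E (u, 0))) x 0).
  { intros x hx; destruct (hE x 0) as [h1 h2]; [apply box_intro; lra|].
    rewrite hG0 in h1, h2 by (apply Rabs_def1; lra).
    split; [exact (dpl_derive_s _ _ _ _ _ h1)|exact (dpl_derive_s _ _ _ _ _ h2)]. }
  assert (e1 := derive_zero_const (fun u => Re (E (u, 0))) (x0 - delta) (x0 + delta) s x0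
    ltac:(lra) ltac:(lra) (fun x hx => proj1 (hd x hx))).
  assert (e2 := derive_zero_const (fun u => Im (E (u, 0))) (x0 - delta) (x0 + delta) s x0
    ltac:(lra) ltac:(lra) (fun x hx => proj2 (hd x hx))).
  simpl in e1, e2; rewrite hE0 in e1, e2.
  destruct (E (s, 0)) as [u w]; unfold Re, Im, RtoC in *; simpl in *; congruence. }
destruct (prim F F1 hF hz) as (E1 & hE1 & hE10).
destruct (prim E1 F hE1 hE10) as (E2 & hE2 & hE20).
assert (hE2z : forall s t, box x0 delta H s t -> E2 (s, t) = RtoC 0).
{ intros s t h; assert (hb := box_elim _ _ _ _ _ h).
  set (d' := (Rabs (s - x0) + delta) / 2); set (H' := (Rabs t + H) / 2).
  assert (hd' : Rabs (s - x0) < d' < delta) by (destruct h; unfold d'; lra).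
  assert (hH' : Rabs t < H' < H) by (destruct h; unfold H'; lra).
  assert (hd0 := Rabs_pos (s - x0)); assert (hH0 := Rabs_pos t).
  destruct hd' as [hd1 hd2], hH' as [hH1 hH2]; apply Rabs_def2 in hd1; apply Rabs_def2 in hH1.
  destruct (Rtotal_order t 0) as [ht|[->|ht]].
  - assert (hg := hol_zero_upper (fun z => E2 (2 * x0 - Re z, - Im z))
      (fun z => Copp (E1 (2 * x0 - Re z, - Im z))) (fun z => F (2 * x0 - Re z, - Im z))
      x0 d' H' (2 * x0 - s) (- t) ltac:(lra) ltac:(lra)).
    simpl in hg; replace (2 * x0 - (2 * x0 - s)) with s in hg by ring.
    rewrite Ropp_involutive in hg; apply hg; try lra.
    + intros x y hx hy; split.
      * apply (hol_reflect E2), hE2, box_intro; lra.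
      * eapply hol_ext_loc; [|eapply hol_eq].
        2:{ apply (hol_scal (RtoC (-1))), (hol_reflect E1 x0), hE1, box_intro; lra. }
        -- apply locally_2d_forall; intros; ring.
        -- ring.
    + intros x hx; rewrite Ropp_0; apply hE20, Rabs_def1; lra.
  - apply hE20, h.
  - apply (hol_zero_upper E2 E1 F x0 d' H'); try lra.
    + intros x y hx hy; split; [apply hE2|apply hE1]; apply box_intro; lra.
    + intros x hx; apply hE20, Rabs_def1; lra. }
assert (hder : forall G G1 : C -> C, (forall s t, box x0 delta H s t -> hol G s t (G1 (s, t))) ->
  (forall s t, box x0 delta H s t -> G (s, t) = RtoC 0) ->
  forall s t, box x0 delta H s t -> G1 (s, t) = RtoC 0).
{ intros G G1 hG hG0 s t h; apply (hol_unique G s t); [now apply hG|].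
  apply hol_ext_loc with (fun _ => RtoC 0); [|apply hol_const].
  generalize (box_locally _ _ _ _ _ h); apply locally_2d_imp.
  intros u v huv; symmetry; now apply hG0. }
apply (hder E1 F hE1); [|exact h0].
apply (hder E2 E1 hE2 hE2z).
Qed.

(** * Power series and linear systems *)

(** A Cauchy estimate that stands in for the radius of convergence. It passes to derivatives,
    products and solutions of recursions with explicit constants, at the price of a smaller r. *)
Definition geo_bounded (b : nat -> R) (r : R) : Prop :=
  exists K, forall n, Rabs (b n) * r ^ n <= K.

Lemma geo_bounded_K_pos b r K : (forall n, Rabs (b n) * r ^ n <= K) -> 0 <= K.
Proof.
intros h; specialize (h O); simpl in h; assert (h' := Rabs_pos (b O)); lra.
Qed.

Lemma geo_bounded_le b r r' : 0 <= r' <= r -> geo_bounded b r -> geo_bounded b r'.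
Proof.
intros hr [K hK]; exists K; intros n; eapply Rle_trans; [|apply hK].
apply Rmult_le_compat_l; [apply Rabs_pos|now apply pow_incr].
Qed.

(** Bernoulli's inequality for 1/q = 1 + h gives n h <= q^-n, so 1/h is a bound. *)
Lemma linear_times_geometric (q : R) : 0 < q < 1 ->
  exists C, 0 < C /\ forall n, INR n * q ^ n <= C.
Proof.
intros hq.
assert (hi : 1 < / q) by (rewrite <- Rinv_1; apply Rinv_lt_contravar; lra).
set (h := / q - 1); exists (/ h).
assert (hh : 0 < h) by (unfold h; lra).
split; [now apply Rinv_0_lt_compat|].
intros n.
assert (hb := poly n h hh).
assert (hqn : 0 < q ^ n) by (apply pow_lt; lra).
replace (1 + h) with (/ q) in hb by (unfold h; ring).
rewrite pow_inv in hb.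
assert (INR n * h * q ^ n <= 1).
{ replace 1 with (/ q ^ n * q ^ n) by (field; lra).
  apply Rmult_le_compat_r; lra. }
apply (Rmult_le_reg_r h); [lra|]; rewrite Rinv_l by lra; lra.
Qed.

(** Write q^n as the square of q^(n/4) times q^(n/2): the product n q^(n/4) is bounded, and q^(n/2)
    is left for convergence. *)
Lemma ex_series_square_geometric (q : R) : 0 < q < 1 ->
  ex_series (fun n => INR n ^ 2 * q ^ n).
Proof.
intros hq.
assert (hs : 0 < sqrt q < 1).
{ split; [apply sqrt_lt_R0; lra|rewrite <- sqrt_1; apply sqrt_lt_1; lra]. }
assert (hss : 0 < sqrt (sqrt q) < 1).
{ split; [apply sqrt_lt_R0; lra|rewrite <- sqrt_1; apply sqrt_lt_1; lra]. }
destruct (linear_times_geometric _ hss) as (C & hC & hb).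
apply (ex_series_le (V := R_CompleteNormedModule)) with (fun n => C ^ 2 * (sqrt q) ^ n).
- intros n; change (Rabs (INR n ^ 2 * q ^ n) <= C ^ 2 * sqrt q ^ n).
  rewrite Rabs_pos_eq by (apply Rmult_le_pos; [apply pow2_ge_0|apply pow_le; lra]).
  replace (q ^ n) with (sqrt (sqrt q) ^ n * sqrt (sqrt q) ^ n * sqrt q ^ n).
  2:{ rewrite <- !Rpow_mult_distr, sqrt_sqrt, sqrt_sqrt by lra; reflexivity. }
  replace (INR n ^ 2 * (sqrt (sqrt q) ^ n * sqrt (sqrt q) ^ n * sqrt q ^ n))
    with ((INR n * sqrt (sqrt q) ^ n) ^ 2 * sqrt q ^ n) by ring.
  apply Rmult_le_compat_r; [apply pow_le; lra|].
  apply pow_incr; split; [|apply hb].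
  apply Rmult_le_pos; [apply pos_INR|apply pow_le; lra].
- apply (ex_series_scal_l (V := R_NormedModule) (C ^ 2)), ex_series_geom.
  rewrite Rabs_pos_eq; lra.
Qed.

Lemma Series_bound (a c : nat -> R) :
  (forall n, Rabs (a n) <= c n) -> ex_series c ->
  ex_series a /\ Rabs (Series a) <= Series c.
Proof.
intros h hc.
assert (ha : ex_series (fun n => Rabs (a n))).
{ apply (ex_series_le (V := R_CompleteNormedModule)) with c; [|exact hc].
  intros n; change (Rabs (Rabs (a n)) <= c n); now rewrite Rabs_Rabsolu. }
split; [now apply ex_series_Rabs|].
eapply Rle_trans; [now apply Series_Rabs|].
apply Series_le; [|exact hc]; intros n; split; [apply Rabs_pos|apply h].
Qed.

Lemma geo_bounded_derive b r r' : 0 < r' < r -> geo_bounded b r ->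
  geo_bounded (PS_derive b) r'.
Proof.
intros hr [K hK].
assert (hKp := geo_bounded_K_pos _ _ _ hK).
assert (hq : 0 < r' / r < 1).
{ split; [apply Rdiv_lt_0_compat; lra|apply Rlt_div_l; lra]. }
destruct (linear_times_geometric _ hq) as (C & hC & hb).
exists (K * C / r'); intros n; unfold PS_derive.
rewrite Rabs_mult, (Rabs_pos_eq (INR (S n))) by apply pos_INR.
specialize (hK (S n)); specialize (hb (S n)).
apply (Rmult_le_reg_r r'); [lra|].
replace (K * C / r' * r') with (K * C) by (field; lra).
replace (INR (S n) * Rabs (b (S n)) * r' ^ n * r')
  with (Rabs (b (S n)) * r ^ S n * (INR (S n) * (r' / r) ^ S n)).
- apply Rmult_le_compat; auto.
  + apply Rmult_le_pos; [apply Rabs_pos|apply pow_le; lra].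
  + apply Rmult_le_pos; [apply pos_INR|apply pow_le; lra].
- unfold Rdiv; rewrite Rpow_mult_distr, pow_inv.
  simpl (r' ^ S n); field; apply pow_nonzero; lra.
Qed.

(** * Power series at complex arguments *)

Definition CPS (b : nat -> R) (z : C) : C :=
  (Series (fun n => b n * Re (Cpow z n)), Series (fun n => b n * Im (Cpow z n))).

Lemma re_le_Cmod' (z : C) : Rabs (Re z) <= Cmod z.
Proof. eapply Rle_trans; [apply Rmax_l|apply Rmax_Cmod]. Qed.

Lemma im_le_Cmod' (z : C) : Rabs (Im z) <= Cmod z.
Proof. eapply Rle_trans; [apply Rmax_r|apply Rmax_Cmod]. Qed.

Lemma CPS_ex_series (b : nat -> R) (r : R) (z d : C) :
  geo_bounded b r -> Cmod z < r ->
  ex_series (fun n => b n * Re (Cmult d (Cpow z n))) /\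
  ex_series (fun n => b n * Im (Cmult d (Cpow z n))).
Proof.
intros [K hK] hz.
assert (hr : 0 < r) by (apply Rle_lt_trans with (1 := Cmod_ge_0 z); exact hz).
assert (hb : forall n, Rabs (b n) * Cmod (Cmult d (Cpow z n)) <= Cmod d * K * (Cmod z / r) ^ n).
{ intros n; rewrite Cmod_mult, Cmod_pow.
  unfold Rdiv; rewrite Rpow_mult_distr, pow_inv.
  assert (hrn : 0 < r ^ n) by (apply pow_lt; lra).
  replace (Rabs (b n) * (Cmod d * Cmod z ^ n))
    with (Cmod d * (Rabs (b n) * r ^ n) * (Cmod z ^ n * / r ^ n)) by (field; lra).
  apply Rmult_le_compat_r.
  - apply Rmult_le_pos; [apply pow_le, Cmod_ge_0|apply Rlt_le, Rinv_0_lt_compat, hrn].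
  - apply Rmult_le_compat_l; [apply Cmod_ge_0|apply hK]. }
assert (hg : ex_series (fun n => Cmod d * K * (Cmod z / r) ^ n)).
{ apply (ex_series_scal_l (V := R_NormedModule) (Cmod d * K)), ex_series_geom.
  rewrite Rabs_pos_eq; [apply Rlt_div_l; lra|].
  apply Rmult_le_pos; [apply Cmod_ge_0|apply Rlt_le, Rinv_0_lt_compat, hr]. }
split; (eapply Series_bound; [|exact hg]); intros n; rewrite Rabs_mult;
  (eapply Rle_trans; [|apply hb]); (apply Rmult_le_compat_l; [apply Rabs_pos|]).
- apply re_le_Cmod'.
- apply im_le_Cmod'.
Qed.

Lemma CPS_mult_l (b : nat -> R) (r : R) (z d : C) :
  geo_bounded b r -> Cmod z < r ->
  Cmult d (CPS b z) = (Series (fun n => b n * Re (Cmult d (Cpow z n))),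
                       Series (fun n => b n * Im (Cmult d (Cpow z n)))).
Proof.
intros hb hz.
destruct (CPS_ex_series b r z (RtoC 1) hb hz) as [h1 h2].
assert (e1 : ex_series (fun n => b n * Re (Cpow z n))).
{ revert h1; apply ex_series_ext; intros n; now rewrite Cmult_1_l. }
assert (e2 : ex_series (fun n => b n * Im (Cpow z n))).
{ revert h2; apply ex_series_ext; intros n; now rewrite Cmult_1_l. }
unfold CPS; destruct d as [x y]; unfold Cmult; simpl; f_equal.
- rewrite <- !Series_scal_l.
  rewrite <- Series_minus by (now apply (ex_series_scal_l (V := R_NormedModule))).
  apply Series_ext; intros n; unfold Re, Im; ring.
- rewrite <- !Series_scal_l.
  rewrite <- Series_plus by (now apply (ex_series_scal_l (V := R_NormedModule))).
  apply Series_ext; intros n; unfold Re, Im; ring.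
Qed.

(** The first-order Taylor remainder of the n-th power at z. At n = 0 the value of [pred] is
    harmless because the factor n vanishes. *)
Definition pow_remainder (z w : C) (n : nat) : C :=
  Cminus (Cminus (Cpow w n) (Cpow z n))
         (Cmult (RtoC (INR n)) (Cmult (Cminus w z) (Cpow z (pred n)))).

(** The remainders obey R_(n+1) = w R_n + n (w - z)^2 z^(n-1), and n^2 + n <= (n + 1)^2 carries the
    bound over. *)
Lemma pow_remainder_bound (z w : C) (rho : R) (n : nat) :
  0 < rho -> Cmod z <= rho -> Cmod w <= rho ->
  Cmod (pow_remainder z w n) <= INR n ^ 2 * rho ^ n * (/ rho ^ 2 * Cmod (Cminus w z) ^ 2).
Proof.
intros hr hz hw.
assert (hd := Cmod_ge_0 (Cminus w z)).
induction n as [|n IH].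
- unfold pow_remainder; simpl INR.
  match goal with |- Cmod ?x <= _ => replace x with (RtoC 0) by (simpl; ring) end.
  rewrite Cmod_0; simpl; lra.
- assert (e : pow_remainder z w (S n) =
    Cplus (Cmult w (pow_remainder z w n))
      (Cmult (RtoC (INR n)) (Cmult (Cmult (Cminus w z) (Cminus w z)) (Cpow z (pred n))))).
  { unfold pow_remainder; rewrite S_INR, RtoC_plus; simpl pred.
    destruct n as [|n].
    - simpl; ring.
    - simpl pred; rewrite !Cpow_S; ring. }
  rewrite e; eapply Rle_trans; [apply Cmod_triangle|].
  rewrite !Cmod_mult, Cmod_R, (Rabs_pos_eq (INR n)), Cmod_pow by apply pos_INR.
  assert (hn := pos_INR n).
  assert (h1 : Cmod w * Cmod (pow_remainder z w n) <=
    rho * (INR n ^ 2 * rho ^ n * (/ rho ^ 2 * Cmod (Cminus w z) ^ 2))).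
  { apply Rmult_le_compat; auto using Cmod_ge_0. }
  assert (h2 : INR n * (Cmod (Cminus w z) * Cmod (Cminus w z) * Cmod z ^ pred n) <=
    INR n * (rho * rho ^ n) * (/ rho ^ 2 * Cmod (Cminus w z) ^ 2)).
  { destruct n as [|n]; [simpl; lra|].
    simpl pred; rewrite (Rmult_assoc (INR (S n)) (rho * rho ^ S n)); apply Rmult_le_compat_l; [exact hn|].
    replace (rho * rho ^ S n * (/ rho ^ 2 * Cmod (Cminus w z) ^ 2))
      with (Cmod (Cminus w z) * Cmod (Cminus w z) * rho ^ n) by (simpl; field; lra).
    apply Rmult_le_compat_l; [nra|]; apply pow_incr; split; [apply Cmod_ge_0|exact hz]. }
  rewrite S_INR; simpl (rho ^ S n).
  assert (hp : 0 <= rho * rho ^ n * (/ rho ^ 2 * Cmod (Cminus w z) ^ 2)).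
  { apply Rmult_le_pos; [apply Rmult_le_pos; [lra|apply pow_le; lra]|].
    apply Rmult_le_pos; [apply Rlt_le, Rinv_0_lt_compat, pow_lt, hr|apply pow2_ge_0]. }
  set (X := rho * rho ^ n * (/ rho ^ 2 * Cmod (Cminus w z) ^ 2)) in *.
  replace (rho * (INR n ^ 2 * rho ^ n * (/ rho ^ 2 * Cmod (Cminus w z) ^ 2)))
    with (INR n ^ 2 * X) in h1 by (unfold X; ring).
  replace (INR n * (rho * rho ^ n) * (/ rho ^ 2 * Cmod (Cminus w z) ^ 2))
    with (INR n * X) in h2 by (unfold X; ring).
  replace ((INR n + 1) ^ 2 * (rho * rho ^ n) * (/ rho ^ 2 * Cmod (Cminus w z) ^ 2))
    with ((INR n + 1) ^ 2 * X) by (unfold X; ring).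
  nra.
Qed.

Lemma dpl_of_quadratic (f : R -> R -> R) (s t a b B : R) :
  locally_2d (fun u v => Rabs (f u v - f s t - (a * (u - s) + b * (v - t)))
     <= B * Cmod (Cminus (u, v) (s, t)) ^ 2) s t ->
  dpl f s t a b.
Proof.
intros [d hd] eps.
set (B' := Rabs B + 1).
assert (hB' : 0 < B') by (unfold B'; assert (h := Rabs_pos B); lra).
assert (he : 0 < eps / (4 * B')) by (apply Rdiv_lt_0_compat; [apply cond_pos|lra]).
assert (hm : 0 < Rmin d (eps / (4 * B'))) by (apply Rmin_glb_lt; [apply cond_pos|exact he]).
exists (mkposreal _ hm); simpl; intros u v hu hv.
assert (m1 := Rmin_l d (eps / (4 * B'))); assert (m2 := Rmin_r d (eps / (4 * B'))).
eapply Rle_trans; [apply hd; lra|].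
assert (hC := Cmod_le_2Rmax (Cminus (u, v) (s, t))); unfold Re, Im in hC; simpl in hC.
change (v + - t) with (v - t) in hC; change (u + - s) with (u - s) in hC.
set (m := Rmax (Rabs (u - s)) (Rabs (v - t))) in *.
assert (hm0 : 0 <= m) by (eapply Rle_trans; [apply (Rabs_pos (u - s))|apply Rmax_l]).
assert (hm1 : m <= eps / (4 * B')) by (apply Rmax_lub; lra).
assert (hC0 := Cmod_ge_0 (Cminus (u, v) (s, t))).
apply Rle_trans with (B' * (2 * m) ^ 2).
- apply Rle_trans with (B' * Cmod (Cminus (u, v) (s, t)) ^ 2).
  + apply Rmult_le_compat_r; [apply pow2_ge_0|]; unfold B'; assert (h := Rle_abs B); lra.
  + apply Rmult_le_compat_l; [lra|apply pow_incr; lra].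
- replace (B' * (2 * m) ^ 2) with (4 * B' * m * m) by ring.
  apply Rmult_le_compat_r; [exact hm0|].
  apply Rle_trans with (4 * B' * (eps / (4 * B'))).
  + apply Rmult_le_compat_l; lra.
  + right; field; lra.
Qed.

(** The remainders of the powers, weighted by the coefficients, sum to at most a constant times |w -
    z|^2 as long as |z|, |w| <= rho < r, because n^2 (rho/r)^n is summable. A quadratic remainder
    implies differentiability. *)
Lemma CPS_hol (b : nat -> R) (r s t : R) :
  geo_bounded b r -> Cmod (s, t) < r ->
  hol (CPS b) s t (CPS (PS_derive b) (s, t)).
Proof.
intros hb hz.
set (z := (s, t) : C).
assert (hz0 := Cmod_ge_0 z).
set (rho := (Cmod z + r) / 2).
assert (hrho : Cmod z < rho < r) by (unfold rho, z; lra).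
assert (hr0 : 0 < rho) by lra.
assert (hb' : geo_bounded (PS_derive b) rho) by (apply geo_bounded_derive with r; [lra|exact hb]).
assert (hq : 0 < rho / r < 1) by (split; [apply Rdiv_lt_0_compat; lra|apply Rlt_div_l; lra]).
destruct hb as [K hK]; assert (hb : geo_bounded b r) by now exists K.
assert (hKp := geo_bounded_K_pos _ _ _ hK).
set (c := fun n => K * / rho ^ 2 * (INR n ^ 2 * (rho / r) ^ n)).
assert (hc : ex_series c) by now apply (ex_series_scal_l (V := R_NormedModule)), ex_series_square_geometric.
assert (hrem : forall w, Cmod w <= rho -> forall n,
   Rabs (b n) * Cmod (pow_remainder z w n) <= c n * Cmod (Cminus w z) ^ 2).
{ intros w hw n.
  assert (h := pow_remainder_bound z w rho n hr0 (Rlt_le _ _ (proj1 hrho)) hw).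
  assert (hrn : 0 < r ^ n) by (apply pow_lt; lra).
  unfold c, Rdiv; rewrite Rpow_mult_distr, pow_inv.
  apply Rle_trans with (Rabs (b n) * (INR n ^ 2 * rho ^ n * (/ rho ^ 2 * Cmod (Cminus w z) ^ 2))).
  - apply Rmult_le_compat_l; [apply Rabs_pos|exact h].
  - replace (Rabs (b n) * (INR n ^ 2 * rho ^ n * (/ rho ^ 2 * Cmod (Cminus w z) ^ 2)))
      with ((Rabs (b n) * r ^ n) * (INR n ^ 2 * rho ^ n * (/ rho ^ 2 * Cmod (Cminus w z) ^ 2) * / r ^ n))
      by (field; lra).
    replace (K * / rho ^ 2 * (INR n ^ 2 * (rho ^ n * / r ^ n)) * Cmod (Cminus w z) ^ 2)
      with (K * (INR n ^ 2 * rho ^ n * (/ rho ^ 2 * Cmod (Cminus w z) ^ 2) * / r ^ n)) by ring.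
    apply Rmult_le_compat_r; [|apply hK].
    apply Rmult_le_pos; [|apply Rlt_le, Rinv_0_lt_compat, hrn].
    apply Rmult_le_pos; [apply Rmult_le_pos; [apply pow2_ge_0|apply pow_le; lra]|].
    apply Rmult_le_pos; [apply Rlt_le, Rinv_0_lt_compat, pow_lt, hr0|apply pow2_ge_0]. }
assert (hloc : locally_2d (fun u v => Cmod (u, v) <= rho) s t).
{ assert (hd : 0 < (rho - Cmod z) / 2) by lra.
  exists (mkposreal _ hd); simpl; intros u v hu hv.
  replace ((u, v) : C) with (Cplus z (u - s, v - t)) by (unfold z, Cplus; simpl; f_equal; ring).
  eapply Rle_trans; [apply Cmod_triangle|].
  assert (h2 := Cmod_le_2Rmax (u - s, v - t)); unfold Re, Im in h2; simpl in h2.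
  assert (Rmax (Rabs (u - s)) (Rabs (v - t)) < (rho - Cmod z) / 2) by now apply Rmax_lub_lt.
  lra. }
assert (main : forall w, Cmod w <= rho ->
  let D := Cminus (Cminus (CPS b w) (CPS b z)) (Cmult (Cminus w z) (CPS (PS_derive b) z)) in
  Rabs (Re D) <= Series c * Cmod (Cminus w z) ^ 2 /\
  Rabs (Im D) <= Series c * Cmod (Cminus w z) ^ 2).
{ intros w hw D; unfold D; rewrite (CPS_mult_l (PS_derive b) rho) by (auto; lra).
  destruct (CPS_ex_series b r w (RtoC 1) hb ltac:(lra)) as [w1 w2].
  destruct (CPS_ex_series b r z (RtoC 1) hb ltac:(unfold z; lra)) as [z1 z2].
  destruct (CPS_ex_series (PS_derive b) rho z (Cminus w z) hb' ltac:(lra)) as [d1 d2].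
  assert (hsum : ex_series (fun n => c n * Cmod (Cminus w z) ^ 2)).
  { now apply (ex_series_scal_r (Cmod (Cminus w z) ^ 2) c). }
  split.
  - assert (hb1 : forall n, Rabs (b n * Re (pow_remainder z w n)) <= c n * Cmod (Cminus w z) ^ 2).
    { intros n; eapply Rle_trans; [|apply (hrem w hw n)]; rewrite Rabs_mult.
      apply Rmult_le_compat_l; [apply Rabs_pos|apply re_le_Cmod']. }
    destruct (Series_bound _ _ hb1 hsum) as [_ hS].
    rewrite Series_scal_r in hS; revert hS.
    match goal with |- Rabs ?x <= _ -> Rabs ?y <= _ => replace y with x; [easy|] end.
    transitivity (Series (fun n => b n * Re (Cpow w n)) - Series (fun n => b n * Re (Cpow z n))
      - Series (fun n => PS_derive b n * Re (Cmult (Cminus w z) (Cpow z n)))); [|reflexivity].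
    rewrite (Series_ext (fun n => b n * Re (pow_remainder z w n))
      (fun n => (b n * Re (Cmult (RtoC 1) (Cpow w n)) - b n * Re (Cmult (RtoC 1) (Cpow z n)))
        - INR n * b n * Re (Cmult (Cminus w z) (Cpow z (pred n))))).
    2:{ intros n; unfold pow_remainder, Re, Im, Cminus, Cplus, Copp, Cmult; simpl; ring. }
    (* The term of index 0 is zero, so this is the series of [PS_derive b] shifted by one index. *)
    assert (hd : ex_series (fun n => INR n * b n * Re (Cmult (Cminus w z) (Cpow z (pred n))))).
    { apply ex_series_incr_1; exact d1. }
    rewrite Series_minus; [|now apply (ex_series_minus (V := R_NormedModule))|exact hd].
    rewrite Series_minus by assumption.
    rewrite (Series_incr_1 _ hd); simpl (INR 0).
    rewrite !Rmult_0_l, Rplus_0_l.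
    unfold Rminus; f_equal; f_equal; [|f_equal]; apply Series_ext; intros n;
      now rewrite Cmult_1_l.
  - assert (hb1 : forall n, Rabs (b n * Im (pow_remainder z w n)) <= c n * Cmod (Cminus w z) ^ 2).
    { intros n; eapply Rle_trans; [|apply (hrem w hw n)]; rewrite Rabs_mult.
      apply Rmult_le_compat_l; [apply Rabs_pos|apply im_le_Cmod']. }
    destruct (Series_bound _ _ hb1 hsum) as [_ hS].
    rewrite Series_scal_r in hS; revert hS.
    match goal with |- Rabs ?x <= _ -> Rabs ?y <= _ => replace y with x; [easy|] end.
    transitivity (Series (fun n => b n * Im (Cpow w n)) - Series (fun n => b n * Im (Cpow z n))
      - Series (fun n => PS_derive b n * Im (Cmult (Cminus w z) (Cpow z n)))); [|reflexivity].
    rewrite (Series_ext (fun n => b n * Im (pow_remainder z w n))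
      (fun n => (b n * Im (Cmult (RtoC 1) (Cpow w n)) - b n * Im (Cmult (RtoC 1) (Cpow z n)))
        - INR n * b n * Im (Cmult (Cminus w z) (Cpow z (pred n))))).
    2:{ intros n; unfold pow_remainder, Re, Im, Cminus, Cplus, Copp, Cmult; simpl; ring. }
    assert (hd : ex_series (fun n => INR n * b n * Im (Cmult (Cminus w z) (Cpow z (pred n))))).
    { apply ex_series_incr_1; exact d2. }
    rewrite Series_minus; [|now apply (ex_series_minus (V := R_NormedModule))|exact hd].
    rewrite Series_minus by assumption.
    rewrite (Series_incr_1 _ hd); simpl (INR 0).
    rewrite !Rmult_0_l, Rplus_0_l.
    unfold Rminus; f_equal; f_equal; [|f_equal]; apply Series_ext; intros n;
      now rewrite Cmult_1_l. }
split; apply dpl_of_quadratic with (Series c); revert hloc; apply locally_2d_imp;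
  intros u v huv; destruct (main (u, v) huv) as [m1 m2].
- eapply Rle_trans; [right|exact m1]; f_equal; unfold z, Re, Im, Cminus, Cplus, Copp, Cmult; simpl; ring.
- eapply Rle_trans; [right|exact m2]; f_equal; unfold z, Re, Im, Cminus, Cplus, Copp, Cmult; simpl; ring.
Qed.

(** Derivatives are kept as witnesses, as in [Cn]. Power series have complex derivatives of every
    order, and carrying [holn n] for all n takes the place of the theorem that one complex
    derivative entails all the others. *)
Fixpoint holn (n : nat) (F : C -> C) (s t : R) : Prop :=
  match n with
  | O => continuity_2d_pt (fun u v => Re (F (u, v))) s t /\
         continuity_2d_pt (fun u v => Im (F (u, v))) s t
  | S n => exists F1 : C -> C,
      locally_2d (fun u v => hol F u v (F1 (u, v))) s t /\ holn n F1 s t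
  end.

Lemma hol_continuity F s t l : hol F s t l ->
  continuity_2d_pt (fun u v => Re (F (u, v))) s t /\
  continuity_2d_pt (fun u v => Im (F (u, v))) s t.
Proof. intros [h1 h2]; split; eapply dpl_continuity; eassumption. Qed.

Lemma holn_continuity n F s t : holn n F s t -> holn 0 F s t.
Proof.
destruct n as [|n]; [easy|].
intros (F1 & h & _); apply locally_2d_singleton in h; eapply hol_continuity, h.
Qed.

Lemma holn_pred n F s t : holn (S n) F s t -> holn n F s t.
Proof.
revert F; induction n as [|n IH]; intros F h.
- now apply holn_continuity in h.
- destruct h as (F1 & h & h1); exists F1; auto.
Qed.

Lemma holn_Cn n F s t : holn n F s t ->
  Cn n (fun u v => Re (F (u, v))) s t /\ Cn n (fun u v => Im (F (u, v))) s t.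
Proof.
revert F; induction n as [|n IH]; intros F h; [exact h|].
destruct h as (F1 & h & h1); destruct (IH _ h1) as [c1 c2]; split.
- exists (fun u v => Re (F1 (u, v))), (fun u v => - Im (F1 (u, v))); repeat split; auto using Cn_opp.
  revert h; apply locally_2d_imp; intros u v h; apply h.
- exists (fun u v => Im (F1 (u, v))), (fun u v => Re (F1 (u, v))); repeat split; auto.
  revert h; apply locally_2d_imp; intros u v h; apply h.
Qed.

Lemma holn_ext_loc n F G s t :
  locally_2d (fun u v => F (u, v) = G (u, v)) s t -> holn n F s t -> holn n G s t.
Proof.
intros h; destruct n as [|n].
- intros [h1 h2]; split;
    [eapply continuity_2d_pt_ext_loc; [|exact h1]|eapply continuity_2d_pt_ext_loc; [|exact h2]];
    revert h; apply locally_2d_imp; now intros u v ->.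
- intros (F1 & h0 & h1); exists F1; split; auto.
  generalize (locally_2d_and _ _ _ _ (locally_2d_locally2 _ _ _ h) h0).
  apply locally_2d_imp; intros u v [k k']; eapply hol_ext_loc; eassumption.
Qed.

Lemma holn_const n k s t : holn n (fun _ => k) s t.
Proof.
revert k; induction n as [|n IH]; intros k.
- split; apply continuity_2d_pt_const.
- exists (fun _ => RtoC 0); split; [|apply IH].
  apply locally_2d_forall; intros; apply hol_const.
Qed.

Lemma holn_plus n F G s t : holn n F s t -> holn n G s t -> holn n (fun z => Cplus (F z) (G z)) s t.
Proof.
revert F G; induction n as [|n IH]; intros F G.
- intros [a b] [a' b']; split; simpl; now apply continuity_2d_pt_plus.
- intros (F1 & h & h1) (G1 & k & k1); exists (fun z => Cplus (F1 z) (G1 z)); split; auto.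
  generalize (locally_2d_and _ _ _ _ h k); apply locally_2d_imp.
  intros u v [a b]; now apply hol_plus.
Qed.

Lemma holn_mult n F G s t : holn n F s t -> holn n G s t -> holn n (fun z => Cmult (F z) (G z)) s t.
Proof.
revert F G; induction n as [|n IH]; intros F G hF hG.
- destruct hF as [a b], hG as [a' b']; split; simpl.
  + apply continuity_2d_pt_minus; now apply continuity_2d_pt_mult.
  + apply continuity_2d_pt_plus; now apply continuity_2d_pt_mult.
- assert (hF' := holn_pred _ _ _ _ hF); assert (hG' := holn_pred _ _ _ _ hG).
  destruct hF as (F1 & h & h1), hG as (G1 & k & k1).
  exists (fun z => Cplus (Cmult (F1 z) (G z)) (Cmult (F z) (G1 z))); split; [|apply holn_plus; auto].
  generalize (locally_2d_and _ _ _ _ h k); apply locally_2d_imp.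
  intros u v [a b]; now apply hol_mult.
Qed.

Lemma holn_scal n k F s t : holn n F s t -> holn n (fun z => Cmult k (F z)) s t.
Proof. apply holn_mult, holn_const. Qed.

Lemma holn_minus n F G s t : holn n F s t -> holn n G s t -> holn n (fun z => Cminus (F z) (G z)) s t.
Proof.
intros hF hG; apply holn_ext_loc with (fun z => Cplus (F z) (Cmult (RtoC (-1)) (G z))).
- apply locally_2d_forall; intros; ring.
- apply holn_plus; [exact hF|now apply holn_scal].
Qed.

Lemma holn_locally n F s t : holn (S n) F s t -> locally_2d (fun u v => exists l, hol F u v l) s t.
Proof.
intros (F1 & h & _); revert h; apply locally_2d_imp; intros u v h; eexists; exact h.
Qed.

Lemma hol_C_derive F s t l : hol F s t l -> C_derive F (s, t) = l.
Proof. intros h; now apply is_C_derive_unique, hol_is_derive. Qed.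

Lemma ex_hol_C_derive F s t : (exists l, hol F s t l) -> hol F s t (C_derive F (s, t)).
Proof. intros [l h]; now rewrite (hol_C_derive _ _ _ _ h). Qed.

Lemma Cmod_lt_locally x0 r s t : Cmod (s - x0, t) < r ->
  locally_2d (fun u v => Cmod (u - x0, v) < r) s t.
Proof.
intros h.
assert (hd : 0 < (r - Cmod (s - x0, t)) / 2) by lra.
exists (mkposreal _ hd); simpl; intros u v hu hv.
replace ((u - x0, v) : C) with (Cplus (s - x0, t) (u - s, v - t))
  by (unfold Cplus; simpl; f_equal; ring).
eapply Rle_lt_trans; [apply Cmod_triangle|].
assert (h2 := Cmod_le_2Rmax (u - s, v - t)); unfold Re, Im in h2; simpl in h2.
assert (Rmax (Rabs (u - s)) (Rabs (v - t)) < (r - Cmod (s - x0, t)) / 2) by now apply Rmax_lub_lt.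
lra.
Qed.

Lemma CPS_holn n b r x0 s t :
  geo_bounded b r -> Cmod (s - x0, t) < r ->
  holn n (fun z => CPS b (Re z - x0, Im z)) s t.
Proof.
revert b r; induction n as [|n IH]; intros b r hb hz.
- eapply hol_continuity, (hol_shift (CPS b)), (CPS_hol b r); eassumption.
- exists (fun z => CPS (PS_derive b) (Re z - x0, Im z)); split.
  + generalize (Cmod_lt_locally _ _ _ _ hz); apply locally_2d_imp; intros u v huv.
    apply (hol_shift (CPS b)), (CPS_hol b r); assumption.
  + assert (h0 := Cmod_ge_0 (s - x0, t)).
    apply IH with ((Cmod (s - x0, t) + r) / 2); [|lra].
    apply geo_bounded_derive with r; [lra|exact hb].
Qed.

Lemma CPS_real b x : CPS b (x, 0) = RtoC (PSeries b x).
Proof.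
assert (h : forall n, Cpow (x, 0) n = (x ^ n, 0)) by (intros n; symmetry; exact (RtoC_pow x n)).
unfold CPS, RtoC, PSeries; f_equal.
- apply Series_ext; intros n; now rewrite h.
- transitivity (Series (fun n => b n * 0)); [|rewrite Series_scal_r; ring].
  apply Series_ext; intros n; now rewrite h.
Qed.

(** * Real analytic functions *)

Definition analytic (f : R -> R) (s : R) : Prop :=
  exists b r, 0 < r /\ geo_bounded b r /\
    forall x, Rabs (x - s) < r -> f x = PSeries b (x - s).

Lemma geo_bounded_CV_radius b r x :
  geo_bounded b r -> Rabs x < r -> Rbar_lt (Rabs x) (CV_radius b).
Proof.
intros [K hK] hx.
apply Rbar_lt_le_trans with r; [exact hx|].
apply (CV_radius_bounded b); exists K; intros n.
rewrite Rabs_mult, <- RPow_abs, (Rabs_pos_eq r); [apply hK|].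
assert (h := Rabs_pos x); lra.
Qed.

(** Convergence at distance d/2 makes the terms there tend to 0, hence bounded: this is the
    coefficient estimate with r = d/2. *)
Lemma real_analytic_at_analytic f s : real_analytic_at f s -> analytic f s.
Proof.
intros (b & [d hd]).
exists b, (d / 2); split; [destruct d; simpl; lra|]; split.
- assert (hin : ball s d (s + d / 2)).
  { change (Rabs (s + d / 2 - s) < d); rewrite Rabs_pos_eq; destruct d; simpl; lra. }
  specialize (hd _ hin); replace (s + d / 2 - s) with (d / 2) in hd by ring.
  assert (hc : ex_pseries b (d / 2)) by (eexists; exact hd).
  assert (hl := ex_series_lim_0 _ hc).
  apply is_lim_seq_Reals in hl.
  destruct (maj_by_pos _ (exist _ _ hl)) as (K & _ & hK).
  exists K; intros n; specialize (hK n); revert hK; unfold scal; simpl; unfold mult; simpl.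
  rewrite pow_n_pow, Rabs_mult, (Rabs_pos_eq ((d / 2) ^ n)); [lra|].
  apply pow_le; destruct d; simpl; lra.
- intros x hx; symmetry; apply is_pseries_unique, hd.
  change (Rabs (x - s) < d); destruct d; simpl in *; lra.
Qed.

Lemma analytic_is_derive f s : analytic f s ->
  exists f1, analytic f1 s /\ locally s (fun x => is_derive f x (f1 x)).
Proof.
intros (b & r & hr & hb & hf).
exists (fun x => PSeries (PS_derive b) (x - s)); split.
- exists (PS_derive b), (r / 2); split; [lra|split; [|easy]].
  apply geo_bounded_derive with r; [lra|exact hb].
- exists (mkposreal r hr); intros x hx; change (Rabs (x - s) < r) in hx.
  apply is_derive_ext_loc with (fun x => PSeries b (x - s)).
  + assert (hd : 0 < r - Rabs (x - s)) by lra.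
    exists (mkposreal _ hd); intros y hy; change (Rabs (y - x) < r - Rabs (x - s)) in hy.
    symmetry; apply hf.
    replace (y - s) with ((y - x) + (x - s)) by ring.
    eapply Rle_lt_trans; [apply Rabs_triang|lra].
  + evar_last.
    * apply (is_derive_comp (PSeries b) (fun x => x - s)).
      -- apply is_derive_PSeries, geo_bounded_CV_radius with r; assumption.
      -- auto_derive; [exact I|reflexivity].
    * unfold scal; simpl; unfold mult; simpl; ring.
Qed.

Lemma analytic_ext_loc f g s : locally s (fun x => f x = g x) -> analytic f s -> analytic g s.
Proof.
intros [d hd] (b & r & hr & hb & hf).
assert (hm : 0 < Rmin d r) by (apply Rmin_glb_lt; [apply cond_pos|exact hr]).
assert (m1 := Rmin_l d r); assert (m2 := Rmin_r d r).
exists b, (Rmin d r); split; [exact hm|split].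
- apply geo_bounded_le with r; [lra|exact hb].
- intros x hx; rewrite <- hd; [apply hf; lra|change (Rabs (x - s) < d); lra].
Qed.

(** Coefficient n is a sum of n + 1 products, each at most K L r^-n; passing from r to r' absorbs
    the factor n + 1. *)
Lemma PS_mult_geo_bounded a b r r' : 0 < r' < r ->
  geo_bounded a r -> geo_bounded b r -> geo_bounded (PS_mult a b) r'.
Proof.
intros hr [K hK] [L hL].
assert (hKp := geo_bounded_K_pos _ _ _ hK); assert (hLp := geo_bounded_K_pos _ _ _ hL).
assert (hq : 0 < r' / r < 1).
{ split; [apply Rdiv_lt_0_compat; lra|apply Rlt_div_l; lra]. }
destruct (linear_times_geometric _ hq) as (D & hD & hb).
assert (main : forall n, Rabs (PS_mult a b n) * r ^ n <= INR (S n) * (K * L)).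
{ intros n; unfold PS_mult.
  apply Rle_trans with (sum_f_R0 (fun _ => K * L) n).
  2:{ rewrite sum_cte; lra. }
  eapply Rle_trans; [apply Rmult_le_compat_r; [apply pow_le; lra|apply Rsum_abs]|].
  rewrite (Rmult_comm _ (r ^ n)), scal_sum; apply sum_Rle; intros k hk.
  rewrite Rabs_mult; replace (r ^ n) with (r ^ k * r ^ (n - k)).
  2:{ rewrite <- pow_add; f_equal; lia. }
  replace (Rabs (a k) * Rabs (b (n - k)%nat) * (r ^ k * r ^ (n - k)))
    with ((Rabs (a k) * r ^ k) * (Rabs (b (n - k)%nat) * r ^ (n - k))) by ring.
  apply Rmult_le_compat; auto; apply Rmult_le_pos; try apply Rabs_pos; apply pow_le; lra. }
exists (K * L * (D + 1)); intros n.
assert (hrn : 0 < r ^ n) by (apply pow_lt; lra).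
replace (Rabs (PS_mult a b n) * r' ^ n) with ((Rabs (PS_mult a b n) * r ^ n) * (r' / r) ^ n).
2:{ unfold Rdiv; rewrite Rpow_mult_distr, pow_inv; field; lra. }
assert (hqn : 0 < (r' / r) ^ n <= 1).
{ split; [apply pow_lt; lra|]; rewrite <- (pow1 n); apply pow_incr; lra. }
eapply Rle_trans; [apply Rmult_le_compat_r; [lra|apply main]|].
rewrite S_INR; specialize (hb n).
replace ((INR n + 1) * (K * L) * (r' / r) ^ n)
  with (K * L * (INR n * (r' / r) ^ n + (r' / r) ^ n)) by ring.
apply Rmult_le_compat_l; [now apply Rmult_le_pos|lra].
Qed.

Lemma analytic_mult f g s : analytic f s -> analytic g s -> analytic (fun x => f x * g x) s.
Proof.
intros (a & r & hr & ha & hf) (b & r' & hr' & hb & hg).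
set (m := Rmin r r').
assert (hm : 0 < m) by (apply Rmin_glb_lt; assumption).
assert (m1 : m <= r) by apply Rmin_l; assert (m2 : m <= r') by apply Rmin_r.
assert (ha' : geo_bounded a m) by (apply geo_bounded_le with r; [lra|exact ha]).
assert (hb' : geo_bounded b m) by (apply geo_bounded_le with r'; [lra|exact hb]).
exists (PS_mult a b), (m / 2); split; [lra|split].
- apply PS_mult_geo_bounded with m; [lra|assumption..].
- intros x hx; rewrite hf, hg by lra; symmetry; apply PSeries_mult;
    apply geo_bounded_CV_radius with m; auto; lra.
Qed.

Lemma analytic_scal k f s : analytic f s -> analytic (fun x => k * f x) s.
Proof.
intros (a & r & hr & [K hK] & hf).
exists (PS_scal k a), r; split; [exact hr|split].
- exists (Rabs k * K); intros n; unfold PS_scal, scal; simpl; unfold mult; simpl.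
  rewrite Rabs_mult, Rmult_assoc; apply Rmult_le_compat_l; [apply Rabs_pos|apply hK].
- intros x hx; rewrite PSeries_scal, hf by assumption; reflexivity.
Qed.

(** Recursion in which term n may read all earlier terms. [T n] is a table whose entries below n are
    final; [x0] merely fills it at the start. *)
Lemma course_of_values {X : Type} (Phi : nat -> (nat -> X) -> X) (x0 : X) :
  (forall n f g, (forall k, (k < n)%nat -> f k = g k) -> Phi n f = Phi n g) ->
  exists y : nat -> X, forall n, y n = Phi n y.
Proof.
intros h.
set (T := fix T n := match n with
  | O => fun _ => x0
  | S n => fun k => if Nat.eqb k n then Phi n (T n) else T n k
  end : nat -> X).
assert (hT : forall n k, (k < n)%nat -> T n k = T (S k) k).
{ induction n as [|n IH]; intros k hk; [lia|].
  simpl; destruct (Nat.eqb_spec k n) as [->|hne].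
  - now rewrite Nat.eqb_refl.
  - rewrite IH by lia; simpl; now rewrite Nat.eqb_refl. }
exists (fun n => T (S n) n); intros n.
transitivity (Phi n (T n)); [simpl; now rewrite Nat.eqb_refl|].
apply h; intros k hk; now apply hT.
Qed.

(** Sums the products of a majorant mu^(k+1) with a majorant M^(n-k), as they occur in the recursion
    for the reciprocal of a power series. *)
Lemma geometric_convolution (mu M : R) (n : nat) :
  (M - mu) * sum_f_R0 (fun k => mu ^ S k * M ^ (n - k)) n = mu * (M ^ S n - mu ^ S n).
Proof.
induction n as [|n IH]; [simpl; ring|].
rewrite tech5, Nat.sub_diag, Rmult_plus_distr_l.
rewrite (sum_eq _ (fun k => (mu ^ S k * M ^ (n - k)) * M)).
2:{ intros k hk; replace (S n - k)%nat with (S (n - k)) by lia; simpl; ring. }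
rewrite <- scal_sum, (Rmult_comm M), <- Rmult_assoc, IH; simpl; ring.
Qed.

(* The coefficients of the reciprocal are dominated by (1/|a 0|) M^n as soon as
   M - mu = mu K / |a 0|, where |a k| <= K mu^k. *)
Lemma analytic_inv f s : f s <> 0 -> analytic f s -> analytic (fun x => / f x) s.
Proof.
intros h0 (a & r & hr & [K hK] & hf).
assert (ha0 : a O <> 0).
{ rewrite hf, Rminus_eq_0, PSeries_0 in h0; [exact h0|]. rewrite Rminus_eq_0, Rabs_R0; exact hr. }
assert (hA : 0 < Rabs (a O)) by now apply Rabs_pos_lt.
assert (hKp := geo_bounded_K_pos _ _ _ hK).
destruct (course_of_values (fun n y => / a O * (match n with O => 1
   | S m => - sum_f_R0 (fun k => a (S k) * y (m - k)%nat) m end)) 0) as [y hy].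
{ intros [|n] u v huv; [reflexivity|].
  do 2 f_equal; apply sum_eq; intros k hk; rewrite huv by lia; reflexivity. }
set (mu := / r); set (M := mu * (1 + K / Rabs (a O))).
assert (hmu : 0 < mu) by now apply Rinv_0_lt_compat.
assert (hKA : 0 <= K / Rabs (a O)).
{ apply Rmult_le_pos; [exact hKp|apply Rlt_le, Rinv_0_lt_compat, hA]. }
assert (hMmu : mu <= M) by (unfold M; nra).
assert (hak : forall k, Rabs (a k) <= K * mu ^ k).
{ intros k; unfold mu; rewrite pow_inv; specialize (hK k).
  assert (0 < r ^ k) by (apply pow_lt; lra).
  apply (Rmult_le_reg_r (r ^ k)); [assumption|]; rewrite Rmult_assoc, Rinv_l; lra. }
assert (hbound : forall n, Rabs (y n) <= / Rabs (a O) * M ^ n).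
{ intros n; induction n as [n IH] using (well_founded_induction Wf_nat.lt_wf).
  rewrite hy, Rabs_mult, Rabs_inv.
  apply Rmult_le_compat_l; [apply Rlt_le, Rinv_0_lt_compat, hA|].
  destruct n as [|n]; [rewrite Rabs_R1; simpl; lra|].
  rewrite Rabs_Ropp; eapply Rle_trans; [apply Rsum_abs|].
  apply Rle_trans with (sum_f_R0 (fun k => (mu ^ S k * M ^ (n - k)) * (K * / Rabs (a O))) n).
  - apply sum_Rle; intros k hk; rewrite Rabs_mult.
    replace (mu ^ S k * M ^ (n - k) * (K * / Rabs (a O)))
      with ((K * mu ^ S k) * (/ Rabs (a O) * M ^ (n - k))) by ring.
    apply Rmult_le_compat; auto using Rabs_pos.
    apply IH; lia.
  - rewrite <- scal_sum.
    assert (hg := geometric_convolution mu M n).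
    set (Sg := sum_f_R0 (fun k => mu ^ S k * M ^ (n - k)) n) in *.
    replace (M - mu) with (mu * (K * / Rabs (a O))) in hg by (unfold M; field; lra).
    assert (e : K * / Rabs (a O) * Sg = M ^ S n - mu ^ S n).
    { apply (Rmult_eq_reg_l mu); [|lra]; rewrite <- hg; ring. }
    rewrite e; assert (0 < mu ^ S n) by now apply pow_lt.
    lra. }
assert (hM : 0 < M) by lra.
assert (hrM : 0 < / M <= r).
{ split; [now apply Rinv_0_lt_compat|]; rewrite <- (Rinv_inv r); apply Rinv_le_contravar; assumption. }
assert (hyb : geo_bounded y (/ M)).
{ exists (/ Rabs (a O)); intros n; rewrite pow_inv.
  assert (0 < M ^ n) by now apply pow_lt.
  apply (Rmult_le_reg_r (M ^ n)); [assumption|].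
  rewrite Rmult_assoc, Rinv_l, Rmult_1_r by lra; apply hbound. }
assert (hab : geo_bounded a (/ M)) by (apply geo_bounded_le with r; [lra|now exists K]).
exists y, (/ M); split; [apply hrM|split; [exact hyb|]].
intros x hx.
assert (e : f x * PSeries y (x - s) = 1).
{ rewrite hf by lra; rewrite <- PSeries_mult by (apply geo_bounded_CV_radius with (/ M); assumption).
  rewrite (PSeries_ext _ (fun n => match n with O => 1 | S _ => 0 end)).
  - apply is_pseries_unique.
    apply (is_series_ext (fun n => match n with O => 1 | S _ => 0 end)).
    + intros [|n]; unfold scal; simpl; unfold mult, one; simpl; ring.
    + apply is_series_decr_1; simpl.
      match goal with |- is_series _ ?l => replace l with 0 end.
      * apply is_series_Reals; intros e he; exists O; intros n _.
        unfold R_dist; replace (sum_f_R0 (fun _ => 0) n) with 0.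
        -- rewrite Rminus_0_r, Rabs_R0; exact he.
        -- symmetry; rewrite sum_cte; ring.
      * unfold plus, opp; simpl; ring.
  - intros [|n]; unfold PS_mult.
    + simpl; rewrite hy; simpl; field; exact ha0.
    + rewrite decomp_sum by lia; simpl pred; rewrite Nat.sub_0_r, hy.
      change (sum_f_R0 (fun i => a (S i) * y (S n - S i)%nat) n)
        with (sum_f_R0 (fun k => a (S k) * y (n - k)%nat) n).
      field; exact ha0. }
apply (Rmult_eq_reg_l (f x)); [|intros e0; rewrite e0 in e; lra].
rewrite e; apply Rinv_r; intros e0; rewrite e0 in e; lra.
Qed.

(** * Linear systems: uniqueness and analyticity *)

Lemma nonincreasing_of_derive (f f1 : R -> R) (a b : R) :
  a <= b -> (forall x, a <= x <= b -> is_derive f x (f1 x)) ->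
  (forall x, a <= x <= b -> f1 x <= 0) -> f b <= f a.
Proof.
intros hab hd hn; destruct (Req_dec a b) as [->|hne]; [lra|].
destruct (MVT_cor2 f f1 a b) as (c & hc & hc'); [lra| |].
- intros x hx; apply is_derive_Reals, hd, hx.
- specialize (hn c ltac:(lra)); nra.
Qed.

(** E exp(-K s) is nonincreasing, which settles the right of [s0]; E exp(K s) is nondecreasing,
    which settles the left. *)
Lemma gronwall_zero (E E1 : R -> R) (a b s0 K : R) :
  (forall s, a <= s <= b -> is_derive E s (E1 s)) ->
  (forall s, a <= s <= b -> 0 <= E s) ->
  (forall s, a <= s <= b -> Rabs (E1 s) <= K * E s) ->
  a <= s0 <= b -> E s0 = 0 -> forall s, a <= s <= b -> E s = 0.
Proof.
intros hd hp hb hs0 h0 s hs.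
assert (hder : forall e x, a <= x <= b ->
  is_derive (fun u => E u * exp (e * u)) x ((E1 x + e * E x) * exp (e * x))).
{ intros e x hx; auto_derive; [eexists; now apply hd|].
  assert (hx' := hd x hx); rewrite_derive hx'; ring. }
destruct (Rle_dec s0 s) as [h|h].
- assert (hm := nonincreasing_of_derive (fun u => E u * exp (- K * u)) _ s0 s h
    (fun x hx => hder (- K) x ltac:(lra))).
  assert (h1 : E s * exp (- K * s) <= E s0 * exp (- K * s0)).
  { apply hm; intros x hx; assert (he := exp_pos (- K * x)).
    specialize (hb x ltac:(lra)); apply Rabs_le_between in hb; nra. }
  rewrite h0, Rmult_0_l in h1; specialize (hp s hs).
  assert (he := exp_pos (- K * s)); nra.
- assert (hm := nonincreasing_of_derive (fun u => - (E u * exp (K * u)))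
    (fun x => - ((E1 x + K * E x) * exp (K * x))) s s0 ltac:(lra)
    (fun x hx => is_derive_opp _ _ _ (hder K x ltac:(lra)))).
  assert (h1 : - (E s0 * exp (K * s0)) <= - (E s * exp (K * s))).
  { apply hm; intros x hx; assert (he := exp_pos (K * x)).
    specialize (hb x ltac:(lra)); apply Rabs_le_between in hb; nra. }
  rewrite h0, Rmult_0_l in h1; specialize (hp s hs).
  assert (he := exp_pos (K * s)); nra.
Qed.

(** One Cartesian coordinate of the frame system of a curve, where r stands for c a. *)
Definition solves (p q r x v n : R -> R) (s : R) : Prop :=
  is_derive x s (v s) /\
  is_derive v s (p s * v s - q s * n s - r s * x s) /\
  is_derive n s (p s * n s + q s * v s).

Lemma solves_minus p q r x v n x' v' n' s :
  solves p q r x v n s -> solves p q r x' v' n' s ->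
  solves p q r (fun u => x u - x' u) (fun u => v u - v' u) (fun u => n u - n' u) s.
Proof.
intros (h1 & h2 & h3) (k1 & k2 & k3); split; [|split].
- apply (is_derive_minus x x'); assumption.
- evar_last; [apply (is_derive_minus v v'); eassumption|].
  unfold minus, plus, opp; simpl; ring.
- evar_last; [apply (is_derive_minus n n'); eassumption|].
  unfold minus, plus, opp; simpl; ring.
Qed.

Lemma continuous_bounded (f : R -> R) (a b : R) :
  (forall s, a <= s <= b -> continuous f s) ->
  exists B, 0 <= B /\ forall s, a <= s <= b -> Rabs (f s) <= B.
Proof.
intros hc; destruct (Rle_dec a b) as [hab|hab].
2:{ exists 0; split; [lra|intros; lra]. }
destruct (continuity_ab_maj (fun s => Rabs (f s)) a b hab) as (M & hM & _).
- intros s hs; apply continuity_pt_filterlim.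
  apply (continuous_comp f Rabs); [now apply hc|apply continuous_Rabs].
- exists (Rabs (f M)); split; [apply Rabs_pos|exact hM].
Qed.

(** In the derivative of the energy x^2 + v^2 + n^2 the q-terms cancel, since q acts as an
    infinitesimal rotation of (v, n). The rest is at most 1 + 2 P + B times the energy, where P and
    B bound p and r. *)
Lemma solves_unique_zero p q r x v n a b s0 :
  (forall s, a <= s <= b -> continuous p s) ->
  (forall s, a <= s <= b -> continuous q s) ->
  (forall s, a <= s <= b -> continuous r s) ->
  (forall s, a <= s <= b -> solves p q r x v n s) ->
  a <= s0 <= b -> x s0 = 0 -> v s0 = 0 -> n s0 = 0 ->
  forall s, a <= s <= b -> x s = 0 /\ v s = 0 /\ n s = 0.
Proof.
intros cp cq cr hs hs0 hx hv hn s hsab.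
destruct (continuous_bounded p a b cp) as (P & hP0 & hP).
destruct (continuous_bounded r a b cr) as (B & hB0 & hB).
assert (hE : x s * x s + v s * v s + n s * n s = 0).
{ apply (gronwall_zero (fun u => x u * x u + v u * v u + n u * n u)
    (fun u => 2 * (x u * v u + p u * (v u * v u + n u * n u) - r u * (x u * v u))) a b s0 (1 + 2 * P + B));
    auto.
  - intros u hu; destruct (hs u hu) as (h1 & h2 & h3).
    auto_derive; [repeat split; eexists; eassumption|].
    rewrite_derive h1; rewrite_derive h2; rewrite_derive h3; ring.
  - intros u hu; nra.
  - intros u hu; specialize (hP u hu); specialize (hB u hu).
    apply Rabs_le_between in hP; apply Rabs_le_between in hB.
    assert (s1 := pow2_ge_0 (x u + v u)); assert (s2 := pow2_ge_0 (x u - v u)).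
    assert (s3 := pow2_ge_0 (x u)); assert (s4 := pow2_ge_0 (v u)); assert (s5 := pow2_ge_0 (n u)).
    assert (h2 : Rabs (p u * (v u * v u + n u * n u)) <= P * (v u * v u + n u * n u)).
    { rewrite Rabs_mult; apply Rmult_le_compat; try apply Rabs_pos; apply Rabs_le_between; lra. }
    assert (h3 : Rabs (r u * (2 * (x u * v u))) <= B * (x u * x u + v u * v u)).
    { rewrite Rabs_mult; apply Rmult_le_compat; try apply Rabs_pos; apply Rabs_le_between; lra. }
    apply Rabs_le_between in h2; apply Rabs_le_between in h3; apply Rabs_le_between.
    assert (0 <= P * (x u ^ 2)) by now apply Rmult_le_pos.
    assert (0 <= B * (n u ^ 2)) by now apply Rmult_le_pos.
    split; lra.
  - rewrite hx, hv, hn; ring. }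
repeat split; nra.
Qed.

Lemma solves_unique p q r x v n x' v' n' a b s0 :
  (forall s, a <= s <= b -> continuous p s) ->
  (forall s, a <= s <= b -> continuous q s) ->
  (forall s, a <= s <= b -> continuous r s) ->
  (forall s, a <= s <= b -> solves p q r x v n s) ->
  (forall s, a <= s <= b -> solves p q r x' v' n' s) ->
  a <= s0 <= b -> x s0 = x' s0 -> v s0 = v' s0 -> n s0 = n' s0 ->
  forall s, a <= s <= b -> x s = x' s /\ v s = v' s /\ n s = n' s.
Proof.
intros cp cq cr h h' hs0 hx hv hn s hs.
assert (hz := solves_unique_zero p q r (fun u => x u - x' u) (fun u => v u - v' u)
  (fun u => n u - n' u) a b s0 cp cq cr (fun u hu => solves_minus _ _ _ _ _ _ _ _ _ _ (h u hu) (h' u hu))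
  hs0 ltac:(lra) ltac:(lra) ltac:(lra) s hs).
simpl in hz; repeat split; lra.
Qed.

Lemma analytic_continuous f s : analytic f s -> locally s (fun x => continuous f x).
Proof.
intros h; destruct (analytic_is_derive f s h) as (f1 & _ & hd).
revert hd; apply filter_imp; intros x hx; apply (ex_derive_continuous f); eexists; exact hx.
Qed.

Lemma PSeries_shift_derive b r s x : geo_bounded b r -> Rabs (x - s) < r ->
  is_derive (fun u => PSeries b (u - s)) x (PSeries (PS_derive b) (x - s)).
Proof.
intros hb hx; evar_last.
- apply (is_derive_comp (PSeries b) (fun x => x - s)).
  + apply is_derive_PSeries, geo_bounded_CV_radius with r; assumption.
  + auto_derive; [exact I|reflexivity].
- unfold scal; simpl; unfold mult; simpl; ring.
Qed.

(** The bound on [b] is asked only up to m, so that it can come from an induction hypothesis on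
    earlier coefficients. *)
Lemma convolution_bound (a b : nat -> R) (K C M : R) (m : nat) :
  0 <= K -> 0 <= C -> 0 < M ->
  (forall k, Rabs (a k) <= K * M ^ k) ->
  (forall k, (k <= m)%nat -> Rabs (b k) <= C * M ^ k) ->
  Rabs (PS_mult a b m) <= INR (S m) * (K * C * M ^ m).
Proof.
intros hK hC hM ha hb; unfold PS_mult.
eapply Rle_trans; [apply Rsum_abs|].
apply Rle_trans with (sum_f_R0 (fun _ => K * C * M ^ m) m).
- apply sum_Rle; intros k hk; rewrite Rabs_mult.
  replace (M ^ m) with (M ^ k * M ^ (m - k)) by (rewrite <- pow_add; f_equal; lia).
  replace (K * C * (M ^ k * M ^ (m - k))) with ((K * M ^ k) * (C * M ^ (m - k))) by ring.
  apply Rmult_le_compat; auto using Rabs_pos; apply hb; lia.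
- rewrite sum_cte; lra.
Qed.

Lemma geo_bounded_growth a r M : 0 < r -> / r <= M -> geo_bounded a r ->
  exists K, 0 <= K /\ forall k, Rabs (a k) <= K * M ^ k.
Proof.
intros hr hM [K hK]; assert (hKp := geo_bounded_K_pos _ _ _ hK).
assert (hri : 0 < / r) by now apply Rinv_0_lt_compat.
exists K; split; [exact hKp|]; intros k.
apply Rle_trans with (K * (/ r) ^ k).
- rewrite pow_inv; specialize (hK k); assert (0 < r ^ k) by (apply pow_lt; lra).
  apply (Rmult_le_reg_r (r ^ k)); [assumption|]; rewrite Rmult_assoc, Rinv_l; lra.
- apply Rmult_le_compat_l; [exact hKp|apply pow_incr; lra].
Qed.

Lemma growth_geo_bounded a C M : 0 < M -> (forall k, Rabs (a k) <= C * M ^ k) ->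
  geo_bounded a (/ M).
Proof.
intros hM h; exists C; intros n; rewrite pow_inv.
assert (0 < M ^ n) by now apply pow_lt.
apply (Rmult_le_reg_r (M ^ n)); [assumption|].
rewrite Rmult_assoc, Rinv_l, Rmult_1_r by lra; apply h.
Qed.

(** The system determines the coefficients of index m + 1 from those up to m, with a division by m +
    1. By induction they stay below C M^k, which is the convergence; uniform constants come from a
    common radius rho. *)
Lemma analytic_solution_exists p q r s0 x0 v0 n0 :
  analytic p s0 -> analytic q s0 -> analytic r s0 ->
  exists x v n, analytic x s0 /\ analytic v s0 /\ analytic n s0 /\
    x s0 = x0 /\ v s0 = v0 /\ n s0 = n0 /\
    locally s0 (fun s => solves p q r x v n s).
Proof.
intros (a & ra & hra & ha & hp) (b & rb & hrb & hb & hq) (c & rc & hrc & hc & hr).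
set (rho := Rmin ra (Rmin rb rc)).
assert (hrho : 0 < rho) by (repeat apply Rmin_glb_lt; assumption).
assert (m1 : rho <= ra) by apply Rmin_l.
assert (m2 : rho <= rb) by (eapply Rle_trans; [apply Rmin_r|apply Rmin_l]).
assert (m3 : rho <= rc) by (eapply Rle_trans; [apply Rmin_r|apply Rmin_r]).
assert (hri : 0 < / rho) by now apply Rinv_0_lt_compat.
destruct (geo_bounded_growth a rho (/ rho)) as (Ka & hKa & ga);
  [lra|lra|apply geo_bounded_le with ra; [lra|exact ha]|].
destruct (geo_bounded_growth b rho (/ rho)) as (Kb & hKb & gb);
  [lra|lra|apply geo_bounded_le with rb; [lra|exact hb]|].
destruct (geo_bounded_growth c rho (/ rho)) as (Kc & hKc & gc);
  [lra|lra|apply geo_bounded_le with rc; [lra|exact hc]|].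
(* M exceeds 1/rho, so that K M^k dominates the given coefficients; it exceeds 3 K, for the three
   convolutions in the second row; and it is at least 1, for the first row. *)
set (K := Ka + Kb + Kc); set (M := / rho + 3 * K + 1).
assert (hK : 0 <= K) by (unfold K; lra).
assert (hM : 1 <= M) by (unfold M; lra).
assert (hKM : 3 * K <= M) by (unfold M; lra).
assert (hMk : forall k, (/ rho) ^ k <= M ^ k) by (intros k; apply pow_incr; unfold M; lra).
assert (hMp : forall k, 0 < M ^ k) by (intros k; apply pow_lt; lra).
assert (grow : forall e L, 0 <= L <= K -> (forall k, Rabs (e k) <= L * (/ rho) ^ k) ->
  forall k, Rabs (e k) <= K * M ^ k).
{ intros e L hL he k; eapply Rle_trans; [apply he|].
  apply Rmult_le_compat; try lra; [apply pow_le; lra|apply hMk]. }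
assert (ga' := grow a Ka ltac:(unfold K; lra) ga).
assert (gb' := grow b Kb ltac:(unfold K; lra) gb).
assert (gc' := grow c Kc ltac:(unfold K; lra) gc).
clear grow ga gb gc.
set (X := fun (y : nat -> R * R * R) k => fst (fst (y k))).
set (V := fun (y : nat -> R * R * R) k => snd (fst (y k))).
set (N := fun (y : nat -> R * R * R) k => snd (y k)).
destruct (course_of_values (fun n y => match n with
  | O => (x0, v0, n0)
  | S m => (/ INR (S m) * V y m,
            / INR (S m) * (PS_mult a (V y) m - PS_mult b (N y) m - PS_mult c (X y) m),
            / INR (S m) * (PS_mult a (N y) m + PS_mult b (V y) m)) end) (0, 0, 0)) as [y hy].
{ intros [|m] f g hfg; [reflexivity|].
  assert (hc1 : forall e (Z : (nat -> R * R * R) -> nat -> R),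
     (forall k, (k <= m)%nat -> Z f k = Z g k) -> PS_mult e (Z f) m = PS_mult e (Z g) m).
  { intros e Z hZ; apply sum_eq; intros k hk; rewrite hZ by lia; reflexivity. }
  rewrite (hc1 a V), (hc1 b N), (hc1 c X), (hc1 a N), (hc1 b V);
    try (intros k hk; unfold X, V, N; rewrite hfg by lia; reflexivity).
  unfold V at 1; rewrite hfg by lia; reflexivity. }
set (C := Rabs x0 + Rabs v0 + Rabs n0).
assert (b1 := Rabs_pos x0); assert (b2 := Rabs_pos v0); assert (b3 := Rabs_pos n0).
assert (hC : 0 <= C) by (unfold C; lra).
assert (bound : forall k, Rabs (X y k) <= C * M ^ k /\ Rabs (V y k) <= C * M ^ k /\
  Rabs (N y k) <= C * M ^ k).
{ intros k; induction k as [k IH] using (well_founded_induction Wf_nat.lt_wf).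
  destruct k as [|m].
  - unfold X, V, N; rewrite hy; simpl; unfold C; lra.
  - assert (hm : 0 < INR (S m)) by (apply lt_0_INR; lia).
    assert (hm1 : 1 <= INR (S m)) by (rewrite S_INR; assert (h := pos_INR m); lra).
    assert (conv : forall e (Z : nat -> R), (forall k, Rabs (e k) <= K * M ^ k) ->
      (forall k, (k <= m)%nat -> Rabs (Z k) <= C * M ^ k) ->
      Rabs (PS_mult e Z m) <= INR (S m) * (K * C * M ^ m)).
    { intros e Z he hZ; apply convolution_bound; auto; lra. }
    assert (cX : forall e, (forall k, Rabs (e k) <= K * M ^ k) ->
      Rabs (PS_mult e (X y) m) <= INR (S m) * (K * C * M ^ m))
      by (intros e he; apply conv; [exact he|intros k hk; apply IH; lia]).
    assert (cV : forall e, (forall k, Rabs (e k) <= K * M ^ k) ->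
      Rabs (PS_mult e (V y) m) <= INR (S m) * (K * C * M ^ m))
      by (intros e he; apply conv; [exact he|intros k hk; apply IH; lia]).
    assert (cN : forall e, (forall k, Rabs (e k) <= K * M ^ k) ->
      Rabs (PS_mult e (N y) m) <= INR (S m) * (K * C * M ^ m))
      by (intros e he; apply conv; [exact he|intros k hk; apply IH; lia]).
    assert (hCM : 0 <= C * M ^ m) by (apply Rmult_le_pos; [lra|apply Rlt_le, hMp]).
    (* The division by m + 1 cancels the number of terms of a convolution, and 3 K <= M pays for the
       passage from M^m to M^(m+1). *)
    assert (fin : forall z, Rabs z <= INR (S m) * (3 * (K * C * M ^ m)) ->
      Rabs (/ INR (S m) * z) <= C * M ^ S m).
    { intros z hz; rewrite Rabs_mult, Rabs_inv, (Rabs_pos_eq (INR (S m))) by lra.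
      apply Rle_trans with (3 * K * (C * M ^ m)).
      - apply (Rmult_le_reg_l (INR (S m))); [lra|].
        rewrite <- Rmult_assoc, Rinv_r, Rmult_1_l by lra; lra.
      - simpl; replace (C * (M * M ^ m)) with (M * (C * M ^ m)) by ring.
        apply Rmult_le_compat_r; lra. }
    specialize (cX c gc') as cX'. assert (cV1 := cV a ga'). assert (cV2 := cV b gb').
    assert (cN1 := cN a ga'). assert (cN2 := cN b gb').
    assert (hKC : 0 <= INR (S m) * (K * C * M ^ m)).
    { apply Rmult_le_pos; [lra|]; rewrite Rmult_assoc; now apply Rmult_le_pos. }
    split; [|split].
    + unfold X; rewrite hy; cbn [fst snd].
      rewrite Rabs_mult, Rabs_inv, (Rabs_pos_eq (INR (S m))) by lra.
      destruct (IH m ltac:(lia)) as (_ & hV & _).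
      apply (Rmult_le_reg_l (INR (S m))); [lra|].
      rewrite <- Rmult_assoc, Rinv_r, Rmult_1_l by lra.
      eapply Rle_trans; [exact hV|]; simpl (M ^ S m).
      replace (INR (S m) * (C * (M * M ^ m))) with (INR (S m) * M * (C * M ^ m)) by ring.
      assert (1 <= INR (S m) * M) by nra; nra.
    + unfold V; rewrite hy; cbn [fst snd]; apply fin.
      apply Rabs_le_between in cX'; apply Rabs_le_between in cV1; apply Rabs_le_between in cN2.
      apply Rabs_le_between; lra.
    + unfold N; rewrite hy; cbn [fst snd]; apply fin.
      apply Rabs_le_between in cV2; apply Rabs_le_between in cN1.
      apply Rabs_le_between; lra. }
assert (hM0 : 0 < M) by lra.
assert (gX : geo_bounded (X y) (/ M)) by (apply growth_geo_bounded with C; [lra|intros; apply bound]).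
assert (gV : geo_bounded (V y) (/ M)) by (apply growth_geo_bounded with C; [lra|intros; apply bound]).
assert (gN : geo_bounded (N y) (/ M)) by (apply growth_geo_bounded with C; [lra|intros; apply bound]).
assert (hMi : 0 < / M <= rho).
{ split; [now apply Rinv_0_lt_compat|]; rewrite <- (Rinv_inv rho).
  apply Rinv_le_contravar; [exact hri|unfold M; lra]. }
assert (ha' : geo_bounded a (/ M)) by (apply geo_bounded_le with ra; [lra|exact ha]).
assert (hb' : geo_bounded b (/ M)) by (apply geo_bounded_le with rb; [lra|exact hb]).
assert (hc' : geo_bounded c (/ M)) by (apply geo_bounded_le with rc; [lra|exact hc]).
exists (fun s => PSeries (X y) (s - s0)), (fun s => PSeries (V y) (s - s0)),
  (fun s => PSeries (N y) (s - s0)).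
assert (an : forall Z, geo_bounded Z (/ M) -> analytic (fun s => PSeries Z (s - s0)) s0).
{ intros Z hZ; exists Z, (/ M); split; [apply hMi|split; [exact hZ|easy]]. }
repeat split; auto; try (rewrite Rminus_eq_0, PSeries_0; unfold X, V, N; rewrite hy; reflexivity).
exists (mkposreal _ (proj1 hMi)); intros s hs; change (Rabs (s - s0) < / M) in hs.
assert (nz : forall m, INR (S m) <> 0) by (intros m; apply not_0_INR; lia).
assert (cv : forall Z, geo_bounded Z (/ M) -> ex_pseries Z (s - s0)).
{ intros Z hZ; apply CV_radius_inside, geo_bounded_CV_radius with (/ M); assumption. }
assert (cvm : forall Z W, geo_bounded Z (/ M) -> geo_bounded W (/ M) ->
  ex_pseries (PS_mult Z W) (s - s0) /\
  PSeries (PS_mult Z W) (s - s0) = PSeries Z (s - s0) * PSeries W (s - s0)).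
{ intros Z W hZ hW; split.
  - apply ex_pseries_mult; apply geo_bounded_CV_radius with (/ M); assumption.
  - apply PSeries_mult; apply geo_bounded_CV_radius with (/ M); assumption. }
unfold solves; rewrite hp, hq, hr by lra; split; [|split].
- evar_last; [apply (PSeries_shift_derive _ (/ M)); assumption|].
  apply PSeries_ext; intros m; unfold PS_derive; unfold X; rewrite hy; cbn [fst snd].
  field; apply nz.
- evar_last; [apply (PSeries_shift_derive _ (/ M)); assumption|].
  destruct (cvm a (V y) ha' gV) as [e1 <-]; destruct (cvm b (N y) hb' gN) as [e2 <-].
  destruct (cvm c (X y) hc' gX) as [e3 <-].
  rewrite <- PSeries_minus by assumption.
  rewrite <- PSeries_minus; [|now apply ex_pseries_minus|assumption].
  apply PSeries_ext; intros m; unfold PS_derive at 1; unfold V at 1; rewrite hy; cbn [fst snd].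
  unfold PS_minus, PS_plus, PS_opp, plus, opp; simpl; field; apply nz.
- evar_last; [apply (PSeries_shift_derive _ (/ M)); assumption|].
  destruct (cvm a (N y) ha' gN) as [e1 <-]; destruct (cvm b (V y) hb' gV) as [e2 <-].
  rewrite <- PSeries_plus by assumption.
  apply PSeries_ext; intros m; unfold PS_derive at 1; unfold N at 1; rewrite hy; cbn [fst snd].
  unfold PS_plus, plus; simpl; field; apply nz.
Qed.

(** The power series solution with the same values at [s0] coincides with the given solution near
    [s0], by uniqueness. *)
Lemma solution_analytic p q r x v n s0 :
  analytic p s0 -> analytic q s0 -> analytic r s0 ->
  locally s0 (fun s => solves p q r x v n s) ->
  analytic x s0 /\ analytic v s0 /\ analytic n s0.
Proof.
intros hp hq hr hs.
destruct (analytic_solution_exists p q r s0 (x s0) (v s0) (n s0) hp hq hr)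
  as (x' & v' & n' & ax & av & an & ex & ev & en & hs').
assert (hall : locally s0 (fun s => solves p q r x v n s /\ solves p q r x' v' n' s /\
  continuous p s /\ continuous q s /\ continuous r s)).
{ apply filter_and; [exact hs|apply filter_and; [exact hs'|]].
  apply filter_and; [now apply analytic_continuous|].
  apply filter_and; now apply analytic_continuous. }
destruct hall as [d hd].
assert (heq : locally s0 (fun s => x' s = x s /\ v' s = v s /\ n' s = n s)).
{ exists (pos_div_2 d); intros s hss; change (Rabs (s - s0) < d / 2) in hss.
  assert (hd0 := cond_pos d); apply Rabs_def2 in hss.
  assert (hin : forall u, s0 - d / 2 <= u <= s0 + d / 2 ->
    solves p q r x v n u /\ solves p q r x' v' n' u /\
    continuous p u /\ continuous q u /\ continuous r u).
  { intros u hu; apply hd; change (Rabs (u - s0) < d); apply Rabs_def1; lra. }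
  apply (solves_unique p q r x' v' n' x v n (s0 - d / 2) (s0 + d / 2) s0); auto; try lra;
    intros u hu; apply hin; lra. }
repeat split; [apply analytic_ext_loc with x'|apply analytic_ext_loc with v'|apply analytic_ext_loc with n'];
  auto; revert heq; apply filter_imp; intros s h; apply h.
Qed.

(** * Holomorphic extension of analytic functions *)

Lemma complexification_local f s0 : analytic f s0 ->
  exists delta F, 0 < delta /\
    (forall s t, box s0 delta delta s t -> forall n, holn n F s t) /\
    forall s, Rabs (s - s0) < delta -> F (s, 0) = RtoC (f s).
Proof.
intros (b & r & hr & hb & hf).
(* The box of half-side r/2 lies in the disc of convergence, since the modulus is at most twice the
   larger component. *)
exists (r / 2), (fun z => CPS b (Re z - s0, Im z)); split; [lra|split].
- intros s t [hs ht] n; apply CPS_holn with r; [exact hb|].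
  eapply Rle_lt_trans; [apply Cmod_le_2Rmax|].
  assert (Rmax (Rabs (s - s0)) (Rabs t) < r / 2) by now apply Rmax_lub_lt.
  unfold Re, Im; simpl; lra.
- intros s hs; simpl; rewrite CPS_real, hf by lra; reflexivity.
Qed.

(** One local extension is chosen for each point of I and they are glued. The overlap of two boxes
    centred on the axis is again such a box, and on its real segment both extensions equal f; by the
    identity theorem they agree on the overlap. *)
Lemma complexification (I : R -> Prop) (f : R -> R) :
  (forall s, I s -> analytic f s) ->
  exists (U : C -> Prop) F, nbhd_of I U /\
    (forall s t, U (s, t) -> forall n, holn n F s t) /\
    forall s, I s -> F (s, 0) = RtoC (f s).
Proof.
intros hf.
set (Good := fun (s : R) (dF : R * (C -> C)) => 0 < fst dF /\
    (forall u v, box s (fst dF) (fst dF) u v -> forall n, holn n (snd dF) u v) /\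
    forall u, Rabs (u - s) < fst dF -> snd dF (u, 0) = RtoC (f u)).
assert (hloc : forall s : R, exists dF, I s -> Good s dF).
{ intros s; destruct (excluded_middle_informative (I s)) as [hs|hs].
  - destruct (complexification_local f s (hf s hs)) as (d & F & h); exists (d, F); auto.
  - exists (0, fun _ => RtoC 0); contradiction. }
set (L := fun s => proj1_sig (constructive_indefinite_description _ (hloc s))).
assert (hL : forall s, I s -> Good s (L s)).
{ intros s; exact (proj2_sig (constructive_indefinite_description _ (hloc s))). }
set (inb := fun (z : C) s => I s /\ box s (fst (L s)) (fst (L s)) (Re z) (Im z)).
set (F := fun z : C => match excluded_middle_informative (exists s, inb z s) with
  | left h => snd (L (proj1_sig (constructive_indefinite_description _ h))) z
  | right _ => RtoC 0 end).
assert (agree : forall z s1 s2, inb z s1 -> inb z s2 -> snd (L s1) z = snd (L s2) z).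
{ intros [x t] s1 s2 [i1 h1] [i2 h2]; simpl in h1, h2.
  destruct (hL s1 i1) as (p1 & q1 & r1); destruct (hL s2 i2) as (p2 & q2 & r2).
  assert (b1 := box_elim _ _ _ _ _ h1); assert (b2 := box_elim _ _ _ _ _ h2).
  set (d1 := fst (L s1)) in *; set (d2 := fst (L s2)) in *.
  set (a := Rmax (s1 - d1) (s2 - d2)); set (b := Rmin (s1 + d1) (s2 + d2)); set (H := Rmin d1 d2).
  assert (a1 : s1 - d1 <= a) by apply Rmax_l; assert (a2 : s2 - d2 <= a) by apply Rmax_r.
  assert (c1 : b <= s1 + d1) by apply Rmin_l; assert (c2 : b <= s2 + d2) by apply Rmin_r.
  assert (e1 : H <= d1) by apply Rmin_l; assert (e2 : H <= d2) by apply Rmin_r.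
  assert (hx : a < x < b).
  { split; [apply Rmax_lub_lt|apply Rmin_glb_lt]; lra. }
  assert (ht : - H < t < H).
  { unfold H, Rmin; destruct (Rle_dec d1 d2); lra. }
  set (D := fun z => Cminus (snd (L s1) z) (snd (L s2) z)).
  assert (hD : D (x, t) = RtoC 0).
  { apply (identity_theorem D (C_derive D) ((a + b) / 2) ((b - a) / 2) H).
    - intros u v huv; apply box_elim in huv; apply ex_hol_C_derive.
      assert (k1 := q1 u v ltac:(apply box_intro; lra) 1%nat); apply holn_locally, locally_2d_singleton in k1.
      assert (k2 := q2 u v ltac:(apply box_intro; lra) 1%nat); apply holn_locally, locally_2d_singleton in k2.
      destruct k1 as [l1 k1], k2 as [l2 k2]; eexists; apply hol_minus; eassumption.
    - intros u hu; apply Rabs_def2 in hu; unfold D.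
      rewrite r1, r2 by (apply Rabs_def1; lra); ring.
    - apply box_intro; lra. }
  unfold D in hD.
  replace (snd (L s1) (x, t)) with (Cplus (Cminus (snd (L s1) (x, t)) (snd (L s2) (x, t))) (snd (L s2) (x, t))) by ring.
  rewrite hD; ring. }
assert (hF : forall z s, inb z s -> F z = snd (L s) z).
{ intros z s hz; unfold F.
  destruct (excluded_middle_informative (exists s, inb z s)) as [h|h]; [|exfalso; eauto].
  destruct (constructive_indefinite_description _ h) as [s' hs']; simpl; now apply agree. }
assert (hop : forall s u v, I s -> box s (fst (L s)) (fst (L s)) u v ->
  locally_2d (fun x y => inb (x, y) s) u v).
{ intros s u v hs h; generalize (box_locally _ _ _ _ _ h); apply locally_2d_imp.
  intros x y hxy; now split. }
exists (fun z => exists s, inb z s), F; split; [split|split].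
- intros [u v] [s [hs h]]; apply locally_2d_C; simpl in h.
  generalize (hop s u v hs h); apply locally_2d_imp; intros x y k; now exists s.
- intros s hs; exists s; split; [exact hs|]; destruct (hL s hs) as [hd _].
  simpl; apply box_intro; lra.
- intros u v [s [hs h]] n; simpl in h.
  apply holn_ext_loc with (snd (L s)).
  + generalize (hop s u v hs h); apply locally_2d_imp; intros x y k; symmetry; now apply hF.
  + destruct (hL s hs) as (_ & hh & _); now apply hh.
- intros s hs; destruct (hL s hs) as (hd & _ & hr).
  rewrite (hF _ s); [apply hr; rewrite Rminus_eq_0, Rabs_R0; exact hd|].
  split; [exact hs|]; simpl; apply box_intro; lra.
Qed.

(** * Picard iteration on the whole interval *)

Lemma geometric_Cauchy (u : nat -> R) (M : R) :
  (forall n, Rabs (u (S n) - u n) <= M * (/ 2) ^ n) ->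
  forall n j, Rabs (u (n + j)%nat - u n) <= 2 * M * (/ 2) ^ n.
Proof.
intros h n j.
assert (hM : 0 <= M) by (specialize (h O); simpl in h; assert (h' := Rabs_pos (u 1%nat - u O)); lra).
assert (k : Rabs (u (n + j)%nat - u n) <= 2 * M * ((/ 2) ^ n - (/ 2) ^ (n + j))).
{ induction j as [|j IH].
  - rewrite Nat.add_0_r, !Rminus_eq_0, Rabs_R0; lra.
  - rewrite Nat.add_succ_r; specialize (h (n + j)%nat).
    replace (u (S (n + j)) - u n) with ((u (S (n + j)) - u (n + j)%nat) + (u (n + j)%nat - u n)) by ring.
    eapply Rle_trans; [apply Rabs_triang|]; simpl; lra. }
assert (hp := pow_half_pos (n + j)); nra.
Qed.

Lemma geometric_CVU (f : nat -> R -> R) (D : R -> Prop) (M : R) :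
  (forall n s, D s -> Rabs (f (S n) s - f n s) <= M * (/ 2) ^ n) -> CVU_dom f D.
Proof.
intros h; apply CVU_dom_cauchy; intros eps.
destruct (small_half_pow (4 * M) eps (cond_pos eps)) as [N hN].
exists N.
assert (key : forall n x, D x -> (N <= n)%nat -> Rabs (f n x - f N x) <= 2 * M * (/ 2) ^ N).
{ intros n x hx hn; replace n with (N + (n - N))%nat by lia.
  apply (geometric_Cauchy (fun n => f n x)); intros k; now apply h. }
intros n m x hx hn hm.
assert (k1 := key n x hx hn); assert (k2 := key m x hx hm).
apply Rabs_le_between in k1; apply Rabs_le_between in k2; apply Rabs_def1; lra.
Qed.

Lemma geometric_is_lim_seq (u : nat -> R) (M : R) :
  (forall n, Rabs (u (S n) - u n) <= M * (/ 2) ^ n) -> is_lim_seq u (real (Lim_seq u)).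
Proof.
intros h; apply Lim_seq_correct', ex_lim_seq_cauchy_corr; intros eps.
destruct (small_half_pow (4 * M) eps (cond_pos eps)) as [N hN].
exists N.
assert (key : forall n, (N <= n)%nat -> Rabs (u n - u N) <= 2 * M * (/ 2) ^ N).
{ intros n hn; replace n with (N + (n - N))%nat by lia; now apply geometric_Cauchy. }
intros n m hn hm.
assert (k1 := key n hn); assert (k2 := key m hm).
apply Rabs_le_between in k1; apply Rabs_le_between in k2; apply Rabs_def1; lra.
Qed.

(** Functions and derivatives both converge uniformly on ]a, b[, at the rate 2^-n, so limit and
    derivative may be exchanged. *)
Lemma geometric_limit_derive (f g : nat -> R -> R) (a b M : R) :
  (forall n s, a < s < b -> is_derive (f n) s (g n s)) ->
  (forall n s, a < s < b -> continuous (g n) s) ->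
  (forall n s, a < s < b -> Rabs (f (S n) s - f n s) <= M * (/ 2) ^ n) ->
  (forall n s, a < s < b -> Rabs (g (S n) s - g n s) <= M * (/ 2) ^ n) ->
  forall s, a < s < b ->
    is_derive (fun x => real (Lim_seq (fun n => f n x))) s (real (Lim_seq (fun n => g n s))).
Proof.
intros hd hc hf hg s hs.
assert (hder : forall n x, a < x < b -> Derive (f n) x = g n x)
  by (intros; now apply is_derive_unique, hd).
assert (hop : forall x, a < x < b -> locally x (fun y => a < y < b)).
{ intros x hx; apply (locally_interval _ x a b); simpl; try lra; intros; lra. }
rewrite (Lim_seq_ext (fun n => g n s) (fun n => Derive (f n) s)) by (intros n; symmetry; auto).
apply (CVU_Derive f (fun x => a < x < b)); auto.
- intros x y z; lra.
- now apply geometric_CVU with M.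
- intros n x hx; eexists; now apply hd.
- intros n x hx; apply continuity_pt_filterlim.
  apply (continuous_ext_loc (Derive (f n)) (g n) x); [|now apply hc].
  generalize (hop x hx); apply filter_imp; intros y hy; symmetry; auto.
- apply geometric_CVU with M; intros n x hx; rewrite !hder by assumption; auto.
Qed.

(** Bielecki's weight: integration divides a bound relative to exp(L |s - s0|) by L. With L twice
    the Lipschitz constant, a Picard step halves the weighted distance on every compact interval,
    however long, and no continuation argument is required. *)
Lemma exponential_bound (D D1 : R -> R) (a b s0 A L : R) :
  0 < L -> 0 <= A ->
  (forall s, a <= s <= b -> is_derive D s (D1 s)) ->
  (forall s, a <= s <= b -> Rabs (D1 s) <= A * exp (L * Rabs (s - s0))) ->
  a <= s0 <= b -> D s0 = 0 ->
  forall s, a <= s <= b -> Rabs (D s) <= A / L * exp (L * Rabs (s - s0)).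
Proof.
intros hL hA.
assert (right : forall (D D1 : R -> R) s0 b,
  (forall s, s0 <= s <= b -> is_derive D s (D1 s)) ->
  (forall s, s0 <= s <= b -> Rabs (D1 s) <= A * exp (L * (s - s0))) ->
  D s0 = 0 -> forall s, s0 <= s <= b -> D s <= A / L * exp (L * (s - s0))).
{ intros E E1 c d hd hb h0 s hs.
  assert (hm := nonincreasing_of_derive (fun u => E u - A / L * exp (L * (u - c)))
    (fun u => E1 u - A * exp (L * (u - c))) c s ltac:(lra)).
  assert (hle : E s - A / L * exp (L * (s - c)) <= E c - A / L * exp (L * (c - c))).
  { apply hm.
    - intros x hx; assert (hx' := hd x ltac:(lra)).
      auto_derive; [repeat split; eexists; exact hx'|].
      rewrite_derive hx'; unfold Rminus; field; lra.
    - intros x hx; specialize (hb x ltac:(lra)); apply Rabs_le_between in hb; lra. }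
  rewrite h0, Rminus_eq_0, Rmult_0_r, exp_0 in hle.
  assert (0 <= A / L) by (apply Rmult_le_pos; [lra|apply Rlt_le, Rinv_0_lt_compat, hL]); lra. }
intros hd hb hs0 h0 s hs; apply Rabs_le_between.
destruct (Rle_dec s0 s) as [h|h].
- rewrite Rabs_pos_eq by lra.
  assert (hb' : forall x, s0 <= x <= b -> Rabs (D1 x) <= A * exp (L * (x - s0))).
  { intros x hx; specialize (hb x ltac:(lra)); rewrite (Rabs_pos_eq (x - s0)) in hb by lra; exact hb. }
  split.
  + assert (- D s <= A / L * exp (L * (s - s0))); [|lra].
    apply (right (fun u => - D u) (fun u => - D1 u) s0 b); auto; try lra.
    * intros x hx; apply (is_derive_opp D), hd; lra.
    * intros x hx; rewrite Rabs_Ropp; auto.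
  + apply (right D D1 s0 b); auto; try lra.
    intros x hx; apply hd; lra.
- rewrite Rabs_left by lra; replace (- (s - s0)) with ((- s) - (- s0)) by ring.
  assert (hb' : forall x, - s0 <= x <= - a -> Rabs (D1 (- x)) <= A * exp (L * (x - - s0))).
  { intros x hx; specialize (hb (- x) ltac:(lra)).
    rewrite (Rabs_left1 (- x - s0)) in hb by lra; replace (- (- x - s0)) with (x - - s0) in hb by ring.
    exact hb. }
  assert (hd' : forall x, - s0 <= x <= - a -> is_derive (fun u => D (- u)) x (- D1 (- x))).
  { intros x hx; assert (hx' := hd (- x) ltac:(lra)).
    auto_derive; [eexists; exact hx'|]; rewrite_derive hx'; ring. }
  split.
  + assert (- D (- - s) <= A / L * exp (L * (- s - - s0))); [|rewrite Ropp_involutive in H; lra].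
    apply (right (fun u => - D (- u)) (fun u => - - D1 (- u)) (- s0) (- a)); try lra.
    * intros x hx; apply (is_derive_opp (fun u => D (- u))), hd'; lra.
    * intros x hx; rewrite Ropp_involutive; auto.
    * rewrite Ropp_involutive; lra.
  + assert (D (- - s) <= A / L * exp (L * (- s - - s0))); [|rewrite Ropp_involutive in H; lra].
    apply (right (fun u => D (- u)) (fun u => - D1 (- u)) (- s0) (- a)); try lra; auto.
    * intros x hx; rewrite Rabs_Ropp; auto.
    * rewrite Ropp_involutive; lra.
Qed.

Lemma Rbar_interval_between lo hi a b s :
  Rbar_interval lo hi a -> Rbar_interval lo hi b -> a <= s <= b -> Rbar_interval lo hi s.
Proof.
intros [h1 h2] [h3 h4] hs; split.
- apply Rbar_lt_le_trans with a; [exact h1|simpl; lra].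
- apply Rbar_le_lt_trans with b; [simpl; lra|exact h4].
Qed.

Lemma Rbar_interval_room lo hi s : Rbar_interval lo hi s ->
  exists e, 0 < e /\ Rbar_interval lo hi (s - e) /\ Rbar_interval lo hi (s + e).
Proof.
intros h.
assert (hl : locally s (Rbar_interval lo hi)).
{ destruct h as [h1 h2]; apply (filter_and (F := locally s)); [exact (open_Rbar_gt lo s h1)|exact (open_Rbar_lt hi s h2)]. }
destruct hl as [d hd]; exists (d / 2); assert (hp := cond_pos d).
split; [lra|split; apply hd].
- change (Rabs (s - d / 2 - s) < d); rewrite Rabs_left; lra.
- change (Rabs (s + d / 2 - s) < d); rewrite Rabs_pos_eq; lra.
Qed.

Lemma Rbar_interval_locally lo hi s : Rbar_interval lo hi s ->
  locally s (Rbar_interval lo hi).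
Proof.
intros h; destruct (Rbar_interval_room lo hi s h) as (e & he & h1 & h2).
exists (mkposreal _ he); intros y hy; change (Rabs (y - s) < e) in hy; apply Rabs_def2 in hy.
apply Rbar_interval_between with (s - e) (s + e); auto; lra.
Qed.

Lemma Rbar_interval_hull lo hi s s' : Rbar_interval lo hi s -> Rbar_interval lo hi s' ->
  exists a b, Rbar_interval lo hi a /\ Rbar_interval lo hi b /\ a < s < b /\ a < s' < b.
Proof.
intros h h'.
destruct (Rbar_interval_room lo hi s h) as (e & he & h1 & h2).
destruct (Rbar_interval_room lo hi s' h') as (e' & he' & h1' & h2').
exists (if Rle_dec (s - e) (s' - e') then s - e else s' - e'),
       (if Rle_dec (s + e) (s' + e') then s' + e' else s + e).
destruct (Rle_dec (s - e) (s' - e')), (Rle_dec (s + e) (s' + e')); (split; [assumption|split; [assumption|lra]]).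
Qed.

Lemma RInt_derive_interval (f : R -> R) lo hi s0 s :
  Rbar_interval lo hi s0 -> Rbar_interval lo hi s ->
  (forall x, Rbar_interval lo hi x -> continuous f x) ->
  is_derive (fun x => RInt f s0 x) s (f s).
Proof.
intros h0 h hf; destruct (Rbar_interval_hull lo hi s0 s h0 h) as (a & b & ha & hb & h1 & h2).
apply (RInt_derive_open f a b); auto.
intros x hx; apply hf, Rbar_interval_between with a b; auto; lra.
Qed.

Lemma exp_monotone x y : x <= y -> exp x <= exp y.
Proof. intros [h| ->]; [now apply Rlt_le, exp_increasing|apply Rle_refl]. Qed.

(** The iterates live on all of I and their limits are taken pointwise. The compact interval [a, b]
    around [s0] and the point at hand only enters the estimates, so the solution does not depend on
    it. *)
Theorem linear_system_exists p q r lo hi s0 x0 v0 n0 :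
  Rbar_interval lo hi s0 ->
  (forall s, Rbar_interval lo hi s -> continuous p s) ->
  (forall s, Rbar_interval lo hi s -> continuous q s) ->
  (forall s, Rbar_interval lo hi s -> continuous r s) ->
  exists x v n, x s0 = x0 /\ v s0 = v0 /\ n s0 = n0 /\
    forall s, Rbar_interval lo hi s -> solves p q r x v n s.
Proof.
intros h0 cp cq cr.
set (Y := fix Y k := match k with
  | O => (fun _ => x0, fun _ => v0, fun _ => n0)
  | S k => (fun s => x0 + RInt (snd (fst (Y k))) s0 s,
            fun s => v0 + RInt (fun u => p u * snd (fst (Y k)) u - q u * snd (Y k) u
                                 - r u * fst (fst (Y k)) u) s0 s,
            fun s => n0 + RInt (fun u => p u * snd (Y k) u + q u * snd (fst (Y k)) u) s0 s)
  end : (R -> R) * (R -> R) * (R -> R)).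
set (X := fun k => fst (fst (Y k))); set (V := fun k => snd (fst (Y k))); set (N := fun k => snd (Y k)).
assert (cm : forall (f g : R -> R) s, continuous f s -> continuous g s -> continuous (fun u => f u * g u) s).
{ intros f g s hf hg; apply (continuous_mult f g); assumption. }
assert (prim : forall (f : R -> R) c s, (forall u, Rbar_interval lo hi u -> continuous f u) ->
  Rbar_interval lo hi s -> is_derive (fun u => c + RInt f s0 u) s (f s)).
{ intros f c s hf hs; evar_last.
  - apply (is_derive_plus (fun _ => c) (fun u => RInt f s0 u)); [apply is_derive_const|].
    now apply RInt_derive_interval with lo hi.
  - unfold plus, zero; simpl; ring. }
assert (contdV : forall f g h : R -> R, forall s, Rbar_interval lo hi s ->
  continuous f s -> continuous g s -> continuous h s ->
  continuous (fun u => p u * f u - q u * g u - r u * h u) s).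
{ intros f g h s hs hf hg hh.
  apply (continuous_minus (fun u => p u * f u - q u * g u)); [apply (continuous_minus (fun u => p u * f u))|];
    apply cm; auto. }
assert (contdN : forall f g : R -> R, forall s, Rbar_interval lo hi s ->
  continuous f s -> continuous g s -> continuous (fun u => p u * f u + q u * g u) s).
{ intros f g s hs hf hg; apply (continuous_plus (fun u => p u * f u)); apply cm; auto. }
assert (hc : forall k s, Rbar_interval lo hi s ->
  continuous (X k) s /\ continuous (V k) s /\ continuous (N k) s).
{ intros k; induction k as [|k IH]; intros s hs.
  - repeat split; apply continuous_const.
  - split; [|split]; apply (ex_derive_continuous (V := R_NormedModule)); eexists.
    + apply prim; [intros u hu; exact (proj1 (proj2 (IH u hu)))|exact hs].
    + apply prim; [|exact hs]; intros u hu; destruct (IH u hu) as (i1 & i2 & i3).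
      now apply contdV.
    + apply prim; [|exact hs]; intros u hu; destruct (IH u hu) as (i1 & i2 & i3).
      now apply contdN. }
assert (hd : forall k s, Rbar_interval lo hi s ->
  is_derive (X (S k)) s (V k s) /\
  is_derive (V (S k)) s (p s * V k s - q s * N k s - r s * X k s) /\
  is_derive (N (S k)) s (p s * N k s + q s * V k s)).
{ intros k s hs; split; [|split].
  - apply (prim (V k)); [intros u hu; exact (proj1 (proj2 (hc k u hu)))|exact hs].
  - apply (prim (fun u => p u * V k u - q u * N k u - r u * X k u)); [|exact hs].
    intros u hu; destruct (hc k u hu) as (i1 & i2 & i3); now apply contdV.
  - apply (prim (fun u => p u * N k u + q u * V k u)); [|exact hs].
    intros u hu; destruct (hc k u hu) as (i1 & i2 & i3); now apply contdN. }
assert (hv : forall k, X k s0 = x0 /\ V k s0 = v0 /\ N k s0 = n0).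
{ intros [|k]; [easy|]; unfold X, V, N; cbn [Y fst snd].
  rewrite !RInt_point; unfold zero; simpl; repeat split; ring. }
exists (fun s => real (Lim_seq (fun k => X k s))), (fun s => real (Lim_seq (fun k => V k s))),
  (fun s => real (Lim_seq (fun k => N k s))).
split; [rewrite (Lim_seq_ext _ (fun _ => x0)), Lim_seq_const by apply hv; reflexivity|].
split; [rewrite (Lim_seq_ext _ (fun _ => v0)), Lim_seq_const by apply hv; reflexivity|].
split; [rewrite (Lim_seq_ext _ (fun _ => n0)), Lim_seq_const by apply hv; reflexivity|].
intros s hs.
destruct (Rbar_interval_hull lo hi s0 s h0 hs) as (a & b & ha & hb & hs0ab & hsab).
assert (hin : forall u, a <= u <= b -> Rbar_interval lo hi u)
  by (intros u hu; now apply Rbar_interval_between with a b).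
destruct (continuous_bounded p a b) as (Bp & hBp & bp); [auto|].
destruct (continuous_bounded q a b) as (Bq & hBq & bq); [auto|].
destruct (continuous_bounded r a b) as (Br & hBr & br); [auto|].
assert (cdiff : forall f g : R -> R, (forall u, a <= u <= b -> continuous f u) ->
  (forall u, a <= u <= b -> continuous g u) ->
  exists B, 0 <= B /\ forall u, a <= u <= b -> Rabs (f u - g u) <= B).
{ intros f g hf hg; apply continuous_bounded; intros u hu; apply (continuous_minus f g); auto. }
destruct (cdiff (X 1%nat) (X O) (fun u hu => proj1 (hc 1%nat u (hin u hu))) (fun u hu => proj1 (hc O u (hin u hu)))) as (C1 & hC1 & c1).
destruct (cdiff (V 1%nat) (V O) (fun u hu => proj1 (proj2 (hc 1%nat u (hin u hu)))) (fun u hu => proj1 (proj2 (hc O u (hin u hu))))) as (C2 & hC2 & c2).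
destruct (cdiff (N 1%nat) (N O) (fun u hu => proj2 (proj2 (hc 1%nat u (hin u hu)))) (fun u hu => proj2 (proj2 (hc O u (hin u hu))))) as (C3 & hC3 & c3).
(* C bounds the first increment, K is a Lipschitz constant of the right-hand side for the maximum
   norm, and L = 2 K makes the weighted increments halve at each step. *)
set (C := C1 + C2 + C3); set (K := 1 + Bp + Bq + Br); set (L := 2 * K).
assert (hC : 0 <= C) by (unfold C; lra); assert (hK : 1 <= K) by (unfold K; lra).
assert (hL : 0 < L) by (unfold L; lra).
set (w := fun k u => C * (/ 2) ^ k * exp (L * Rabs (u - s0))).
assert (hw0 : forall k u, 0 <= w k u).
{ intros k u; apply Rmult_le_pos; [|apply Rlt_le, exp_pos].
  apply Rmult_le_pos; [exact hC|apply Rlt_le, pow_half_pos]. }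
assert (lipV : forall u x y z W, a <= u <= b -> 0 <= W -> Rabs x <= W -> Rabs y <= W -> Rabs z <= W ->
  Rabs (p u * y - q u * z - r u * x) <= K * W /\ Rabs (p u * z + q u * y) <= K * W /\ Rabs y <= K * W).
{ intros u x y z W hu hW hx hy hz.
  assert (t : forall e B c, Rabs e <= B -> Rabs c <= W -> Rabs (e * c) <= B * W).
  { intros e B c he hc'; rewrite Rabs_mult; apply Rmult_le_compat; auto using Rabs_pos. }
  assert (t1 := t _ _ _ (bp u hu) hy); assert (t2 := t _ _ _ (bq u hu) hz).
  assert (t3 := t _ _ _ (br u hu) hx); assert (t4 := t _ _ _ (bp u hu) hz).
  assert (t5 := t _ _ _ (bq u hu) hy).
  apply Rabs_le_between in t1; apply Rabs_le_between in t2; apply Rabs_le_between in t3.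
  apply Rabs_le_between in t4; apply Rabs_le_between in t5; apply Rabs_le_between in hy.
  assert (eK : K * W = W + Bp * W + Bq * W + Br * W) by (unfold K; ring).
  assert (0 <= Bp * W) by now apply Rmult_le_pos.
  assert (0 <= Bq * W) by now apply Rmult_le_pos.
  assert (0 <= Br * W) by now apply Rmult_le_pos.
  repeat split; apply Rabs_le_between; lra. }
assert (key : forall k u, a <= u <= b -> Rabs (X (S k) u - X k u) <= w k u /\
  Rabs (V (S k) u - V k u) <= w k u /\ Rabs (N (S k) u - N k u) <= w k u).
{ intros k; induction k as [|k IH]; intros u hu.
  - assert (he : 1 <= exp (L * Rabs (u - s0))).
    { rewrite <- exp_0; apply exp_monotone; apply Rmult_le_pos; [lra|apply Rabs_pos]. }
    assert (hwC : C <= w O u) by (unfold w; simpl; nra).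
    specialize (c1 u hu); specialize (c2 u hu); specialize (c3 u hu); unfold C in hwC; lra.
  - assert (e : forall y, w (S k) y = K * (C * (/ 2) ^ k) / L * exp (L * Rabs (y - s0))).
    { intros y; unfold w, L; simpl; field; lra. }
    assert (hA : 0 <= K * (C * (/ 2) ^ k)).
    { apply Rmult_le_pos; [lra|]; apply Rmult_le_pos; [exact hC|apply Rlt_le, pow_half_pos]. }
    assert (hKw : forall y, K * w k y = K * (C * (/ 2) ^ k) * exp (L * Rabs (y - s0)))
      by (intros y; unfold w; ring).
    rewrite e.
    destruct (hv (S (S k))) as (e1 & e2 & e3); destruct (hv (S k)) as (e4 & e5 & e6).
    split; [|split].
    + apply (exponential_bound (fun y => X (S (S k)) y - X (S k) y) (fun y => V (S k) y - V k y) a b);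
        auto; try lra.
      * intros y hy; apply (is_derive_minus (X (S (S k))) (X (S k))); apply hd; auto.
      * intros y hy; rewrite <- hKw; destruct (IH y hy) as (i1 & i2 & i3).
        now apply (lipV y _ _ _ (w k y) hy (hw0 k y) i1 i2 i3).
    + apply (exponential_bound (fun y => V (S (S k)) y - V (S k) y)
        (fun y => (p y * V (S k) y - q y * N (S k) y - r y * X (S k) y)
                  - (p y * V k y - q y * N k y - r y * X k y)) a b); auto; try lra.
      * intros y hy; apply (is_derive_minus (V (S (S k))) (V (S k))); apply hd; auto.
      * intros y hy; rewrite <- hKw; destruct (IH y hy) as (i1 & i2 & i3).
        match goal with |- Rabs ?z <= _ => replace z with (p y * (V (S k) y - V k y)
          - q y * (N (S k) y - N k y) - r y * (X (S k) y - X k y)) by ring end.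
        now apply lipV.
    + apply (exponential_bound (fun y => N (S (S k)) y - N (S k) y)
        (fun y => (p y * N (S k) y + q y * V (S k) y) - (p y * N k y + q y * V k y)) a b); auto; try lra.
      * intros y hy; apply (is_derive_minus (N (S (S k))) (N (S k))); apply hd; auto.
      * intros y hy; rewrite <- hKw; destruct (IH y hy) as (i1 & i2 & i3).
        match goal with |- Rabs ?z <= _ => replace z with (p y * (N (S k) y - N k y)
          + q y * (V (S k) y - V k y)) by ring end.
        now apply (lipV y _ _ _ (w k y) hy (hw0 k y) i1 i2 i3). }
(* A common bound for the increments of the iterates and of their derivatives, as K >= 1. *)
set (M := K * (C * exp (L * (b - a)))).
assert (hE := exp_pos (L * (b - a))).
assert (hwM : forall k u, a <= u <= b -> w k u <= C * exp (L * (b - a)) * (/ 2) ^ k).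
{ intros k u hu; unfold w.
  replace (C * exp (L * (b - a)) * (/ 2) ^ k) with (C * (/ 2) ^ k * exp (L * (b - a))) by ring.
  apply Rmult_le_compat_l.
  - apply Rmult_le_pos; [exact hC|apply Rlt_le, pow_half_pos].
  - apply exp_monotone, Rmult_le_compat_l; [lra|]; apply Rabs_le_between; lra. }
assert (hCE : 0 <= C * exp (L * (b - a))) by (apply Rmult_le_pos; lra).
assert (step : forall k z, Rabs z <= C * exp (L * (b - a)) * (/ 2) ^ k -> Rabs z <= M * (/ 2) ^ k).
{ intros k z hz; eapply Rle_trans; [exact hz|]; apply Rmult_le_compat_r; [apply Rlt_le, pow_half_pos|].
  unfold M; nra. }
assert (half : forall k, (/ 2) ^ S k <= (/ 2) ^ k).
{ intros k; simpl; assert (h := pow_half_pos k); lra. }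
assert (dX : forall k u, a < u < b -> Rabs (X (S k) u - X k u) <= C * exp (L * (b - a)) * (/ 2) ^ k).
{ intros k u hu; eapply Rle_trans; [apply key; lra|apply hwM; lra]. }
assert (dV : forall k u, a < u < b -> Rabs (V (S k) u - V k u) <= C * exp (L * (b - a)) * (/ 2) ^ k).
{ intros k u hu; eapply Rle_trans; [apply key; lra|apply hwM; lra]. }
assert (dN : forall k u, a < u < b -> Rabs (N (S k) u - N k u) <= C * exp (L * (b - a)) * (/ 2) ^ k).
{ intros k u hu; eapply Rle_trans; [apply key; lra|apply hwM; lra]. }
assert (shift : forall (Z : nat -> R -> R), (forall k u, a < u < b ->
    Rabs (Z (S k) u - Z k u) <= C * exp (L * (b - a)) * (/ 2) ^ k) ->
  forall k u, a < u < b -> Rabs (Z (S (S k)) u - Z (S k) u) <= M * (/ 2) ^ k).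
{ intros Z hZ k u hu; apply step; eapply Rle_trans; [now apply hZ|].
  apply Rmult_le_compat_l; auto. }
assert (lX := geometric_is_lim_seq (fun k => X k s) _ (fun k => dX k s hsab)).
assert (lV := geometric_is_lim_seq (fun k => V k s) _ (fun k => dV k s hsab)).
assert (lN := geometric_is_lim_seq (fun k => N k s) _ (fun k => dN k s hsab)).
simpl in lX, lV, lN.
assert (hW0 : forall k, 0 <= C * exp (L * (b - a)) * (/ 2) ^ k).
{ intros k; apply Rmult_le_pos; [exact hCE|apply Rlt_le, pow_half_pos]. }
assert (eM : forall k, K * (C * exp (L * (b - a)) * (/ 2) ^ k) = M * (/ 2) ^ k)
  by (intros k; unfold M; ring).
(* The derivative of iterate k + 1 is expressed by iterate k; the shift by one leaves the limit
   unchanged. *)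
assert (fin : forall (Z G : nat -> R -> R) l,
  (forall k u, a < u < b -> is_derive (Z (S k)) u (G k u)) ->
  (forall k u, a < u < b -> continuous (G k) u) ->
  (forall k u, a < u < b -> Rabs (Z (S k) u - Z k u) <= C * exp (L * (b - a)) * (/ 2) ^ k) ->
  (forall k u, a < u < b -> Rabs (G (S k) u - G k u) <= M * (/ 2) ^ k) ->
  is_lim_seq (fun k => G k s) (Finite l) ->
  is_derive (fun u => real (Lim_seq (fun k => Z k u))) s l).
{ intros Z G l hZ hG h1 h2 hl.
  apply is_lim_seq_unique in hl.
  replace l with (real (Lim_seq (fun k => G k s))) by (rewrite hl; reflexivity).
  apply (is_derive_ext (fun u => real (Lim_seq (fun k => Z (S k) u)))).
  - intros u; now rewrite (Lim_seq_incr_1 (fun k => Z k u)).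
  - apply (geometric_limit_derive (fun k => Z (S k)) G a b M); auto. }
split; [|split].
- apply (fin X V); auto.
  + intros k u hu; apply hd, hin; lra.
  + intros k u hu; apply hc, hin; lra.
- apply (fin V (fun k u => p u * V k u - q u * N k u - r u * X k u)); auto.
  + intros k u hu; apply hd, hin; lra.
  + intros k u hu; destruct (hc k u) as (i1 & i2 & i3); [apply hin; lra|].
    apply contdV; auto; apply hin; lra.
  + intros k u hu; rewrite <- eM.
    match goal with |- Rabs ?z <= _ => replace z with (p u * (V (S k) u - V k u)
      - q u * (N (S k) u - N k u) - r u * (X (S k) u - X k u)) by ring end.
    apply lipV; auto; lra.
  + apply is_lim_seq_minus'; [apply is_lim_seq_minus'|];
      apply (is_lim_seq_scal_l _ _ (Finite _)); assumption.
- apply (fin N (fun k u => p u * N k u + q u * V k u)); auto.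
  + intros k u hu; apply hd, hin; lra.
  + intros k u hu; destruct (hc k u) as (i1 & i2 & i3); [apply hin; lra|].
    apply contdN; auto; apply hin; lra.
  + intros k u hu; rewrite <- eM.
    match goal with |- Rabs ?z <= _ => replace z with (p u * (N (S k) u - N k u)
      + q u * (V (S k) u - V k u)) by ring end.
    apply (lipV u _ _ _ _ ltac:(lra) (hW0 k) (dX k u hu) (dV k u hu) (dN k u hu)).
  + apply is_lim_seq_plus'; apply (is_lim_seq_scal_l _ _ (Finite _)); assumption.
Qed.

(** * Frames along curves *)

(* The three cases of [normal] are [mu * p + mu0 * e_0]. *)
Definition mu (c : R) : R :=
  if Rlt_dec 0 c then - sqrt c else if Rlt_dec c 0 then sqrt (- c) else 0.
Definition mu0 (c : R) : R :=
  if Rlt_dec 0 c then 0 else if Rlt_dec c 0 then 0 else 1.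

Lemma normal_comp c p :
  x0 (normal c p) = mu c * x0 p + mu0 c /\
  x1 (normal c p) = mu c * x1 p /\ x2 (normal c p) = mu c * x2 p.
Proof.
destruct p as [[p0 p1] p2]; unfold normal, mu, mu0.
destruct (Rlt_dec 0 c); [|destruct (Rlt_dec c 0)];
  unfold x0, x1, x2, scal; simpl; unfold scal, mult; simpl; unfold mult; simpl;
  repeat split; ring.
Qed.

Lemma sig_sq c : sig c * sig c = 1.
Proof. unfold sig; destruct (Rlt_dec c 0); ring. Qed.

(** Relations valid for every sign of c; through them most later computations treat the sphere, the
    plane and the hyperboloid at once. *)
Lemma mu_facts c :
  sig c * (mu c * mu c) = c /\ mu c * mu0 c = 0 /\ c * mu0 c = 0 /\
  sig c * mu0 c = mu0 c /\ mu0 c * mu0 c = mu0 c.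
Proof.
unfold sig, mu, mu0; destruct (Rlt_dec 0 c) as [h|h].
- destruct (Rlt_dec c 0); [lra|].
  assert (sqrt c * sqrt c = c) by (apply sqrt_sqrt; lra); repeat split; nra.
- destruct (Rlt_dec c 0) as [h'|h'].
  + assert (sqrt (- c) * sqrt (- c) = - c) by (apply sqrt_sqrt; lra); repeat split; nra.
  + repeat split; nra.
Qed.

Lemma mu_nonzero c : c <> 0 -> mu c <> 0 /\ mu0 c = 0.
Proof.
intros h; destruct (mu_facts c) as (h1 & h2 & h3 & _); split.
- intros e; rewrite e in h1; lra.
- apply (Rmult_eq_reg_l c); lra.
Qed.

Lemma mu_zero : mu 0 = 0 /\ mu0 0 = 1.
Proof. unfold mu, mu0; destruct (Rlt_dec 0 0); [lra|easy]. Qed.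

(** Cramer's rule, with the cofactors written out. *)
Lemma det3_zero (a0 a1 a2 b0 b1 b2 c0 c1 c2 d0 d1 d2 : R) :
  a0 * (b1 * c2 - b2 * c1) - a1 * (b0 * c2 - b2 * c0) + a2 * (b0 * c1 - b1 * c0) <> 0 ->
  a0 * d0 + a1 * d1 + a2 * d2 = 0 ->
  b0 * d0 + b1 * d1 + b2 * d2 = 0 ->
  c0 * d0 + c1 * d1 + c2 * d2 = 0 -> d0 = 0 /\ d1 = 0 /\ d2 = 0.
Proof.
set (D := a0 * (b1 * c2 - b2 * c1) - a1 * (b0 * c2 - b2 * c0) + a2 * (b0 * c1 - b1 * c0)).
intros hD h1 h2 h3.
assert (e0 : D * d0 = (b1 * c2 - b2 * c1) * (a0 * d0 + a1 * d1 + a2 * d2)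
  - (a1 * c2 - a2 * c1) * (b0 * d0 + b1 * d1 + b2 * d2)
  + (a1 * b2 - a2 * b1) * (c0 * d0 + c1 * d1 + c2 * d2)) by (unfold D; ring).
assert (e1 : D * d1 = - (b0 * c2 - b2 * c0) * (a0 * d0 + a1 * d1 + a2 * d2)
  + (a0 * c2 - a2 * c0) * (b0 * d0 + b1 * d1 + b2 * d2)
  - (a0 * b2 - a2 * b0) * (c0 * d0 + c1 * d1 + c2 * d2)) by (unfold D; ring).
assert (e2 : D * d2 = (b0 * c1 - b1 * c0) * (a0 * d0 + a1 * d1 + a2 * d2)
  - (a0 * c1 - a1 * c0) * (b0 * d0 + b1 * d1 + b2 * d2)
  + (a0 * b1 - a1 * b0) * (c0 * d0 + c1 * d1 + c2 * d2)) by (unfold D; ring).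
rewrite h1, h2, h3 in e0, e1, e2.
repeat split; apply (Rmult_eq_reg_l D); auto; lra.
Qed.

(* With [e = sig c], [dot e] is the ambient form and [rot e (normal c p)] is
   [J c p]. *)
Definition dot (e : R) (u w : R3) : R := e * x0 u * x0 w + x1 u * x1 w + x2 u * x2 w.
Definition rot (e : R) (n v : R3) : R3 :=
  (e * (x1 n * x2 v - x2 n * x1 v), x2 n * x0 v - x0 n * x2 v, x0 n * x1 v - x1 n * x0 v).
Definition det3 (u v w : R3) : R :=
  x0 u * (x1 v * x2 w - x2 v * x1 w) - x1 u * (x0 v * x2 w - x2 v * x0 w)
  + x2 u * (x0 v * x1 w - x1 v * x0 w).

(** [n] is the unit normal, timelike when e = -1. The tangent vectors [v] and [w] keep the common
    squared length a instead of being normalised, which avoids square roots. *)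
Record frame (e a : R) (n v w : R3) : Prop := {
  frame_sq : e * e = 1;
  frame_nn : dot e n n = e;
  frame_nv : dot e n v = 0;
  frame_vv : dot e v v = a;
  frame_w : w = rot e n v }.

Lemma form_dot c u v : form c u v = dot (sig c) u v.
Proof. reflexivity. Qed.

Lemma J_rot c p v : J c p v = rot (sig c) (normal c p) v.
Proof. reflexivity. Qed.

Lemma sq_one_cases e : e * e = 1 -> e = 1 \/ e = -1.
Proof.
intros h; assert (h' : (e - 1) * (e + 1) = 0) by lra.
destruct (Rmult_integral _ _ h'); [left|right]; lra.
Qed.

(** Lagrange's identity <w, w> = e (<n, n> <v, v> - <n, v>^2) for the cross product of the form, and
    the double cross product formula. *)
Lemma frame_more e a n v w : frame e a n v w ->
  dot e n w = 0 /\ dot e v w = 0 /\ dot e w w = a /\ det3 n v w = a /\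
  rot e n w = (- x0 v, - x1 v, - x2 v).
Proof.
intros [he hnn hnv hvv ->].
destruct n as [[n0 n1] n2], v as [[v0 v1] v2]; unfold dot, rot, det3, x0, x1, x2 in *; simpl in *.
assert (L : e * (e * (n1 * v2 - n2 * v1)) * (e * (n1 * v2 - n2 * v1)) +
  (n2 * v0 - n0 * v2) * (n2 * v0 - n0 * v2) + (n0 * v1 - n1 * v0) * (n0 * v1 - n1 * v0) = a).
{ transitivity (e * ((e * n0 * n0 + n1 * n1 + n2 * n2) * (e * v0 * v0 + v1 * v1 + v2 * v2)
    - (e * n0 * v0 + n1 * v1 + n2 * v2) * (e * n0 * v0 + n1 * v1 + n2 * v2))).
  - destruct (sq_one_cases e he) as [-> | ->]; ring.
  - rewrite hnn, hnv, hvv; transitivity (e * e * a); [ring|rewrite he; ring]. }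
repeat split.
- transitivity (e * e * (n0 * (n1 * v2 - n2 * v1)) + n1 * (n2 * v0 - n0 * v2) + n2 * (n0 * v1 - n1 * v0)); [ring|rewrite he; ring].
- transitivity (e * e * (v0 * (n1 * v2 - n2 * v1)) + v1 * (n2 * v0 - n0 * v2) + v2 * (n0 * v1 - n1 * v0)); [ring|rewrite he; ring].
- exact L.
- rewrite <- L; destruct (sq_one_cases e he) as [-> | ->]; ring.
- f_equal; [f_equal|].
  + transitivity (e * (n0 * (e * n0 * v0 + n1 * v1 + n2 * v2) - v0 * (e * n0 * n0 + n1 * n1 + n2 * n2))); [ring|].
    rewrite hnv, hnn; transitivity (- (e * e) * v0); [ring|rewrite he; ring].
  + transitivity (e * (n1 * (e * n0 * v0 + n1 * v1 + n2 * v2) - v1 * (e * n0 * n0 + n1 * n1 + n2 * n2))).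
    * destruct (sq_one_cases e he) as [-> | ->]; ring.
    * rewrite hnv, hnn; transitivity (- (e * e) * v1); [ring|rewrite he; ring].
  + transitivity (e * (n2 * (e * n0 * v0 + n1 * v1 + n2 * v2) - v2 * (e * n0 * n0 + n1 * n1 + n2 * n2))).
    * destruct (sq_one_cases e he) as [-> | ->]; ring.
    * rewrite hnv, hnn; transitivity (- (e * e) * v2); [ring|rewrite he; ring].
Qed.

Lemma dot_sym e u v : dot e u v = dot e v u.
Proof. unfold dot; ring. Qed.

Lemma R3_eq (u v : R3) : x0 u = x0 v -> x1 u = x1 v -> x2 u = x2 v -> u = v.
Proof.
destruct u as [[u0 u1] u2], v as [[v0 v1] v2]; unfold x0, x1, x2; simpl; congruence.
Qed.

Lemma dot_nondegenerate e n v w d : e * e = 1 -> det3 n v w <> 0 ->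
  dot e d n = 0 -> dot e d v = 0 -> dot e d w = 0 -> x0 d = 0 /\ x1 d = 0 /\ x2 d = 0.
Proof.
intros he hD h1 h2 h3; unfold dot, det3 in *.
destruct (det3_zero (x0 n) (x1 n) (x2 n) (x0 v) (x1 v) (x2 v) (x0 w) (x1 w) (x2 w)
  (e * x0 d) (x1 d) (x2 d) hD ltac:(lra) ltac:(lra) ltac:(lra)) as (e0 & e1 & e2).
repeat split; auto.
apply (Rmult_eq_reg_l e); [lra|intros e'; rewrite e' in he; lra].
Qed.

Definition comb (k1 : R) (u : R3) (k2 : R) (v : R3) (k3 : R) (w : R3) : R3 :=
  (k1 * x0 u + k2 * x0 v + k3 * x0 w, k1 * x1 u + k2 * x1 v + k3 * x1 w,
   k1 * x2 u + k2 * x2 v + k3 * x2 w).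

Lemma dot_comb e k1 u k2 v k3 w z :
  dot e (comb k1 u k2 v k3 w) z = k1 * dot e u z + k2 * dot e v z + k3 * dot e w z.
Proof. unfold dot, comb, x0, x1, x2; simpl; ring. Qed.

(** Both sides have the same products with n, v and w, and the form is nondegenerate. The factor e
    before n comes from <n, n> = e = 1/e. *)
Lemma frame_expand e a n v w u : a <> 0 -> frame e a n v w ->
  u = comb (e * dot e u n) n (dot e u v / a) v (dot e u w / a) w.
Proof.
intros ha hf; destruct (frame_more _ _ _ _ _ hf) as (hnw & hvw & hww & hdet & _).
destruct hf as [he hnn hnv hvv _].
set (u' := comb (e * dot e u n) n (dot e u v / a) v (dot e u w / a) w).
set (d := (x0 u - x0 u', x1 u - x1 u', x2 u - x2 u') : R3).
assert (hd : forall z, dot e d z = dot e u z - dot e u' z).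
{ intros z; unfold dot, d, x0, x1, x2; simpl; ring. }
destruct (dot_nondegenerate e n v w d he) as (d0 & d1 & d2).
- now rewrite hdet.
- rewrite hd; unfold u'; rewrite dot_comb, hnn, (dot_sym e v n), (dot_sym e w n), hnv, hnw.
  transitivity (dot e u n * (1 - e * e)); [ring|rewrite he; ring].
- rewrite hd; unfold u'; rewrite dot_comb, hnv, hvv, (dot_sym e w v), hvw; field; exact ha.
- rewrite hd; unfold u'; rewrite dot_comb, hnw, hvw, hww; field; exact ha.
- change (x0 u - x0 u' = 0) in d0; change (x1 u - x1 u' = 0) in d1; change (x2 u - x2 u' = 0) in d2.
  apply R3_eq; lra.
Qed.

(** The frame equations act on each Cartesian coordinate separately, so what they preserve are
    expressions bilinear in two coordinates. Hence the dual form of orthogonality: e n n^T + (v v^T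
    + w w^T)/a is the inverse diag(e, 1, 1) of the form. The determinant adds the orientation. *)
Lemma frame_of_completeness e a n v w : e * e = 1 -> a <> 0 -> det3 n v w = a ->
  let E f g := e * f n * g n + (f v * g v + f w * g w) / a in
  E x0 x0 = e -> E x0 x1 = 0 -> E x0 x2 = 0 -> E x1 x1 = 1 -> E x1 x2 = 0 -> E x2 x2 = 1 ->
  frame e a n v w.
Proof.
intros he ha hdet E h00 h01 h02 h11 h12 h22; unfold E in *; clear E.
assert (exp : forall u, u = comb (e * dot e u n) n (dot e u v / a) v (dot e u w / a) w).
{ intros u; apply R3_eq; unfold comb at 1; unfold x0 at 2, x1 at 2, x2 at 2; simpl.
  - transitivity (e * (x0 u * (e * x0 n * x0 n + (x0 v * x0 v + x0 w * x0 w) / a))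
      + x1 u * (e * x0 n * x1 n + (x0 v * x1 v + x0 w * x1 w) / a)
      + x2 u * (e * x0 n * x2 n + (x0 v * x2 v + x0 w * x2 w) / a)).
    + rewrite h00, h01, h02; transitivity (e * e * x0 u); [rewrite he; ring|ring].
    + unfold dot; unfold x0, x1, x2; field; exact ha.
  - transitivity (e * (x0 u * (e * x0 n * x1 n + (x0 v * x1 v + x0 w * x1 w) / a))
      + x1 u * (e * x1 n * x1 n + (x1 v * x1 v + x1 w * x1 w) / a)
      + x2 u * (e * x1 n * x2 n + (x1 v * x2 v + x1 w * x2 w) / a)).
    + rewrite h01, h11, h12; ring.
    + unfold dot; unfold x0, x1, x2; field; exact ha.
  - transitivity (e * (x0 u * (e * x0 n * x2 n + (x0 v * x2 v + x0 w * x2 w) / a))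
      + x1 u * (e * x1 n * x2 n + (x1 v * x2 v + x1 w * x2 w) / a)
      + x2 u * (e * x2 n * x2 n + (x2 v * x2 v + x2 w * x2 w) / a)).
    + rewrite h02, h12, h22; ring.
    + unfold dot; unfold x0, x1, x2; field; exact ha. }
assert (indep : forall k1 k2 k3, comb k1 n k2 v k3 w = (0, 0, 0) -> k1 = 0 /\ k2 = 0 /\ k3 = 0).
{ intros k1 k2 k3 h; unfold comb in h; injection h as h1 h2 h3.
  apply (det3_zero (x0 n) (x0 v) (x0 w) (x1 n) (x1 v) (x1 w) (x2 n) (x2 v) (x2 w)); try lra.
  unfold det3 in hdet; intros h; apply ha; rewrite <- hdet; lra. }
(* Expanding n, v and w in the basis n, v, w itself and comparing coefficients yields the
   orthogonality relations. *)
assert (en := exp n); assert (ev := exp v).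
assert (n1 : e * dot e n n - 1 = 0 /\ dot e n v / a = 0 /\ dot e n w / a = 0).
{ apply indep; assert (f0 := f_equal x0 en); assert (f1 := f_equal x1 en); assert (f2 := f_equal x2 en).
  unfold comb, x0, x1, x2 in f0, f1, f2 |- *; simpl in f0, f1, f2 |- *; f_equal; [f_equal|]; lra. }
assert (n2 : e * dot e v n = 0 /\ dot e v v / a - 1 = 0 /\ dot e v w / a = 0).
{ apply indep; assert (f0 := f_equal x0 ev); assert (f1 := f_equal x1 ev); assert (f2 := f_equal x2 ev).
  unfold comb, x0, x1, x2 in f0, f1, f2 |- *; simpl in f0, f1, f2 |- *; f_equal; [f_equal|]; lra. }
assert (ew := exp w).
assert (n3 : e * dot e w n = 0 /\ dot e w v / a = 0 /\ dot e w w / a - 1 = 0).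
{ apply indep; assert (f0 := f_equal x0 ew); assert (f1 := f_equal x1 ew); assert (f2 := f_equal x2 ew).
  unfold comb, x0, x1, x2 in f0, f1, f2 |- *; simpl in f0, f1, f2 |- *; f_equal; [f_equal|]; lra. }
assert (div : forall y, y / a = 0 -> y = 0).
{ intros y hy; replace y with (y / a * a) by (field; exact ha); rewrite hy; ring. }
destruct n1 as (i1 & i2 & i3), n2 as (_ & i4 & i5), n3 as (_ & _ & i6).
apply div in i2; apply div in i3; apply div in i5.
assert (i4' : dot e v v = a) by (replace (dot e v v) with (dot e v v / a * a) by (field; exact ha); nra).
assert (i6' : dot e w w = a) by (replace (dot e w w) with (dot e w w / a * a) by (field; exact ha); nra).
split; auto.
- transitivity (e * e * dot e n n); [rewrite he; ring|].
  transitivity (e * (e * dot e n n)); [ring|]; replace (e * dot e n n) with 1 by lra; ring.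
- set (r := rot e n v).
  assert (q1 : dot e r n = 0).
  { unfold r, dot, rot, x0, x1, x2; simpl.
    transitivity ((e * e - 1) * (snd (fst n) * snd v - snd n * snd (fst v)) * fst (fst n)); [ring|rewrite he; ring]. }
  assert (q2 : dot e r v = 0).
  { unfold r, dot, rot, x0, x1, x2; simpl.
    transitivity ((e * e - 1) * (snd (fst n) * snd v - snd n * snd (fst v)) * fst (fst v)); [ring|rewrite he; ring]. }
  assert (q3 : dot e r w = a).
  { rewrite <- hdet; unfold r, dot, rot, det3, x0, x1, x2; simpl.
    match goal with |- ?x = ?y => transitivity (y + (e * e - 1) * (snd (fst n) * snd v - snd n * snd (fst v)) * fst (fst w)); [ring|rewrite he; ring] end. }
  set (d := (x0 w - x0 r, x1 w - x1 r, x2 w - x2 r) : R3).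
  assert (hd : forall z, dot e d z = dot e w z - dot e r z).
  { intros z; unfold dot, d, x0, x1, x2; simpl; ring. }
  destruct (dot_nondegenerate e n v w d he) as (d0 & d1 & d2).
  + now rewrite hdet.
  + rewrite hd, q1, dot_sym; lra.
  + rewrite hd, q2, dot_sym; lra.
  + rewrite hd, q3; lra.
  + change (x0 w - x0 r = 0) in d0; change (x1 w - x1 r = 0) in d1; change (x2 w - x2 r = 0) in d2.
    apply R3_eq; lra.
Qed.

(** * Frame equations of a curve *)

Definition vel (alpha : R -> R3) (s : R) : R3 := curve_deriv 1 alpha s.
Definition nrm (c : R) (alpha : R -> R3) (s : R) : R3 := J c (alpha s) (vel alpha s).

Definition solves3 (p q r : R -> R) (x v n : R -> R3) (s : R) : Prop :=
  solves p q r (fun u => x0 (x u)) (fun u => x0 (v u)) (fun u => x0 (n u)) s /\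
  solves p q r (fun u => x1 (x u)) (fun u => x1 (v u)) (fun u => x1 (n u)) s /\
  solves p q r (fun u => x2 (x u)) (fun u => x2 (v u)) (fun u => x2 (n u)) s.

Definition derive3 (x : R -> R3) (s : R) (l : R3) : Prop :=
  is_derive (fun u => x0 (x u)) s (x0 l) /\
  is_derive (fun u => x1 (x u)) s (x1 l) /\
  is_derive (fun u => x2 (x u)) s (x2 l).

Lemma derive_eq (f : R -> R) (s l l' : R) : is_derive f s l -> l = l' -> is_derive f s l'.
Proof. now intros h <-. Qed.

Lemma derive_mul (f g : R -> R) (s a b : R) : is_derive f s a -> is_derive g s b ->
  is_derive (fun u => f u * g u) s (a * g s + f s * b).
Proof.
intros hf hg; auto_derive; [repeat split; eexists; eassumption|].
rewrite_derive hf; rewrite_derive hg; ring.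
Qed.

Lemma derive_add (f g : R -> R) (s a b : R) : is_derive f s a -> is_derive g s b ->
  is_derive (fun u => f u + g u) s (a + b).
Proof. intros hf hg; apply (is_derive_plus f g); assumption. Qed.

Lemma derive_sub (f g : R -> R) (s a b : R) : is_derive f s a -> is_derive g s b ->
  is_derive (fun u => f u - g u) s (a - b).
Proof. intros hf hg; apply (is_derive_minus f g); assumption. Qed.

Lemma derive_cst (k s : R) : is_derive (fun _ : R => k) s 0.
Proof. apply (is_derive_const (V := R_NormedModule) k s). Qed.

Lemma derive3_dot e x y s l m : derive3 x s l -> derive3 y s m ->
  is_derive (fun u => dot e (x u) (y u)) s (dot e l (y s) + dot e (x s) m).
Proof.
intros (h1 & h2 & h3) (k1 & k2 & k3); unfold dot.
eapply derive_eq.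
- apply derive_add; [apply derive_add|]; apply derive_mul; try eassumption.
  apply derive_mul; [apply derive_cst|eassumption].
- cbv beta; ring.
Qed.

Lemma derive3_rot e x y s l m : derive3 x s l -> derive3 y s m ->
  derive3 (fun u => rot e (x u) (y u)) s
    (x0 (rot e l (y s)) + x0 (rot e (x s) m), x1 (rot e l (y s)) + x1 (rot e (x s) m),
     x2 (rot e l (y s)) + x2 (rot e (x s) m)).
Proof.
intros (h1 & h2 & h3) (k1 & k2 & k3); split; [|split].
- eapply derive_eq; [apply (derive_mul (fun _ => e)); [apply derive_cst|];
    apply derive_sub; apply derive_mul; eassumption|].
  unfold rot, x0, x1, x2; simpl; ring.
- eapply derive_eq; [apply derive_sub; apply derive_mul; eassumption|].
  unfold rot, x0, x1, x2; simpl; ring.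
- eapply derive_eq; [apply derive_sub; apply derive_mul; eassumption|].
  unfold rot, x0, x1, x2; simpl; ring.
Qed.

Lemma derive3_normal c alpha s l : derive3 alpha s l ->
  derive3 (fun u => normal c (alpha u)) s (mu c * x0 l, mu c * x1 l, mu c * x2 l).
Proof.
intros (h1 & h2 & h3); split; [|split].
- apply (is_derive_ext (fun u => mu c * x0 (alpha u) + mu0 c)).
  + intros u; symmetry; apply normal_comp.
  + eapply derive_eq; [apply derive_add; [apply (derive_mul (fun _ => mu c)); [apply derive_cst|exact h1]|apply derive_cst]|].
    unfold x0 at 3; simpl; ring.
- apply (is_derive_ext (fun u => mu c * x1 (alpha u))).
  + intros u; symmetry; apply normal_comp.
  + eapply derive_eq; [apply (derive_mul (fun _ => mu c)); [apply derive_cst|exact h2]|].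
    unfold x1 at 3; simpl; ring.
- apply (is_derive_ext (fun u => mu c * x2 (alpha u))).
  + intros u; symmetry; apply normal_comp.
  + eapply derive_eq; [apply (derive_mul (fun _ => mu c)); [apply derive_cst|exact h3]|].
    unfold x2 at 3; simpl; ring.
Qed.

Lemma dot_normal_l c p u : dot (sig c) (normal c p) u = mu c * dot (sig c) p u + mu0 c * x0 u.
Proof.
destruct (normal_comp c p) as (e0 & e1 & e2), (mu_facts c) as (_ & _ & _ & h & _).
unfold dot; rewrite e0, e1, e2; rewrite <- h at 2; ring.
Qed.

Lemma dot_normal_normal c p : Q c p -> dot (sig c) (normal c p) (normal c p) = sig c.
Proof.
intros (hq0 & hq1 & _).
destruct (normal_comp c p) as (e0 & e1 & e2), (mu_facts c) as (m1 & m2 & m3 & m4 & m5).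
transitivity (mu c * mu c * dot (sig c) p p + 2 * sig c * x0 p * (mu c * mu0 c) + sig c * (mu0 c * mu0 c)).
{ unfold dot; rewrite e0, e1, e2; ring. }
rewrite m2, m5.
destruct (Req_dec c 0) as [h|h].
- rewrite h; destruct mu_zero as [-> ->]; ring.
- specialize (hq1 h); rewrite form_dot in hq1; rewrite hq1.
  destruct (mu_nonzero c h) as [_ ->].
  transitivity (sig c * sig c * (mu c * mu c) * (1 / c)); [rewrite sig_sq; field; exact h|].
  transitivity (sig c * (sig c * (mu c * mu c)) * (1 / c)); [ring|rewrite m1; field; exact h].
Qed.

(** For c <> 0 the normal is a multiple of p and the cross product is zero; for c = 0 the factor c
    is. *)
Lemma rot_normal_self c p : c * x0 (rot (sig c) (normal c p) p) = 0 /\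
  c * x1 (rot (sig c) (normal c p) p) = 0 /\ c * x2 (rot (sig c) (normal c p) p) = 0.
Proof.
destruct (normal_comp c p) as (e0 & e1 & e2), (mu_facts c) as (m1 & m2 & m3 & m4 & m5).
set (nu := normal c p) in *.
change (c * (sig c * (x1 nu * x2 p - x2 nu * x1 p)) = 0 /\ c * (x2 nu * x0 p - x0 nu * x2 p) = 0 /\
  c * (x0 nu * x1 p - x1 nu * x0 p) = 0).
rewrite e0, e1, e2; repeat split.
- ring.
- transitivity (- (c * mu0 c) * x2 p); [ring|rewrite m3; ring].
- transitivity ((c * mu0 c) * x1 p); [ring|rewrite m3; ring].
Qed.

Lemma Rpower_3_2 a : 0 < a -> Rpower a (3 / 2) = sqrt a ^ 3.
Proof.
intros h; rewrite <- Rpower_sqrt by exact h.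
rewrite <- Rpower_pow by (unfold Rpower; apply exp_pos).
rewrite Rpower_mult; f_equal; simpl; field.
Qed.

Lemma C2_fun_at_derive f s : C2_fun_at f s ->
  is_derive f s (Derive f s) /\ is_derive (Derive f) s (Derive_n f 2 s).
Proof.
intros (h1 & h2 & _); split; [now apply Derive_correct|].
exact (Derive_correct (Derive f) s h2).
Qed.

Lemma regular_curve_derive c I alpha s : regular_curve c I alpha -> I s ->
  derive3 alpha s (vel alpha s) /\ derive3 (vel alpha) s (curve_deriv 2 alpha s).
Proof.
intros h hs; destruct (h s hs) as (_ & h0 & h1 & h2 & _).
apply C2_fun_at_derive in h0; apply C2_fun_at_derive in h1; apply C2_fun_at_derive in h2.
split; (split; [|split]); tauto.
Qed.

(** Both lengths measured from s are functions of the upper limit that agree near s; their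
    derivatives at s are the two continuous integrands. *)
Lemma curve_speed c lo hi a d alpha s :
  curve_with_data c (Rbar_interval lo hi) a d alpha ->
  (forall s, Rbar_interval lo hi s -> 0 < a s) ->
  (forall s, Rbar_interval lo hi s -> continuous a s) ->
  Rbar_interval lo hi s ->
  speed c alpha s = sqrt (a s) /\ dot (sig c) (vel alpha s) (vel alpha s) = a s.
Proof.
intros (hreg & hlen & _) ha ca hs.
assert (hpos : forall u, Rbar_interval lo hi u -> 0 < dot (sig c) (vel alpha u) (vel alpha u)).
{ intros u hu; destruct (hreg u hu) as (_ & _ & _ & _ & h).
  apply Rnot_le_lt; intros hle; unfold speed in h; rewrite form_dot in h.
  rewrite sqrt_neg_0 in h; [lra|exact hle]. }
assert (csq : forall (f : R -> R) u, continuous f u -> continuous (fun x => sqrt (f x)) u).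
{ intros f u hf; apply (continuous_comp f sqrt); [exact hf|apply continuous_sqrt]. }
assert (cspeed : forall u, Rbar_interval lo hi u -> continuous (speed c alpha) u).
{ intros u hu; unfold speed; apply csq.
  destruct (regular_curve_derive _ _ _ _ hreg hu) as (_ & h2).
  apply (ex_derive_continuous (V := R_NormedModule)); eexists.
  exact (derive3_dot (sig c) _ _ _ _ _ h2 h2). }
assert (e : speed c alpha s = sqrt (a s)).
{ assert (d1 := RInt_derive_interval (speed c alpha) lo hi s s hs hs cspeed).
  assert (d2 := RInt_derive_interval (fun x => sqrt (a x)) lo hi s s hs hs
    (fun u hu => csq a u (ca u hu))).
  apply is_derive_unique in d1; apply is_derive_unique in d2.
  rewrite <- d1, <- d2; apply Derive_ext_loc.
  generalize (Rbar_interval_locally lo hi s hs); apply filter_imp; intros y hy; auto. }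
split; [exact e|].
unfold speed in e; rewrite form_dot in e.
apply sqrt_inj in e; [exact e|apply Rlt_le, hpos, hs|apply Rlt_le, ha, hs].
Qed.

Lemma curve_frame c lo hi a d alpha s :
  curve_with_data c (Rbar_interval lo hi) a d alpha ->
  (forall s, Rbar_interval lo hi s -> 0 < a s) ->
  (forall s, Rbar_interval lo hi s -> continuous a s) ->
  Rbar_interval lo hi s ->
  frame (sig c) (a s) (normal c (alpha s)) (vel alpha s) (nrm c alpha s).
Proof.
intros hcurve ha ca hs; assert (hreg := proj1 hcurve).
destruct (hreg s hs) as (hQ & _).
split.
- apply sig_sq.
- now apply dot_normal_normal.
- rewrite dot_normal_l.
  destruct (regular_curve_derive _ _ _ _ hreg hs) as (h1 & _).
  destruct (Req_dec c 0) as [h|h].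
  + rewrite h; destruct mu_zero as [-> ->].
    assert (e : x0 (vel alpha s) = 0); [|rewrite e; ring].
    destruct h1 as (h1 & _); apply is_derive_unique in h1; rewrite <- h1.
    rewrite <- (Derive_const 0 s); apply Derive_ext_loc.
    generalize (Rbar_interval_locally lo hi s hs); apply filter_imp; intros y hy.
    destruct (hreg y hy) as ((hq0 & _) & _); auto.
  + destruct (mu_nonzero c h) as [_ ->].
    assert (e : dot (sig c) (vel alpha s) (alpha s) + dot (sig c) (alpha s) (vel alpha s) = 0).
    { assert (k := derive3_dot (sig c) _ _ _ _ _ h1 h1); apply is_derive_unique in k; rewrite <- k.
      rewrite <- (Derive_const (1 / c) s); apply Derive_ext_loc.
      generalize (Rbar_interval_locally lo hi s hs); apply filter_imp; intros y hy.
      destruct (hreg y hy) as ((_ & hq1 & _) & _); rewrite <- form_dot; auto. }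
    rewrite (dot_sym _ (vel alpha s)) in e; nra.
- now apply (curve_speed c lo hi a d).
- reflexivity.
Qed.

Definition coef_p (a1 a : R -> R) (s : R) : R := a1 s / (2 * a s).
Definition coef_q (a d : R -> R) (s : R) : R := d s / (2 * a s).

(** The subtracted multiple of alpha carries the factor c, and c <alpha, u> = sig mu <mu alpha, u>
    vanishes for tangent u. *)
Lemma cov_accel_dot c alpha s u : dot (sig c) (normal c (alpha s)) u = 0 ->
  form c (cov_accel c alpha s) u = dot (sig c) (curve_deriv 2 alpha s) u.
Proof.
intros h; set (w := curve_deriv 2 alpha s).
transitivity (dot (sig c) w u - dot (sig c) w (alpha s) * (c * dot (sig c) (alpha s) u)).
- unfold cov_accel; fold w; unfold form, dot, minus, plus, opp, scal, x0, x1, x2; simpl.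
  unfold plus, opp, scal, mult; simpl; unfold mult; simpl; ring.
- assert (e : c * dot (sig c) (alpha s) u = 0); [|rewrite e; ring].
  rewrite dot_normal_l in h; destruct (mu_facts c) as (m1 & m2 & _).
  transitivity (sig c * mu c * (mu c * dot (sig c) (alpha s) u + mu0 c * x0 u)).
  + rewrite <- m1 at 1; transitivity (sig c * (mu c * mu c) * dot (sig c) (alpha s) u
      + sig c * (mu c * mu0 c) * x0 u); [rewrite m2; ring|ring].
  + rewrite h; ring.
Qed.

(** The acceleration is expanded in the frame. Differentiating <v, v> = a gives the component along
    v, differentiating <nu, v> = 0 the one along the normal nu, and the curvature the one along n.
    With c = sig mu^2 the normal part becomes -c a alpha. *)
Lemma curve_solves c lo hi a a1 d alpha s :
  curve_with_data c (Rbar_interval lo hi) a d alpha ->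
  (forall s, Rbar_interval lo hi s -> 0 < a s) ->
  (forall s, Rbar_interval lo hi s -> is_derive a s (a1 s)) ->
  Rbar_interval lo hi s ->
  solves3 (coef_p a1 a) (coef_q a d) (fun u => c * a u) alpha (vel alpha) (nrm c alpha) s.
Proof.
intros hcurve ha da hs; assert (hreg := proj1 hcurve).
assert (ca : forall u, Rbar_interval lo hi u -> continuous a u).
{ intros u hu; apply (ex_derive_continuous a); eexists; now apply da. }
assert (hf : forall u, Rbar_interval lo hi u -> frame (sig c) (a u) (normal c (alpha u)) (vel alpha u) (nrm c alpha u)).
{ intros u hu; now apply (curve_frame c lo hi a d). }
destruct (regular_curve_derive _ _ _ _ hreg hs) as (h1 & h2).
set (w := curve_deriv 2 alpha s) in *.
assert (has := ha s hs); assert (hfs := hf s hs).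
destruct (frame_more _ _ _ _ _ hfs) as (hnw & hvw & hww & hdet & hrw).
assert (hloc := Rbar_interval_locally lo hi s hs).
assert (ev : 2 * dot (sig c) w (vel alpha s) = a1 s).
{ assert (k := derive3_dot (sig c) _ _ _ _ _ h2 h2).
  rewrite (dot_sym _ (vel alpha s)) in k; apply is_derive_unique in k.
  transitivity (dot (sig c) w (vel alpha s) + dot (sig c) w (vel alpha s)); [ring|rewrite <- k].
  rewrite <- (is_derive_unique _ _ _ (da s hs)); apply Derive_ext_loc.
  revert hloc; apply filter_imp; intros y hy; now destruct (hf y hy). }
assert (en : dot (sig c) w (normal c (alpha s)) = - mu c * a s).
{ assert (k := derive3_dot (sig c) _ _ _ _ _ (derive3_normal c _ _ _ h1) h2).
  apply is_derive_unique in k.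
  rewrite (Derive_ext_loc _ (fun _ => 0)), Derive_const in k.
  - destruct hfs as [_ _ _ hvv _]; rewrite <- hvv, dot_sym.
    transitivity (dot (sig c) (normal c (alpha s)) w - 0); [ring|rewrite k].
    unfold dot; cbn [x0 x1 x2]; unfold x0 at 4, x1 at 4, x2 at 4; cbn [fst snd]; unfold w, x0, x1, x2; simpl; ring.
  - revert hloc; apply filter_imp; intros y hy; now destruct (hf y hy). }
assert (eN : dot (sig c) w (nrm c alpha s) = - d s / 2).
{ assert (hk := proj2 (proj2 hcurve) s hs); unfold geod_curvature in hk.
  fold (vel alpha s) in hk; fold (nrm c alpha s) in hk.
  destruct (curve_speed c lo hi a d alpha s) as [hsp _]; auto.
  rewrite hsp, Rpower_3_2 in hk by exact has.
  assert (hX0 : 0 < sqrt (a s)) by apply sqrt_lt_R0, has.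
  assert (hX : 0 < sqrt (a s) ^ 3) by now apply pow_lt.
  assert (hcov := cov_accel_dot c alpha s (nrm c alpha s) hnw); fold w in hcov.
  rewrite hcov in hk.
  apply (Rmult_eq_reg_r (/ sqrt (a s) ^ 3)); [|apply Rinv_neq_0_compat; lra].
  unfold Rdiv in hk; rewrite hk; field; lra. }
assert (ew : w = (coef_p a1 a s * x0 (vel alpha s) - coef_q a d s * x0 (nrm c alpha s) - c * a s * x0 (alpha s),
  coef_p a1 a s * x1 (vel alpha s) - coef_q a d s * x1 (nrm c alpha s) - c * a s * x1 (alpha s),
  coef_p a1 a s * x2 (vel alpha s) - coef_q a d s * x2 (nrm c alpha s) - c * a s * x2 (alpha s))).
{ assert (hne : a s <> 0) by lra.
  rewrite (frame_expand _ _ _ _ _ w hne hfs), en, eN.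
  replace (dot (sig c) w (vel alpha s)) with (a1 s / 2) by lra.
  destruct (normal_comp c (alpha s)) as (n0 & n1 & n2), (mu_facts c) as (m1 & m2 & _).
  unfold comb; rewrite n0, n1, n2; unfold coef_p, coef_q; f_equal; [f_equal|].
  - transitivity (- (sig c * (mu c * mu c)) * a s * x0 (alpha s) - sig c * a s * (mu c * mu0 c)
      + a1 s / 2 / a s * x0 (vel alpha s) + - d s / 2 / a s * x0 (nrm c alpha s)); [ring|].
    rewrite m1, m2; field; lra.
  - transitivity (- (sig c * (mu c * mu c)) * a s * x1 (alpha s)
      + a1 s / 2 / a s * x1 (vel alpha s) + - d s / 2 / a s * x1 (nrm c alpha s)); [ring|].
    rewrite m1; field; lra.
  - transitivity (- (sig c * (mu c * mu c)) * a s * x2 (alpha s)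
      + a1 s / 2 / a s * x2 (vel alpha s) + - d s / 2 / a s * x2 (nrm c alpha s)); [ring|].
    rewrite m1; field; lra. }
(* Differentiate the cross product n of nu and v: nu' = mu v contributes nothing, the product of nu
   with n is -v, and that of nu with alpha vanishes after multiplication by c. *)
assert (hn : derive3 (nrm c alpha) s
  (coef_p a1 a s * x0 (nrm c alpha s) + coef_q a d s * x0 (vel alpha s),
   coef_p a1 a s * x1 (nrm c alpha s) + coef_q a d s * x1 (vel alpha s),
   coef_p a1 a s * x2 (nrm c alpha s) + coef_q a d s * x2 (vel alpha s))).
{ assert (k := derive3_rot (sig c) _ _ _ _ _ (derive3_normal c _ _ _ h1) h2).
  destruct (rot_normal_self c (alpha s)) as (r0 & r1 & r2).
  set (nu := normal c (alpha s)) in *.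
  assert (enrm : nrm c alpha s = rot (sig c) nu (vel alpha s)) by reflexivity.
  match type of k with derive3 _ _ ?l => match goal with |- derive3 _ _ ?l' =>
    assert (el : l = l'); [|rewrite <- el; exact k] end end.
  assert (f0 : x0 (rot (sig c) nu (nrm c alpha s)) = - x0 (vel alpha s)) by exact (f_equal x0 hrw); assert (f1 : x1 (rot (sig c) nu (nrm c alpha s)) = - x1 (vel alpha s)) by exact (f_equal x1 hrw); assert (f2 : x2 (rot (sig c) nu (nrm c alpha s)) = - x2 (vel alpha s)) by exact (f_equal x2 hrw).
  rewrite ew; set (nn := nrm c alpha s) in *.
  set (vv := vel alpha s) in *; set (p := coef_p a1 a s); set (q := coef_q a d s).
  set (rv := rot (sig c) nu vv) in enrm; set (rn := rot (sig c) nu nn) in *.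
  set (ra := rot (sig c) nu (alpha s)) in *.
  clearbody nn vv nu.
  f_equal; [f_equal|].
  - transitivity (p * x0 rv - q * x0 rn - a s * (c * x0 ra)).
    + unfold rv, rn, ra, rot, x0, x1, x2; simpl; ring.
    + rewrite r0, f0, <- enrm; ring.
  - transitivity (p * x1 rv - q * x1 rn - a s * (c * x1 ra)).
    + unfold rv, rn, ra, rot, x0, x1, x2; simpl; ring.
    + rewrite r1, f1, <- enrm; ring.
  - transitivity (p * x2 rv - q * x2 rn - a s * (c * x2 ra)).
    + unfold rv, rn, ra, rot, x0, x1, x2; simpl; ring.
    + rewrite r2, f2, <- enrm; ring. }
rewrite ew in h2; destruct h1 as (h10 & h11 & h12), h2 as (h20 & h21 & h22), hn as (hn0 & hn1 & hn2).
split; [|split]; (split; [|split]); assumption.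
Qed.

(** * First integrals and existence of the curve *)

Lemma interval_constant (f : R -> R) lo hi s0 s :
  Rbar_interval lo hi s0 -> Rbar_interval lo hi s ->
  (forall x, Rbar_interval lo hi x -> is_derive f x 0) -> f s = f s0.
Proof.
intros h0 h hd; destruct (Rbar_interval_hull lo hi s0 s h0 h) as (a & b & ha & hb & h1 & h2).
apply (derive_zero_const f a b); auto.
intros x hx; apply hd, Rbar_interval_between with a b; auto; lra.
Qed.

(** (A, V, N) and (B, W, M) are two coordinates of the unknown frame, and m A + k, m B + l the
    corresponding coordinates of the normal, so the expression is an entry of the completeness
    relation. Division by a compensates for the coefficient p = a'/(2a). *)
Lemma completeness_derive e c m k l (p q a a1 A V N B W M : R -> R) s :
  e * (m * m) = c -> m * k = 0 -> m * l = 0 -> a s <> 0 -> is_derive a s (a1 s) ->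
  p s = a1 s / (2 * a s) ->
  solves p q (fun u => c * a u) A V N s -> solves p q (fun u => c * a u) B W M s ->
  is_derive (fun u => e * (m * A u + k) * (m * B u + l) + (V u * W u + N u * M u) / a u) s 0.
Proof.
intros hc hk hl ha da hp (hA & hV & hN) (hB & hW & hM).
auto_derive; [repeat split; try (eexists; eassumption); exact ha|].
rewrite_derive da; rewrite_derive hA; rewrite_derive hV; rewrite_derive hN.
rewrite_derive hB; rewrite_derive hW; rewrite_derive hM.
rewrite hp, <- hc.
transitivity (e * V s * (m * l) + e * W s * (m * k)); [field; exact ha|rewrite hk, hl; ring].
Qed.

(** The other first integral, the determinant of the normal, v and n over a, decides the orientation
    that the completeness relation leaves open. *)
Lemma determinant_derive c m k (p q a a1 A0 V0 N0 A1 V1 N1 A2 V2 N2 : R -> R) s :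
  c * k = 0 -> a s <> 0 -> is_derive a s (a1 s) -> p s = a1 s / (2 * a s) ->
  solves p q (fun u => c * a u) A0 V0 N0 s -> solves p q (fun u => c * a u) A1 V1 N1 s ->
  solves p q (fun u => c * a u) A2 V2 N2 s ->
  is_derive (fun u => ((m * A0 u + k) * (V1 u * N2 u - V2 u * N1 u)
    - m * A1 u * (V0 u * N2 u - V2 u * N0 u) + m * A2 u * (V0 u * N1 u - V1 u * N0 u)) / a u) s 0.
Proof.
intros hk ha da hp (hA0 & hV0 & hN0) (hA1 & hV1 & hN1) (hA2 & hV2 & hN2).
auto_derive; [repeat split; try (eexists; eassumption); exact ha|].
rewrite_derive da; rewrite_derive hA0; rewrite_derive hV0; rewrite_derive hN0.
rewrite_derive hA1; rewrite_derive hV1; rewrite_derive hN1.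
rewrite_derive hA2; rewrite_derive hV2; rewrite_derive hN2.
rewrite hp.
transitivity (- (c * k) * (A1 s * N2 s - A2 s * N1 s)); [field; exact ha|rewrite hk; ring].
Qed.

Lemma interval_C2 lo hi (x v w : R -> R) s :
  (forall u, Rbar_interval lo hi u -> is_derive x u (v u)) ->
  (forall u, Rbar_interval lo hi u -> is_derive v u (w u)) ->
  (forall u, Rbar_interval lo hi u -> continuous w u) ->
  Rbar_interval lo hi s ->
  C2_fun_at x s /\ Derive x s = v s /\ Derive_n x 2 s = w s.
Proof.
intros hx hv hw.
assert (h2 : forall u, Rbar_interval lo hi u -> is_derive (Derive x) u (w u)).
{ intros u hu; apply (is_derive_ext_loc v); [|now apply hv].
  generalize (Rbar_interval_locally lo hi u hu); apply filter_imp; intros y hy.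
  symmetry; now apply is_derive_unique, hx. }
assert (h2' : forall u, Rbar_interval lo hi u -> Derive_n x 2 u = w u).
{ intros u hu; apply is_derive_unique, h2, hu. }
intros hs; split; [|split; [now apply is_derive_unique, hx|now apply h2']].
split; [eexists; now apply hx|split; [eexists; exact (h2 s hs)|]].
apply (continuous_ext_loc (Derive_n x 2) w s); [|now apply hw].
generalize (Rbar_interval_locally lo hi s hs); apply filter_imp; intros y hy.
symmetry; now apply h2'.
Qed.

Lemma curve_exists c lo hi (a a1 d : R -> R) s0 :
  Rbar_interval lo hi s0 ->
  (forall s, Rbar_interval lo hi s -> 0 < a s) ->
  (forall s, Rbar_interval lo hi s -> is_derive a s (a1 s)) ->
  (forall s, Rbar_interval lo hi s -> continuous a1 s) ->
  (forall s, Rbar_interval lo hi s -> continuous d s) ->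
  exists alpha, curve_with_data c (Rbar_interval lo hi) a d alpha.
Proof.
intros h0 ha da ca1 cd.
set (I := Rbar_interval lo hi) in *.
assert (ca : forall s, I s -> continuous a s).
{ intros s hs; apply (ex_derive_continuous a); eexists; now apply da. }
set (p := coef_p a1 a); set (q := coef_q a d); set (r := fun u => c * a u).
assert (ci : forall s, I s -> continuous (fun u => / (2 * a u)) s).
{ intros s hs; apply (ex_derive_continuous (V := R_NormedModule)); eexists.
  specialize (ha s hs); assert (h := da s hs).
  auto_derive; [split; [eexists; exact h|split; [lra|exact Logic.I]]|reflexivity]. }
assert (cp : forall s, I s -> continuous p s).
{ intros s hs; apply (continuous_mult a1 (fun u => / (2 * a u))); auto. }
assert (cq : forall s, I s -> continuous q s).
{ intros s hs; apply (continuous_mult d (fun u => / (2 * a u))); auto. }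
assert (cr : forall s, I s -> continuous r s).
{ intros s hs; apply (continuous_scal_r c a); auto. }
set (b := sqrt (a s0)).
assert (hb : b * b = a s0) by (apply sqrt_sqrt, Rlt_le, ha, h0).
(* The initial frame is e_0, b e_1, b e_2 at (1/mu, 0, 0), the point that is projected to 0. For c =
   0 the convention that the inverse of 0 is 0 makes this the origin. *)
destruct (linear_system_exists p q r lo hi s0 (/ mu c) 0 0 h0 cp cq cr)
  as (A0 & V0 & N0 & iA0 & iV0 & iN0 & h0s).
destruct (linear_system_exists p q r lo hi s0 0 b 0 h0 cp cq cr)
  as (A1 & V1 & N1 & iA1 & iV1 & iN1 & h1s).
destruct (linear_system_exists p q r lo hi s0 0 0 b h0 cp cq cr)
  as (A2 & V2 & N2 & iA2 & iV2 & iN2 & h2s).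
set (alpha := fun s => (A0 s, A1 s, A2 s) : R3).
set (v := fun s => (V0 s, V1 s, V2 s) : R3); set (n := fun s => (N0 s, N1 s, N2 s) : R3).
destruct (mu_facts c) as (m1 & m2 & m3 & m4 & m5); assert (he := sig_sq c).
set (e := sig c) in *; set (m := mu c) in *; set (k := mu0 c) in *.
assert (hm : m * / m + k = 1).
{ unfold m, k; destruct (Req_dec c 0) as [h|h].
  - rewrite h; destruct mu_zero as [-> ->]; ring.
  - destruct (mu_nonzero c h) as [h' ->]; field; exact h'. }
assert (hnu : forall s, normal c (alpha s) = (m * A0 s + k, m * A1 s, m * A2 s)).
{ intros s; destruct (normal_comp c (alpha s)) as (e0 & e1 & e2); apply R3_eq;
    [rewrite e0|rewrite e1|rewrite e2]; reflexivity. }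
assert (hne : forall s, I s -> a s <> 0) by (intros s hs; specialize (ha s hs); lra).
assert (const : forall (A V N B W M : R -> R) k1 k2 l, m * k1 = 0 -> m * k2 = 0 ->
  (forall s, I s -> solves p q r A V N s) -> (forall s, I s -> solves p q r B W M s) ->
  e * (m * A s0 + k1) * (m * B s0 + k2) + (V s0 * W s0 + N s0 * M s0) / a s0 = l ->
  forall s, I s -> e * (m * A s + k1) * (m * B s + k2) + (V s * W s + N s * M s) / a s = l).
{ intros A V N B W M k1 k2 l hk1 hk2 hA hB hl s hs; rewrite <- hl.
  apply (interval_constant (fun u => e * (m * A u + k1) * (m * B u + k2) + (V u * W u + N u * M u) / a u) lo hi s0 s h0 hs).
  intros x hx; apply (completeness_derive e c m k1 k2 p q a a1); auto. }
assert (hframe : forall s, I s -> frame e (a s) (normal c (alpha s)) (v s) (n s)).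
{ intros s hs; specialize (hne s hs) as hnes; specialize (hne s0 h0) as hne0.
  assert (z0 : m * 0 = 0) by ring.
  assert (bb : b * b / a s0 = 1) by (rewrite hb; field; exact hne0).
  assert (E00 := const A0 V0 N0 A0 V0 N0 k k e m2 m2 h0s h0s).
  assert (E01 := const A0 V0 N0 A1 V1 N1 k 0 0 m2 z0 h0s h1s).
  assert (E02 := const A0 V0 N0 A2 V2 N2 k 0 0 m2 z0 h0s h2s).
  assert (E11 := const A1 V1 N1 A1 V1 N1 0 0 1 z0 z0 h1s h1s).
  assert (E12 := const A1 V1 N1 A2 V2 N2 0 0 0 z0 z0 h1s h2s).
  assert (E22 := const A2 V2 N2 A2 V2 N2 0 0 1 z0 z0 h2s h2s).
  rewrite iA0, iV0, iN0 in E00, E01, E02; rewrite iA1, iV1, iN1 in E01, E11, E12.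
  rewrite iA2, iV2, iN2 in E02, E12, E22; rewrite hm in E00, E01, E02.
  specialize (E00 ltac:(field; exact hne0) s hs); specialize (E01 ltac:(field; exact hne0) s hs).
  specialize (E02 ltac:(field; exact hne0) s hs); specialize (E12 ltac:(field; exact hne0) s hs).
  assert (t1 : e * (m * 0 + 0) * (m * 0 + 0) + (b * b + 0 * 0) / a s0 = 1)
    by (rewrite <- bb; field; exact hne0).
  assert (t2 : e * (m * 0 + 0) * (m * 0 + 0) + (0 * 0 + b * b) / a s0 = 1)
    by (rewrite <- bb; field; exact hne0).
  specialize (E11 t1 s hs); specialize (E22 t2 s hs).
  rewrite !Rplus_0_r in E01, E02, E11, E12, E22.
  assert (hdet : det3 (normal c (alpha s)) (v s) (n s) = a s).
  { rewrite hnu; unfold det3, v, n, x0, x1, x2; simpl.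
    assert (hD := interval_constant (fun u => ((m * A0 u + k) * (V1 u * N2 u - V2 u * N1 u)
      - m * A1 u * (V0 u * N2 u - V2 u * N0 u) + m * A2 u * (V0 u * N1 u - V1 u * N0 u)) / a u) lo hi s0 s h0 hs).
    assert (hD1 : ((m * A0 s + k) * (V1 s * N2 s - V2 s * N1 s)
      - m * A1 s * (V0 s * N2 s - V2 s * N0 s) + m * A2 s * (V0 s * N1 s - V1 s * N0 s)) / a s = 1).
    { rewrite hD.
      - rewrite iA0, iV0, iN0, iA1, iV1, iN1, iA2, iV2, iN2, hm; transitivity (b * b / a s0); [field; exact hne0|exact bb].
      - intros x hx; apply (determinant_derive c m k p q a a1); auto. }
    match type of hD1 with ?y / _ = 1 => replace y with (y / a s * a s) by (field; exact hnes) end.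
    rewrite hD1; ring. }
  apply frame_of_completeness; auto; rewrite hnu; unfold v, n, x0, x1, x2; simpl; lra. }
assert (hC2 : forall A V N, (forall s, I s -> solves p q r A V N s) ->
  forall s, I s -> C2_fun_at A s /\ Derive A s = V s /\ Derive_n A 2 s = p s * V s - q s * N s - r s * A s).
{ intros A V N hA.
  assert (cc : forall u, I u -> continuous A u /\ continuous V u /\ continuous N u).
  { intros u hu; destruct (hA u hu) as (k1 & k2 & k3).
    repeat split; apply (ex_derive_continuous (V := R_NormedModule)); eexists; eassumption. }
  intros s; apply (interval_C2 lo hi A V (fun s => p s * V s - q s * N s - r s * A s));
    intros u hu; try apply hA, hu; destruct (cc u hu) as (k1 & k2 & k3).
  apply (continuous_minus (fun s => p s * V s - q s * N s) (fun s => r s * A s));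
    [apply (continuous_minus (fun s => p s * V s) (fun s => q s * N s));
      [apply (continuous_mult p V)|apply (continuous_mult q N)]|apply (continuous_mult r A)]; auto. }
assert (C0 := hC2 A0 V0 N0 h0s); assert (C1 := hC2 A1 V1 N1 h1s); assert (C2 := hC2 A2 V2 N2 h2s).
assert (hvel : forall s, I s -> vel alpha s = v s).
{ intros s hs; destruct (C0 s hs) as (_ & d0 & _), (C1 s hs) as (_ & d1 & _), (C2 s hs) as (_ & d2 & _).
  apply R3_eq; [exact d0|exact d1|exact d2]. }
assert (hacc : forall s, I s -> curve_deriv 2 alpha s = comb (p s) (v s) (- q s) (n s) (- r s) (alpha s)).
{ intros s hs; destruct (C0 s hs) as (_ & _ & d0), (C1 s hs) as (_ & _ & d1), (C2 s hs) as (_ & _ & d2).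
  apply R3_eq; [etransitivity; [exact d0|]|etransitivity; [exact d1|]|etransitivity; [exact d2|]];
    unfold comb, v, n, alpha, x0, x1, x2; simpl; ring. }
assert (hnrm : forall s, I s -> nrm c alpha s = n s).
{ intros s hs; destruct (hframe s hs) as [_ _ _ _ ->]; unfold nrm; now rewrite hvel. }
assert (hspeed : forall s, I s -> speed c alpha s = sqrt (a s)).
{ intros s hs; unfold speed; fold (vel alpha s); rewrite form_dot, (hvel s hs); fold e.
  now destruct (hframe s hs) as [_ _ _ -> _]. }
assert (hform : c <> 0 -> forall s, I s -> dot e (alpha s) (alpha s) = 1 / c).
{ intros hc s hs; destruct (hframe s hs) as [_ hnn _ _ _]; rewrite hnu in hnn.
  destruct (mu_nonzero c hc) as [hmz hk]; fold m in hmz; fold k in hk.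
  assert (em : m * m * dot e (alpha s) (alpha s) = e).
  { rewrite <- hnn at 2; unfold dot, alpha, x0, x1, x2; simpl; rewrite hk; ring. }
  apply (Rmult_eq_reg_l c); [|exact hc].
  rewrite <- m1 at 1; replace (e * (m * m) * dot e (alpha s) (alpha s)) with (e * (m * m * dot e (alpha s) (alpha s))) by ring.
  rewrite em, he; field; exact hc. }
assert (hQ : forall s, I s -> Q c (alpha s)).
{ intros s hs; split; [|split].
  - intros hc.
    assert (hz : forall u, I u -> V0 u = 0).
    { intros u hu; destruct (hframe u hu) as [_ _ hnv _ _]; rewrite hnu in hnv.
      unfold m, k in hnv; rewrite hc in hnv; destruct mu_zero as [e1 e2]; rewrite e1, e2 in hnv.
      unfold dot, v, x0, x1, x2 in hnv; simpl in hnv.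
      destruct (sq_one_cases e he) as [e3 | e3]; rewrite e3 in hnv; lra. }
    unfold alpha, x0; simpl.
    rewrite (interval_constant A0 lo hi s0 s h0 hs), iA0.
    + unfold m; rewrite hc; destruct mu_zero as [-> _]; apply Rinv_0.
    + intros u hu; rewrite <- (hz u hu); apply h0s, hu.
  - intros hc; rewrite form_dot; now apply hform.
  - intros hc.
    assert (hsq : forall u, I u -> 0 < A0 u * A0 u).
    { intros u hu; assert (hf := hform ltac:(lra) u hu).
      assert (hi' : 1 / c < 0) by (unfold Rdiv; rewrite Rmult_1_l; now apply Rinv_lt_0_compat).
      unfold dot, alpha, e, sig, x0, x1, x2 in hf; simpl in hf.
      destruct (Rlt_dec c 0); [|lra]; nra. }
    (* The sign of [A0], written as [A0] over its absolute value, has zero derivative: the curve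
       stays on the sheet where it starts. *)
    assert (hcst : A0 s / sqrt (A0 s * A0 s) = A0 s0 / sqrt (A0 s0 * A0 s0)).
    { apply (interval_constant (fun u => A0 u / sqrt (A0 u * A0 u)) lo hi s0 s h0 hs).
      intros u hu; specialize (hsq u hu); destruct (h0s u hu) as (hd & _).
      assert (hs1 : 0 < sqrt (A0 u * A0 u)) by now apply sqrt_lt_R0.
      assert (hs2 : sqrt (A0 u * A0 u) * sqrt (A0 u * A0 u) = A0 u * A0 u) by (apply sqrt_sqrt; lra).
      auto_derive; [repeat split; try (eexists; exact hd); lra|].
      rewrite_derive hd.
      set (S := sqrt (A0 u * A0 u)) in *.
      transitivity (V0 u * (S * S - A0 u * A0 u) / (S * S * S)); [field; lra|rewrite hs2; unfold Rdiv; ring]. }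
    assert (hp0 : 0 < A0 s0).
    { rewrite iA0; apply Rinv_0_lt_compat; unfold m, mu.
      destruct (Rlt_dec 0 c); [lra|]; destruct (Rlt_dec c 0); [apply sqrt_lt_R0; lra|lra]. }
    rewrite (sqrt_square (A0 s0)) in hcst by lra.
    replace (A0 s0 / A0 s0) with 1 in hcst by (field; lra).
    assert (hs1 : 0 < sqrt (A0 s * A0 s)) by (apply sqrt_lt_R0, hsq, hs).
    unfold alpha, x0; simpl.
    replace (A0 s) with (A0 s / sqrt (A0 s * A0 s) * sqrt (A0 s * A0 s)) by (field; lra).
    rewrite hcst; lra. }
exists alpha; split; [|split].
- intros s hs; split; [now apply hQ|].
  split; [apply C0, hs|split; [apply C1, hs|split; [apply C2, hs|]]].
  rewrite hspeed by exact hs; apply sqrt_lt_R0, ha, hs.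
- intros x y hx hy; apply RInt_ext; intros u hu; apply hspeed.
  revert hu; unfold Rmin, Rmax; destruct (Rle_dec x y); intros hu;
    [apply Rbar_interval_between with x y|apply Rbar_interval_between with y x]; auto; lra.
- intros s hs; unfold geod_curvature; fold (vel alpha s); fold (nrm c alpha s).
  assert (hf := hframe s hs); destruct (frame_more _ _ _ _ _ hf) as (hnw & hvw & hww & _ & _).
  rewrite (hspeed s hs), (hnrm s hs), cov_accel_dot by exact hnw.
  rewrite (hacc s hs), dot_comb; fold e; rewrite hvw, hww.
  rewrite Rpower_3_2 by now apply ha.
  assert (hX0 : 0 < sqrt (a s)) by apply sqrt_lt_R0, ha, hs.
  (* Since c = e m^2, the factor c in r turns alpha into a multiple of the normal, to which n is
     orthogonal. *)
  assert (hr0 : r s * dot e (alpha s) (n s) = 0).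
  { unfold e in hnw; rewrite dot_normal_l in hnw; fold m k e in hnw; unfold r.
    transitivity (a s * (e * m * (m * dot e (alpha s) (n s) + k * x0 (n s)))).
    - rewrite <- m1 at 1.
      transitivity (a s * (e * (m * m) * dot e (alpha s) (n s) + e * (m * k) * x0 (n s))); [rewrite m2; ring|ring].
    - rewrite hnw; ring. }
  transitivity ((- q s * a s - r s * dot e (alpha s) (n s)) / sqrt (a s) ^ 3); [unfold Rdiv; f_equal; ring|].
  rewrite hr0; unfold q, coef_q; field; specialize (ha s hs); split; lra.
Qed.

(* The linear map that sends the frame (n, v, w) to (n', v', w'). *)
Definition transfer (e a : R) (n v w n' v' w' u : R3) : R3 :=
  comb (e * dot e u n) n' (dot e u v / a) v' (dot e u w / a) w'.

Lemma transfer_comb e a n v w n' v' w' k1 k2 k3 : a <> 0 -> frame e a n v w ->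
  transfer e a n v w n' v' w' (comb k1 n k2 v k3 w) = comb k1 n' k2 v' k3 w'.
Proof.
intros ha hf; destruct (frame_more _ _ _ _ _ hf) as (hnw & hvw & hww & _ & _).
destruct hf as [he hnn hnv hvv _]; unfold transfer; rewrite !dot_comb.
rewrite (dot_sym e v n), (dot_sym e w n), (dot_sym e w v), hnn, hnv, hvv, hnw, hvw, hww.
replace (e * (k1 * e + k2 * 0 + k3 * 0)) with (k1 * (e * e)) by ring; rewrite he.
unfold comb; f_equal; [f_equal|]; field; exact ha.
Qed.

Lemma transfer_dot e a n v w n' v' w' x y : a <> 0 -> frame e a n v w -> frame e a n' v' w' ->
  dot e (transfer e a n v w n' v' w' x) (transfer e a n v w n' v' w' y) = dot e x y.
Proof.
intros ha hf hf'.
assert (ex := frame_expand e a n v w x ha hf).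
set (k1 := e * dot e x n) in ex; set (k2 := dot e x v / a) in ex; set (k3 := dot e x w / a) in ex.
rewrite ex at 1; rewrite transfer_comb by assumption; rewrite ex.
rewrite !dot_comb, (dot_sym e n'), (dot_sym e v'), (dot_sym e w').
unfold transfer; rewrite !dot_comb.
destruct (frame_more _ _ _ _ _ hf') as (hnw & hvw & hww & _ & _).
destruct hf' as [he hnn hnv hvv _].
rewrite (dot_sym e v' n'), (dot_sym e w' n'), (dot_sym e w' v'), hnn, hnv, hvv, hnw, hvw, hww.
rewrite (dot_sym e n y), (dot_sym e v y), (dot_sym e w y).
transitivity (k1 * (e * e * dot e y n) + k2 * dot e y v + k3 * dot e y w); [field; exact ha|rewrite he; ring].
Qed.

Lemma transfer_inverse e a n v w n' v' w' x : a <> 0 -> frame e a n v w -> frame e a n' v' w' ->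
  transfer e a n' v' w' n v w (transfer e a n v w n' v' w' x) = x.
Proof.
intros ha hf hf'; unfold transfer at 2; rewrite transfer_comb by assumption.
symmetry; now apply frame_expand.
Qed.

(** The multiplication table of the frame: n with v gives w, n with w gives -v, and v with w gives e
    a n. *)
Lemma rot_comb e a n v w k1 k2 k3 l1 l2 l3 : a <> 0 -> frame e a n v w ->
  rot e (comb k1 n k2 v k3 w) (comb l1 n l2 v l3 w) =
  comb (e * a * (k2 * l3 - k3 * l2)) n (- (k1 * l3 - k3 * l1)) v (k1 * l2 - k2 * l1) w.
Proof.
intros ha hf; destruct (frame_more _ _ _ _ _ hf) as (hnw & hvw & hww & hdet & hrw).
assert (hvw' : rot e v w = (e * a * x0 n, e * a * x1 n, e * a * x2 n)).
{ rewrite (frame_expand e a n v w (rot e v w) ha hf).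
  assert (he := frame_sq _ _ _ _ _ hf).
  assert (q1 : dot e (rot e v w) n = a).
  { rewrite <- hdet; transitivity (e * e * (x0 n * (x1 v * x2 w - x2 v * x1 w))
      - x1 n * (x0 v * x2 w - x2 v * x0 w) + x2 n * (x0 v * x1 w - x1 v * x0 w)).
    - unfold dot, rot, x0, x1, x2; simpl; ring.
    - rewrite he; unfold det3; ring. }
  assert (q2 : dot e (rot e v w) v = 0).
  { transitivity ((e * e - 1) * (x0 v * (x1 v * x2 w - x2 v * x1 w))).
    - unfold dot, rot, x0, x1, x2; simpl; ring.
    - rewrite he; ring. }
  assert (q3 : dot e (rot e v w) w = 0).
  { transitivity ((e * e - 1) * (x0 w * (x1 v * x2 w - x2 v * x1 w))).
    - unfold dot, rot, x0, x1, x2; simpl; ring.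
    - rewrite he; ring. }
  rewrite q1, q2, q3; unfold comb; f_equal; [f_equal|]; field; exact ha. }
assert (hnv' := frame_w _ _ _ _ _ hf).
assert (A : forall f : R3 -> R, (f = x0 \/ f = x1 \/ f = x2) ->
  f (rot e (comb k1 n k2 v k3 w) (comb l1 n l2 v l3 w)) =
  (k1 * l2 - k2 * l1) * f (rot e n v) + (k1 * l3 - k3 * l1) * f (rot e n w)
  + (k2 * l3 - k3 * l2) * f (rot e v w)).
{ intros f [-> | [-> | ->]]; unfold rot, comb, x0, x1, x2; simpl; ring. }
apply R3_eq; rewrite A by tauto; rewrite <- hnv', hrw, hvw';
  unfold comb; unfold x0, x1, x2; simpl; ring.
Qed.

Lemma transfer_rot e a n v w n' v' w' x y : a <> 0 -> frame e a n v w -> frame e a n' v' w' ->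
  transfer e a n v w n' v' w' (rot e x y) =
  rot e (transfer e a n v w n' v' w' x) (transfer e a n v w n' v' w' y).
Proof.
intros ha hf hf'.
rewrite (frame_expand e a n v w x ha hf), (frame_expand e a n v w y ha hf).
rewrite (rot_comb e a) by assumption; rewrite !transfer_comb by assumption.
now rewrite (rot_comb e a) by assumption.
Qed.

Lemma is_linear_functional (k0 k1 k2 : R) :
  is_linear (U := prod_NormedModule R_AbsRing (prod_NormedModule R_AbsRing R_NormedModule R_NormedModule) R_NormedModule)
    (V := R_NormedModule) (fun u : R3 => k0 * x0 u + k1 * x1 u + k2 * x2 u).
Proof.
set (U := prod_NormedModule R_AbsRing (prod_NormedModule R_AbsRing R_NormedModule R_NormedModule) R_NormedModule).
assert (sc : forall (k : R) (f : U -> R), is_linear (U := U) (V := R_NormedModule) f ->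
  is_linear (U := U) (V := R_NormedModule) (fun u => k * f u)).
{ intros k f hf; apply (is_linear_comp f (fun y : R_NormedModule => scal k y) hf).
  exact (is_linear_scal_r (K := R_AbsRing) (V := R_NormedModule) k Rmult_comm). }
assert (ad : forall f g : U -> R, is_linear (U := U) (V := R_NormedModule) f ->
  is_linear (U := U) (V := R_NormedModule) g ->
  is_linear (U := U) (V := R_NormedModule) (fun u => f u + g u)).
{ intros f g hf hg; apply (is_linear_comp (fun u => (f u, g u)) (fun y : R * R => plus (fst y) (snd y))).
  - now apply is_linear_prod.
  - exact (is_linear_plus (K := R_AbsRing) (V := R_NormedModule)). }
assert (f12 : is_linear (U := U) (fun u => fst u)) by apply is_linear_fst.
apply ad; [apply ad|]; apply sc.
- exact (is_linear_comp _ _ f12 (is_linear_fst (K := R_AbsRing) (U := R_NormedModule) (V := R_NormedModule))).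
- exact (is_linear_comp _ _ f12 (is_linear_snd (K := R_AbsRing) (U := R_NormedModule) (V := R_NormedModule))).
- exact (is_linear_snd (K := R_AbsRing) (V := R_NormedModule)).
Qed.

Lemma is_linear_transfer e a n v w n' v' w' : is_linear (transfer e a n v w n' v' w').
Proof.
set (k := fun (f g : R3 -> R) (h : R) => e * (h * g n) * f n' + h * g v / a * f v' + h * g w / a * f w').
apply is_linear_ext with (fun u : R3 =>
  (k x0 x0 e * x0 u + k x0 x1 1 * x1 u + k x0 x2 1 * x2 u,
   k x1 x0 e * x0 u + k x1 x1 1 * x1 u + k x1 x2 1 * x2 u,
   k x2 x0 e * x0 u + k x2 x1 1 * x1 u + k x2 x2 1 * x2 u)).
- intros u; unfold transfer, comb, k, dot; f_equal; [f_equal|]; unfold Rdiv; ring.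
- apply (is_linear_prod (fun u => (_, _))); [apply is_linear_prod|]; apply is_linear_functional.
Qed.

(** * Rigid motions of the ambient space *)

Definition sub3 (u v : R3) : R3 := (x0 u - x0 v, x1 u - x1 v, x2 u - x2 v).
Definition add3 (u v : R3) : R3 := (x0 u + x0 v, x1 u + x1 v, x2 u + x2 v).

Lemma minus_sub3 u v : minus u v = sub3 u v.
Proof. reflexivity. Qed.

Lemma transfer_sub3 e a n v w n' v' w' x y :
  transfer e a n v w n' v' w' (sub3 x y) =
  sub3 (transfer e a n v w n' v' w' x) (transfer e a n v w n' v' w' y).
Proof.
unfold transfer, sub3, comb, dot, x0, x1, x2; simpl; f_equal; [f_equal|]; unfold Rdiv; ring.
Qed.

Lemma transfer_smul e a n v w n' v' w' k x y : (x0 y = k * x0 x /\ x1 y = k * x1 x /\ x2 y = k * x2 x) ->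
  let T := transfer e a n v w n' v' w' in
  x0 (T y) = k * x0 (T x) /\ x1 (T y) = k * x1 (T x) /\ x2 (T y) = k * x2 (T x).
Proof.
intros (h0 & h1 & h2); unfold transfer, comb, dot; rewrite h0, h1, h2.
unfold x0, x1, x2; simpl; unfold Rdiv; repeat split; ring.
Qed.

(** Cauchy-Schwarz in the last two coordinates, whose squared lengths are p0^2 - k and q0^2 - k. The
    sign tells the two sheets of the hyperboloid apart. *)
Lemma hyperboloid_dot_neg (k p0 p1 p2 q0 q1 q2 : R) :
  0 < k -> - p0 * p0 + p1 * p1 + p2 * p2 = - k -> - q0 * q0 + q1 * q1 + q2 * q2 = - k ->
  0 < p0 -> 0 < q0 -> - p0 * q0 + p1 * q1 + p2 * q2 < 0.
Proof.
intros hk hp hq hp0 hq0; apply Rnot_le_lt; intros h.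
assert (h1 : p0 * q0 <= p1 * q1 + p2 * q2) by lra.
assert (hpq : 0 < p0 * q0) by now apply Rmult_lt_0_compat.
assert (h2 : (p0 * q0) * (p0 * q0) <= (p1 * q1 + p2 * q2) * (p1 * q1 + p2 * q2))
  by (apply Rmult_le_compat; lra).
assert (h3 : (p1 * q1 + p2 * q2) * (p1 * q1 + p2 * q2) <= (p1 * p1 + p2 * p2) * (q1 * q1 + q2 * q2)).
{ assert (hs := pow2_ge_0 (p1 * q2 - p2 * q1)); lra. }
assert (e1 : p1 * p1 + p2 * p2 = p0 * p0 - k) by lra.
assert (e2 : q1 * q1 + q2 * q2 = q0 * q0 - k) by lra.
rewrite e1, e2 in h3.
assert (0 <= q0 * q0 - k) by (rewrite <- e2; nra).
assert (0 <= p0 * p0 - k) by (rewrite <- e1; nra).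
assert ((p0 * p0 - k) * (q0 * q0 - k) < p0 * p0 * (q0 * q0)).
{ assert (0 < k * (p0 * p0)) by (apply Rmult_lt_0_compat; nra).
  assert (0 <= k * (q0 * q0 - k)) by (apply Rmult_le_pos; lra). lra. }
lra.
Qed.

Definition motion (e a : R) (p0 n v w q0 n' v' w' p : R3) : R3 :=
  add3 q0 (transfer e a n v w n' v' w' (sub3 p p0)).

Lemma add3_sub3 p q : add3 p (sub3 q p) = q.
Proof. apply R3_eq; unfold add3, sub3, x0, x1, x2; simpl; ring. Qed.

Lemma sub3_add3 p q : sub3 (add3 p q) p = q.
Proof. apply R3_eq; unfold add3, sub3, x0, x1, x2; simpl; ring. Qed.

(** For c <> 0 the normal is mu p, so the linear part, which matches the normals, already carries
    [p0] to [q0] and no translation is left. *)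
Lemma motion_linear c a p0 v w q0 v' w' p : a <> 0 -> c <> 0 ->
  frame (sig c) a (normal c p0) v w ->
  motion (sig c) a p0 (normal c p0) v w q0 (normal c q0) v' w' p =
  transfer (sig c) a (normal c p0) v w (normal c q0) v' w' p.
Proof.
intros ha hc hf.
set (n := normal c p0) in *; set (n' := normal c q0).
destruct (mu_nonzero c hc) as [hm hk].
destruct (normal_comp c p0) as (e0 & e1 & e2), (normal_comp c q0) as (f0 & f1 & f2).
rewrite hk in e0, f0; fold n in e0, e1, e2; fold n' in f0, f1, f2.
assert (hT : transfer (sig c) a n v w n' v' w' p0 = q0).
{ destruct (transfer_smul (sig c) a n v w n' v' w' (mu c) p0 n) as (t0 & t1 & t2); [repeat split; lra|].
  assert (hn : transfer (sig c) a n v w n' v' w' n = n').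
  { transitivity (transfer (sig c) a n v w n' v' w' (comb 1 n 0 v 0 w)).
    - f_equal; apply R3_eq; unfold comb, x0, x1, x2; simpl; ring.
    - rewrite transfer_comb by assumption; apply R3_eq; unfold comb, x0, x1, x2; simpl; ring. }
  rewrite hn in t0, t1, t2.
  apply R3_eq; apply (Rmult_eq_reg_l (mu c)); auto; lra. }
unfold motion; fold n n'; rewrite transfer_sub3, hT; apply add3_sub3.
Qed.

Lemma motion_Q c a p0 v w q0 v' w' p : a <> 0 -> Q c p0 -> Q c q0 ->
  frame (sig c) a (normal c p0) v w -> frame (sig c) a (normal c q0) v' w' -> Q c p ->
  Q c (motion (sig c) a p0 (normal c p0) v w q0 (normal c q0) v' w' p).
Proof.
intros ha hp0 hq0 hf hf' hp; split; [|split].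
- intros hc; assert (hn : forall u, dot (sig c) u (normal c u) = x0 u).
  { intros u; rewrite dot_sym, dot_normal_l, hc; destruct mu_zero as [-> ->]; ring. }
  assert (he : sig c = 1) by (unfold sig; destruct (Rlt_dec c 0); lra).
  (* For c = 0 the normal is e_0 everywhere, and the product with it reads off the first coordinate;
     an isometry that matches the normals preserves it. *)
  assert (hnn : forall u u', dot (sig c) u (normal c u') = x0 u).
  { intros u u'; rewrite dot_sym, dot_normal_l, hc; destruct mu_zero as [-> ->]; ring. }
  set (w0 := sub3 p p0).
  assert (ht : x0 (transfer (sig c) a (normal c p0) v w (normal c q0) v' w' w0) = x0 w0).
  { rewrite <- (hnn _ q0), <- (hnn w0 p0).
    rewrite <- (transfer_dot (sig c) a (normal c p0) v w (normal c q0) v' w' w0 (normal c p0)) by assumption.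
    f_equal; transitivity (transfer (sig c) a (normal c p0) v w (normal c q0) v' w' (comb 1 (normal c p0) 0 v 0 w)).
    - rewrite transfer_comb by assumption; apply R3_eq; unfold comb, x0, x1, x2; simpl; ring.
    - f_equal; apply R3_eq; unfold comb, x0, x1, x2; simpl; ring. }
  destruct hp as (hp & _), hp0 as (hp0 & _), hq0 as (hq0 & _).
  transitivity (x0 q0 + x0 (transfer (sig c) a (normal c p0) v w (normal c q0) v' w' w0)); [reflexivity|].
  rewrite ht; transitivity (x0 q0 + (x0 p - x0 p0)); [reflexivity|].
  rewrite hp, hp0, hq0 by assumption; ring.
- intros hc; rewrite motion_linear, form_dot, transfer_dot by assumption.
  rewrite <- form_dot; now apply hp.
- intros hc; assert (hc0 : c <> 0) by lra.
  assert (hT := motion_linear c a p0 v w q0 v' w').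
  set (T := transfer (sig c) a (normal c p0) v w (normal c q0) v' w') in hT.
  assert (d1 : dot (sig c) (T p) (T p) = 1 / c).
  { unfold T; rewrite transfer_dot by assumption; rewrite <- form_dot; now apply hp. }
  assert (hTp0 : T p0 = q0).
  { rewrite <- hT by assumption; unfold motion.
    apply R3_eq; unfold transfer, comb, dot, sub3, add3, x0, x1, x2; simpl; unfold Rdiv; ring. }
  assert (d2 : dot (sig c) (T p) q0 = dot (sig c) p p0).
  { rewrite <- hTp0; unfold T; now apply transfer_dot. }
  rewrite hT by assumption.
  assert (he : sig c = -1) by (unfold sig; destruct (Rlt_dec c 0); lra).
  destruct hp as (_ & hp1 & hp2), hp0 as (_ & hp01 & hp02), hq0 as (_ & hq01 & hq02).
  specialize (hp1 hc0); specialize (hp01 hc0); specialize (hq01 hc0).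
  specialize (hp2 hc); specialize (hp02 hc); specialize (hq02 hc).
  rewrite form_dot in hp1, hp01, hq01.
  assert (hk : 0 < - (1 / c)).
  { unfold Rdiv; rewrite Rmult_1_l; assert (/ c < 0) by now apply Rinv_lt_0_compat. lra. }
  unfold dot in *; rewrite he in *.
  assert (g1 := hyperboloid_dot_neg (- (1 / c)) (x0 p) (x1 p) (x2 p) (x0 p0) (x1 p0) (x2 p0) hk
    ltac:(lra) ltac:(lra) hp2 hp02).
  apply Rnot_le_lt; intros hle.
  (* If T p were on the lower sheet, -T p would be on the upper one and have a negative product with
     q0; yet <T p, q0> = <p, p0> is negative as well. *)
  assert (hlt : 0 < - x0 (T p)).
  { assert (0 < x0 (T p) * x0 (T p)) by nra. nra. }
  assert (g2 := hyperboloid_dot_neg (- (1 / c)) (- x0 (T p)) (- x1 (T p)) (- x2 (T p)) (x0 q0) (x1 q0) (x2 q0) hk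
    ltac:(lra) ltac:(lra) hlt hq02).
  lra.
Qed.

Lemma motion_congruence c a p0 v w q0 v' w' : a <> 0 -> Q c p0 -> Q c q0 ->
  frame (sig c) a (normal c p0) v w -> frame (sig c) a (normal c q0) v' w' ->
  congruence c (motion (sig c) a p0 (normal c p0) v w q0 (normal c q0) v' w').
Proof.
intros ha hp0 hq0 hf hf'; split; [|split].
- intros p hp; now apply motion_Q.
- intros q hq; exists (motion (sig c) a q0 (normal c q0) v' w' p0 (normal c p0) v w q).
  split; [now apply motion_Q|].
  unfold motion; rewrite sub3_add3, transfer_inverse by assumption; apply add3_sub3.
- exists (transfer (sig c) a (normal c p0) v w (normal c q0) v' w'); split; [|split; [|split]].
  + apply is_linear_transfer.
  + intros x y; rewrite !form_dot; now apply transfer_dot.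
  + intros p q; rewrite !minus_sub3; unfold motion; rewrite !transfer_sub3.
    apply R3_eq; unfold add3, sub3, x0, x1, x2; simpl; ring.
  (* J is the cross product with the normal. The linear part respects cross products and sends the
     normal at p to the normal at the image of p. *)
  + intros p u _ _; rewrite !J_rot, (transfer_rot (sig c) a) by assumption; f_equal.
    destruct (Req_dec c 0) as [hc|hc].
    * assert (hn : forall u u', normal c u = normal c u').
      { intros y y'; destruct (normal_comp c y) as (e0 & e1 & e2), (normal_comp c y') as (f0 & f1 & f2).
        destruct mu_zero as [m1 m2]; rewrite hc in *; rewrite m1 in *; apply R3_eq; lra. }
      rewrite (hn p p0), (hn (motion _ _ _ _ _ _ _ _ _ _ _) q0).
      transitivity (transfer (sig c) a (normal c p0) v w (normal c q0) v' w' (comb 1 (normal c p0) 0 v 0 w)).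
      -- f_equal; apply R3_eq; unfold comb, x0, x1, x2; simpl; ring.
      -- rewrite transfer_comb by assumption; apply R3_eq; unfold comb, x0, x1, x2; simpl; ring.
    * rewrite motion_linear by assumption.
      destruct (mu_nonzero c hc) as [hm hk].
      set (T := transfer (sig c) a (normal c p0) v w (normal c q0) v' w').
      destruct (normal_comp c p) as (e0 & e1 & e2), (normal_comp c (T p)) as (f0 & f1 & f2).
      destruct (transfer_smul (sig c) a (normal c p0) v w (normal c q0) v' w' (mu c) p (normal c p))
        as (t0 & t1 & t2); [repeat split; lra|]; fold T in t0, t1, t2.
      apply R3_eq; lra.
Qed.

(** One row of an affine map applied to a solution. The constant k enters the second equation as r
    k, which is zero for a translation of the plane because r = c a. *)
Lemma solves_combination p q r k x v n k1 x' v' n' k2 x'' v'' n'' k3 s :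
  solves p q r x v n s -> solves p q r x' v' n' s -> solves p q r x'' v'' n'' s -> r s * k = 0 ->
  solves p q r (fun u => k + (k1 * x u + k2 * x' u + k3 * x'' u)) (fun u => k1 * v u + k2 * v' u + k3 * v'' u)
    (fun u => k1 * n u + k2 * n' u + k3 * n'' u) s.
Proof.
intros (a1 & a2 & a3) (b1 & b2 & b3) (c1 & c2 & c3) hk; split; [|split].
- auto_derive; [repeat split; eexists; eassumption|].
  rewrite_derive a1; rewrite_derive b1; rewrite_derive c1; ring.
- auto_derive; [repeat split; eexists; eassumption|].
  rewrite_derive a2; rewrite_derive b2; rewrite_derive c2.
  match goal with |- ?l = _ => transitivity (l - r s * k) end; [rewrite hk; ring|ring].
- auto_derive; [repeat split; eexists; eassumption|].
  rewrite_derive a3; rewrite_derive b3; rewrite_derive c3; ring.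
Qed.

Lemma curve_unique c lo hi (a a1 d : R -> R) s0 alpha beta :
  Rbar_interval lo hi s0 ->
  (forall s, Rbar_interval lo hi s -> 0 < a s) ->
  (forall s, Rbar_interval lo hi s -> is_derive a s (a1 s)) ->
  (forall s, Rbar_interval lo hi s -> continuous a1 s) ->
  (forall s, Rbar_interval lo hi s -> continuous d s) ->
  curve_with_data c (Rbar_interval lo hi) a d alpha ->
  curve_with_data c (Rbar_interval lo hi) a d beta ->
  exists T, congruence c T /\ forall s, Rbar_interval lo hi s -> beta s = T (alpha s).
Proof.
intros h0 ha da ca1 cd hal hbe.
assert (ca : forall s, Rbar_interval lo hi s -> continuous a s).
{ intros s hs; apply (ex_derive_continuous a); eexists; now apply da. }
assert (hfa := curve_frame c lo hi a d alpha s0 hal ha ca h0).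
assert (hfb := curve_frame c lo hi a d beta s0 hbe ha ca h0).
assert (ha0 : a s0 <> 0) by (specialize (ha s0 h0); lra).
destruct (proj1 hal s0 h0) as (hQa & _); destruct (proj1 hbe s0 h0) as (hQb & _).
set (nu := normal c (alpha s0)) in *; set (nu' := normal c (beta s0)) in *.
set (T := motion (sig c) (a s0) (alpha s0) nu (vel alpha s0) (nrm c alpha s0)
  (beta s0) nu' (vel beta s0) (nrm c beta s0)).
exists T; split; [now apply motion_congruence|].
set (L := transfer (sig c) (a s0) nu (vel alpha s0) (nrm c alpha s0) nu' (vel beta s0) (nrm c beta s0)).
intros s hs.
set (p := coef_p a1 a); set (q := coef_q a d); set (r := fun u => c * a u).
assert (ci : forall u, Rbar_interval lo hi u -> continuous (fun x => / (2 * a x)) u).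
{ intros u hu; apply (ex_derive_continuous (V := R_NormedModule)); eexists.
  specialize (ha u hu); assert (h := da u hu).
  auto_derive; [split; [eexists; exact h|split; [lra|exact Logic.I]]|reflexivity]. }
assert (cp : forall u, Rbar_interval lo hi u -> continuous p u).
{ intros u hu; apply (continuous_mult a1 (fun x => / (2 * a x))); auto. }
assert (cq : forall u, Rbar_interval lo hi u -> continuous q u).
{ intros u hu; apply (continuous_mult d (fun x => / (2 * a x))); auto. }
assert (cr : forall u, Rbar_interval lo hi u -> continuous r u).
{ intros u hu; apply (continuous_scal_r c a); auto. }
destruct (Rbar_interval_hull lo hi s0 s h0 hs) as (x & y & hx & hy & hxs0 & hxs).
assert (hin : forall u, x <= u <= y -> Rbar_interval lo hi u)
  by (intros u hu; now apply Rbar_interval_between with x y).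
set (kk := fun (f g : R3 -> R) (h : R) => sig c * (h * g nu) * f nu' + h * g (vel alpha s0) / a s0 * f (vel beta s0)
   + h * g (nrm c alpha s0) / a s0 * f (nrm c beta s0)).
assert (hL : forall u, L u =
  (kk x0 x0 (sig c) * x0 u + kk x0 x1 1 * x1 u + kk x0 x2 1 * x2 u,
   kk x1 x0 (sig c) * x0 u + kk x1 x1 1 * x1 u + kk x1 x2 1 * x2 u,
   kk x2 x0 (sig c) * x0 u + kk x2 x1 1 * x1 u + kk x2 x2 1 * x2 u)).
{ intros u; unfold L, transfer, comb, kk, dot; f_equal; [f_equal|]; unfold Rdiv; ring. }
set (b := sub3 (beta s0) (L (alpha s0))).
assert (hT : forall u, T u = add3 b (L u)).
{ intros u; unfold T, motion; fold L; unfold L at 1; rewrite transfer_sub3; fold L.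
  apply R3_eq; unfold b, add3, sub3, x0, x1, x2; simpl; ring. }
(* The motion has a translation part only for c = 0, so its rows carry solutions to solutions. *)
assert (hcb : c * x0 b = 0 /\ c * x1 b = 0 /\ c * x2 b = 0).
{ destruct (Req_dec c 0) as [hc|hc]; [rewrite hc; repeat split; ring|].
  assert (e : T (alpha s0) = L (alpha s0)) by (unfold T, L; now apply motion_linear).
  rewrite hT in e.
  assert (e0 := f_equal x0 e); assert (e1 := f_equal x1 e); assert (e2 := f_equal x2 e).
  change (x0 b + x0 (L (alpha s0)) = x0 (L (alpha s0))) in e0.
  change (x1 b + x1 (L (alpha s0)) = x1 (L (alpha s0))) in e1.
  change (x2 b + x2 (L (alpha s0)) = x2 (L (alpha s0))) in e2.
  replace (x0 b) with 0 by lra; replace (x1 b) with 0 by lra; replace (x2 b) with 0 by lra.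
  repeat split; ring. }
assert (hLv : L (vel alpha s0) = vel beta s0).
{ transitivity (L (comb 0 nu 1 (vel alpha s0) 0 (nrm c alpha s0))).
  - f_equal; apply R3_eq; unfold comb; unfold x0, x1, x2; simpl; ring.
  - unfold L; rewrite transfer_comb by assumption; apply R3_eq; unfold comb, x0, x1, x2; simpl; ring. }
assert (hLn : L (nrm c alpha s0) = nrm c beta s0).
{ transitivity (L (comb 0 nu 0 (vel alpha s0) 1 (nrm c alpha s0))).
  - f_equal; apply R3_eq; unfold comb; unfold x0, x1, x2; simpl; ring.
  - unfold L; rewrite transfer_comb by assumption; apply R3_eq; unfold comb, x0, x1, x2; simpl; ring. }
assert (hT0 : T (alpha s0) = beta s0).
{ rewrite hT; unfold b; apply R3_eq; unfold add3, sub3, x0, x1, x2; simpl; ring. }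
assert (key : forall (f : R3 -> R) k0 k1 k2 kb,
  (forall u, f (L u) = k0 * x0 u + k1 * x1 u + k2 * x2 u) ->
  (forall u, f (T u) = kb + (k0 * x0 u + k1 * x1 u + k2 * x2 u)) -> c * kb = 0 ->
  (forall u, Rbar_interval lo hi u -> solves p q r (fun z => f (beta z)) (fun z => f (vel beta z)) (fun z => f (nrm c beta z)) u) ->
  f (beta s) = f (T (alpha s))).
{ intros f k0 k1 k2 kb hk hkT hkb hsb.
  rewrite hkT.
  apply (solves_unique p q r (fun u => f (beta u)) (fun u => f (vel beta u)) (fun u => f (nrm c beta u))
     (fun u => kb + (k0 * x0 (alpha u) + k1 * x1 (alpha u) + k2 * x2 (alpha u)))
     (fun u => k0 * x0 (vel alpha u) + k1 * x1 (vel alpha u) + k2 * x2 (vel alpha u))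
     (fun u => k0 * x0 (nrm c alpha u) + k1 * x1 (nrm c alpha u) + k2 * x2 (nrm c alpha u)) x y s0
     (fun u hu => cp u (hin u hu)) (fun u hu => cq u (hin u hu)) (fun u hu => cr u (hin u hu))
     (fun u hu => hsb u (hin u hu))); try lra.
  - intros u hu; destruct (curve_solves c lo hi a a1 d alpha u hal ha da (hin u hu)) as (i0 & i1 & i2).
    apply (solves_combination p q r kb _ _ _ k0 _ _ _ k1 _ _ _ k2); auto.
    unfold r; transitivity (a u * (c * kb)); [ring|rewrite hkb; ring].
  - rewrite <- hkT, hT0; reflexivity.
  - rewrite <- hk, hLv; reflexivity.
  - rewrite <- hk, hLn; reflexivity. }
destruct hcb as (b0 & b1 & b2).
assert (hsb : forall u, Rbar_interval lo hi u -> solves3 p q r beta (vel beta) (nrm c beta) u)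
  by (intros u hu; now apply (curve_solves c lo hi)).
apply R3_eq.
- apply (key x0 (kk x0 x0 (sig c)) (kk x0 x1 1) (kk x0 x2 1) (x0 b)); auto.
  + intros u; now rewrite hL.
  + intros u; rewrite hT, hL; reflexivity.
  + intros u hu; destruct (hsb u hu) as (i0 & i1 & i2); exact i0.
- apply (key x1 (kk x1 x0 (sig c)) (kk x1 x1 1) (kk x1 x2 1) (x1 b)); auto.
  + intros u; now rewrite hL.
  + intros u; rewrite hT, hL; reflexivity.
  + intros u hu; destruct (hsb u hu) as (i0 & i1 & i2); exact i1.
- apply (key x2 (kk x2 x0 (sig c)) (kk x2 x1 1) (kk x2 x2 1) (x2 b)); auto.
  + intros u; now rewrite hL.
  + intros u; rewrite hT, hL; reflexivity.
  + intros u hu; destruct (hsb u hu) as (i0 & i1 & i2); exact i2.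
Qed.

(** * Uniqueness for the Liouville equation *)

(* [A] and [B] are minus one half of the partial derivatives of [ln phi]; the
   equation reads [A_s + B_t = c phi]. *)
Definition liouville_system (c : R) (phi A B : R -> R -> R) (u v : R) : Prop :=
  0 < phi u v /\ exists As At Bt,
  dpl phi u v (- 2 * A u v * phi u v) (- 2 * B u v * phi u v) /\
  dpl A u v As At /\ dpl B u v At Bt /\ As + Bt = c * phi u v.

Definition log_s (phi : R -> R -> R) (u v : R) : R :=
  - Derive (fun z => phi z v) u / (2 * phi u v).
Definition log_t (phi : R -> R -> R) (u v : R) : R :=
  - Derive (fun z => phi u z) v / (2 * phi u v).

Lemma dpl_scal (k : R) (f : R -> R -> R) s t a b :
  dpl f s t a b -> dpl (fun u v => k * f u v) s t (k * a) (k * b).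
Proof.
intros h; eapply dpl_eq; [exact (dpl_mult _ _ _ _ _ _ _ _ (dpl_const k s t) h)| |]; cbv beta; ring.
Qed.

Lemma ex_diff_n_1_dpl f u v : locally_2d (ex_diff_n f 1) u v ->
  dpl f u v (Derive (fun z => f z v) u) (Derive (fun z => f u z) v).
Proof.
intros h.
apply (dpl_of_partials f (fun x y => Derive (fun z => f z y) x)).
- revert h; apply locally_2d_imp; intros x y (_ & h & _); now apply Derive_correct.
- apply locally_2d_singleton in h; destruct h as (_ & _ & h & _); now apply Derive_correct.
- apply locally_2d_singleton in h; destruct h as (_ & _ & _ & (h & _) & _); exact h.
Qed.

(** Schwarz's theorem for phi gives A_t = B_s, which is why A and B share the witness [At] in the
    system. *)
Lemma liouville_system_of_solution c phi s t :
  locally_2d (fun u v => 0 < phi u v /\ ex_diff_n phi 2 u v /\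
    Laplacian (fun x y => ln (phi x y)) u v = - 2 * c * phi u v) s t ->
  liouville_system c phi (log_s phi) (log_t phi) s t.
Proof.
intros h.
assert (h2 : locally_2d (fun u v => ex_diff_n phi 2 u v) s t)
  by (revert h; apply locally_2d_imp; tauto).
assert (h0 : locally_2d (fun u v => 0 < phi u v) s t)
  by (revert h; apply locally_2d_imp; tauto).
destruct (locally_2d_singleton _ _ _ h) as (hp & hd2 & hL); clear h.
assert (dphi : locally_2d (fun u v => dpl phi u v (Derive (fun z => phi z v) u) (Derive (fun z => phi u z) v)) s t).
{ generalize (locally_2d_locally2 _ _ _ h2); apply locally_2d_imp; intros u v h.
  apply ex_diff_n_1_dpl; revert h; apply locally_2d_imp; intros x y (a & b & d & e & f).
  repeat split; auto; [destruct e; assumption|destruct f; assumption]. }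
set (ps := fun u v => Derive (fun z => phi z v) u) in *.
set (pt := fun u v => Derive (fun z => phi u z) v) in *.
assert (dps := ex_diff_n_1_dpl ps s t).
assert (dpt := ex_diff_n_1_dpl pt s t).
lapply dps; [clear dps; intros dps|].
2:{ revert h2; apply locally_2d_imp; intros u v (_ & _ & _ & h & _); exact h. }
lapply dpt; [clear dpt; intros dpt|].
2:{ revert h2; apply locally_2d_imp; intros u v (_ & _ & _ & _ & h); exact h. }
assert (hschwarz : Derive (fun z => ps s z) t = Derive (fun z => pt z t) s).
{ symmetry; apply (Schwarz phi s t).
  - revert h2; apply locally_2d_imp; intros u v (_ & a & b & (_ & _ & d & _) & (_ & e & _)).
    repeat split; assumption.
  - destruct hd2 as (_ & _ & _ & _ & (_ & _ & _ & (h & _) & _)); exact h.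
  - destruct hd2 as (_ & _ & _ & (_ & _ & _ & _ & (h & _)) & _); exact h. }
set (pss := Derive (fun z => ps z t) s) in *; set (pst := Derive (fun z => ps s z) t) in *.
set (ptt := Derive (fun z => pt s z) t) in *; rewrite <- hschwarz in dpt.
assert (dphi0 := locally_2d_singleton _ _ _ dphi); simpl in dphi0; fold (ps s t) (pt s t) in dphi0.
assert (dinv := dpl_inv phi s t _ _ ltac:(lra) dphi0).
assert (dA := dpl_mult _ _ _ _ _ _ _ _ (dpl_mult _ _ _ _ _ _ _ _ (dpl_const (- / 2) s t) dps) dinv).
assert (dB := dpl_mult _ _ _ _ _ _ _ _ (dpl_mult _ _ _ _ _ _ _ _ (dpl_const (- / 2) s t) dpt) dinv).
assert (eA : forall u v, - / 2 * ps u v * / phi u v = log_s phi u v).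
{ intros u v; unfold log_s; fold (ps u v); unfold Rdiv; rewrite Rinv_mult; ring. }
assert (eB : forall u v, - / 2 * pt u v * / phi u v = log_t phi u v).
{ intros u v; unfold log_t; fold (pt u v); unfold Rdiv; rewrite Rinv_mult; ring. }
apply (differentiable_pt_lim_ext _ (log_s phi)) in dA; [|apply locally_2d_forall; intros; apply eA].
apply (differentiable_pt_lim_ext _ (log_t phi)) in dB; [|apply locally_2d_forall; intros; apply eB].
split; [exact hp|].
eexists _, _, _; split; [|split; [exact dA|split]].
- eapply dpl_eq; [exact dphi0| |]; [unfold log_s; fold (ps s t)|unfold log_t; fold (pt s t)]; field; lra.
- eapply dpl_eq; [exact dB| |reflexivity]; field; lra.
- assert (L1 : Derive_n (fun x => ln (phi x t)) 2 s = -2 *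
    ((0 * ps s t + - / 2 * pss) * / phi s t + - / 2 * ps s t * (- ps s t * / phi s t * / phi s t))).
  { change (Derive (Derive (fun x => ln (phi x t))) s = -2 *
    ((0 * ps s t + - / 2 * pss) * / phi s t + - / 2 * ps s t * (- ps s t * / phi s t * / phi s t))).
    rewrite (Derive_ext_loc _ (fun x => -2 * log_s phi x t)).
    - rewrite Derive_scal; f_equal; apply is_derive_unique; exact (dpl_derive_s _ _ _ _ _ dA).
    - generalize (locally_2d_1d_const_y _ _ _ (locally_2d_and _ _ _ _ h0 dphi)); apply filter_imp.
      intros u [hu du]; apply is_derive_unique.
      assert (k := dpl_derive_s _ _ _ _ _ (dpl_comp1 ln phi u t (/ phi u t) _ _
        (proj2 (is_derive_Reals _ _ _) (derivable_pt_lim_ln _ hu)) du)).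
      replace (-2 * log_s phi u t) with (/ phi u t * Derive (fun z => phi z t) u); [exact k|].
      unfold log_s; field; lra. }
  assert (L2 : Derive_n (fun x => ln (phi s x)) 2 t = -2 *
    ((0 * pt s t + - / 2 * ptt) * / phi s t + - / 2 * pt s t * (- pt s t * / phi s t * / phi s t))).
  { change (Derive (Derive (fun x => ln (phi s x))) t = -2 *
    ((0 * pt s t + - / 2 * ptt) * / phi s t + - / 2 * pt s t * (- pt s t * / phi s t * / phi s t))).
    rewrite (Derive_ext_loc _ (fun x => -2 * log_t phi s x)).
    - rewrite Derive_scal; f_equal; apply is_derive_unique; exact (dpl_derive_t _ _ _ _ _ dB).
    - generalize (locally_2d_1d_const_x _ _ _ (locally_2d_and _ _ _ _ h0 dphi)); apply filter_imp.
      intros u [hu du]; apply is_derive_unique.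
      assert (k := dpl_derive_t _ _ _ _ _ (dpl_comp1 ln phi s u (/ phi s u) _ _
        (proj2 (is_derive_Reals _ _ _) (derivable_pt_lim_ln _ hu)) du)).
      replace (-2 * log_t phi s u) with (/ phi s u * Derive (fun z => phi s z) u); [exact k|].
      unfold log_t; field; lra. }
  unfold Laplacian in hL.
  change (Derive_n (fun x => ln (phi x t)) 2 s + Derive_n (fun x => ln (phi s x)) 2 t = -2 * c * phi s t) in hL.
  rewrite L1, L2 in hL; lra.
Qed.

(* With [A, B] as above the 1-forms (A^2 - B^2 - c phi) ds + 2AB dt and
   -2AB ds + (A^2 - B^2 + c phi) dt are closed; adding potentials of them to
   2A and -2B gives a holomorphic function whose derivative is (minus twice)
   the Schwarzian of the developing map. No third derivative of phi enters. *)
Lemma liouville_hopf (c : R) (phi A B : R -> R -> R) (s0 delta : R) :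
  0 < delta ->
  (forall u v, box s0 delta delta u v -> liouville_system c phi A B u v) ->
  exists F : C -> C, F (s0, 0) = (2 * A s0 0, - 2 * B s0 0) /\
    forall u v, box s0 delta delta u v -> forall As At Bt,
      dpl A u v As At -> dpl B u v At Bt -> As + Bt = c * phi u v ->
      hol F u v (2 * As + (A u v ^ 2 - B u v ^ 2 - c * phi u v), - 2 * At - 2 * A u v * B u v).
Proof.
intros hdelta hS.
set (As := fun u v => Derive (fun z => A z v) u); set (At := fun u v => Derive (fun z => A u z) v).
set (Bt := fun u v => Derive (fun z => B u z) v).
assert (hd : forall u v, box s0 delta delta u v ->
  dpl phi u v (- 2 * A u v * phi u v) (- 2 * B u v * phi u v) /\
  dpl A u v (As u v) (At u v) /\ dpl B u v (At u v) (Bt u v) /\ As u v + Bt u v = c * phi u v).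
{ intros u v huv; destruct (hS u v huv) as (_ & x & y & z & h1 & h2 & h3 & h4).
  destruct (differentiable_pt_lim_unique _ _ _ _ _ h2) as [e1 e2].
  destruct (differentiable_pt_lim_unique _ _ _ _ _ h3) as [e3 e4].
  unfold As, At, Bt; rewrite e1, e2, e4; auto. }
set (P1 := fun u v => A u v * A u v - B u v * B u v - c * phi u v).
set (R1 := fun u v => 2 * (A u v * B u v)).
set (P2 := fun u v => - (2 * (A u v * B u v))).
set (R2 := fun u v => A u v * A u v - B u v * B u v + c * phi u v).
assert (dd : forall u v, box s0 delta delta u v ->
  dpl P1 u v (2 * A u v * As u v - 2 * B u v * At u v + 2 * c * A u v * phi u v)
     (2 * A u v * At u v - 2 * B u v * Bt u v + 2 * c * B u v * phi u v) /\
  dpl R1 u v (2 * (As u v * B u v + A u v * At u v)) (2 * (At u v * B u v + A u v * Bt u v)) /\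
  dpl P2 u v (- (2 * (As u v * B u v + A u v * At u v))) (- (2 * (At u v * B u v + A u v * Bt u v))) /\
  dpl R2 u v (2 * A u v * As u v - 2 * B u v * At u v - 2 * c * A u v * phi u v)
     (2 * A u v * At u v - 2 * B u v * Bt u v - 2 * c * B u v * phi u v)).
{ intros u v huv; destruct (hd u v huv) as (h1 & h2 & h3 & h4).
  assert (dAA := dpl_mult _ _ _ _ _ _ _ _ h2 h2); assert (dBB := dpl_mult _ _ _ _ _ _ _ _ h3 h3).
  assert (dAB := dpl_mult _ _ _ _ _ _ _ _ h2 h3).
  assert (dc := dpl_scal c _ _ _ _ _ h1).
  assert (d2 := dpl_scal 2 _ _ _ _ _ dAB).
  repeat split.
  - eapply dpl_eq; [exact (dpl_minus _ _ _ _ _ _ _ _ (dpl_minus _ _ _ _ _ _ _ _ dAA dBB) dc)| |]; ring.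
  - eapply dpl_eq; [exact d2| |]; ring.
  - eapply dpl_eq; [exact (dpl_opp _ _ _ _ _ d2)| |]; ring.
  - eapply dpl_eq; [exact (dpl_plus _ _ _ _ _ _ _ _ (dpl_minus _ _ _ _ _ _ _ _ dAA dBB) dc)| |]; ring. }
destruct (closed_form_potential P1 R1
  (fun u v => 2 * A u v * As u v - 2 * B u v * At u v + 2 * c * A u v * phi u v)
  (fun u v => 2 * (As u v * B u v + A u v * At u v))
  (fun u v => 2 * (At u v * B u v + A u v * Bt u v)) s0 delta delta hdelta hdelta) as (Y1 & y10 & y1).
{ intros u v huv; destruct (dd u v huv) as (q1 & q2 & _); destruct (hd u v huv) as (_ & _ & _ & h4).
  split; [|exact q2]; eapply dpl_eq; [exact q1|reflexivity|].
  replace (As u v) with (c * phi u v - Bt u v) by lra; ring. }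
destruct (closed_form_potential P2 R2
  (fun u v => - (2 * (As u v * B u v + A u v * At u v)))
  (fun u v => - (2 * (At u v * B u v + A u v * Bt u v)))
  (fun u v => 2 * A u v * At u v - 2 * B u v * Bt u v - 2 * c * B u v * phi u v)
  s0 delta delta hdelta hdelta) as (Y2 & y20 & y2).
{ intros u v huv; destruct (dd u v huv) as (_ & _ & q1 & q2); destruct (hd u v huv) as (_ & _ & _ & h4).
  split; [exact q1|]; eapply dpl_eq; [exact q2| |reflexivity].
  replace (As u v) with (c * phi u v - Bt u v) by lra; ring. }
exists (fun z => (2 * A (Re z) (Im z) + Y1 (Re z) (Im z), - 2 * B (Re z) (Im z) + Y2 (Re z) (Im z))); split.
- simpl; rewrite y10, y20; f_equal; ring.
- intros u v huv xs xt xb h2 h3 h4.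
  assert (d2A := dpl_scal 2 _ _ _ _ _ h2).
  assert (d2B := dpl_scal (-2) _ _ _ _ _ h3).
  assert (k1 := dpl_plus _ _ _ _ _ _ _ _ d2A (y1 u v huv)).
  assert (k2 := dpl_plus _ _ _ _ _ _ _ _ d2B (y2 u v huv)).
  split.
  + eapply dpl_eq; [exact k1| |]; unfold P1, R1, Re, Im; simpl; ring.
  + eapply dpl_eq; [exact k2| |]; unfold P2, R2, Re, Im; simpl; [ring|].
    replace xs with (c * phi u v - xb) by lra; ring.
Qed.

(** On the axis the data fix phi, A, B and their s-derivatives, hence also A_t = B_s: the complex
    derivatives of the two holomorphic functions agree there. Once they agree everywhere, the
    imaginary part gives A_t, and the real part with A_s + B_t = c phi gives B_t, both without
    derivatives on the right. *)
Lemma liouville_unique (c : R) (phi A B psi A' B' : R -> R -> R) (s0 delta : R) :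
  0 < delta ->
  (forall u v, box s0 delta delta u v -> liouville_system c phi A B u v) ->
  (forall u v, box s0 delta delta u v -> liouville_system c psi A' B' u v) ->
  (forall u, Rabs (u - s0) < delta -> phi u 0 = psi u 0 /\ A u 0 = A' u 0 /\ B u 0 = B' u 0) ->
  forall u v, box s0 delta delta u v -> phi u v = psi u v.
Proof.
intros hdelta hS hS' h0.
destruct (liouville_hopf c phi A B s0 delta hdelta hS) as (F & hF0 & hF).
destruct (liouville_hopf c psi A' B' s0 delta hdelta hS') as (G & hG0 & hG).
set (D := fun z => Cminus (F z) (G z)).
assert (hax : forall u, Rabs (u - s0) < delta -> box s0 delta delta u 0).
{ intros u hu; split; [exact hu|rewrite Rabs_R0; exact hdelta]. }
assert (hs0 : Rabs (s0 - s0) < delta) by (rewrite Rminus_eq_0, Rabs_R0; exact hdelta).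
assert (hD : forall u v, box s0 delta delta u v -> exists l, hol D u v l).
{ intros u v huv.
  destruct (hS u v huv) as (_ & x & y & z & _ & h2 & h3 & h4).
  destruct (hS' u v huv) as (_ & x' & y' & z' & _ & h2' & h3' & h4').
  eexists; apply hol_minus; [exact (hF u v huv x y z h2 h3 h4)|exact (hG u v huv x' y' z' h2' h3' h4')]. }
assert (hDax : forall u, Rabs (u - s0) < delta -> hol D u 0 (RtoC 0)).
{ intros u hu; destruct (h0 u hu) as (e1 & e2 & e3).
  destruct (hS u 0 (hax u hu)) as (_ & x & y & z & _ & h2 & h3 & h4).
  destruct (hS' u 0 (hax u hu)) as (_ & x' & y' & z' & _ & h2' & h3' & h4').
  assert (loc : locally u (fun w => A w 0 = A' w 0 /\ B w 0 = B' w 0)).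
  { assert (hr : 0 < delta - Rabs (u - s0)) by lra.
    exists (mkposreal _ hr); intros w hw; change (Rabs (w - u) < delta - Rabs (u - s0)) in hw.
    apply h0; replace (w - s0) with ((w - u) + (u - s0)) by ring.
    eapply Rle_lt_trans; [apply Rabs_triang|lra]. }
  assert (ex : x = x').
  { assert (k := dpl_derive_s _ _ _ _ _ h2); assert (k' := dpl_derive_s _ _ _ _ _ h2').
    apply is_derive_unique in k; apply is_derive_unique in k'; rewrite <- k, <- k'.
    apply Derive_ext_loc; revert loc; apply filter_imp; tauto. }
  assert (ey : y = y').
  { assert (k := dpl_derive_s _ _ _ _ _ h3); assert (k' := dpl_derive_s _ _ _ _ _ h3').
    apply is_derive_unique in k; apply is_derive_unique in k'; rewrite <- k, <- k'.
    apply Derive_ext_loc; revert loc; apply filter_imp; tauto. }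
  eapply hol_eq; [apply hol_minus; [exact (hF u 0 (hax u hu) x y z h2 h3 h4)|exact (hG u 0 (hax u hu) x' y' z' h2' h3' h4')]|].
  rewrite ex, ey, e1, e2, e3; ring. }
assert (hDz : forall u v, box s0 delta delta u v -> D (u, v) = RtoC 0).
{ apply (identity_theorem D (C_derive D)).
  - intros u v huv; apply ex_hol_C_derive, hD, huv.
  - intros u hu.
    (* The potentials inside F and G vanish at [s0], which fixes the constant of integration. *)
    assert (hDs0 : D (s0, 0) = RtoC 0).
    { unfold D; rewrite hF0, hG0; destruct (h0 s0 hs0) as (_ & -> & ->); ring. }
    apply Rabs_def2 in hu.
    assert (e1 := derive_zero_const (fun w => Re (D (w, 0))) (s0 - delta) (s0 + delta) u s0 ltac:(lra) ltac:(lra)).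
    assert (e2 := derive_zero_const (fun w => Im (D (w, 0))) (s0 - delta) (s0 + delta) u s0 ltac:(lra) ltac:(lra)).
    assert (hd : forall x, s0 - delta < x < s0 + delta ->
      is_derive (fun w => Re (D (w, 0))) x 0 /\ is_derive (fun w => Im (D (w, 0))) x 0).
    { intros x hx; destruct (hDax x ltac:(apply Rabs_def1; lra)) as [k1 k2].
      split; [exact (dpl_derive_s _ _ _ _ _ k1)|exact (dpl_derive_s _ _ _ _ _ k2)]. }
    specialize (e1 (fun x hx => proj1 (hd x hx))); specialize (e2 (fun x hx => proj2 (hd x hx))).
    cbv beta in e1, e2; rewrite hDs0 in e1, e2.
    destruct (D (u, 0)) as [d1 d2]; unfold Re, Im, RtoC in *; simpl in *; congruence. }
intros s t hst; assert (hb := box_elim _ _ _ _ _ hst).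
set (T := Rabs t); assert (hT : 0 <= T < delta) by (split; [apply Rabs_pos|apply hst]).
assert (hbx : forall v, - T <= v <= T -> box s0 delta delta s v).
{ intros v hv; apply box_intro; lra. }
assert (bd : forall f : R -> R -> R, (forall v, - T <= v <= T -> continuity_2d_pt f s v) ->
  exists M, 0 <= M /\ forall v, - T <= v <= T -> Rabs (f s v) <= M).
{ intros f hf; apply (continuous_bounded (fun v => f s v)); intros v hv.
  apply (continuity_2d_continuous_t f), hf, hv. }
assert (cS : forall ph X Y, (forall u v, box s0 delta delta u v -> liouville_system c ph X Y u v) ->
  forall v, - T <= v <= T -> continuity_2d_pt ph s v /\ continuity_2d_pt X s v /\ continuity_2d_pt Y s v).
{ intros ph X Y h v hv; destruct (h s v (hbx v hv)) as (_ & x & y & z & k1 & k2 & k3 & _).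
  repeat split; eapply dpl_continuity; eassumption. }
destruct (bd phi) as (M1 & p1 & m1); [intros v hv; apply (cS phi A B hS v hv)|].
destruct (bd A) as (M2 & p2 & m2); [intros v hv; apply (cS phi A B hS v hv)|].
destruct (bd B) as (M3 & p3 & m3); [intros v hv; apply (cS phi A B hS v hv)|].
destruct (bd psi) as (M4 & p4 & m4); [intros v hv; apply (cS psi A' B' hS' v hv)|].
destruct (bd A') as (M5 & p5 & m5); [intros v hv; apply (cS psi A' B' hS' v hv)|].
destruct (bd B') as (M6 & p6 & m6); [intros v hv; apply (cS psi A' B' hS' v hv)|].
set (M := M1 + M2 + M3 + M4 + M5 + M6 + Rabs c).
assert (hM : 0 <= M) by (unfold M; assert (h := Rabs_pos c); lra).
assert (hc := Rabs_pos c).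
set (x := fun v => phi s v - psi s v); set (y := fun v => A s v - A' s v); set (z := fun v => B s v - B' s v).
assert (hder : forall v, - T <= v <= T ->
  is_derive x v (- 2 * B s v * x v - 2 * psi s v * z v) /\
  is_derive y v (- A s v * z v - B' s v * y v) /\
  is_derive z v (((A s v + A' s v) * y v - (B s v + B' s v) * z v + c * x v) / 2)).
{ intros v hv; assert (hbv := hbx v hv).
  destruct (hS s v hbv) as (_ & xs & xt & xb & h1 & h2 & h3 & h4).
  destruct (hS' s v hbv) as (_ & ys & yt & yb & h1' & h2' & h3' & h4').
  assert (hl : Cminus (2 * xs + (A s v ^ 2 - B s v ^ 2 - c * phi s v), - 2 * xt - 2 * A s v * B s v)
     (2 * ys + (A' s v ^ 2 - B' s v ^ 2 - c * psi s v), - 2 * yt - 2 * A' s v * B' s v) = RtoC 0).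
  { apply (hol_unique D s v).
    - apply hol_minus; [exact (hF s v hbv xs xt xb h2 h3 h4)|exact (hG s v hbv ys yt yb h2' h3' h4')].
    - apply hol_ext_loc with (fun _ => RtoC 0); [|apply hol_const].
      generalize (box_locally _ _ _ _ _ hbv); apply locally_2d_imp; intros; symmetry; auto. }
  unfold Cminus, Cplus, Copp, RtoC in hl; simpl in hl; injection hl as l1 l2.
  assert (k1 := dpl_derive_t _ _ _ _ _ (dpl_minus _ _ _ _ _ _ _ _ h1 h1')).
  assert (k2 := dpl_derive_t _ _ _ _ _ (dpl_minus _ _ _ _ _ _ _ _ h2 h2')).
  assert (k3 := dpl_derive_t _ _ _ _ _ (dpl_minus _ _ _ _ _ _ _ _ h3 h3')).
  split; [|split].
  - replace (- 2 * B s v * x v - 2 * psi s v * z v) with (- 2 * B s v * phi s v - - 2 * B' s v * psi s v)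
      by (unfold x, z; ring); exact k1.
  - replace (- A s v * z v - B' s v * y v) with (xt - yt) by (unfold y, z; lra); exact k2.
  - replace (((A s v + A' s v) * y v - (B s v + B' s v) * z v + c * x v) / 2) with (xb - yb)
      by (unfold x, y, z; lra); exact k3. }
assert (hE : x t * x t + y t * y t + z t * z t = 0).
(* Every product of two differences is at most their sum of squares. The coefficients of these
   products add up to 17 M, and 20 leaves room. *)
{ apply (gronwall_zero (fun v => x v * x v + y v * y v + z v * z v)
    (fun v => 2 * (x v * (- 2 * B s v * x v - 2 * psi s v * z v) + y v * (- A s v * z v - B' s v * y v)
       + z v * (((A s v + A' s v) * y v - (B s v + B' s v) * z v + c * x v) / 2))) (- T) T 0 (20 * M)).
  - intros v hv; destruct (hder v hv) as (k1 & k2 & k3).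
    auto_derive; [repeat split; eexists; eassumption|].
    rewrite_derive k1; rewrite_derive k2; rewrite_derive k3; field.
  - intros v hv; assert (i1 := pow2_ge_0 (x v)); assert (i2 := pow2_ge_0 (y v)); assert (i3 := pow2_ge_0 (z v)); lra.
  - intros v hv; specialize (m2 v hv); specialize (m3 v hv); specialize (m4 v hv).
    specialize (m5 v hv); specialize (m6 v hv).
    set (E := x v * x v + y v * y v + z v * z v).
    assert (i1 := pow2_ge_0 (x v)); assert (i2 := pow2_ge_0 (y v)); assert (i3 := pow2_ge_0 (z v)).
    assert (pr : forall k w, Rabs k <= M -> Rabs w <= E -> Rabs (k * w) <= M * E).
    { intros k w hk hw; rewrite Rabs_mult; apply Rmult_le_compat; auto using Rabs_pos. }
    assert (xx : Rabs (x v * x v) <= E) by (apply Rabs_le_between; unfold E; lra).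
    assert (yy : Rabs (y v * y v) <= E) by (apply Rabs_le_between; unfold E; lra).
    assert (zz : Rabs (z v * z v) <= E) by (apply Rabs_le_between; unfold E; lra).
    assert (xz : Rabs (x v * z v) <= E).
    { assert (j1 := pow2_ge_0 (x v + z v)); assert (j2 := pow2_ge_0 (x v - z v)).
      apply Rabs_le_between; unfold E; lra. }
    assert (yz : Rabs (y v * z v) <= E).
    { assert (j1 := pow2_ge_0 (y v + z v)); assert (j2 := pow2_ge_0 (y v - z v)).
      apply Rabs_le_between; unfold E; lra. }
    assert (n1 := pr (B s v) _ ltac:(unfold M; lra) xx).
    assert (n2 := pr (psi s v) _ ltac:(unfold M; lra) xz).
    assert (n3 := pr (A s v) _ ltac:(unfold M; lra) yz).
    assert (n4 := pr (B' s v) _ ltac:(unfold M; lra) yy).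
    assert (n5 := pr (A' s v) _ ltac:(unfold M; lra) yz).
    assert (n6 := pr (B s v) _ ltac:(unfold M; lra) zz).
    assert (n7 := pr (B' s v) _ ltac:(unfold M; lra) zz).
    assert (n8 := pr c _ ltac:(unfold M; lra) xz).
    apply Rabs_le_between in n1; apply Rabs_le_between in n2; apply Rabs_le_between in n3.
    apply Rabs_le_between in n4; apply Rabs_le_between in n5; apply Rabs_le_between in n6.
    apply Rabs_le_between in n7; apply Rabs_le_between in n8.
    assert (hME : 0 <= M * E) by (apply Rmult_le_pos; [exact hM|unfold E; lra]).
    apply Rabs_le_between; lra.
  - lra.
  - destruct (h0 s) as (e1 & e2 & e3); [apply hst|].
    unfold x, y, z; rewrite e1, e2, e3; ring.
  - assert (h := Rabs_le_between t T); apply h; unfold T; lra. }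
assert (i1 := pow2_ge_0 (x t)); assert (i2 := pow2_ge_0 (y t)); assert (i3 := pow2_ge_0 (z t)).
assert (hx : x t * x t = 0) by lra.
apply Rmult_integral in hx; unfold x in hx; lra.
Qed.

(** * Metrics induced by quotients *)

Lemma Laplacian_of_dpl (f fs ft : R -> R -> R) s t a b' a' b :
  locally_2d (fun u v => dpl f u v (fs u v) (ft u v)) s t ->
  dpl fs s t a b' -> dpl ft s t a' b -> Laplacian f s t = a + b.
Proof.
intros h hs ht; unfold Laplacian.
change (Derive (Derive (fun x => f x t)) s + Derive (Derive (fun y => f s y)) t = a + b).
f_equal.
- rewrite (Derive_ext_loc _ (fun x => fs x t)).
  + apply is_derive_unique; exact (dpl_derive_s _ _ _ _ _ hs).
  + generalize (locally_2d_1d_const_y _ _ _ h); apply filter_imp; intros x hx.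
    apply is_derive_unique; exact (dpl_derive_s _ _ _ _ _ hx).
- rewrite (Derive_ext_loc _ (fun y => ft s y)).
  + apply is_derive_unique; exact (dpl_derive_t _ _ _ _ _ ht).
  + generalize (locally_2d_1d_const_x _ _ _ h); apply filter_imp; intros x hx.
    apply is_derive_unique; exact (dpl_derive_t _ _ _ _ _ hx).
Qed.

(** For positive f, the Laplacian of ln f is (f Delta f - |grad f|^2) / f^2; the result is this
    expression for g minus twice the one for m. *)
Lemma Laplacian_ln_quotient (g gs gt m ms mt : R -> R -> R) s t gss gst gts gtt mss mst mts mtt :
  locally_2d (fun u v => 0 < g u v /\ m u v <> 0 /\
     dpl g u v (gs u v) (gt u v) /\ dpl m u v (ms u v) (mt u v)) s t ->
  dpl gs s t gss gst -> dpl gt s t gts gtt -> dpl ms s t mss mst -> dpl mt s t mts mtt ->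
  Laplacian (fun u v => ln (4 * g u v / m u v ^ 2)) s t =
    (g s t * (gss + gtt) - gs s t ^ 2 - gt s t ^ 2) / g s t ^ 2
    - 2 * ((m s t * (mss + mtt) - ms s t ^ 2 - mt s t ^ 2) / m s t ^ 2).
Proof.
intros h dgs dgt dms dmt.
destruct (locally_2d_singleton _ _ _ h) as (hg & hm & dg & dm).
assert (ig := dpl_inv g s t _ _ ltac:(lra) dg); assert (im := dpl_inv m s t _ _ hm dm).
assert (k1 := dpl_minus _ _ _ _ _ _ _ _ (dpl_mult _ _ _ _ _ _ _ _ dgs ig)
  (dpl_scal 2 _ _ _ _ _ (dpl_mult _ _ _ _ _ _ _ _ dms im))).
assert (k2 := dpl_minus _ _ _ _ _ _ _ _ (dpl_mult _ _ _ _ _ _ _ _ dgt ig)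
  (dpl_scal 2 _ _ _ _ _ (dpl_mult _ _ _ _ _ _ _ _ dmt im))).
cbv beta in k1, k2.
assert (hl : locally_2d (fun u v => dpl (fun x y => ln (4 * g x y / m x y ^ 2)) u v
  (gs u v * / g u v - 2 * (ms u v * / m u v)) (gt u v * / g u v - 2 * (mt u v * / m u v))) s t).
{ revert h; apply locally_2d_imp; intros u v (hg' & hm' & dg' & dm').
  assert (hm2 : 0 < m u v * m u v) by (assert (0 < m u v ^ 2) by (apply pow2_gt_0; exact hm'); lra).
  assert (e := dpl_mult _ _ _ _ _ _ _ _ (dpl_scal 4 _ _ _ _ _ dg')
    (dpl_inv _ _ _ _ _ (Rgt_not_eq _ _ hm2) (dpl_mult _ _ _ _ _ _ _ _ dm' dm'))).
  assert (hp : 0 < 4 * g u v * / (m u v * m u v)).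
  { apply Rmult_lt_0_compat; [lra|now apply Rinv_0_lt_compat]. }
  assert (k := dpl_comp1 ln _ u v _ _ _ (proj2 (is_derive_Reals _ _ _) (derivable_pt_lim_ln _ hp)) e).
  cbv beta in k.
  eapply differentiable_pt_lim_ext; [|eapply dpl_eq; [exact k| |]].
  - apply locally_2d_forall; intros x y; unfold Rdiv; do 3 f_equal; ring.
  - field; split; [exact hm'|lra].
  - field; split; [exact hm'|lra]. }
rewrite (Laplacian_of_dpl _ _ _ s t _ _ _ _ hl k1 k2).
field; split; [exact hm|lra].
Qed.

(** The squared modulus of F. [n2s] and [n2t] are its partial derivatives when F1 is the complex
    derivative of F. *)
Definition n2 (F : C -> C) (u v : R) : R := Re (F (u, v)) ^ 2 + Im (F (u, v)) ^ 2.
Definition n2s (F F1 : C -> C) (u v : R) : R :=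
  2 * (Re (F (u, v)) * Re (F1 (u, v)) + Im (F (u, v)) * Im (F1 (u, v))).
Definition n2t (F F1 : C -> C) (u v : R) : R :=
  2 * (Im (F (u, v)) * Re (F1 (u, v)) - Re (F (u, v)) * Im (F1 (u, v))).

Lemma n2_dpl F F1 u v : hol F u v (F1 (u, v)) -> dpl (n2 F) u v (n2s F F1 u v) (n2t F F1 u v).
Proof.
intros [h1 h2].
assert (k := dpl_plus _ _ _ _ _ _ _ _ (dpl_mult _ _ _ _ _ _ _ _ h1 h1) (dpl_mult _ _ _ _ _ _ _ _ h2 h2)).
eapply differentiable_pt_lim_ext; [|eapply dpl_eq; [exact k| |]].
- apply locally_2d_forall; intros; unfold n2; ring.
- unfold n2s; ring.
- unfold n2t; ring.
Qed.

Lemma n2s_dpl F F1 l m u v : hol F u v l -> hol F1 u v m ->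
  let z := F (u, v) in let w := F1 (u, v) in
  dpl (n2s F F1) u v (2 * (Re l * Re w + Im l * Im w + Re z * Re m + Im z * Im m))
    (2 * (- Im l * Re w + Re l * Im w - Re z * Im m + Im z * Re m)).
Proof.
intros [h1 h2] [k1 k2] z w.
assert (k := dpl_scal 2 _ _ _ _ _ (dpl_plus _ _ _ _ _ _ _ _ (dpl_mult _ _ _ _ _ _ _ _ h1 k1) (dpl_mult _ _ _ _ _ _ _ _ h2 k2))).
eapply dpl_eq; [exact k| |]; unfold z, w; ring.
Qed.

Lemma n2t_dpl F F1 l m u v : hol F u v l -> hol F1 u v m ->
  let z := F (u, v) in let w := F1 (u, v) in
  dpl (n2t F F1) u v (2 * (Im l * Re w - Re l * Im w + Im z * Re m - Re z * Im m))
    (2 * (Re l * Re w + Im l * Im w - Im z * Im m - Re z * Re m)).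
Proof.
intros [h1 h2] [k1 k2] z w.
assert (k := dpl_scal 2 _ _ _ _ _ (dpl_minus _ _ _ _ _ _ _ _ (dpl_mult _ _ _ _ _ _ _ _ h2 k1) (dpl_mult _ _ _ _ _ _ _ _ h1 k2))).
eapply dpl_eq; [exact k| |]; unfold z, w; ring.
Qed.

Definition wronskian (N N1 D D1 : C -> C) (z : C) : C :=
  Cminus (Cmult (N1 z) (D z)) (Cmult (N z) (D1 z)).
Definition quotient_metric (c : R) (N N1 D D1 : C -> C) (u v : R) : R :=
  4 * n2 (wronskian N N1 D D1) u v / (n2 D u v + c * n2 N u v) ^ 2.

Lemma n2_Cn n F s t : holn n F s t -> Cn n (n2 F) s t.
Proof.
intros h; destruct (holn_Cn n F s t h) as [h1 h2].
apply Cn_ext_loc with (fun u v => Re (F (u, v)) * Re (F (u, v)) + Im (F (u, v)) * Im (F (u, v))).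
- apply locally_2d_forall; intros; unfold n2; ring.
- apply Cn_plus; apply Cn_mult; assumption.
Qed.

Lemma n2_pos F u v : F (u, v) <> RtoC 0 -> 0 < n2 F u v.
Proof. apply Cnorm2_pos. Qed.

(* Lagrange's identity: with m = |D|^2 + c|N|^2 one has
   m Delta m - |grad m|^2 = 4 c |W|^2, while ln |W|^2 is harmonic. *)
Lemma quotient_metric_liouville c (N N1 N2 D D1 D2 : C -> C) s t l3 d3 :
  locally_2d (fun u v => hol N u v (N1 (u, v)) /\ hol N1 u v (N2 (u, v)) /\
     hol D u v (D1 (u, v)) /\ hol D1 u v (D2 (u, v))) s t ->
  hol N2 s t l3 -> hol D2 s t d3 ->
  wronskian N N1 D D1 (s, t) <> RtoC 0 -> n2 D s t + c * n2 N s t <> 0 ->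
  Laplacian (fun u v => ln (quotient_metric c N N1 D D1 u v)) s t =
    - 2 * c * quotient_metric c N N1 D D1 s t.
Proof.
intros h hN2 hD2 hW hm.
destruct (locally_2d_singleton _ _ _ h) as (hN & hN1 & hD & hD1).
set (W := wronskian N N1 D D1) in *.
set (W1 := fun z => Cminus (Cmult (N2 z) (D z)) (Cmult (N z) (D2 z))).
assert (lW : forall u v, hol N u v (N1 (u, v)) /\ hol N1 u v (N2 (u, v)) /\
     hol D u v (D1 (u, v)) /\ hol D1 u v (D2 (u, v)) -> hol W u v (W1 (u, v))).
{ intros u v (k1 & k2 & k3 & k4).
  eapply hol_eq; [apply hol_minus; apply hol_mult; eassumption|unfold W1; ring]. }
assert (lW1 : exists w2, hol W1 s t w2).
{ eexists; apply hol_minus; apply hol_mult; eassumption. }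
destruct lW1 as [w2 lW1].
assert (hW0 := lW s t (conj hN (conj hN1 (conj hD hD1)))).
set (m := fun u v => n2 D u v + c * n2 N u v).
set (ms := fun u v => n2s D D1 u v + c * n2s N N1 u v).
set (mt := fun u v => n2t D D1 u v + c * n2t N N1 u v).
assert (dm : forall u v, hol N u v (N1 (u, v)) -> hol D u v (D1 (u, v)) -> dpl m u v (ms u v) (mt u v)).
{ intros u v k1 k2; apply dpl_plus; [now apply n2_dpl|now apply dpl_scal, n2_dpl]. }
assert (dms := dpl_plus _ _ _ _ _ _ _ _ (n2s_dpl _ _ _ _ _ _ hD hD1) (dpl_scal c _ _ _ _ _ (n2s_dpl _ _ _ _ _ _ hN hN1))).
assert (dmt := dpl_plus _ _ _ _ _ _ _ _ (n2t_dpl _ _ _ _ _ _ hD hD1) (dpl_scal c _ _ _ _ _ (n2t_dpl _ _ _ _ _ _ hN hN1))).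
change (Laplacian (fun u v => ln (4 * n2 W u v / m u v ^ 2)) s t = - 2 * c * (4 * n2 W s t / m s t ^ 2)).
assert (cW : continuity_2d_pt (n2 W) s t) by (eapply dpl_continuity; exact (n2_dpl W W1 s t hW0)).
assert (cm : continuity_2d_pt m s t) by (eapply dpl_continuity; exact (dm s t hN hD)).
assert (hl : locally_2d (fun u v => 0 < n2 W u v /\ m u v <> 0 /\
  dpl (n2 W) u v (n2s W W1 u v) (n2t W W1 u v) /\ dpl m u v (ms u v) (mt u v)) s t).
{ generalize (locally_2d_and _ _ _ _ h (locally_2d_and _ _ _ _
    (continuity_2d_pt_locally _ _ _ _ cW (open_gt 0 _ (n2_pos W s t hW)))
    (continuity_2d_pt_neq_0 _ _ _ cm hm))); apply locally_2d_imp.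
  intros u v (hall & hp & hq); repeat split; auto.
  - apply n2_dpl, lW, hall.
  - apply dm; tauto. }
rewrite (Laplacian_ln_quotient (n2 W) (n2s W W1) (n2t W W1) m ms mt s t _ _ _ _ _ _ _ _ hl
  (n2s_dpl W W1 _ _ s t hW0 lW1) (n2t_dpl W W1 _ _ s t hW0 lW1) dms dmt).
assert (hWp := n2_pos W s t hW).
  assert (eW : n2 W s t = n2 W s t) by reflexivity.
  assert (hm' : m s t <> 0) by exact hm.
  assert (z1 : n2 W s t * (2 * (Re (W1 (s, t)) * Re (W1 (s, t)) + Im (W1 (s, t)) * Im (W1 (s, t))
      + Re (W (s, t)) * Re w2 + Im (W (s, t)) * Im w2) +
     2 * (Re (W1 (s, t)) * Re (W1 (s, t)) + Im (W1 (s, t)) * Im (W1 (s, t))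
      - Im (W (s, t)) * Im w2 - Re (W (s, t)) * Re w2)) - n2s W W1 s t ^ 2 - n2t W W1 s t ^ 2 = 0).
  { unfold n2, n2s, n2t; ring. }
  rewrite z1.
  match goal with |- _ - 2 * (?x / _) = _ => assert (z2 : x = 4 * c * n2 W s t) end.
  { unfold m, ms, mt, n2, n2s, n2t, W, wronskian.
    destruct (N (s, t)) as [a1 a2], (N1 (s, t)) as [b1 b2], (N2 (s, t)) as [e1 e2].
    destruct (D (s, t)) as [f1 f2], (D1 (s, t)) as [g1 g2], (D2 (s, t)) as [h1 h2].
    unfold Re, Im, Cminus, Cplus, Copp, Cmult; simpl; ring. }
  rewrite z2; field; split; [exact hm'|lra].
Qed.

Lemma quotient_metric_Cn c (N N1 D D1 : C -> C) s t :
  holn 2 N s t -> holn 2 N1 s t -> holn 2 D s t -> holn 2 D1 s t ->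
  n2 D s t + c * n2 N s t <> 0 -> Cn 2 (quotient_metric c N N1 D D1) s t.
Proof.
intros h1 h2 h3 h4 hm.
apply Cn_ext_loc with (fun u v => 4 * n2 (wronskian N N1 D D1) u v
  * (/ (n2 D u v + c * n2 N u v) * / (n2 D u v + c * n2 N u v))).
- apply locally_2d_forall; intros u v; unfold quotient_metric, Rdiv; f_equal.
  rewrite <- Rinv_mult; f_equal; ring.
- assert (hi : Cn 2 (fun u v => / (n2 D u v + c * n2 N u v)) s t).
  { apply Cn_inv; [exact hm|]; apply Cn_plus; [now apply n2_Cn|].
    apply Cn_mult; [apply Cn_const|now apply n2_Cn]. }
  apply Cn_mult; [|now apply Cn_mult].
  apply Cn_mult; [apply Cn_const|]; apply n2_Cn, holn_minus; now apply holn_mult.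
Qed.

(** * Cauchy data on the axis *)

Definition smooth_on (U : C -> Prop) (F : C -> C) : Prop :=
  forall s t, U (s, t) -> forall n, holn n F s t.

Lemma open_locally_2d (U : C -> Prop) s t : open U -> U (s, t) ->
  locally_2d (fun u v => U (u, v)) s t.
Proof. intros ho h; apply locally_2d_C; exact (ho _ h). Qed.

Lemma smooth_on_derive U F : open U -> smooth_on U F ->
  (forall s t, U (s, t) -> hol F s t (C_derive F (s, t))) /\ smooth_on U (C_derive F).
Proof.
intros ho hF.
assert (h1 : forall s t, U (s, t) -> hol F s t (C_derive F (s, t))).
{ intros s t h; apply ex_hol_C_derive.
  exact (locally_2d_singleton _ _ _ (holn_locally 0 F s t (hF s t h 1%nat))). }
split; [exact h1|].
intros s t h n; destruct (hF s t h (S n)) as (F1 & k & k1).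
apply holn_ext_loc with F1; [|exact k1].
revert k; apply locally_2d_imp; intros u v k; symmetry; now apply hol_C_derive.
Qed.

(** The complex derivative at an axis point is the derivative along the axis, so it is read off the
    restrictions f and g. *)
Lemma hol_axis F s l (f g : R -> R) f1 g1 :
  hol F s 0 l -> locally s (fun u => F (u, 0) = (f u, g u)) ->
  is_derive f s f1 -> is_derive g s g1 -> l = (f1, g1).
Proof.
intros [h1 h2] h hf hg.
assert (e1 : Re l = f1).
{ assert (k := dpl_derive_s _ _ _ _ _ h1); apply is_derive_unique in k; rewrite <- k.
  rewrite <- (is_derive_unique _ _ _ hf); apply Derive_ext_loc.
  revert h; apply filter_imp; intros u hu; exact (f_equal Re hu). }
assert (e2 : Im l = g1).
{ assert (k := dpl_derive_s _ _ _ _ _ h2); apply is_derive_unique in k; rewrite <- k.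
  rewrite <- (is_derive_unique _ _ _ hg); apply Derive_ext_loc.
  revert h; apply filter_imp; intros u hu; exact (f_equal Im hu). }
destruct l; unfold Re, Im in *; simpl in *; congruence.
Qed.

(** Here (n0, n1, n2) is the normal, D = 1 + n0 and N = x1' + i x2'. Then W1 + i W2 is the Wronskian
    N' D - N D', and V1 + i V2 its derivative. The conclusions are the denominator |D|^2 + c |N|^2,
    the squared modulus of the Wronskian, and the t-derivative of the latter. *)
Lemma axis_algebra (e c a q p k m x0' x1' x2' v0 v1 v2 w0 w1 w2 : R) :
  let n0 := m * x0' + k in let n1 := m * x1' in let n2 := m * x2' in
  e * e = 1 -> e * (m * m) = c -> c * k = 0 ->
  e * n0 * n0 + n1 * n1 + n2 * n2 = e ->
  e * n0 * v0 + n1 * v1 + n2 * v2 = 0 ->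
  e * v0 * v0 + v1 * v1 + v2 * v2 = a ->
  w0 = p * v0 - q * (e * (n1 * v2 - n2 * v1)) - c * a * x0' ->
  w1 = p * v1 - q * (n2 * v0 - n0 * v2) - c * a * x1' ->
  w2 = p * v2 - q * (n0 * v1 - n1 * v0) - c * a * x2' ->
  let W1 := v1 * (1 + n0) - x1' * (m * v0) in let W2 := v2 * (1 + n0) - x2' * (m * v0) in
  let V1 := w1 * (1 + n0) - x1' * (m * w0) in let V2 := w2 * (1 + n0) - x2' * (m * w0) in
  (1 + n0) ^ 2 + c * (x1' ^ 2 + x2' ^ 2) = 2 * (1 + n0) /\
  W1 ^ 2 + W2 ^ 2 = a * (1 + n0) ^ 2 /\
  2 * (W2 * V1 - W1 * V2) = 2 * q * a * (1 + n0) ^ 2 + 2 * a * (1 + n0) * (c * (x2' * v1 - x1' * v2)).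
Proof.
intros n0 n1 n2 he hc hk hnn hnv hvv h0 h1 h2 W1 W2 V1 V2.
assert (hnn' : n0 * n0 + e * (n1 * n1 + n2 * n2) = 1).
{ transitivity (e * e * (n0 * n0) + e * (n1 * n1 + n2 * n2)); [rewrite he; ring|].
  transitivity (e * (e * n0 * n0 + n1 * n1 + n2 * n2)); [ring|rewrite hnn; exact he]. }
assert (eW1 : W1 = v1 * (1 + n0) - n1 * v0) by (unfold W1, n1; ring).
assert (eW2 : W2 = v2 * (1 + n0) - n2 * v0) by (unfold W2, n2; ring).
assert (hG : W1 ^ 2 + W2 ^ 2 = a * (1 + n0) ^ 2).
{ rewrite eW1, eW2.
  transitivity ((1 + n0) ^ 2 * (v1 * v1 + v2 * v2) - 2 * (1 + n0) * v0 * (e * n0 * v0 + n1 * v1 + n2 * v2)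
    + 2 * (1 + n0) * v0 * e * n0 * v0 + v0 * v0 * (n1 * n1 + n2 * n2)); [ring|].
  rewrite hnv; replace (n1 * n1 + n2 * n2) with (e - e * n0 * n0) by lra; rewrite <- hvv; ring. }
split; [|split; [exact hG|]].
- replace (c * (x1' ^ 2 + x2' ^ 2)) with (e * (n1 * n1 + n2 * n2)) by (rewrite <- hc; unfold n1, n2; ring).
  replace (e * (n1 * n1 + n2 * n2)) with (1 - n0 * n0) by lra; ring.
- assert (l1 : (n2 * v0 - n0 * v2) * (1 + n0) - n1 * (e * (n1 * v2 - n2 * v1)) = - W2).
  { rewrite eW2.
    transitivity (- (v2 * (1 + n0) - n2 * v0) + (- v2 * (n0 * n0 + e * (n1 * n1 + n2 * n2) - 1)
      + e * n2 * (e * n0 * v0 + n1 * v1 + n2 * v2) + (1 - e * e) * n0 * n2 * v0)); [ring|].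
    rewrite hnn', hnv, he; ring. }
  assert (l2 : (n0 * v1 - n1 * v0) * (1 + n0) - n2 * (e * (n1 * v2 - n2 * v1)) = W1).
  { rewrite eW1.
    transitivity ((v1 * (1 + n0) - n1 * v0) + (v1 * (n0 * n0 + e * (n1 * n1 + n2 * n2) - 1)
      - e * n1 * (e * n0 * v0 + n1 * v1 + n2 * v2) - (1 - e * e) * n0 * n1 * v0)); [ring|].
    rewrite hnn', hnv, he; ring. }
  assert (eV1 : V1 = p * W1 + q * W2 - a * (c * x1')).
  { transitivity (p * W1 - q * ((n2 * v0 - n0 * v2) * (1 + n0) - n1 * (e * (n1 * v2 - n2 * v1)))
      - a * (c * x1' + x1' * (c * k))).
    - unfold V1; rewrite h0, h1; unfold W1, n0, n1, n2; ring.
    - rewrite l1, hk; ring. }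
  assert (eV2 : V2 = p * W2 - q * W1 - a * (c * x2')).
  { transitivity (p * W2 - q * ((n0 * v1 - n1 * v0) * (1 + n0) - n2 * (e * (n1 * v2 - n2 * v1)))
      - a * (c * x2' + x2' * (c * k))).
    - unfold V2; rewrite h0, h2; unfold W2, n0, n1, n2; ring.
    - rewrite l2, hk; ring. }
  rewrite eV1, eV2.
  transitivity (2 * q * (W1 ^ 2 + W2 ^ 2) + 2 * a * c * (W1 * x2' - W2 * x1')); [ring|].
  rewrite hG; unfold W1, W2; ring.
Qed.

(** By the preceding algebra the metric is 4 a D^2 / (2 D)^2 = a. In its t-derivative the term K
    from the Wronskian cancels against the one from the denominator, and 2 q a = d remains. *)
Lemma quotient_metric_axis c lo hi (a a1 d : R -> R) alpha U N D s :
  curve_with_data c (Rbar_interval lo hi) a d alpha ->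
  (forall s, Rbar_interval lo hi s -> 0 < a s) ->
  (forall s, Rbar_interval lo hi s -> is_derive a s (a1 s)) ->
  open U -> (forall s, Rbar_interval lo hi s -> U (s, 0)) ->
  smooth_on U N -> smooth_on U D ->
  (forall s, Rbar_interval lo hi s -> N (s, 0) = (x1 (alpha s), x2 (alpha s))) ->
  (forall s, Rbar_interval lo hi s -> D (s, 0) = (1 + x0 (normal c (alpha s)), 0)) ->
  Rbar_interval lo hi s -> 1 + x0 (normal c (alpha s)) <> 0 ->
  n2 D s 0 + c * n2 N s 0 <> 0 /\ wronskian N (C_derive N) D (C_derive D) (s, 0) <> RtoC 0 /\
  quotient_metric c N (C_derive N) D (C_derive D) s 0 = a s /\
  is_derive (fun t => quotient_metric c N (C_derive N) D (C_derive D) s t) 0 (d s).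
Proof.
intros hcurve ha da hU hIU hN hD hNax hDax hs hD0.
set (I := Rbar_interval lo hi) in *.
set (N1 := C_derive N); set (D1 := C_derive D).
destruct (smooth_on_derive U N hU hN) as [dN hN1]; destruct (smooth_on_derive U D hU hD) as [dD hD1].
fold N1 in dN, hN1; fold D1 in dD, hD1.
destruct (smooth_on_derive U N1 hU hN1) as [dN1 _]; destruct (smooth_on_derive U D1 hU hD1) as [dD1 _].
assert (hreg := proj1 hcurve).
assert (ca : forall u, I u -> continuous a u).
{ intros u hu; apply (ex_derive_continuous a); eexists; now apply da. }
assert (hloc : forall u, I u -> locally u I) by (intros u hu; now apply Rbar_interval_locally).
assert (nx0 : forall p, x0 (normal c p) = mu c * x0 p + mu0 c) by (intros p; apply normal_comp).
assert (axN1 : forall u, I u -> N1 (u, 0) = (x1 (vel alpha u), x2 (vel alpha u))).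
{ intros u hu; destruct (regular_curve_derive _ _ _ _ hreg hu) as ((h0 & h1 & h2) & _).
  apply (hol_axis N u _ (fun u => x1 (alpha u)) (fun u => x2 (alpha u))); auto.
  generalize (hloc u hu); apply filter_imp; auto. }
assert (axD1 : forall u, I u -> D1 (u, 0) = (mu c * x0 (vel alpha u), 0)).
{ intros u hu; destruct (regular_curve_derive _ _ _ _ hreg hu) as ((h0 & h1 & h2) & _).
  apply (hol_axis D u _ (fun u => 1 + (mu c * x0 (alpha u) + mu0 c)) (fun _ => 0)); auto.
  - generalize (hloc u hu); apply filter_imp; intros y hy; rewrite hDax, nx0 by exact hy; reflexivity.
  - eapply derive_eq; [apply derive_add; [apply derive_cst|apply derive_add;
      [apply (derive_mul (fun _ => mu c)); [apply derive_cst|exact h0]|apply derive_cst]]|].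
    cbv beta; ring.
  - apply derive_cst. }
destruct (regular_curve_derive _ _ _ _ hreg hs) as (_ & (h0 & h1 & h2)).
set (w := curve_deriv 2 alpha s) in *.
assert (axN2 : C_derive N1 (s, 0) = (x1 w, x2 w)).
{ apply (hol_axis N1 s _ (fun u => x1 (vel alpha u)) (fun u => x2 (vel alpha u))); auto.
  generalize (hloc s hs); apply filter_imp; auto. }
assert (axD2 : C_derive D1 (s, 0) = (mu c * x0 w, 0)).
{ apply (hol_axis D1 s _ (fun u => mu c * x0 (vel alpha u)) (fun _ => 0)); auto.
  - generalize (hloc s hs); apply filter_imp; auto.
  - eapply derive_eq; [apply (derive_mul (fun _ => mu c)); [apply derive_cst|exact h0]|].
    cbv beta; ring.
  - apply derive_cst. }
assert (hf := curve_frame c lo hi a d alpha s hcurve ha ca hs).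
destruct (curve_solves c lo hi a a1 d alpha s hcurve ha da hs) as ((_ & e0 & _) & (_ & e1 & _) & (_ & e2 & _)).
assert (w0 : x0 w = coef_p a1 a s * x0 (vel alpha s) - coef_q a d s * x0 (nrm c alpha s) - c * a s * x0 (alpha s))
  by exact (eq_trans (eq_sym (is_derive_unique _ _ _ h0)) (is_derive_unique _ _ _ e0)).
assert (w1 : x1 w = coef_p a1 a s * x1 (vel alpha s) - coef_q a d s * x1 (nrm c alpha s) - c * a s * x1 (alpha s))
  by exact (eq_trans (eq_sym (is_derive_unique _ _ _ h1)) (is_derive_unique _ _ _ e1)).
assert (w2 : x2 w = coef_p a1 a s * x2 (vel alpha s) - coef_q a d s * x2 (nrm c alpha s) - c * a s * x2 (alpha s))
  by exact (eq_trans (eq_sym (is_derive_unique _ _ _ h2)) (is_derive_unique _ _ _ e2)).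
clear e0 e1 e2 h0 h1 h2.
destruct hf as [he hnn hnv hvv hw].
destruct (normal_comp c (alpha s)) as (n0 & n1 & n2').
destruct (mu_facts c) as (m1 & m2 & m3 & _).
unfold dot in hnn, hnv, hvv; rewrite n0, n1, n2' in hnn, hnv.
assert (g0 := f_equal x0 hw); assert (g1 := f_equal x1 hw); assert (g2 := f_equal x2 hw).
change (x0 (nrm c alpha s) = sig c * (x1 (normal c (alpha s)) * x2 (vel alpha s) - x2 (normal c (alpha s)) * x1 (vel alpha s))) in g0.
change (x1 (nrm c alpha s) = x2 (normal c (alpha s)) * x0 (vel alpha s) - x0 (normal c (alpha s)) * x2 (vel alpha s)) in g1.
change (x2 (nrm c alpha s) = x0 (normal c (alpha s)) * x1 (vel alpha s) - x1 (normal c (alpha s)) * x0 (vel alpha s)) in g2.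
rewrite g0, n1, n2' in w0; rewrite g1, n0, n2' in w1; rewrite g2, n0, n1 in w2.
destruct (axis_algebra (sig c) c (a s) (coef_q a d s) (coef_p a1 a s) (mu0 c) (mu c)
  (x0 (alpha s)) (x1 (alpha s)) (x2 (alpha s)) (x0 (vel alpha s)) (x1 (vel alpha s)) (x2 (vel alpha s))
  (x0 w) (x1 w) (x2 w) he m1 m3 hnn hnv hvv w0 w1 w2) as (A1 & A2 & A3).
rewrite <- n0 in A1, A2, A3.
set (D0 := 1 + x0 (normal c (alpha s))) in *.
set (W := wronskian N N1 D D1).
set (W1 := fun z => Cminus (Cmult (C_derive N1 z) (D z)) (Cmult (N z) (C_derive D1 z))).
assert (hW : hol W s 0 (W1 (s, 0))).
{ specialize (hIU s hs).
  eapply hol_eq; [apply hol_minus; apply hol_mult; [exact (dN1 s 0 hIU)|exact (dD s 0 hIU)|exact (dN s 0 hIU)|exact (dD1 s 0 hIU)]|].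
  unfold W1; ring. }
assert (has := ha s hs).
assert (em : n2 D s 0 + c * n2 N s 0 = 2 * D0).
{ rewrite <- A1; unfold n2; rewrite (hDax s hs), (hNax s hs); fold D0; unfold Re, Im; simpl; ring. }
assert (eW : W (s, 0) = (x1 (vel alpha s) * D0 - x1 (alpha s) * (mu c * x0 (vel alpha s)),
   x2 (vel alpha s) * D0 - x2 (alpha s) * (mu c * x0 (vel alpha s)))).
{ unfold W, wronskian; rewrite (axN1 s hs), (axD1 s hs), (hNax s hs), (hDax s hs); fold D0.
  unfold Cminus, Cplus, Copp, Cmult; simpl; f_equal; ring. }
assert (eW1 : W1 (s, 0) = (x1 w * D0 - x1 (alpha s) * (mu c * x0 w),
   x2 w * D0 - x2 (alpha s) * (mu c * x0 w))).
{ unfold W1; rewrite axN2, axD2, (hNax s hs), (hDax s hs); fold D0.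
  unfold Cminus, Cplus, Copp, Cmult; simpl; f_equal; ring. }
assert (eg : n2 W s 0 = a s * D0 ^ 2).
{ unfold n2; rewrite eW; unfold Re, Im; simpl fst; simpl snd; exact A2. }
assert (hD2 : 0 < D0 ^ 2) by (apply pow2_gt_0; exact hD0).
split; [rewrite em; lra|split; [|split]].
- intros h0; assert (h : n2 W s 0 = 0).
  { unfold n2; fold W in h0; rewrite h0; simpl; ring. }
  rewrite eg in h; nra.
- unfold quotient_metric; fold N1 D1 W; rewrite em, eg; field; exact hD0.
- assert (kW := dpl_derive_t _ _ _ _ _ (n2_dpl W W1 s 0 hW)).
  assert (km := dpl_derive_t _ _ _ _ _ (dpl_plus _ _ _ _ _ _ _ _ (n2_dpl D D1 s 0 (dD s 0 (hIU s hs)))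
     (dpl_scal c _ _ _ _ _ (n2_dpl N N1 s 0 (dN s 0 (hIU s hs)))))).
  set (K := c * (x2 (alpha s) * x1 (vel alpha s) - x1 (alpha s) * x2 (vel alpha s))) in *.
  replace (n2t W W1 s 0) with (2 * coef_q a d s * a s * D0 ^ 2 + 2 * a s * D0 * K) in kW.
  2:{ rewrite <- A3; unfold n2t; rewrite eW, eW1; unfold Re, Im; simpl; ring. }
  replace (n2t D D1 s 0 + c * n2t N N1 s 0) with (2 * K) in km.
  2:{ unfold n2t; rewrite (axN1 s hs), (axD1 s hs), (hNax s hs), (hDax s hs).
      unfold K, Re, Im; simpl; ring. }
  unfold quotient_metric; fold N1 D1 W.
  assert (hm0 : n2 D s 0 + c * n2 N s 0 <> 0) by (rewrite em; lra).
  set (gW := fun t => n2 W s t) in *; set (gm := fun t => n2 D s t + c * n2 N s t) in *.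
  change (is_derive (fun t => 4 * gW t / gm t ^ 2) 0 (d s)).
  change (is_derive gm 0 (2 * K)) in km.
  change (gm 0 <> 0) in hm0; change (gm 0 = 2 * D0) in em; change (gW 0 = a s * D0 ^ 2) in eg.
  auto_derive.
  + repeat split; try (eexists; eassumption).
    apply Rgt_not_eq; assert (h := pow2_gt_0 _ hm0); simpl in *; lra.
  + rewrite_derive kW; rewrite_derive km; rewrite em, eg.
    unfold coef_q; field; split; [exact hD0|lra].
Qed.

(** * The meromorphic extension *)

(** The linear part l (z - z0) has squared modulus at least |l|^2 M^2, with M the larger coordinate
    difference. The errors, taken with eps = |l|/2 in each component, have squares that sum to at
    most half of this. *)
Lemma isolated_zero F s t l : hol F s t l -> F (s, t) = RtoC 0 -> l <> RtoC 0 ->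
  locally_2d (fun u v => (u, v) <> (s, t) -> F (u, v) <> RtoC 0) s t.
Proof.
intros [h1 h2] h0 hl.
assert (hn := Cnorm2_pos l hl); set (n := Re l ^ 2 + Im l ^ 2) in *.
assert (he : 0 < sqrt n / 2) by (assert (0 < sqrt n) by (now apply sqrt_lt_R0); lra).
assert (hs : sqrt n * sqrt n = n) by (apply sqrt_sqrt; lra).
generalize (locally_2d_and _ _ _ _ (h1 (mkposreal _ he)) (h2 (mkposreal _ he))).
apply locally_2d_imp; simpl; intros u v [k1 k2] hne hF.
rewrite h0, hF in k1, k2; unfold Re at 1 2 in k1; unfold Im at 1 2 in k2; simpl in k1, k2.
set (x := u - s) in *; set (y := v - t) in *.
set (M := Rmax (Rabs x) (Rabs y)) in *.
assert (hM : 0 < M).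
{ apply Rnot_le_lt; intros hM; apply hne.
  assert (hx := Rle_trans _ _ _ (Rmax_l _ _) hM); assert (hy := Rle_trans _ _ _ (Rmax_r _ _) hM).
  assert (ex : x = 0) by (apply NNPP; intros h; apply Rabs_pos_lt in h; lra).
  assert (ey : y = 0) by (apply NNPP; intros h; apply Rabs_pos_lt in h; lra).
  unfold x in ex; unfold y in ey; f_equal; lra. }
assert (hM2 : M * M <= x * x + y * y).
{ unfold M, Rmax; destruct (Rle_dec (Rabs x) (Rabs y)); rewrite <- Rabs_mult, Rabs_pos_eq; nra. }
assert (sq : forall z, Rabs z <= sqrt n / 2 * M -> z * z <= n / 4 * (M * M)).
{ intros z hz; replace (n / 4 * (M * M)) with ((sqrt n / 2 * M) * (sqrt n / 2 * M)) by (transitivity (sqrt n * sqrt n / 4 * (M * M)); [field|rewrite hs; reflexivity]).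
  rewrite <- (Rabs_pos_eq (z * z)) by nra; rewrite Rabs_mult.
  apply Rmult_le_compat; auto using Rabs_pos. }
apply sq in k1; apply sq in k2.
assert (hsum : n * (x * x + y * y) <= n / 2 * (M * M)).
{ unfold n at 1; lra. }
assert (n * (M * M) <= n * (x * x + y * y)) by (apply Rmult_le_compat_l; lra).
assert (0 < n * (M * M)) by (apply Rmult_lt_0_compat; nra).
lra.
Qed.

(** In all three models the denominator of the projection is 1 + x0 of the normal; for c = 0 it
    equals 2, which is the factor 1/2. This is the function whose extension is called D. *)
Lemma stereo_formula c p : Q c p ->
  (1 + x0 (normal c p) = 0 -> stereo c p = None) /\
  (1 + x0 (normal c p) <> 0 ->
     stereo c p = Some (Cdiv (x1 p, x2 p) (RtoC (1 + x0 (normal c p))))).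
Proof.
intros hQ; destruct (normal_comp c p) as (e & _ & _); rewrite e; clear e.
unfold stereo, mu, mu0; destruct (Rlt_dec 0 c) as [h|h].
- replace (1 + (- sqrt c * x0 p + 0)) with (1 - sqrt c * x0 p) by ring.
  destruct (Req_EM_T (1 - sqrt c * x0 p) 0); split; easy.
- destruct (Rlt_dec c 0) as [h'|h'].
  + assert (hs : 0 < sqrt (- c)) by (apply sqrt_lt_R0; lra).
    destruct hQ as (_ & _ & hQ); specialize (hQ h').
    replace (1 + (sqrt (- c) * x0 p + 0)) with (1 + sqrt (- c) * x0 p) by ring.
    split; [|easy]; assert (0 < sqrt (- c) * x0 p) by now apply Rmult_lt_0_compat.
    intros; lra.
  + replace (1 + (0 * x0 p + 1)) with 2 by ring; split; [intros; lra|intros _].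
    f_equal; unfold Cdiv, Cinv, Cmult, RtoC; simpl; f_equal; field.
Qed.

Lemma Cmod_sq z : Cmod z ^ 2 = Re z ^ 2 + Im z ^ 2.
Proof.
unfold Cmod; rewrite <- (Rmult_1_r (sqrt _ ^ 2)); unfold pow at 1.
rewrite !Rmult_1_r, sqrt_sqrt; [reflexivity|].
assert (h1 := pow2_ge_0 (fst z)); assert (h2 := pow2_ge_0 (snd z)); lra.
Qed.

Lemma quotient_metric_pullback c N N1 D D1 u v :
  D (u, v) <> RtoC 0 -> n2 D u v + c * n2 N u v <> 0 ->
  4 * Cmod (Cdiv (wronskian N N1 D D1 (u, v)) (Cmult (D (u, v)) (D (u, v)))) ^ 2
    / (1 + c * Cmod (Cdiv (N (u, v)) (D (u, v))) ^ 2) ^ 2 = quotient_metric c N N1 D D1 u v.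
Proof.
intros hD hm.
assert (hp := n2_pos D u v hD).
assert (hDD : Cmult (D (u, v)) (D (u, v)) <> RtoC 0) by now apply Cmult_neq_0.
rewrite !Cmod_div by assumption; rewrite Cmod_mult.
unfold quotient_metric.
assert (e1 : Cmod (D (u, v)) ^ 2 = n2 D u v) by apply Cmod_sq.
assert (e2 : Cmod (N (u, v)) ^ 2 = n2 N u v) by apply Cmod_sq.
assert (e3 : Cmod (wronskian N N1 D D1 (u, v)) ^ 2 = n2 (wronskian N N1 D D1) u v) by apply Cmod_sq.
assert (hd : Cmod (D (u, v)) <> 0) by (intros h; rewrite h in e1; simpl in e1; lra).
rewrite <- e1, <- e2 in hm.
rewrite <- e1, <- e2, <- e3.
set (x := Cmod (D (u, v))) in *; set (y := Cmod (N (u, v))) in *.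
replace (1 + c * (y / x) ^ 2) with ((x ^ 2 + c * y ^ 2) / x ^ 2) by (field; exact hd).
field; split; [exact hm|exact hd].
Qed.

Lemma analytic_Derive f s : locally s (fun x => analytic f x) -> analytic (Derive f) s.
Proof.
intros h; apply locally_singleton in h.
destruct (analytic_is_derive f s h) as (f1 & h1 & h2).
apply analytic_ext_loc with f1; [|exact h1].
revert h2; apply filter_imp; intros x hx; symmetry; now apply is_derive_unique.
Qed.

(* [N / D] is the projection on the axis, and [N' / D'] is the same quotient in
   a form that stays defined where [D] vanishes. *)
Definition curve_lift (c : R) (I : R -> Prop) (alpha : R -> R3) (U : C -> Prop)
    (N D N' D' : C -> C) : Prop :=
  nbhd_of I U /\ smooth_on U N /\ smooth_on U D /\ smooth_on U N' /\ smooth_on U D' /\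
  forall s, I s ->
    N (s, 0) = (x1 (alpha s), x2 (alpha s)) /\
    D (s, 0) = (1 + x0 (normal c (alpha s)), 0) /\
    N' (s, 0) = (1 - mu c * x0 (alpha s), 0) /\
    D' (s, 0) = (c * x1 (alpha s), - (c * x2 (alpha s))).

Lemma curve_complexification c lo hi (a d : R -> R) alpha :
  curve_with_data c (Rbar_interval lo hi) a d alpha ->
  (forall s, Rbar_interval lo hi s -> 0 < a s) ->
  (forall s, Rbar_interval lo hi s -> analytic a s) ->
  (forall s, Rbar_interval lo hi s -> analytic d s) ->
  exists U N D N' D', curve_lift c (Rbar_interval lo hi) alpha U N D N' D'.
Proof.
intros hcurve ha aa ad.
assert (da : forall s, Rbar_interval lo hi s -> is_derive a s (Derive a s)).
{ intros s hs; destruct (analytic_is_derive a s (aa s hs)) as (f1 & _ & h).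
  apply locally_singleton in h; apply Derive_correct; eexists; exact h. }
assert (aa1 : forall s, Rbar_interval lo hi s -> analytic (Derive a) s).
{ intros s hs; apply analytic_Derive.
  generalize (Rbar_interval_locally lo hi s hs); apply filter_imp; exact aa. }
assert (ai : forall s, Rbar_interval lo hi s -> analytic (fun u => / (2 * a u)) s).
{ intros s hs; apply analytic_inv; [specialize (ha s hs); lra|].
  apply analytic_scal; auto. }
assert (ap : forall s, Rbar_interval lo hi s -> analytic (coef_p (Derive a) a) s).
{ intros s hs; apply (analytic_mult (Derive a) (fun u => / (2 * a u))); auto. }
assert (aq : forall s, Rbar_interval lo hi s -> analytic (coef_q a d) s).
{ intros s hs; apply (analytic_mult d (fun u => / (2 * a u))); auto. }
assert (ar : forall s, Rbar_interval lo hi s -> analytic (fun u => c * a u) s).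
{ intros s hs; apply analytic_scal; auto. }
assert (hsol : forall s, Rbar_interval lo hi s -> locally s (fun u =>
   solves3 (coef_p (Derive a) a) (coef_q a d) (fun u => c * a u) alpha (vel alpha) (nrm c alpha) u)).
{ intros s hs; generalize (Rbar_interval_locally lo hi s hs); apply filter_imp; intros u hu.
  now apply (curve_solves c lo hi). }
destruct (complexification (Rbar_interval lo hi) (fun s => x0 (alpha s))) as (U0 & X0 & [o0 i0] & s0 & ax0).
{ intros s hs.
  apply (solution_analytic _ _ _ _ (fun u => x0 (vel alpha u)) (fun u => x0 (nrm c alpha u)) s (ap s hs) (aq s hs) (ar s hs)).
  generalize (hsol s hs); apply filter_imp; intros u (h & _); exact h. }
destruct (complexification (Rbar_interval lo hi) (fun s => x1 (alpha s))) as (U1 & X1 & [o1 i1] & s1 & ax1).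
{ intros s hs.
  apply (solution_analytic _ _ _ _ (fun u => x1 (vel alpha u)) (fun u => x1 (nrm c alpha u)) s (ap s hs) (aq s hs) (ar s hs)).
  generalize (hsol s hs); apply filter_imp; intros u (_ & h & _); exact h. }
destruct (complexification (Rbar_interval lo hi) (fun s => x2 (alpha s))) as (U2 & X2 & [o2 i2] & s2 & ax2).
{ intros s hs.
  apply (solution_analytic _ _ _ _ (fun u => x2 (vel alpha u)) (fun u => x2 (nrm c alpha u)) s (ap s hs) (aq s hs) (ar s hs)).
  generalize (hsol s hs); apply filter_imp; intros u (_ & _ & h); exact h. }
(* On the axis D' is c times the conjugate of N; its holomorphic extension is c (X1 - i X2), which
   is not a conjugate off the axis. *)
exists (fun z => U0 z /\ U1 z /\ U2 z),
  (fun z => Cplus (X1 z) (Cmult (0, 1) (X2 z))),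
  (fun z => Cplus (RtoC (1 + mu0 c)) (Cmult (RtoC (mu c)) (X0 z))),
  (fun z => Cminus (RtoC 1) (Cmult (RtoC (mu c)) (X0 z))),
  (fun z => Cmult (RtoC c) (Cminus (X1 z) (Cmult (0, 1) (X2 z)))).
split; [split|].
- apply open_and; [exact o0|now apply open_and].
- intros s hs; auto.
- split; [|split; [|split; [|split]]].
  + intros s t (_ & h1 & h2) n; apply holn_plus; [now apply s1|now apply holn_scal, s2].
  + intros s t (h0 & _ & _) n; apply holn_plus; [apply holn_const|now apply holn_scal, s0].
  + intros s t (h0 & _ & _) n; apply holn_minus; [apply holn_const|now apply holn_scal, s0].
  + intros s t (_ & h1 & h2) n; apply holn_scal, holn_minus; [now apply s1|now apply holn_scal, s2].
  + intros s hs; rewrite (ax0 s hs), (ax1 s hs), (ax2 s hs).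
    destruct (normal_comp c (alpha s)) as (-> & _ & _).
    unfold Cminus, Cplus, Copp, Cmult, RtoC; simpl; repeat split; f_equal; ring.
Qed.

(** * Poles on the axis *)

Lemma smooth_hol U F s t : open U -> smooth_on U F -> U (s, t) -> hol F s t (C_derive F (s, t)).
Proof. intros ho hF; now apply smooth_on_derive. Qed.

Lemma hol_identity_locally (F G : C -> C) s :
  locally_2d (fun u v => (exists l, hol F u v l) /\ (exists l, hol G u v l)) s 0 ->
  locally s (fun u => F (u, 0) = G (u, 0)) ->
  locally_2d (fun u v => F (u, v) = G (u, v)) s 0.
Proof.
intros [r1 h1] [r2 h2].
assert (hr : 0 < Rmin r1 r2) by (apply Rmin_glb_lt; apply cond_pos).
assert (m1 := Rmin_l r1 r2); assert (m2 := Rmin_r r1 r2).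
exists (mkposreal _ hr); simpl; intros u v hu hv.
set (D := fun z => Cminus (F z) (G z)).
assert (e : D (u, v) = RtoC 0).
{ apply (identity_theorem D (C_derive D) s (Rmin r1 r2) (Rmin r1 r2)).
  - intros x y [hx hy]; apply ex_hol_C_derive.
    destruct (h1 x y) as [[l hl] [l' hl']]; [lra|rewrite Rminus_0_r; lra|].
    eexists; apply hol_minus; eassumption.
  - intros x hx; assert (e : F (x, 0) = G (x, 0)) by (apply h2; change (Rabs (x - s) < r2); lra).
    unfold D; rewrite e; ring.
  - split; [exact hu|rewrite Rminus_0_r in hv; exact hv]. }
unfold D in e; replace (F (u, v)) with (Cplus (Cminus (F (u, v)) (G (u, v))) (G (u, v))) by ring.
rewrite e; ring.
Qed.

Lemma hol_neq_0_locally F s t l : hol F s t l -> F (s, t) <> RtoC 0 ->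
  locally_2d (fun u v => F (u, v) <> RtoC 0) s t.
Proof.
intros h hne; destruct (hol_continuity _ _ _ _ h) as [c1 c2].
assert (hn : Re (F (s, t)) <> 0 \/ Im (F (s, t)) <> 0).
{ apply NNPP; intros k; apply hne; destruct (F (s, t)) as [p q]; unfold Re, Im, RtoC in *; simpl in *.
  f_equal; apply NNPP; tauto. }
destruct hn as [hn|hn].
- generalize (continuity_2d_pt_neq_0 _ _ _ c1 hn); apply locally_2d_imp.
  intros u v k e; apply k; rewrite e; reflexivity.
- generalize (continuity_2d_pt_neq_0 _ _ _ c2 hn); apply locally_2d_imp.
  intros u v k e; apply k; rewrite e; reflexivity.
Qed.

(** Only the sphere has a point at infinity of the projection. There the normal is -e_0, so the
    velocity has no x0-component and both N and D' have simple zeros, whereas N' = 2. By D N' = N D'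
    the function D vanishes to second order, and N'/D' is the form of the quotient without common
    zero. *)
Lemma pole_local c lo hi (a a1 d : R -> R) alpha U N D N' D' s :
  curve_with_data c (Rbar_interval lo hi) a d alpha ->
  (forall s, Rbar_interval lo hi s -> 0 < a s) ->
  (forall s, Rbar_interval lo hi s -> is_derive a s (a1 s)) ->
  curve_lift c (Rbar_interval lo hi) alpha U N D N' D' ->
  Rbar_interval lo hi s -> 1 + x0 (normal c (alpha s)) = 0 ->
  0 < c /\ D' (s, 0) = RtoC 0 /\ N' (s, 0) <> RtoC 0 /\
  wronskian N' (C_derive N') D' (C_derive D') (s, 0) <> RtoC 0 /\
  n2 D' s 0 + c * n2 N' s 0 <> 0 /\
  locally_2d (fun u v => U (u, v) /\ N' (u, v) <> RtoC 0 /\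
    Cmult (D (u, v)) (N' (u, v)) = Cmult (N (u, v)) (D' (u, v)) /\
    ((u, v) <> (s, 0) -> N (u, v) <> RtoC 0 /\ D' (u, v) <> RtoC 0 /\ D (u, v) <> RtoC 0)) s 0.
Proof.
intros hcurve ha da ([hU hIU] & hN & hD & hN' & hD' & hax) hs hpole.
assert (ca : forall u, Rbar_interval lo hi u -> continuous a u).
{ intros u hu; apply (ex_derive_continuous a); eexists; now apply da. }
assert (hreg := proj1 hcurve).
destruct (hreg s hs) as (hQs & _).
assert (hf := curve_frame c lo hi a d alpha s hcurve ha ca hs).
destruct hf as [he hnn hnv hvv _].
destruct (normal_comp c (alpha s)) as (n0 & n1 & n2').
assert (hc : 0 < c).
{ apply Rnot_le_lt; intros hle; rewrite n0 in hpole; unfold mu, mu0 in hpole.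
  destruct (Rlt_dec 0 c); [lra|]; destruct (Rlt_dec c 0) as [h|h]; [|lra].
  destruct hQs as (_ & _ & hq); specialize (hq h).
  assert (0 < sqrt (- c)) by (apply sqrt_lt_R0; lra).
  assert (0 < sqrt (- c) * x0 (alpha s)) by now apply Rmult_lt_0_compat. lra. }
assert (hsig : sig c = 1) by (unfold sig; destruct (Rlt_dec c 0); lra).
destruct (mu_nonzero c ltac:(lra)) as [hmu hmu0].
rewrite hsig in hnn, hnv, hvv; unfold dot in hnn, hnv, hvv.
set (nu := normal c (alpha s)) in *.
(* A unit vector with first coordinate -1 is -e_0. *)
assert (hnu0 : x0 nu = -1) by lra.
assert (hnu1 : x1 nu = 0) by nra.
assert (hnu2 : x2 nu = 0) by nra.
rewrite hnu0, hnu1, hnu2 in hnv.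
assert (hv0 : x0 (vel alpha s) = 0) by lra.
assert (hx1 : x1 (alpha s) = 0) by (apply (Rmult_eq_reg_l (mu c)); lra).
assert (hx2 : x2 (alpha s) = 0) by (apply (Rmult_eq_reg_l (mu c)); lra).
assert (hx0 : mu c * x0 (alpha s) = -1) by lra.
rewrite hv0 in hvv; assert (has := ha s hs).
destruct (hax s hs) as (aN & aD & aN' & aD'); rewrite hx1, hx2 in aN, aD'; rewrite hx0 in aN'.
assert (hloc := Rbar_interval_locally lo hi s hs).
destruct (regular_curve_derive _ _ _ _ hreg hs) as ((h0 & h1 & h2) & _).
assert (dN1 : C_derive N (s, 0) = (x1 (vel alpha s), x2 (vel alpha s))).
{ apply (hol_axis N s _ (fun u => x1 (alpha u)) (fun u => x2 (alpha u))); auto.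
  - now apply smooth_hol with U; auto.
  - revert hloc; apply filter_imp; intros u hu; now apply hax. }
assert (dD1' : C_derive D' (s, 0) = (c * x1 (vel alpha s), - (c * x2 (vel alpha s)))).
{ apply (hol_axis D' s _ (fun u => c * x1 (alpha u)) (fun u => - (c * x2 (alpha u)))).
  - now apply smooth_hol with U; auto.
  - revert hloc; apply filter_imp; intros u hu; now apply hax.
  - now apply (is_derive_scal (fun u => x1 (alpha u))).
  - apply (is_derive_opp (fun u => c * x2 (alpha u))).
    now apply (is_derive_scal (fun u => x2 (alpha u))). }
assert (hvne : x1 (vel alpha s) <> 0 \/ x2 (vel alpha s) <> 0).
{ apply NNPP; intros k; assert (e1 : x1 (vel alpha s) = 0) by (apply NNPP; tauto).
  assert (e2 : x2 (vel alpha s) = 0) by (apply NNPP; tauto). rewrite e1, e2 in hvv; lra. }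
assert (hN1ne : C_derive N (s, 0) <> RtoC 0).
{ rewrite dN1; intros k; injection k as k1 k2; tauto. }
assert (hD1ne : C_derive D' (s, 0) <> RtoC 0).
{ rewrite dD1'; intros k; injection k as k1 k2.
  assert (hc' : c <> 0) by lra.
  destruct hvne as [hv|hv]; apply (Rmult_integral_contrapositive_currified _ _ hc' hv); [exact k1|].
  apply Ropp_eq_0_compat in k2; rewrite Ropp_involutive in k2; exact k2. }
assert (zD' : D' (s, 0) = RtoC 0) by (rewrite aD'; unfold RtoC; f_equal; ring).
assert (zN : N (s, 0) = RtoC 0) by exact aN.
assert (zN' : N' (s, 0) <> RtoC 0) by (rewrite aN'; intros k; injection k as k; lra).
split; [exact hc|split; [exact zD'|split; [exact zN'|]]].
split; [|split].
- unfold wronskian; rewrite zD'.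
  replace (Cminus (Cmult (C_derive N' (s, 0)) (RtoC 0)) (Cmult (N' (s, 0)) (C_derive D' (s, 0))))
    with (Copp (Cmult (N' (s, 0)) (C_derive D' (s, 0)))) by ring.
  intros k; apply (Cmult_neq_0 _ _ zN' hD1ne).
  replace (Cmult (N' (s, 0)) (C_derive D' (s, 0))) with (Copp (Copp (Cmult (N' (s, 0)) (C_derive D' (s, 0))))) by ring.
  rewrite k; ring.
- assert (hp := n2_pos N' s 0 zN').
  assert (e : n2 D' s 0 = 0) by (unfold n2; rewrite zD'; simpl; ring).
  rewrite e; assert (0 < c * n2 N' s 0) by now apply Rmult_lt_0_compat. lra.
- assert (hUs := hIU s hs).
  (* On the axis this is the equation of the sphere; the identity theorem carries it off the
     axis. *)
  assert (hid : locally_2d (fun u v => Cmult (D (u, v)) (N' (u, v)) = Cmult (N (u, v)) (D' (u, v))) s 0).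
  { apply (hol_identity_locally (fun z => Cmult (D z) (N' z)) (fun z => Cmult (N z) (D' z))).
    - generalize (open_locally_2d U s 0 hU hUs); apply locally_2d_imp; intros u v huv; split.
      + eexists; apply hol_mult; [exact (smooth_hol U D u v hU hD huv)|exact (smooth_hol U N' u v hU hN' huv)].
      + eexists; apply hol_mult; [exact (smooth_hol U N u v hU hN huv)|exact (smooth_hol U D' u v hU hD' huv)].
    - revert hloc; apply filter_imp; intros u hu.
      change (Cmult (D ((u : R), 0)) (N' ((u : R), 0)) = Cmult (N ((u : R), 0)) (D' ((u : R), 0))).
      destruct (hax u hu) as (-> & -> & -> & ->).
      destruct (hreg u hu) as ((_ & hq & _) & _); specialize (hq ltac:(lra)).
      destruct (normal_comp c (alpha u)) as (-> & _ & _); rewrite hmu0.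
      destruct (mu_facts c) as (m1 & _); rewrite hsig in m1.
      unfold form in hq; rewrite hsig in hq.
      unfold Cmult; simpl; f_equal; [|ring].
      transitivity (1 - 1 * (mu c * mu c) * (x0 (alpha u) * x0 (alpha u))); [ring|rewrite m1].
      replace (x0 (alpha u) * x0 (alpha u)) with (1 / c - x1 (alpha u) * x1 (alpha u) - x2 (alpha u) * x2 (alpha u)) by lra.
      field; lra. }
  generalize (locally_2d_and _ _ _ _ (open_locally_2d U s 0 hU hUs)
    (locally_2d_and _ _ _ _ hid
    (locally_2d_and _ _ _ _ (hol_neq_0_locally N' s 0 _ (smooth_hol U N' s 0 hU hN' hUs) zN')
    (locally_2d_and _ _ _ _ (isolated_zero N s 0 _ (smooth_hol U N s 0 hU hN hUs) zN hN1ne)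
      (isolated_zero D' s 0 _ (smooth_hol U D' s 0 hU hD' hUs) zD' hD1ne))))).
  apply locally_2d_imp; intros u v (i1 & i2 & i3 & i4 & i5).
  split; [exact i1|split; [exact i3|split; [exact i2|]]].
  intros hne; split; [auto|split; [auto|]].
  intros k; rewrite k in i2; apply (Cmult_neq_0 _ _ (i4 hne) (i5 hne)).
  rewrite <- i2; ring.
Qed.

(** * The metric extended across the poles *)

Notation quotient_metric' c N D := (quotient_metric c N (C_derive N) D (C_derive D)).

Lemma quotient_metric_solution c U N D s t :
  open U -> smooth_on U N -> smooth_on U D -> U (s, t) ->
  n2 D s t + c * n2 N s t <> 0 -> wronskian N (C_derive N) D (C_derive D) (s, t) <> RtoC 0 ->
  locally_2d (fun u v => n2 D u v + c * n2 N u v <> 0 /\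
    0 < quotient_metric' c N D u v /\ Cn 2 (quotient_metric' c N D) u v /\
    Laplacian (fun x y => ln (quotient_metric' c N D x y)) u v = - 2 * c * quotient_metric' c N D u v) s t.
Proof.
intros hU hN hD hst hm hW.
destruct (smooth_on_derive U N hU hN) as [dN hN1]; destruct (smooth_on_derive U D hU hD) as [dD hD1].
destruct (smooth_on_derive U _ hU hN1) as [dN1 hN2]; destruct (smooth_on_derive U _ hU hD1) as [dD1 hD2].
destruct (smooth_on_derive U _ hU hN2) as [dN2 _]; destruct (smooth_on_derive U _ hU hD2) as [dD2 _].
assert (lm : locally_2d (fun u v => n2 D u v + c * n2 N u v <> 0) s t).
{ apply (continuity_2d_pt_neq_0 (fun u v => n2 D u v + c * n2 N u v)); [|exact hm].
  apply (Cn_continuity 0), Cn_plus; [apply n2_Cn; now apply hD|].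
  apply Cn_mult; [apply Cn_const|apply n2_Cn; now apply hN]. }
assert (lW : locally_2d (fun u v => wronskian N (C_derive N) D (C_derive D) (u, v) <> RtoC 0) s t).
{ eapply hol_neq_0_locally; [|exact hW].
  apply hol_minus; apply hol_mult; eauto. }
assert (lU := open_locally_2d U s t hU hst).
generalize (locally_2d_and _ _ _ _ lm (locally_2d_and _ _ _ _ lW lU)).
apply locally_2d_imp; intros u v (m & w & h).
split; [exact m|split; [|split]].
- assert (h2 := n2_pos _ _ _ w); unfold quotient_metric.
  apply Rdiv_lt_0_compat; [lra|now apply pow2_gt_0].
- apply quotient_metric_Cn; auto.
- eapply (quotient_metric_liouville c N (C_derive N) (C_derive (C_derive N))
    D (C_derive D) (C_derive (C_derive D)) u v).
  + generalize (open_locally_2d U u v hU h); apply locally_2d_imp; auto.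
  + exact (dN2 u v h).
  + exact (dD2 u v h).
  + exact w.
  + exact m.
Qed.

(** With h = 1/g the pullback metric reads 4 |h'|^2 / (|h|^2 + c)^2; the second branch is its value
    at h = 0. *)
Definition extended_metric (c : R) (G : C -> sphere) (z : C) : R :=
  match G z with
  | Some _ => pullback_metric c G z
  | None => 4 * Cmod (C_derive (fun w => finite_part (sphere_inv (G w))) z) ^ 2 / c ^ 2
  end.

Lemma pullback_quotient c (G : C -> sphere) (N D : C -> C) s t :
  locally_2d (fun u v => finite_part (G (u, v)) = Cdiv (N (u, v)) (D (u, v))) s t ->
  hol N s t (C_derive N (s, t)) -> hol D s t (C_derive D (s, t)) ->
  D (s, t) <> RtoC 0 -> n2 D s t + c * n2 N s t <> 0 ->
  pullback_metric c G (s, t) = quotient_metric' c N D s t.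
Proof.
intros h hN hD hD0 hm; unfold pullback_metric.
assert (k := hol_div N D s t _ _ hD0 hN hD).
apply (hol_ext_loc _ (fun w : C => finite_part (G w))) in k.
2:{ revert h; apply locally_2d_imp; intros u v e; now rewrite e. }
rewrite (hol_C_derive _ _ _ _ k), (locally_2d_singleton _ _ _ h).
now apply quotient_metric_pullback.
Qed.

Lemma pole_quotient c (G : C -> sphere) (N D : C -> C) s t : c <> 0 ->
  locally_2d (fun u v => finite_part (sphere_inv (G (u, v))) = Cdiv (D (u, v)) (N (u, v))) s t ->
  hol N s t (C_derive N (s, t)) -> hol D s t (C_derive D (s, t)) ->
  N (s, t) <> RtoC 0 -> D (s, t) = RtoC 0 ->
  4 * Cmod (C_derive (fun w => finite_part (sphere_inv (G w))) (s, t)) ^ 2 / c ^ 2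
    = quotient_metric' c N D s t.
Proof.
intros hc h hN hD hN0 hD0.
assert (k := hol_div D N s t _ _ hN0 hD hN).
apply (hol_ext_loc _ (fun w : C => finite_part (sphere_inv (G w)))) in k.
2:{ revert h; apply locally_2d_imp; intros u v e; now rewrite e. }
rewrite (hol_C_derive _ _ _ _ k).
assert (hp := n2_pos N s t hN0).
unfold quotient_metric.
assert (e1 : n2 D s t = 0) by (unfold n2; rewrite hD0; simpl; ring).
assert (e2 : n2 (wronskian N (C_derive N) D (C_derive D)) s t =
  Cmod (Cminus (Cmult (C_derive D (s, t)) (N (s, t))) (Cmult (D (s, t)) (C_derive N (s, t)))) ^ 2).
{ rewrite Cmod_sq; unfold n2, wronskian; rewrite hD0; unfold Re, Im; simpl; ring. }
assert (hNN : Cmult (N (s, t)) (N (s, t)) <> RtoC 0) by now apply Cmult_neq_0.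
rewrite e1, e2, Cmod_div, Cmod_mult by exact hNN.
assert (e3 : Cmod (N (s, t)) ^ 2 = n2 N s t) by apply Cmod_sq.
assert (hn : Cmod (N (s, t)) <> 0) by (intros e; rewrite e in e3; simpl in e3; lra).
rewrite <- e3; field; split; [exact hn|exact hc].
Qed.

Lemma holomorphic_at_hol G s t : holomorphic_at G (s, t) ->
  locally_2d (fun u v => G (u, v) <> None /\ exists l, hol (fun w => finite_part (G w)) u v l) s t.
Proof.
intros h; apply locally_2d_C in h; revert h; apply locally_2d_imp.
intros u v [h1 [l h2]]; split; [exact h1|exists l; now apply hol_is_derive].
Qed.

Lemma punctured_locally (s t u v : R) : (u, v) <> (s, t) ->
  locally_2d (fun x y => (x, y) <> (s, t)) u v.
Proof.
intros h.
assert (key : forall z w : C, Cminus z w = RtoC 0 <-> z = w).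
{ intros z w; split; [|intros ->; ring].
  intros e; replace z with (Cplus (Cminus z w) w) by ring; rewrite e; ring. }
assert (k : locally_2d (fun x y => Cminus (x, y) (s, t) <> RtoC 0) u v).
{ apply (hol_neq_0_locally (fun z => Cminus z (s, t)) u v _
    (hol_minus _ _ _ _ _ _ (hol_id u v) (hol_const (s, t) u v))).
  intros e; apply h; now apply key. }
revert k; apply locally_2d_imp; intros x y hxy e; apply hxy; now apply key.
Qed.

Lemma Cinv_quotient (n d n' d' : C) : n <> RtoC 0 -> d <> RtoC 0 -> n' <> RtoC 0 ->
  Cmult d n' = Cmult n d' -> Cdiv n d <> RtoC 0 /\ Cinv (Cdiv n d) = Cdiv d' n'.
Proof.
intros hn hd hn' h; split.
- intros e; apply hn; replace n with (Cmult (Cdiv n d) d) by (field; exact hd); rewrite e; ring.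
- transitivity (Cdiv (Cmult d n') (Cmult n n')); [field; tauto|].
  rewrite h; field; tauto.
Qed.

Lemma Cinv_eq_quotient (z n' d' : C) : z <> RtoC 0 -> n' <> RtoC 0 -> d' <> RtoC 0 ->
  Cinv z = Cdiv d' n' -> z = Cdiv n' d'.
Proof.
intros hz hn hd h; transitivity (Cinv (Cinv z)); [field; exact hz|rewrite h].
field; tauto.
Qed.

(** N, D serve where the projection is finite and N', D' at a pole; in both cases the denominator
    and the Wronskian do not vanish. An arbitrary extension G is recognised as the quotient by the
    identity theorem. The Cauchy data are asserted where G is finite, and the last clause, that
    poles are isolated in I, prepares the passage to the limit. *)
Lemma extended_metric_local c lo hi (a a1 d : R -> R) alpha U N D N' D' U' G s :
  curve_with_data c (Rbar_interval lo hi) a d alpha ->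
  (forall s, Rbar_interval lo hi s -> 0 < a s) ->
  (forall s, Rbar_interval lo hi s -> is_derive a s (a1 s)) ->
  curve_lift c (Rbar_interval lo hi) alpha U N D N' D' ->
  meromorphic_extension (Rbar_interval lo hi) (fun s => stereo c (alpha s)) U' G ->
  Rbar_interval lo hi s ->
  exists M E, smooth_on U M /\ smooth_on U E /\
    n2 E s 0 + c * n2 M s 0 <> 0 /\
    wronskian M (C_derive M) E (C_derive E) (s, 0) <> RtoC 0 /\
    locally_2d (fun u v => extended_metric c G (u, v) = quotient_metric' c M E u v) s 0 /\
    (G (s, 0) <> None -> quotient_metric' c M E s 0 = a s /\
       is_derive (fun t => quotient_metric' c M E s t) 0 (d s)) /\
    locally s (fun u => u <> s -> G (u, 0) <> None).
Proof.
intros hcurve ha da hlift (hU' & hmero & hGax) hs.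
destruct (hlift) as (hU & hN & hD & hN' & hD' & hax).
assert (hst : forall u, Rbar_interval lo hi u -> Q c (alpha u)) by (intros u hu; apply (proj1 hcurve u hu)).
assert (hloc := Rbar_interval_locally lo hi s hs).
assert (hUs := proj2 hU s hs).
assert (lU := open_locally_2d U s 0 (proj1 hU) hUs).
specialize (hmero _ (proj2 hU' s hs)).
destruct (Req_EM_T (1 + x0 (normal c (alpha s))) 0) as [hpole|hfin].
- destruct (pole_local c lo hi a a1 d alpha U N D N' D' s hcurve ha da hlift hs hpole)
    as (hc & zD' & zN' & hW & hm & hP).
  assert (hGs : G (s, 0) = None) by (rewrite (hGax s hs); exact (proj1 (stereo_formula c (alpha s) (hst s hs)) hpole)).
  rewrite hGs in hmero; destruct hmero as [hh hpunct].
  apply holomorphic_at_hol in hh; apply locally_2d_C in hpunct.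
  exists N', D'; split; [exact hN'|split; [exact hD'|split; [exact hm|split; [exact hW|]]]].
  (* At a pole it is 1/G that is holomorphic nearby; on the axis it equals D'/N', also at the pole,
     where both are 0. *)
  assert (hinv : locally_2d (fun u v => finite_part (sphere_inv (G (u, v))) = Cdiv (D' (u, v)) (N' (u, v))) s 0).
  { apply (hol_identity_locally (fun w : C => finite_part (sphere_inv (G w))) (fun w : C => Cdiv (D' w) (N' w))).
    - generalize (locally_2d_and _ _ _ _ hh hP); apply locally_2d_imp.
      intros u v ((_ & h1) & h2 & h3 & _); split; [exact h1|eexists].
      apply hol_div; [exact h3|apply (smooth_hol U)|apply (smooth_hol U)]; try assumption; apply hU.
    - generalize (filter_and _ _ hloc (locally_2d_1d_const_y _ _ _ hP)); apply filter_imp; intros u [hu (_ & k1 & k2 & k3)].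
      change (finite_part (sphere_inv (G ((u : R), 0))) = Cdiv (D' ((u : R), 0)) (N' ((u : R), 0))).
      rewrite (hGax u hu); destruct (Req_dec u s) as [->|hne].
      + rewrite <- (hGax s hs), hGs, zD'; simpl; unfold Cdiv; ring.
      + destruct k3 as (n1 & n2 & n3); [intros e; injection e as e; tauto|].
        destruct (hax u hu) as (aN & aD & _).
        destruct (stereo_formula c (alpha u) (hst u hu)) as [_ hf].
        rewrite hf; [|intros e; apply n3; rewrite aD, e; reflexivity].
        rewrite <- aN; change (RtoC (1 + x0 (normal c (alpha u)))) with (1 + x0 (normal c (alpha u)), 0).
        rewrite <- aD; simpl.
        destruct (Cinv_quotient (N (u, 0)) (D (u, 0)) (N' (u, 0)) (D' (u, 0)) n1 n3 k1 k2) as [nz e].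
        destruct (Ceq_dec _ _) as [e'|_]; [contradiction|exact e]. }
  split; [|split].
  + assert (hfp : locally_2d (fun u v => (u, v) <> (s, 0) ->
      G (u, v) <> None /\ finite_part (G (u, v)) = Cdiv (N' (u, v)) (D' (u, v))) s 0).
    { generalize (locally_2d_and _ _ _ _ hpunct (locally_2d_and _ _ _ _ hinv (locally_2d_and _ _ _ _ hh hP))).
      apply locally_2d_imp; intros u v (k1 & k2 & (k3 & _) & _ & k4 & _ & k5) hne.
      specialize (k1 hne); specialize (k5 hne); split; [exact k1|].
      destruct (G (u, v)) as [z|]; [|contradiction]; simpl in k2, k3 |- *.
      destruct (Ceq_dec z (RtoC 0)) as [_|hz]; [contradiction|]; simpl in k2.
      now apply Cinv_eq_quotient. }
    generalize (locally_2d_and _ _ _ _ lU (locally_2d_and _ _ _ _ (locally_2d_locally2 _ _ _ hfp) (locally_2d_and _ _ _ _ hP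
      (quotient_metric_solution c U N' D' s 0 (proj1 hU) hN' hD' hUs hm hW)))).
    apply locally_2d_imp; intros u v (k1 & k2 & k3 & k4 & _).
    destruct (Ceq_dec (u, v) (s, 0)) as [e|hne].
    * injection e as -> ->; unfold extended_metric; rewrite hGs.
      apply pole_quotient; [lra|exact hinv|apply (smooth_hol U)|apply (smooth_hol U)|exact zN'|exact zD'];
        try assumption; apply hU.
    * assert (k5 := locally_2d_singleton _ _ _ k2 hne).
      unfold extended_metric; destruct (G (u, v)) as [z|] eqn:ez; [|tauto].
      apply pullback_quotient; [|apply (smooth_hol U); try assumption; apply hU|apply (smooth_hol U); try assumption; apply hU| |exact k4].
      -- generalize (locally_2d_and _ _ _ _ k2 (punctured_locally _ _ _ _ hne)).
         apply locally_2d_imp; tauto.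
      -- destruct k3 as (_ & _ & _ & k3); now apply k3.
  + intros h; contradiction.
  + generalize (locally_2d_1d_const_y _ _ _ hpunct); apply filter_imp.
    intros u hu hne; apply hu; intros e; injection e as e; tauto.
- assert (aD := proj1 (proj2 (hax s hs))).
  assert (hDs : D (s, 0) <> RtoC 0) by (rewrite aD; intros e; injection e as e; tauto).
  destruct (stereo_formula c (alpha s) (hst s hs)) as [_ hf]; specialize (hf hfin).
  rewrite (hGax s hs), hf in hmero; apply holomorphic_at_hol in hmero.
  destruct (quotient_metric_axis c lo hi a a1 d alpha U N D s) as (hm & hW & ax1' & ax2'); try assumption;
    try apply hU; try (intros; now apply hax).
  exists N, D; split; [exact hN|split; [exact hD|split; [exact hm|split; [exact hW|]]]].
  assert (lD := hol_neq_0_locally D s 0 _ (smooth_hol U D s 0 (proj1 hU) hD hUs) hDs).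
  assert (hq : locally_2d (fun u v => finite_part (G (u, v)) = Cdiv (N (u, v)) (D (u, v))) s 0).
  { apply (hol_identity_locally (fun w : C => finite_part (G w)) (fun w : C => Cdiv (N w) (D w))).
    - generalize (locally_2d_and _ _ _ _ hmero (locally_2d_and _ _ _ _ lU lD)); apply locally_2d_imp.
      intros u v ((_ & h1) & h2 & h3); split; [exact h1|eexists].
      apply hol_div; [exact h3|apply (smooth_hol U)|apply (smooth_hol U)]; try assumption; apply hU.
    - generalize (filter_and _ _ hloc (locally_2d_1d_const_y _ _ _ lD)); apply filter_imp; intros u [hu k].
      change (finite_part (G ((u : R), 0)) = Cdiv (N ((u : R), 0)) (D ((u : R), 0))).
      destruct (hax u hu) as (bN & bD & _); rewrite (hGax u hu).
      destruct (stereo_formula c (alpha u) (hst u hu)) as [_ hfu].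
      rewrite hfu, bN, bD; [reflexivity|].
      intros e; apply k; change (D ((u : R), 0) = RtoC 0); rewrite bD, e; reflexivity. }
  split; [|split; [now split|]].
  + generalize (locally_2d_and _ _ _ _ lU (locally_2d_and _ _ _ _ (locally_2d_locally2 _ _ _ hq)
      (locally_2d_and _ _ _ _ lD (locally_2d_and _ _ _ _ hmero
      (quotient_metric_solution c U N D s 0 (proj1 hU) hN hD hUs hm hW))))).
    apply locally_2d_imp; intros u v (k1 & k2 & k3 & (k4 & _) & k5 & _).
    unfold extended_metric; destruct (G (u, v)) as [z|] eqn:ez; [|tauto].
    apply pullback_quotient; [exact k2|apply (smooth_hol U); try assumption; apply hU|apply (smooth_hol U); try assumption; apply hU| exact k3|exact k5].
  + generalize (locally_2d_1d_const_y _ _ _ hmero); apply filter_imp; intros u [hu _] _; exact hu.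
Qed.

(** * Existence of the meromorphic extension *)

Lemma hol_holomorphic_at G s t :
  locally_2d (fun u v => G (u, v) <> None /\ exists l, hol (fun w => finite_part (G w)) u v l) s t ->
  holomorphic_at G (s, t).
Proof.
intros h; apply locally_2d_C; revert h; apply locally_2d_imp.
intros u v [h1 [l h2]]; split; [exact h1|exists l; now apply hol_is_derive].
Qed.

Definition quotient_map (N D : C -> C) (w : C) : sphere :=
  if Ceq_dec (D w) (RtoC 0) then None else Some (Cdiv (N w) (D w)).

Lemma quotient_map_some (N D : C -> C) w : D w <> RtoC 0 -> quotient_map N D w = Some (Cdiv (N w) (D w)).
Proof. intros h; unfold quotient_map; destruct (Ceq_dec _ _); [contradiction|reflexivity]. Qed.

Lemma quotient_map_holomorphic U N D s t : open U -> smooth_on U N -> smooth_on U D ->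
  U (s, t) -> D (s, t) <> RtoC 0 -> holomorphic_at (quotient_map N D) (s, t).
Proof.
intros hU hN hD hst h0; apply hol_holomorphic_at.
assert (lD := hol_neq_0_locally D s t _ (smooth_hol U D s t hU hD hst) h0).
generalize (locally_2d_and _ _ _ _ (open_locally_2d U s t hU hst) (locally_2d_locally2 _ _ _ lD)).
apply locally_2d_imp; intros u v [k1 k2].
assert (k3 := locally_2d_singleton _ _ _ k2); split; [rewrite quotient_map_some by exact k3; discriminate|].
eexists; apply (hol_ext_loc (fun w => Cdiv (N w) (D w))).
- revert k2; apply locally_2d_imp; intros x y k; now rewrite quotient_map_some.
- apply hol_div; [exact k3|now apply (smooth_hol U)|now apply (smooth_hol U)].
Qed.

(** Off the axis N and D may vanish together, so the domain is cut down to the interior of the set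
    where [quotient_map N D] is meromorphic. It contains I: around a point s of I the only possible
    zero of D is s itself, and there the reciprocal of the map is D'/N'. *)
Lemma meromorphic_extension_exists c lo hi (a a1 d : R -> R) alpha U N D N' D' :
  curve_with_data c (Rbar_interval lo hi) a d alpha ->
  (forall s, Rbar_interval lo hi s -> 0 < a s) ->
  (forall s, Rbar_interval lo hi s -> is_derive a s (a1 s)) ->
  curve_lift c (Rbar_interval lo hi) alpha U N D N' D' ->
  exists U' G, meromorphic_extension (Rbar_interval lo hi) (fun s => stereo c (alpha s)) U' G.
Proof.
intros hcurve ha da hlift.
destruct (hlift) as (hU & hN & hD & hN' & hD' & hax).
set (G := quotient_map N D).
set (good := fun z => match G z with
    | Some _ => holomorphic_at G z
    | None => holomorphic_at (fun w => sphere_inv (G w)) z /\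
              locally z (fun w => w <> z -> G w <> None) end).
assert (hreg : forall u v, U (u, v) -> D (u, v) <> RtoC 0 -> good (u, v)).
{ intros u v h1 h2; unfold good; unfold G at 1; rewrite quotient_map_some by exact h2.
  now apply (quotient_map_holomorphic U); try apply hU. }
exists (fun z => locally z (fun w => U w /\ good w)), G; split; [split|split].
- intros z h; exact (locally_locally _ _ h).
- intros s hs; apply locally_2d_C.
  assert (lU := open_locally_2d U s 0 (proj1 hU) (proj2 hU s hs)).
  destruct (Ceq_dec (D (s, 0)) (RtoC 0)) as [h0|h0].
  + assert (hpole : 1 + x0 (normal c (alpha s)) = 0).
    { destruct (hax s hs) as (_ & aD & _); rewrite aD in h0; injection h0 as h0; exact h0. }
    destruct (pole_local c lo hi a a1 d alpha U N D N' D' s hcurve ha da hlift hs hpole)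
      as (_ & zD' & _ & _ & _ & hP).
    assert (hinv : locally_2d (fun u v => sphere_inv (G (u, v)) = Some (Cdiv (D' (u, v)) (N' (u, v)))) s 0).
    { revert hP; apply locally_2d_imp; intros u v (k1 & k2 & k3 & k4).
      destruct (Ceq_dec (u, v) (s, 0)) as [e|hne].
      - injection e as -> ->; unfold G, quotient_map; destruct (Ceq_dec (D (s, 0)) (RtoC 0)); [|contradiction].
        simpl; rewrite zD'; f_equal; unfold Cdiv; ring.
      - destruct (k4 hne) as (n1 & n2 & n3); unfold G; rewrite quotient_map_some by exact n3; simpl.
        destruct (Cinv_quotient _ _ _ _ n1 n3 k2 k3) as [nz e].
        destruct (Ceq_dec _ _) as [e'|_]; [contradiction|now rewrite e]. }
    generalize (locally_2d_and _ _ _ _ lU hP); apply locally_2d_imp.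
    intros u v (k1 & _ & k2 & _ & k4); split; [exact k1|].
    destruct (Ceq_dec (u, v) (s, 0)) as [e|hne]; [|apply hreg; [exact k1|now apply k4]].
    injection e as -> ->; unfold good; replace (G (s, 0)) with (@None C).
    2:{ unfold G, quotient_map; destruct (Ceq_dec (D (s, 0)) (RtoC 0)); [reflexivity|contradiction]. }
    split.
    * apply hol_holomorphic_at.
      generalize (locally_2d_and _ _ _ _ (locally_2d_locally2 _ _ _ hinv) hP); apply locally_2d_imp.
      intros u v (e1 & e2 & e3 & _); split.
      -- rewrite (locally_2d_singleton _ _ _ e1); discriminate.
      -- eexists; apply (hol_ext_loc (fun w => Cdiv (D' w) (N' w))).
         ++ revert e1; apply locally_2d_imp; intros x y e; now rewrite e.
         ++ apply hol_div; [exact e3|apply (smooth_hol U)|apply (smooth_hol U)]; try assumption; apply hU.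
    * apply locally_2d_C; revert hP; apply locally_2d_imp; intros x y (_ & _ & _ & k) hne.
      unfold G; rewrite quotient_map_some by now apply k. discriminate.
  + assert (lD := hol_neq_0_locally D s 0 _ (smooth_hol U D s 0 (proj1 hU) hD (proj2 hU s hs)) h0).
    generalize (locally_2d_and _ _ _ _ lU lD); apply locally_2d_imp; intros u v [k1 k2].
    split; [exact k1|now apply hreg].
- intros z h; exact (proj2 (locally_singleton _ _ h)).
- intros s hs; destruct (hax s hs) as (aN & aD & _).
  destruct (stereo_formula c (alpha s) (proj1 (proj1 hcurve s hs))) as [f1 f2].
  unfold G, quotient_map; destruct (Ceq_dec _ _) as [e|e]; rewrite aD in e.
  + injection e as e; now rewrite f1.
  + rewrite f2, aN, aD; [reflexivity|intros k; apply e; rewrite k; reflexivity].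
Qed.

(** * The Cauchy problem *)

Lemma continuous_eq_punctured (f g : R -> R) s :
  continuous f s -> continuous g s -> locally s (fun u => u <> s -> f u = g u) -> f s = g s.
Proof.
intros hf hg h.
assert (k : forall e : R -> R, continuous e s -> is_lim e s (e s)).
{ intros e he; apply is_lim_continuity, continuity_pt_filterlim; exact he. }
assert (k1 := is_lim_unique _ _ _ (k f hf)).
assert (k2 := is_lim_unique _ _ _ (is_lim_ext_loc f g s _ h (k f hf))).
assert (k3 := is_lim_unique _ _ _ (k g hg)); rewrite k3 in k2; injection k2; easy.
Qed.

(** Regularity and the equation come from the local representation as a quotient metric. At a pole
    the Cauchy data are limits: phi and phi_t restricted to the axis are continuous, and equal a and
    d at the neighbouring points. *)
Lemma extended_metric_solution c lo hi (a a1 d : R -> R) alpha U N D N' D' U' G s :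
  curve_with_data c (Rbar_interval lo hi) a d alpha ->
  (forall s, Rbar_interval lo hi s -> 0 < a s) ->
  (forall s, Rbar_interval lo hi s -> is_derive a s (a1 s)) ->
  (forall s, Rbar_interval lo hi s -> continuous d s) ->
  curve_lift c (Rbar_interval lo hi) alpha U N D N' D' ->
  meromorphic_extension (Rbar_interval lo hi) (fun s => stereo c (alpha s)) U' G ->
  Rbar_interval lo hi s ->
  let phi := fun u v => extended_metric c G (u, v) in
  locally_2d (fun u v => 0 < phi u v /\ ex_diff_n phi 2 u v /\
    Laplacian (fun x y => ln (phi x y)) u v = - 2 * c * phi u v) s 0 /\
  phi s 0 = a s /\ Derive (fun t => phi s t) 0 = d s.
Proof.
intros hcurve ha da cd hlift hG hs phi.
destruct (hlift) as (hU & hN & hD & hN' & hD' & hax).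
assert (loc := fun u => extended_metric_local c lo hi a a1 d alpha U N D N' D' U' G u
  hcurve ha da hlift hG).
assert (axis : forall u, Rbar_interval lo hi u -> G (u, 0) <> None ->
  phi u 0 = a u /\ Derive (fun t => phi u t) 0 = d u).
{ intros u hu hne; destruct (loc u hu) as (M & E & _ & _ & _ & _ & k1 & k2 & _).
  destruct (k2 hne) as [k3 k4]; split.
  - unfold phi; now rewrite (locally_2d_singleton _ _ _ k1).
  - rewrite (Derive_ext_loc _ (fun t => quotient_metric' c M E u t)).
    + now apply is_derive_unique.
    + exact (locally_2d_1d_const_x _ _ _ k1). }
destruct (loc s hs) as (M & E & hM & hE & hm & hW & k1 & _ & k2).
assert (q := quotient_metric_solution c U M E s 0 (proj1 hU) hM hE (proj2 hU s hs) hm hW).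
split.
- generalize (locally_2d_and _ _ _ _ q (locally_2d_locally2 _ _ _ k1)); apply locally_2d_imp.
  intros u v ((_ & q1 & q2 & q3) & e); assert (e0 := locally_2d_singleton _ _ _ e); unfold phi.
  rewrite e0; split; [exact q1|split].
  + apply ex_diff_n_ext_loc with (quotient_metric' c M E); [|now apply Cn_ex_diff_n].
    revert e; apply locally_2d_imp; easy.
  + rewrite <- q3; unfold Laplacian; f_equal; apply partial_derive_ext_loc;
      revert e; apply locally_2d_imp; intros x y e; now rewrite e.
- destruct (locally_2d_singleton _ _ _ q) as (_ & _ & (qs & qt & dq & _ & ct) & _).
  assert (hloc := Rbar_interval_locally lo hi s hs).
  (* Near s both data can be read off one quotient metric, whose t-derivative [qt] is continuous at
     the point. *)
  assert (e : forall u, locally_2d (fun x y => phi x y = quotient_metric' c M E x y /\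
      dpl (quotient_metric' c M E) x y (qs x y) (qt x y)) u 0 ->
    phi u 0 = quotient_metric' c M E u 0 /\ Derive (fun t => phi u t) 0 = qt u 0).
  { intros u h; split; [exact (proj1 (locally_2d_singleton _ _ _ h))|].
    rewrite (Derive_ext_loc _ (fun t => quotient_metric' c M E u t)).
    - apply is_derive_unique; eapply dpl_derive_t; exact (proj2 (locally_2d_singleton _ _ _ h)).
    - apply (locally_2d_1d_const_x (fun x y => phi x y = quotient_metric' c M E x y) u 0); revert h; apply locally_2d_imp; tauto. }
  assert (h := locally_2d_and _ _ _ _ k1 dq).
  destruct (e s h) as [-> ->].
  assert (h' : locally s (fun u => u <> s -> quotient_metric' c M E u 0 = a u /\ qt u 0 = d u)).
  { generalize (filter_and _ _ (locally_2d_1d_const_y _ _ _ (locally_2d_locally2 _ _ _ h)) (filter_and _ _ hloc k2)).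
    apply filter_imp; intros u (h1 & hu & h2) hne.
    destruct (e u h1) as [<- <-]; auto. }
  split.
  + apply (continuous_eq_punctured (fun u => quotient_metric' c M E u 0) a).
    * apply (continuity_2d_continuous_s (quotient_metric' c M E)).
      eapply dpl_continuity; exact (locally_2d_singleton _ _ _ dq).
    * apply (ex_derive_continuous a); eexists; now apply da.
    * revert h'; apply filter_imp; intros u hu hne; now apply hu.
  + apply (continuous_eq_punctured (fun u => qt u 0) d).
    * apply (continuity_2d_continuous_s qt); exact (Cn_continuity _ _ _ _ ct).
    * now apply cd.
    * revert h'; apply filter_imp; intros u hu hne; now apply hu.
Qed.

(** V' is the interior of the set where the two solutions coincide. Each point of I has a box inside
    V and W whose base lies in I; on this base the common data determine phi, phi_s = a' and phi_t =
    d, and the local uniqueness applies. *)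
Lemma liouville_solution_unique c lo hi (a d : R -> R) V phi W psi :
  nbhd_of (Rbar_interval lo hi) V -> liouville_solution c (Rbar_interval lo hi) a d V phi ->
  nbhd_of (Rbar_interval lo hi) W -> liouville_solution c (Rbar_interval lo hi) a d W psi ->
  exists V' : C -> Prop, nbhd_of (Rbar_interval lo hi) V' /\
    (forall z, V' z -> V z /\ W z) /\ forall s t, V' (s, t) -> psi s t = phi s t.
Proof.
intros [oV iV] [hphi axphi] [oW iW] [hpsi axpsi].
exists (fun z => locally z (fun w => V w /\ W w /\ psi (Re w) (Im w) = phi (Re w) (Im w))).
split; [split|split].
- intros z h; exact (locally_locally _ _ h).
- intros s hs; apply locally_2d_C.
  destruct (open_locally_2d V s 0 oV (iV s hs)) as [r1 h1].
  destruct (open_locally_2d W s 0 oW (iW s hs)) as [r2 h2].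
  destruct (Rbar_interval_locally lo hi s hs) as [r3 h3].
  set (r := Rmin r1 (Rmin r2 r3)).
  assert (hr : 0 < r) by (repeat apply Rmin_glb_lt; apply cond_pos).
  assert (m1 : r <= r1) by apply Rmin_l.
  assert (m2 : r <= r2) by (eapply Rle_trans; [apply Rmin_r|apply Rmin_l]).
  assert (m3 : r <= r3) by (eapply Rle_trans; [apply Rmin_r|apply Rmin_r]).
  assert (bV : forall u v, box s r r u v -> V (u, v) /\ W (u, v)).
  { intros u v [hu hv]; split; [apply h1|apply h2]; rewrite ?Rminus_0_r; lra. }
  exists (mkposreal r hr); simpl; intros u v hu hv; rewrite Rminus_0_r in hv.
  assert (huv : box s r r u v) by now split.
  split; [now apply bV|split; [now apply bV|]].
  symmetry; change (phi u v = psi u v).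
  apply (liouville_unique c phi (log_s phi) (log_t phi) psi (log_s psi) (log_t psi) s r hr); [| | |exact huv].
  + intros x y hxy; apply liouville_system_of_solution.
    generalize (open_locally_2d V x y oV (proj1 (bV x y hxy))); apply locally_2d_imp; auto.
  + intros x y hxy; apply liouville_system_of_solution.
    generalize (open_locally_2d W x y oW (proj2 (bV x y hxy))); apply locally_2d_imp; auto.
  + intros x hx; assert (hx' : Rbar_interval lo hi x) by (apply h3; change (Rabs (x - s) < r3); lra).
    destruct (axphi x hx') as [p1 p2]; destruct (axpsi x hx') as [q1 q2].
    split; [congruence|split].
    * unfold log_s; rewrite p1, q1; f_equal; f_equal; apply Derive_ext_loc.
      generalize (Rbar_interval_locally lo hi x hx'); apply filter_imp; intros y hy.
      transitivity (a y); [now apply axphi|symmetry; now apply axpsi].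
    * unfold log_t; rewrite p1, q1, p2, q2; reflexivity.
- intros z h; apply locally_singleton in h; tauto.
- intros s t h; apply locally_singleton in h; exact (proj2 (proj2 h)).
Qed.

Lemma Rbar_interval_inhabited lo hi : Rbar_lt lo hi -> exists s, Rbar_interval lo hi s.
Proof.
unfold Rbar_interval; destruct lo as [x| |], hi as [y| |]; simpl; try easy; intros h.
- exists ((x + y) / 2); lra.
- exists (x + 1); lra.
- exists (y - 1); lra.
- now exists 0.
Qed.

Theorem theorem3 (c : R) (lo hi : Rbar) (a d : R -> R)
  (hI : Rbar_lt lo hi)
  (ha : forall s, Rbar_interval lo hi s -> real_analytic_at a s)
  (hd : forall s, Rbar_interval lo hi s -> real_analytic_at d s)
  (hpos : forall s, Rbar_interval lo hi s -> 0 < a s) :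
  (exists alpha, curve_with_data c (Rbar_interval lo hi) a d alpha) /\
  (forall alpha beta,
     curve_with_data c (Rbar_interval lo hi) a d alpha ->
     curve_with_data c (Rbar_interval lo hi) a d beta ->
     exists T, congruence c T /\
       forall s, Rbar_interval lo hi s -> beta s = T (alpha s)) /\
  (forall alpha,
     curve_with_data c (Rbar_interval lo hi) a d alpha ->
     (exists U G, meromorphic_extension (Rbar_interval lo hi)
                    (fun s => stereo c (alpha s)) U G) /\
     (forall U G,
        meromorphic_extension (Rbar_interval lo hi)
          (fun s => stereo c (alpha s)) U G ->
        exists (V : C -> Prop) (phi : R -> R -> R),
          nbhd_of (Rbar_interval lo hi) V /\
          (forall z, V z -> U z) /\
          liouville_solution c (Rbar_interval lo hi) a d V phi /\
          (forall s t, V (s, t) -> G (s, t) <> None ->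
             phi s t = pullback_metric c G (s, t)) /\
          (forall (W : C -> Prop) (psi : R -> R -> R),
             nbhd_of (Rbar_interval lo hi) W ->
             liouville_solution c (Rbar_interval lo hi) a d W psi ->
             exists V' : C -> Prop,
               nbhd_of (Rbar_interval lo hi) V' /\
               (forall z, V' z -> V z /\ W z) /\
               forall s t, V' (s, t) -> psi s t = phi s t))).
Proof.
destruct (Rbar_interval_inhabited lo hi hI) as [s0 hs0].
assert (aa : forall s, Rbar_interval lo hi s -> analytic a s) by (intros s hs; now apply real_analytic_at_analytic, ha).
assert (ad : forall s, Rbar_interval lo hi s -> analytic d s) by (intros s hs; now apply real_analytic_at_analytic, hd).
assert (da : forall s, Rbar_interval lo hi s -> is_derive a s (Derive a s)).
{ intros s hs; destruct (analytic_is_derive a s (aa s hs)) as (f1 & _ & h).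
  apply locally_singleton in h; apply Derive_correct; eexists; exact h. }
assert (ca : forall s, Rbar_interval lo hi s -> continuous (Derive a) s).
{ intros s hs; apply (locally_singleton (T := R_UniformSpace) _ _ (analytic_continuous _ _ (analytic_Derive a s ltac:(generalize (Rbar_interval_locally lo hi s hs); apply filter_imp; exact aa)))). }
assert (cd : forall s, Rbar_interval lo hi s -> continuous d s) by
  (intros s hs; exact (locally_singleton (T := R_UniformSpace) _ _ (analytic_continuous d s (ad s hs)))).
split; [|split].
- exact (curve_exists c lo hi a (Derive a) d s0 hs0 hpos da ca cd).
- intros alpha beta; exact (curve_unique c lo hi a (Derive a) d s0 alpha beta hs0 hpos da ca cd).
- intros alpha hcurve.
  destruct (curve_complexification c lo hi a d alpha hcurve hpos aa ad)
    as (U & N & D & N' & D' & hlift).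
  split; [exact (meromorphic_extension_exists c lo hi a (Derive a) d alpha U N D N' D'
    hcurve hpos da hlift)|].
  intros U' G hG.
  assert (hsol := fun s => extended_metric_solution c lo hi a (Derive a) d alpha U N D N' D' U' G s
    hcurve hpos da cd hlift hG).
  set (phi := fun u v => extended_metric c G (u, v)) in hsol.
  destruct hG as [[oU iU] _].
  (* The interior of the part of U' where the extended metric is a solution; it contains I because
     the equation holds near every axis point. *)
  set (V := fun z : C => locally z (fun w => U' w /\ 0 < phi (Re w) (Im w) /\ ex_diff_n phi 2 (Re w) (Im w) /\
    Laplacian (fun x y => ln (phi x y)) (Re w) (Im w) = - 2 * c * phi (Re w) (Im w))).
  assert (nV : nbhd_of (Rbar_interval lo hi) V).
  { split; [intros z h; exact (locally_locally _ _ h)|].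
    intros s hs; apply locally_2d_C.
    generalize (locally_2d_and _ _ _ _ (open_locally_2d U' s 0 oU (iU s hs)) (proj1 (hsol s hs))).
    apply locally_2d_imp; auto. }
  assert (sV : liouville_solution c (Rbar_interval lo hi) a d V phi).
  { split; [|intros s hs; exact (proj2 (hsol s hs))].
    intros s t h; exact (proj2 (locally_singleton _ _ h)). }
  exists V, phi; split; [exact nV|split; [|split; [exact sV|split]]].
  + intros z h; exact (proj1 (locally_singleton _ _ h)).
  + intros s t _ hne; unfold phi, extended_metric; destruct (G (s, t)); [reflexivity|contradiction].
  + intros W psi; now apply liouville_solution_unique.
Qed.
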